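(* Let $\phi(x)=x\log x$ and let $X_1,X_2,\ldots$ be i.i.d. with density $f$ on $A:=[c_1,c_2]$. As $n\to\infty$, $$n^{-1}\operatorname{Var}[S^g_{n,\phi,1}]\to\sigma_\phi^2(f,g)\quad\text{and}\quad n^{-1/2}\big(S^g_{n,\phi,1}-\mathbb{E}S^g_{n,\phi,1}\big)\xrightarrow{\mathcal{D}}N\big(0,\sigma^2_\phi(f,g)\big),$$ where $$\sigma^2_\phi(f,g):=\Big(\frac{\pi^2}{3}-2\Big)\int_A\frac{g^2(x)}{f(x)}\,dx-\Big(\int_A g(x)\,dx\Big)^2.$$
   Context: $f$ and $g$ are probability densities with common support $A=[c_1,c_2]\subset\mathbb{R}$ (both vanish outside it), bounded, and bounded away from zero on $A$; $G$ is the distribution function of $g$. $X_{(1)}\le\cdots\le X_{(n)}$ are the order statistics of $X_1,\ldots,X_n$. $$S^g_{n,\phi,1}:=\sum_{i=1}^{n-1}\phi\big(n[G(X_{(i+1)})-G(X_{(i)})]\big).$$ $\log$ is the natural logarithm; $N(0,\sigma^2)$ is the centered normal law with variance $\sigma^2$. *)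

(* Defs.v *)
From HB Require Import structures.
From mathcomp Require Import all_boot all_order all_algebra.
From mathcomp Require Import all_classical all_reals all_analysis.

Set Implicit Arguments.
Unset Strict Implicit.
Unset Printing Implicit Defensive.

Import Order.TTheory GRing.Theory Num.Theory.
Import numFieldNormedType.Exports.

Local Open Scope classical_set_scope.
Local Open Scope ring_scope.

Definition is_density (R : realType) (f : R -> R) : Prop :=
  [/\ measurable_fun setT f, (forall x, 0 <= f x) &
      (\int[lebesgue_measure]_x (f x)%:E = 1)%E].

(* [c1 < c2] is not required separately: it follows from total mass 1. *)
Definition is_density_on (R : realType) (c1 c2 : R) (f : R -> R) : Prop :=
  [/\ is_density f,
      (forall x, x \notin `[c1, c2] -> f x = 0),
      (exists M, forall x, f x <= M) &
      (exists2 m, 0 < m & forall x, x \in `[c1, c2] -> m <= f x)].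

Definition density_cdf (R : realType) (g : R -> R) (x : R) : R :=
  \int[lebesgue_measure]_(y in `]-oo, x]) g y.

Definition mutually_independent d (T : measurableType d) (R : realType)
    (P : probability T R) (X : nat -> {RV P >-> R}) : Prop :=
  forall (s : seq nat) (B : nat -> set R),
    uniq s -> (forall i, measurable (B i)) ->
    P (\bigcap_(i in [set` s]) (X i @^-1` B i)) =
    (\prod_(i <- s) P (X i @^-1` B i))%E.

Definition has_density d (T : measurableType d) (R : realType)
    (P : probability T R) (Y : {RV P >-> R}) (f : R -> R) : Prop :=
  forall B : set R, measurable B ->
    distribution P Y B = (\int[lebesgue_measure]_(x in B) (f x)%:E)%E.

(* The sample is indexed from 0 (X_1, ..., X_n are [X 0], ..., [X n.-1]),
   whereas the rank [k] runs from 1 to [n], as in X_(1) <= ... <= X_(n). *)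
Definition order_stat (T : Type) (R : realType) (X : nat -> T -> R)
    (n k : nat) (w : T) : R :=
  nth 0 (sort <=%R [seq X i w | i <- iota 0 n]) k.-1.

Definition spacing_stat (T : Type) (R : realType) (phi g : R -> R)
    (X : nat -> T -> R) (n : nat) (w : T) : R :=
  \sum_(1 <= i < n)
    phi (n%:R * (density_cdf g (order_stat X n i.+1 w) -
                 density_cdf g (order_stat X n i w))).

(* [ln 0 = 0], so that [xlogx 0 = 0]. *)
Definition xlogx (R : realType) (x : R) : R := x * ln x.

Definition sigma2 (R : realType) (c1 c2 : R) (f g : R -> R) : R :=
  (pi ^+ 2 / 3 - 2) *
    (\int[lebesgue_measure]_(x in `[c1, c2]) (g x ^+ 2 / f x)) -
  (\int[lebesgue_measure]_(x in `[c1, c2]) g x) ^+ 2.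

(* Pointwise convergence of distribution functions at the continuity points
   of the limiting one; the [Y n] are required to be random variables. *)
Definition cvg_in_distribution d (T : measurableType d) (R : realType)
    (P : probability T R) (Y : nat -> T -> R)
    (Q : probability (measurableTypeR R) R) : Prop :=
  (forall n, measurable_fun setT (Y n)) /\
  forall x : R,
    {for x, continuous (fun y : R => fine (Q `]-oo, y]%classic))} ->
    P [set w | Y n w <= x] @[n --> \oo] --> Q `]-oo, x]%classic.

(* Main.v *)
(* Let U_i = F(X_i), H = G o F^-1 and h = H' = (g / f) o F^-1, so that the U_i are
   i.i.d. uniform, a <= h <= b, and S_n equals, up to a constant and two boundary
   terms that are bounded in L^2, n times the gap sum L_n of phi over the spacings of
   H(U_(1)), ..., H(U_(n)).

   When h is Lipschitz, remove the points one at a time, the largest first: given that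
   k points remain, all below u, the next maximum is u w with w of density k w^(k-1).
   Each step changes the centred sum by an increment of mean O(k^-2) and of explicit
   second moment, and a Lindeberg argument against the heat semigroup along this chain
   gives E psi(sqrt n (L_n - c_n)) for psi quadratic or a smoothed indicator, hence
   the variance and the limit law.  The constant pi^2/3 - 2 = 2 (zeta(2) - 1) comes from
   the sum of 1/j^2.

   A general h is replaced by its Steklov averages h_m.  By the Efron-Stein inequality
   n Var(L_n(h) - L_n(h_m)) is at most a constant times the integral of (h - h_m)^2,
   which tends to 0 by Lebesgue differentiation and dominated convergence. *)
Require Import Defs.
From HB Require Import structures.
From mathcomp Require Import all_boot all_order all_algebra.
From mathcomp Require Import all_classical all_reals all_analysis.
From mathcomp Require Import measurable_realfun.
From mathcomp Require Import ring lra zify.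

Set Implicit Arguments.
Unset Strict Implicit.
Unset Printing Implicit Defensive.

Import Order.TTheory GRing.Theory Num.Theory.
Import numFieldNormedType.Exports.

Local Open Scope classical_set_scope.
Local Open Scope ring_scope.

(** * The function x log x *)

(** The time argument of the test function is itself random: after the step to [u * w] it is
    [n * rest_var (u * w) / (k - 1)], the limiting variance still to come. This works because
    [q = rest_var] solves the Euler equation [u q' - q = step_var], so that its mean decrease
    cancels the second moment of the increment to leading order. Nothing bounds [u] in terms of [k]
    along a path, so every error is measured in [s = n u / k]: its powers are carried by the exact
    martingale [quartic_mart], and the unbounded first derivative of a quadratic test function by a
    term in [y ^ 2] whose weight stays below [3 / sqrt n]. The chain is stopped at two points, where
    a crude bound is affordable.

    In the Efron-Stein step the danger is a small gap next to a large one, where the derivative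
    [ln (1 + y / x)] of the interaction [eta] blows up. The inequality [ln (1 + y) ^ 2 <= 4 y]
    trades this singularity for the ratio of the two gaps, and the ratio cancels against the
    Cauchy-Schwarz bound for the perturbed gap. *)

Section is_derive_pow.
Context {R : realType}.

Lemma is_derive_pow (f : R -> R) (n : nat) (x df : R) : is_derive x 1 f df ->
  is_derive x 1 (fun w : R => f w ^+ n) (n%:R * f x ^+ n.-1 * df).
Proof.
move=> dfx; have := is_deriveX n dfx.
have -> : f ^+ n = (fun w : R => f w ^+ n) by apply/funext => w; rewrite exprfctE.
by [].
Qed.

Lemma is_derive_exprn (n : nat) (x : R) :
  is_derive x 1 (fun w : R => w ^+ n) (n%:R * x ^+ n.-1).
Proof. by have := is_derive_pow n (is_derive_id x (1 : R)); rewrite mulr1. Qed.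

End is_derive_pow.

Section xlogx.
Context {R : realType}.
Implicit Types x y : R.

Lemma xlogx_le0 x : x <= 0 -> xlogx x = 0.
Proof. by move=> x0; rewrite /xlogx ln0// mulr0. Qed.

Lemma is_derive_xlogx x : 0 < x -> is_derive x 1 (@xlogx R) (ln x + 1).
Proof.
move=> x0; rewrite /xlogx.
have dl := is_derive1_ln x0.
apply: is_derive_eq.
by rewrite /GRing.scale /=; field; rewrite gt_eqF.
Qed.

(* [sqrt x * ln (sqrt x)] is bounded near [0], so [xlogx x = O(sqrt x)]. *)
Lemma norm_xlogx_sqrt x : 0 <= x -> x <= 1 -> `|xlogx x| <= 2 * Num.sqrt x.
Proof.
rewrite le_eqVlt => /predU1P[<-|x0] x1.
  by rewrite xlogx_le0// normr0 sqrtr0 mulr0.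
have s0 : 0 < Num.sqrt x by rewrite sqrtr_gt0.
have xE : x = Num.sqrt x ^+ 2 by rewrite sqr_sqrtr// ltW.
have lx : ln x <= 0 by apply: ln_le0.
rewrite /xlogx normrM (ger0_norm (ltW x0)) (ler0_norm lx).
have : ln (Num.sqrt x)^-1 < (Num.sqrt x)^-1 by apply: ln_sublinear; rewrite invr_gt0.
rewrite lnV ?posrE// => h.
rewrite {1 2}xE lnXn// mulr2n opprD.
have h2 : Num.sqrt x * (- ln (Num.sqrt x)) <= 1.
  by rewrite -(mulfV (lt0r_neq0 s0)); apply: ler_wpM2l; apply: ltW.
have := ler_wpM2l (ltW s0) h2; nra.
Qed.

Lemma continuous_xlogx : continuous (@xlogx R).
Proof.
move=> x; have [x0|x0|->] := ltgtP x 0.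
- rewrite /continuous_at xlogx_le0 ?ltW//.
  apply: cvg_near_cst; near=> y; apply: xlogx_le0; apply: ltW.
  by near: y; exact: lt_nbhsl.
- apply: differentiable_continuous; apply/derivable1_diffP.
  by have [] := is_derive_xlogx x0.
- rewrite /continuous_at xlogx_le0//; apply/cvgrPdist_le => e e0 /=.
  near=> y; rewrite sub0r normrN.
  have [y0|y0] := leP y 0; first by rewrite xlogx_le0// normr0 ltW.
  have y1 : y <= 1.
    by apply: ltW; near: y; apply: lt_nbhsl; exact: ltr01.
  apply: (le_trans (norm_xlogx_sqrt (ltW y0) y1)).
  have ye : y <= (e / 2) ^+ 2.
    by apply: ltW; near: y; apply: lt_nbhsl; rewrite exprn_gt0// divr_gt0.
  have := ler_wsqrtr ye; rewrite sqrtr_sqr ger0_norm; last by rewrite divr_ge0// ltW.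
  by lra.
Unshelve. all: by end_near. Qed.

Lemma measurable_xlogx : measurable_fun setT (@xlogx R).
Proof. exact: (continuous_measurable_fun continuous_xlogx). Qed.

End xlogx.

Section FTC01.
Context {R : realType}.
Local Notation mu := (@lebesgue_measure R).

(** The derivative is asked for only inside the interval: derivatives of products with [xlogx] come
    from the rule for [ln], valid at positive points only. *)
Lemma Rintegral_FTC01 (f F : R -> R) : continuous f -> continuous F ->
  (forall x : R, 0 < x < 1 -> is_derive x 1 F (f x)) ->
  \int[mu]_(x in `[0, 1]) f x = F 1 - F 0.
Proof.
move=> cf cF dF; rewrite /Rintegral (@continuous_FTC2 _ f F)//.
- exact: continuous_subspaceT.
- split.
  + by move=> x; rewrite in_itv /= => /dF[].
  + by apply: cvg_at_right_filter; exact: cF.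
  + by apply: cvg_at_left_filter; exact: cF.
- move=> x; rewrite in_itv /= => /dF [_ dFx].
  by rewrite derive1E.
Qed.

Lemma continuous_integrable01 (f : R -> R) : continuous f ->
  mu.-integrable `[0, 1] (EFin \o f).
Proof.
move=> cf; apply: continuous_compact_integrable; first exact: segment_compact.
exact: continuous_subspaceT.
Qed.

End FTC01.

Lemma bdd_integrable d (T : measurableType d) (R : realType)
    (m : {measure set T -> \bar R}) (D : set T) (f : T -> R) (C : R) :
  measurable D -> (m D < +oo)%E -> measurable_fun D f ->
  (forall x, D x -> `|f x| <= C) -> m.-integrable D (EFin \o f).
Proof.
move=> mD moo mf fC; apply: measurable_bounded_integrable => //.
exists C; split; first exact: num_real.
by move=> M CM x Dx /=; apply: (le_trans (fC x Dx)); exact: ltW.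
Qed.

(** * Beta and logarithmic integrals *)

Section beta_log.
Context {R : realType}.
Local Notation mu := (@lebesgue_measure R).

(** [g] is read at [1 - w], the relative size of the gap above a maximum at [w]. For [g] a power
    this is a Beta integral. *)
Definition betaI (g : R -> R) (k : nat) : R :=
  \int[mu]_(w in `[0, 1]) (g (1 - w) * w ^+ k).

Lemma continuous_betaI (g : R -> R) k : continuous g ->
  continuous (fun w : R => g (1 - w) * w ^+ k).
Proof.
move=> cg x; apply: cvgM; last exact: exprn_continuous.
apply: (@continuous_comp _ _ _ (fun w : R => 1 - w) g); last exact: cg.
by apply: cvgB; [exact: cvg_cst|exact: cvg_id].
Qed.

(* Integration by parts of [(1 - w) g(1 - w) w^k]. *)
Lemma betaI_rec (p : R) (g g1 : R -> R) (k : nat) :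
  continuous g -> continuous g1 ->
  (forall z : R, 0 < z -> is_derive z 1 (fun z => z * g z) (p * g z + g1 z)) ->
  (p + k.+1%:R) * betaI g k.+1 = k.+1%:R * betaI g k - betaI g1 k.+1.
Proof.
move=> cg cg1 dg.
pose F := fun w : R => (1 - w) * g (1 - w) * w ^+ k.+1.
pose f := fun w : R => k.+1%:R * (g (1 - w) * w ^+ k)
  - (p + k.+1%:R) * (g (1 - w) * w ^+ k.+1) - g1 (1 - w) * w ^+ k.+1.
have cf : continuous f.
  move=> x; apply: cvgB; [apply: cvgB|exact: continuous_betaI];
    by apply: cvgM; [exact: cvg_cst|exact: continuous_betaI].
have cF : continuous F.
  apply: (@continuous_betaI (fun z => z * g z)) => x.
  by apply: cvgM; [exact: cvg_id|exact: cg].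
have dF (x : R) : 0 < x < 1 -> is_derive x 1 F (f x).
  move=> /andP[x0 x1].
  have d1 : is_derive x 1 (fun w : R => 1 - w) (-1).
    have := is_deriveB (is_derive_cst (1 : R) x 1) (is_derive_id x (1 : R)).
    by rewrite sub0r.
  have x1' : 0 < 1 - x by rewrite subr_gt0.
  have d2 := @is_derive1_comp _ (fun z => z * g z) (fun w : R => 1 - w) x _ _ (dg _ x1') d1.
  have d3 : is_derive x 1 (fun w : R => w ^+ k.+1) (k.+1%:R * x ^+ k).
    exact: is_derive_exprn.
  rewrite /f; apply: (is_derive_eq (is_deriveM d2 d3)).
  by rewrite /= /GRing.scale /= exprS; ring.
have := Rintegral_FTC01 cf cF dF.
rewrite /F subrr !mul0r expr0n /= mulr0 subrr /f.
have ic (c : R) (h : R -> R) i : continuous h ->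
    mu.-integrable `[0, 1] (EFin \o (fun w => c * (h (1 - w) * w ^+ i))).
  move=> ch; apply: continuous_integrable01 => x.
  by apply: cvgM; [exact: cvg_cst|exact: continuous_betaI].
have ic1 (h : R -> R) i : continuous h ->
    mu.-integrable `[0, 1] (EFin \o (fun w => h (1 - w) * w ^+ i)).
  by move=> ch; apply: continuous_integrable01; exact: continuous_betaI.
have icB : mu.-integrable `[0, 1] (EFin \o (fun w => k.+1%:R * (g (1 - w) * w ^+ k)
    - (p + k.+1%:R) * (g (1 - w) * w ^+ k.+1))).
  apply: continuous_integrable01 => x.
  by apply: cvgB; apply: cvgM; [exact: cvg_cst|exact: continuous_betaI
    |exact: cvg_cst|exact: continuous_betaI].
rewrite RintegralB//; [|exact: ic1].
rewrite RintegralB//; try exact: ic.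
rewrite !RintegralZl//; try exact: ic1.
rewrite -/(betaI g k) -/(betaI g k.+1) -/(betaI g1 k.+1) => h.
by lra.
Qed.

(** The boundary value at [w = 0], killed by a positive power of [w] in [betaI_rec], survives here
    as [g 1]. *)
Lemma betaI_rec0 (p : R) (g g1 : R -> R) :
  continuous g -> continuous g1 ->
  (forall z : R, 0 < z -> is_derive z 1 (fun z => z * g z) (p * g z + g1 z)) ->
  p * betaI g 0 = g 1 - betaI g1 0.
Proof.
move=> cg cg1 dg.
pose F := fun w : R => (1 - w) * g (1 - w) * w ^+ 0.
pose f := fun w : R => - (p * (g (1 - w) * w ^+ 0)) - g1 (1 - w) * w ^+ 0.
have cf : continuous f.
  move=> x; apply: cvgB; [apply: cvgN|exact: continuous_betaI].
  by apply: cvgM; [exact: cvg_cst|exact: continuous_betaI].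
have cF : continuous F.
  apply: (@continuous_betaI (fun z => z * g z)) => x.
  by apply: cvgM; [exact: cvg_id|exact: cg].
have dF (x : R) : 0 < x < 1 -> is_derive x 1 F (f x).
  move=> /andP[x0 x1].
  have d1 : is_derive x 1 (fun w : R => 1 - w) (-1).
    have := is_deriveB (is_derive_cst (1 : R) x 1) (is_derive_id x (1 : R)).
    by rewrite sub0r.
  have x1' : 0 < 1 - x by rewrite subr_gt0.
  have d2 := @is_derive1_comp _ (fun z => z * g z) (fun w : R => 1 - w) x _ _ (dg _ x1') d1.
  have -> : F = (fun z => z * g z) \o (fun w : R => 1 - w).
    by apply/funext => w; rewrite /F expr0 mulr1.
  by rewrite /f; apply: is_derive_eq; rewrite !expr0 !mulr1; ring.
have := Rintegral_FTC01 cf cF dF.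
rewrite /F subrr !mul0r !expr0 !mulr1 subr0 mul1r sub0r /f.
have ic1 (h : R -> R) i : continuous h ->
    mu.-integrable `[0, 1] (EFin \o (fun w => h (1 - w) * w ^+ i)).
  by move=> ch; apply: continuous_integrable01; exact: continuous_betaI.
under eq_Rintegral do rewrite -mulNr.
have ic (c : R) (h : R -> R) i : continuous h ->
    mu.-integrable `[0, 1] (EFin \o (fun w => c * (h (1 - w) * w ^+ i))).
  move=> ch; apply: continuous_integrable01 => x.
  by apply: cvgM; [exact: cvg_cst|exact: continuous_betaI].
rewrite RintegralB//; try exact: ic; try exact: ic1.
rewrite RintegralZl//; try exact: ic1.
rewrite -/(betaI g 0) -/(betaI g1 0) => h.
by lra.
Qed.

(** The upper limit is excluded: [harm 2 k.+1] is the harmonic number of [k] minus 1. *)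
Definition harm (m n : nat) : R := \sum_(m <= j < n) (j%:R)^-1.
Definition harm2 (m n : nat) : R := \sum_(m <= j < n) (j%:R ^+ 2)^-1.

Lemma harmS m n : (m <= n)%N -> harm m n.+1 = harm m n + n%:R^-1.
Proof. by move=> mn; rewrite /harm big_nat_recr. Qed.

Lemma harm2S m n : (m <= n)%N -> harm2 m n.+1 = harm2 m n + (n%:R ^+ 2)^-1.
Proof. by move=> mn; rewrite /harm2 big_nat_recr. Qed.

Lemma harmnn m : harm m m = 0. Proof. by rewrite /harm big_geq. Qed.
Lemma harm2nn m : harm2 m m = 0. Proof. by rewrite /harm2 big_geq. Qed.

Let cst0c : continuous (fun _ : R => 0 : R).
Proof. by move=> x; exact: cvg_cst. Qed.

Let betaI0 k : betaI (fun=> 0) k = 0.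
Proof.
by rewrite /betaI; under eq_Rintegral do rewrite mul0r; rewrite Rintegral_cst//= mul0r.
Qed.

Let sqc : continuous (fun z : R => z ^+ 2).
Proof. exact: exprn_continuous. Qed.
Let idc : continuous (fun z : R => z).
Proof. by move=> x; exact: cvg_id. Qed.
Let zxlogxc : continuous (fun z : R => z * xlogx z).
Proof. by move=> x; apply: cvgM; [exact: cvg_id|exact: continuous_xlogx]. Qed.
Let xlogx2c : continuous (fun z : R => xlogx z ^+ 2).
Proof.
move=> x; apply: (@continuous_comp _ _ _ (@xlogx R) (fun y => y ^+ 2)).
  exact: continuous_xlogx.
exact: exprn_continuous.
Qed.

(** In this lemma and the next four, [g] is [z ^ (p - 1)] times a power of [ln z], and [g1] has one
    logarithm less. The recursion in [k] thus closes on integrals already known, and the harmonic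
    sums start at [p]. *)
Lemma betaI_id k : betaI (fun z => z) k = ((k.+1 * k.+2)%:R)^-1.
Proof.
have d (z : R) : 0 < z -> is_derive z 1 (fun z : R => z * z) (2 * z + 0).
  by move=> _; apply: is_derive_eq; rewrite /GRing.scale /=; ring.
elim: k => [|k IH].
  have := betaI_rec0 idc cst0c d; rewrite betaI0 subr0 => h.
  by rewrite mul1n; lra.
have := betaI_rec k idc cst0c d; rewrite betaI0 subr0 IH => h.
have k0 : (2 : R) + k.+1%:R != 0 by rewrite -natrD pnatr_eq0.
apply: (mulfI k0); rewrite h !natrM -!natr1; field.
by rewrite !natr1 !pnatr_eq0.
Qed.

Lemma betaI_sqr k : betaI (fun z => z ^+ 2) k = 2 * ((k.+1 * k.+2 * k.+3)%:R)^-1.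
Proof.
have d (z : R) : 0 < z -> is_derive z 1 (fun z : R => z * z ^+ 2) (3 * z ^+ 2 + 0).
  by move=> _; apply: is_derive_eq; rewrite /GRing.scale /=; ring.
elim: k => [|k IH].
  have := betaI_rec0 sqc cst0c d; rewrite betaI0 subr0 expr1n => h.
  by rewrite mul1n; lra.
have := betaI_rec k sqc cst0c d; rewrite betaI0 subr0 IH => h.
have k0 : (3 : R) + k.+1%:R != 0 by rewrite -natrD pnatr_eq0.
apply: (mulfI k0); rewrite h !natrM -!natr1; field.
by rewrite !natr1 !pnatr_eq0.
Qed.

Lemma betaI_xlogx k :
  betaI (@xlogx R) k = - ((k.+1 * k.+2)%:R)^-1 * harm 2 k.+3.
Proof.
have d (z : R) : 0 < z -> is_derive z 1 (fun z : R => z * xlogx z) (2 * xlogx z + z).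
  move=> z0; have dz := is_derive_xlogx z0.
  by apply: is_derive_eq; rewrite /GRing.scale /= /xlogx; ring.
elim: k => [|k IH].
  have := betaI_rec0 (@continuous_xlogx R) idc d; rewrite betaI_id /xlogx ln1 mulr0 => h.
  by rewrite mul1n harmS// harmnn; lra.
have := betaI_rec k (@continuous_xlogx R) idc d; rewrite betaI_id IH => h.
have k0 : (2 : R) + k.+1%:R != 0 by rewrite -natrD pnatr_eq0.
apply: (mulfI k0); rewrite h (@harmS 2 k.+3)// !natrM -!natr1; field.
by rewrite !natr1 !pnatr_eq0.
Qed.

Lemma betaI_zxlogx k : betaI (fun z => z * xlogx z) k =
  - (2 * ((k.+1 * k.+2 * k.+3)%:R)^-1) * harm 3 k.+4.
Proof.
have d (z : R) : 0 < z ->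
    is_derive z 1 (fun z : R => z * (z * xlogx z)) (3 * (z * xlogx z) + z ^+ 2).
  move=> z0; have dz := is_derive_xlogx z0.
  by apply: is_derive_eq; rewrite /GRing.scale /= /xlogx; ring.
elim: k => [|k IH].
  have := betaI_rec0 zxlogxc sqc d; rewrite betaI_sqr /xlogx ln1 !mulr0 => h.
  by move: h; rewrite mul1n harmS// harmnn => h; lra.
have := betaI_rec k zxlogxc sqc d; rewrite betaI_sqr IH => h.
have k0 : (3 : R) + k.+1%:R != 0 by rewrite -natrD pnatr_eq0.
apply: (mulfI k0); rewrite h (@harmS 3 k.+4)// !natrM -!natr1; field.
by rewrite !natr1 !pnatr_eq0.
Qed.

Lemma betaI_xlogx2 k : betaI (fun z => xlogx z ^+ 2) k =
  2 * ((k.+1 * k.+2 * k.+3)%:R)^-1 * (harm 3 k.+4 ^+ 2 + harm2 3 k.+4).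
Proof.
have c1 : continuous (fun z : R => 2 * (z * xlogx z)).
  by move=> x; apply: cvgM; [exact: cvg_cst|exact: zxlogxc].
have d (z : R) : 0 < z -> is_derive z 1 (fun z : R => z * (xlogx z ^+ 2))
    (3 * (xlogx z ^+ 2) + 2 * (z * xlogx z)).
  move=> z0; have dz := is_derive_xlogx z0.
  by apply: is_derive_eq; rewrite /GRing.scale /= /xlogx; ring.
have bE i : betaI (fun z : R => 2 * (z * xlogx z)) i = 2 * betaI (fun z => z * xlogx z) i.
  rewrite /betaI -RintegralZl//; last first.
    by apply: continuous_integrable01; exact: (continuous_betaI zxlogxc).
  by apply: eq_Rintegral => w _; rewrite !mulrA.
elim: k => [|k IH].
  have := betaI_rec0 xlogx2c c1 d; rewrite bE betaI_zxlogx /xlogx ln1 !mulr0 expr0n /= => h.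
  by move: h; rewrite mul1n harmS// harmnn harm2S// harm2nn => h; lra.
have := betaI_rec k xlogx2c c1 d; rewrite bE betaI_zxlogx IH => h.
have k0 : (3 : R) + k.+1%:R != 0 by rewrite -natrD pnatr_eq0.
apply: (mulfI k0); rewrite h (@harmS 3 k.+4)// (@harm2S 3 k.+4)// !natrM -!natr1; field.
by rewrite !natr1 !pnatr_eq0.
Qed.

Lemma int_wlogw (j : nat) :
  \int[mu]_(w in `[0, 1]) (w ^+ j * xlogx w) = - ((j.+2%:R) ^+ 2)^-1.
Proof.
pose F := fun w : R => j.+2%:R^-1 * (w ^+ j.+1 * xlogx w) - (j.+2%:R ^+ 2)^-1 * w ^+ j.+2.
have cM i : continuous (fun w : R => w ^+ i * xlogx w).
  by move=> x; apply: cvgM; [exact: exprn_continuous|exact: continuous_xlogx].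
have cF : continuous F.
  move=> x; apply: cvgB; apply: cvgM; try exact: cvg_cst; first exact: cM.
  exact: exprn_continuous.
have dF (x : R) : 0 < x < 1 -> is_derive x 1 F ((fun w : R => w ^+ j * xlogx w) x).
  move=> /andP[x0 x1]; have dx := is_derive_xlogx x0.
  have dX i := is_derive_exprn i x.
  apply: (is_derive_eq (is_deriveB (is_deriveZ j.+2%:R^-1 (is_deriveM (dX j.+1) dx)) (is_deriveZ (j.+2%:R ^+ 2)^-1 (dX j.+2)))); rewrite /GRing.scale /= /xlogx !exprS.
  have n0 : j.+2%:R != 0 :> R by rewrite pnatr_eq0.
  rewrite -!natr1 in n0 *; move: (x ^+ j) (ln x) (j%:R : R) n0 => p l y n0.
  by field.
rewrite (@Rintegral_FTC01 _ (fun w : R => w ^+ j * xlogx w) F (cM j) cF dF).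
by rewrite /F !expr1n /xlogx ln1 ln0// !mulr0 !expr0n /= !mulr0 !subr0; ring.
Qed.

Lemma int_wlogw2 (j : nat) :
  \int[mu]_(w in `[0, 1]) (w ^+ j * xlogx w ^+ 2) = 2 * ((j.+3%:R) ^+ 3)^-1.
Proof.
pose F := fun w : R => j.+3%:R^-1 * (w ^+ j.+1 * xlogx w ^+ 2)
  - 2 * (j.+3%:R ^+ 2)^-1 * (w ^+ j.+2 * xlogx w) + 2 * (j.+3%:R ^+ 3)^-1 * w ^+ j.+3.
have cM i : continuous (fun w : R => w ^+ i * xlogx w).
  by move=> x; apply: cvgM; [exact: exprn_continuous|exact: continuous_xlogx].
have cM2 i : continuous (fun w : R => w ^+ i * xlogx w ^+ 2).
  by move=> x; apply: cvgM; [exact: exprn_continuous|exact: xlogx2c].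
have cF : continuous F.
  move=> x; apply: cvgD; [apply: cvgB|]; apply: cvgM; try exact: cvg_cst.
  - exact: cM2.
  - exact: cM.
  - exact: exprn_continuous.
have dF (x : R) : 0 < x < 1 -> is_derive x 1 F ((fun w : R => w ^+ j * xlogx w ^+ 2) x).
  move=> /andP[x0 x1]; have dx := is_derive_xlogx x0.
  have dX i := is_derive_exprn i x.
  apply: (is_derive_eq (is_deriveD (is_deriveB (is_deriveZ j.+3%:R^-1 (is_deriveM (dX j.+1) (is_derive_pow 2 dx))) (is_deriveZ (2 * (j.+3%:R ^+ 2)^-1) (is_deriveM (dX j.+1.+1) dx))) (is_deriveZ (2 * (j.+3%:R ^+ 3)^-1) (dX j.+3)))); rewrite /GRing.scale /= /xlogx !exprS.
  have n0 : j.+3%:R != 0 :> R by rewrite pnatr_eq0.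
  rewrite -!natr1 in n0 *; move: (x ^+ j) (ln x) (j%:R : R) n0 => p l y n0.
  by field.
rewrite (@Rintegral_FTC01 _ (fun w : R => w ^+ j * xlogx w ^+ 2) F (cM2 j) cF dF).
by rewrite /F !expr1n /xlogx ln1 ln0// !mulr0 !expr0n /= !mulr0 !subr0; ring.
Qed.

End beta_log.

(** * Moments under the law of a maximum of uniform points *)

Section power_law.
Context {R : realType}.
Local Notation mu := (@lebesgue_measure R).
Implicit Types (f g : R -> R) (k : nat) (w : R).

(* Expectation under the law of the maximum of [k] uniform points of [[0, 1]]. *)
Definition powE k f : R := \int[mu]_(w in `]0, 1[) (k%:R * w ^+ k.-1 * f w).

(** Under the law of [powE k], [- k ln w] is a standard exponential variable. This weight therefore
    has order 1 uniformly in [k], and all increments are bounded by its powers. *)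
Definition log_weight k w : R := 1 - k%:R * ln w.

Lemma Yk_ge1 k w : 0 < w < 1 -> 1 <= log_weight k w.
Proof.
move=> /andP[w0 w1]; rewrite /log_weight.
have : ln w <= 0 by apply: ln_le0; exact: ltW.
have : 0 <= k%:R :> R by [].
by move: (ln w) (k%:R : R) => l r; nra.
Qed.

(** With [y = - k ln w], half of the exponent gives [exp (- y / 3)], because [k <= 3 * k./2], and
    [1 + y <= 27 exp (y / 27)] gives [exp (y / 3)] after the ninth power. The exponent 9 is that of
    a cubic Taylor remainder whose increment has order [log_weight ^ 3]. *)
Lemma pow_Yk_le k w : (2 <= k)%N -> 0 < w < 1 ->
  w ^+ k./2 * log_weight k w ^+ 9 <= 27%:R ^+ 9.
Proof.
move=> k2 /andP[w0 w1].
have lw : ln w <= 0 by apply: ln_le0; exact: ltW.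
have kj : k%:R <= 3 * (k./2)%:R :> R.
  by rewrite -natrM ler_nat; lia.
have wE : w ^+ k./2 = expR ((k./2)%:R * ln w).
  by rewrite expRM_natl lnK// posrE.
set y := - (k%:R * ln w).
have y0 : 0 <= y by rewrite /y oppr_ge0 mulr_ge0_le0.
have h1 : log_weight k w <= 27%:R * expR (y / 27%:R).
  have := expR_ge1Dx (y / 27%:R); rewrite /log_weight -/y => h; lra.
have h2 : log_weight k w ^+ 9 <= (27%:R * expR (y / 27%:R)) ^+ 9.
  by apply: lerXn2r => //; rewrite nnegrE; [rewrite /log_weight -/y; lra|rewrite mulr_ge0// expR_ge0].
apply: (@le_trans _ _ (w ^+ k./2 * (27%:R * expR (y / 27%:R)) ^+ 9)).
  by apply: ler_wpM2l => //; rewrite exprn_ge0// ltW.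
rewrite exprMn -expRM_natl mulrCA ler_piMr ?exprn_ge0// wE -expRD.
rewrite -[leRHS]expR0 ler_expR.
have -> : 9%:R * (y / 27%:R) = y / 3 by field.
by rewrite /y; nra.
Qed.

(** A growth bound in place of integrability: it gives integrability for every [k >= 2], and for
    products of increments it is checked by adding exponents. *)
Definition admissible k f := measurable_fun setT f /\
  exists C, forall w, 0 < w < 1 -> `|f w| <= C * log_weight k w ^+ 9.

Lemma adm_ge0 k f : admissible k f ->
  exists2 C, 0 <= C & forall w, 0 < w < 1 -> `|f w| <= C * log_weight k w ^+ 9.
Proof.
move=> [_ [C hC]]; exists `|C| => // w w01; apply: (le_trans (hC w w01)).
apply: ler_wpM2r; last exact: ler_norm.
by rewrite exprn_ge0// (le_trans _ (Yk_ge1 k w01)).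
Qed.

Lemma admD k f g : admissible k f -> admissible k g -> admissible k (fun w => f w + g w).
Proof.
move=> [mf [C hC]] [mg [D hD]]; split; first exact: measurable_funD.
exists (C + D) => w w01; rewrite mulrDl (le_trans (ler_normD _ _))//.
by apply: lerD; [exact: hC|exact: hD].
Qed.

Lemma admN k f : admissible k f -> admissible k (fun w => - f w).
Proof.
move=> [mf [C hC]]; split; first exact: measurableT_comp.
by exists C => w w01; rewrite normrN; exact: hC.
Qed.

Lemma admB k f g : admissible k f -> admissible k g -> admissible k (fun w => f w - g w).
Proof. by move=> ? ?; apply: admD => //; exact: admN. Qed.

Lemma admZ k (c : R) f : admissible k f -> admissible k (fun w => c * f w).
Proof.
move=> [mf [C hC]]; split; first exact: measurable_funM.
exists (`|c| * C) => w w01; rewrite normrM -mulrA.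
by apply: ler_wpM2l => //; exact: hC.
Qed.

Lemma adm_le k f g : measurable_fun setT f -> admissible k g ->
  (forall w, 0 < w < 1 -> `|f w| <= `|g w|) -> admissible k f.
Proof.
move=> mf [mg [C hC]] fg; split => //.
by exists C => w w01; apply: (le_trans (fg w w01)); exact: hC.
Qed.

Lemma measurable_Yk k : measurable_fun setT (log_weight k).
Proof.
by apply: measurable_funB => //; apply: measurable_funM => //; exact: measurable_ln.
Qed.

Lemma admY k (i : nat) : (i <= 9)%N -> admissible k (fun w => log_weight k w ^+ i).
Proof.
move=> i9; split; first by apply: measurable_funX; exact: measurable_Yk.
exists 1 => w w01; rewrite mul1r.
rewrite ger0_norm; last by rewrite exprn_ge0// (le_trans _ (Yk_ge1 k w01)).
by rewrite ler_weXn2l// Yk_ge1.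
Qed.

Lemma adm_cst k (c : R) : admissible k (fun=> c).
Proof.
have := admZ c (@admY k 0 isT).
by congr admissible; apply/funext => w; rewrite expr0 mulr1.
Qed.

Lemma le_Yk k (i j : nat) w : (i <= j)%N -> 0 < w < 1 -> log_weight k w ^+ i <= log_weight k w ^+ j.
Proof. by move=> ij w01; rewrite ler_weXn2l// Yk_ge1. Qed.

Section expectation.
Variable k : nat.
Hypothesis k2 : (2 <= k)%N.

Let k0 : 0 <= k%:R :> R. Proof. by []. Qed.

Lemma powE_integrable f : admissible k f ->
  mu.-integrable `]0, 1[ (EFin \o (fun w => k%:R * w ^+ k.-1 * f w)).
Proof.
move=> af; have [mf _] := af; have [C C0 hC] := adm_ge0 af.
apply: (@bdd_integrable _ _ _ _ _ _ (k%:R * (C * 27%:R ^+ 9))) => //.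
- by rewrite /= lebesgue_measure_itv/= lte01 oppr0 adde0 ltry.
- apply: measurable_funTS; apply: measurable_funM => //.
  by apply: measurable_funM => //; exact: measurable_funX.
- move=> w /=; rewrite in_itv /= => w01.
  have [w0 w1] := andP w01.
  rewrite !normrM (ger0_norm k0) -mulrA ler_wpM2l// (@ger0_norm _ (w ^+ _)); last by rewrite exprn_ge0// ltW.
  apply: (@le_trans _ _ (w ^+ k./2 * (C * log_weight k w ^+ 9))).
    apply: ler_pM => //; first by rewrite exprn_ge0// ltW.
      by apply: ler_wiXn2l; [exact: ltW|exact: ltW|lia].
    exact: hC.
  by rewrite mulrCA ler_wpM2l// pow_Yk_le.
Qed.

Lemma powED f g : admissible k f -> admissible k g -> powE k (fun w => f w + g w) = powE k f + powE k g.
Proof.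
move=> af ag; rewrite /powE -RintegralD//; try exact: powE_integrable.
by apply: eq_Rintegral => w _; rewrite mulrDr.
Qed.

Lemma powEB f g : admissible k f -> admissible k g -> powE k (fun w => f w - g w) = powE k f - powE k g.
Proof.
move=> af ag; rewrite /powE -RintegralB//; try exact: powE_integrable.
by apply: eq_Rintegral => w _; rewrite mulrBr.
Qed.

Lemma powEZ c f : admissible k f -> powE k (fun w => c * f w) = c * powE k f.
Proof.
move=> af; rewrite /powE -RintegralZl//; last exact: powE_integrable.
by apply: eq_Rintegral => w _; rewrite mulrCA.
Qed.

Lemma le_powE f g : admissible k f -> admissible k g ->
  (forall w, 0 < w < 1 -> f w <= g w) -> powE k f <= powE k g.
Proof.
move=> af ag fg; apply: le_Rintegral => //; try exact: powE_integrable.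
move=> w /=; rewrite in_itv /= => w01; apply: ler_wpM2l; last exact: fg.
by have [w0 _] := andP w01; rewrite mulr_ge0// exprn_ge0// ltW.
Qed.

Lemma norm_powE f g : admissible k f -> admissible k g ->
  (forall w, 0 < w < 1 -> `|f w| <= g w) -> `|powE k f| <= powE k g.
Proof.
move=> af ag fg; rewrite ler_norml; apply/andP; split.
  rewrite -mulN1r -powEZ//; apply: le_powE => //; first exact: admZ.
  by move=> w w01; have := fg w w01; rewrite ler_norml => /andP[]; lra.
apply: le_powE => // w w01; have := fg w w01.
by rewrite ler_norml => /andP[].
Qed.

(** The closed formulas live on [[0, 1]]. With integrability as an alternative rather than a
    hypothesis, each use refutes the second case by continuity of the integrand. *)
Lemma powE_closed f : measurable_fun setT f ->
  powE k f = k%:R * \int[mu]_(w in `[0, 1]) (w ^+ k.-1 * f w) \/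
  ~ mu.-integrable `[0, 1] (EFin \o (fun w => w ^+ k.-1 * f w)).
Proof.
move=> mf; have [ii|ni] := pselect (mu.-integrable `[0, 1] (EFin \o (fun w => w ^+ k.-1 * f w))); last by right.
left; rewrite -RintegralZl// /powE /Rintegral; congr fine.
rewrite [RHS]integral_itv_bndoo; last first.
  apply: measurable_funTS; apply/measurable_EFinP; apply: measurable_funM => //.
  by apply: measurable_funM => //; exact: measurable_funX.
by apply: eq_integral => w _; rewrite mulrA.
Qed.

Lemma powE_beta g : continuous g -> powE k (fun w => g (1 - w)) = k%:R * betaI g k.-1.
Proof.
move=> cg; have cg' : continuous (fun w : R => w ^+ k.-1 * g (1 - w)).
  move=> x; have := @continuous_betaI R g k.-1 cg x.
  by under eq_fun do rewrite mulrC.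
have mg : measurable_fun setT (fun w : R => g (1 - w)).
  apply: (@measurableT_comp _ _ _ _ _ _ g) => //; first exact: continuous_measurable_fun.
  exact: measurable_funB.
have [->|] := powE_closed mg; last by have := continuous_integrable01 cg'.
by congr (_ * _); apply: eq_Rintegral => w _; rewrite mulrC.
Qed.

Lemma powE1 : powE k (fun=> 1) = 1.
Proof.
have cX : continuous (fun w : R => w ^+ k.-1 * 1).
  by move=> x; apply: cvgM; [exact: exprn_continuous|exact: cvg_cst].
have [//|->|] := powE_closed (f := fun=> 1); last by have := continuous_integrable01 cX.
rewrite -RintegralZl//; last exact: (continuous_integrable01 cX).
have cf : continuous (fun w : R => k%:R * (w ^+ k.-1 * 1)).
  by move=> x; apply: cvgM; [exact: cvg_cst|exact: cX].
have dF (x : R) : 0 < x < 1 -> is_derive x 1 (fun w : R => w ^+ k) (k%:R * (x ^+ k.-1 * 1)).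
  by move=> _; rewrite mulr1; exact: is_derive_exprn.
rewrite (@Rintegral_FTC01 _ _ _ cf (@exprn_continuous _ k) dF) expr1n expr0n.
by case: k k2 => // j _; rewrite subr0.
Qed.

Lemma powE_cst c : powE k (fun=> c) = c.
Proof.
rewrite -[RHS]mulr1 -powE1 -powEZ; last exact: adm_cst.
by congr powE; apply/funext => w; rewrite mulr1.
Qed.

(** [pow_Yk_le] consumes only half of the exponent; the other half integrates to [1 / (j + 1)] with
    [2 (j + 1) >= k], which absorbs the factor [k]. *)
Lemma powE_Y9 : powE k (fun w => log_weight k w ^+ 9) <= 2 * 27%:R ^+ 9.
Proof.
have mg : measurable_fun setT (fun w : R => w ^+ (k.-1 - k./2)).
  exact: measurable_funX.
pose j := (k.-1 - k./2)%N.
have jE : (j + k./2 = k.-1)%N by rewrite /j; lia.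
have ij : mu.-integrable `]0, 1[ (EFin \o (fun w : R => (k%:R * 27%:R ^+ 9) * w ^+ j)).
  apply: (@integrableS _ _ _ mu `[0, 1]) => //.
    exact: subset_itv_oo_cc.
  apply: continuous_integrable01 => x.
  by apply: cvgM; [exact: cvg_cst|exact: exprn_continuous].
apply: (@le_trans _ _ (\int[mu]_(w in `]0, 1[) ((k%:R * 27%:R ^+ 9) * w ^+ j))).
  apply: le_Rintegral => //; first by apply: powE_integrable; exact: admY.
  move=> w /=; rewrite in_itv /= => w01.
  have w0 : 0 <= w by case/andP: w01 => /ltW.
  have := pow_Yk_le k2 w01; rewrite -jE exprD.
  move: (27%:R ^+ 9 : R) (log_weight k w ^+ 9) => c Y h.
  have -> : k%:R * (w ^+ j * w ^+ k./2) * Y = k%:R * w ^+ j * (w ^+ k./2 * Y) by ring.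
  have -> : k%:R * c * w ^+ j = k%:R * w ^+ j * c by ring.
  by apply: ler_wpM2l h; rewrite mulr_ge0// exprn_ge0.
have -> : \int[mu]_(w in `]0, 1[) ((k%:R * 27%:R ^+ 9) * w ^+ j)
    = \int[mu]_(w in `[0, 1]) ((k%:R * 27%:R ^+ 9) * w ^+ j).
  rewrite /Rintegral [in RHS]integral_itv_bndoo//.
  by apply: measurable_funTS; apply/measurable_EFinP; apply: measurable_funM.
have j0 : j.+1%:R != 0 :> R by rewrite pnatr_eq0.
pose F := fun w : R => (k%:R * 27%:R ^+ 9 / j.+1%:R) * w ^+ j.+1.
have cM (c : R) i : continuous (fun w : R => c * w ^+ i).
  by move=> x; apply: cvgM; [exact: cvg_cst|exact: exprn_continuous].
have dF (x : R) : 0 < x < 1 -> is_derive x 1 F (k%:R * 27%:R ^+ 9 * x ^+ j).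
  move=> _; apply: (is_derive_eq (is_deriveZ _ (is_derive_exprn j.+1 x))).
  rewrite /GRing.scale /=; move: (j.+1%:R : R) j0 => y y0.
  by field.
rewrite (@Rintegral_FTC01 _ _ _ (cM _ _) (cM _ _) dF) /F.
rewrite expr1n expr0n /= mulr0 subr0 mulr1 mulrAC ler_wpM2r ?exprn_ge0//.
by rewrite ler_pdivrMr ?ltr0n// -natrM ler_nat; lia.
Qed.

Lemma norm_powE_Y f (B : R) (i : nat) : (i <= 9)%N -> 0 <= B -> measurable_fun setT f ->
  (forall w, 0 < w < 1 -> `|f w| <= B * log_weight k w ^+ i) ->
  `|powE k f| <= B * (2 * 27%:R ^+ 9).
Proof.
move=> i9 B0 mf hf.
have aY := admZ B (@admY k 9 isT).
have hf' w : 0 < w < 1 -> `|f w| <= B * log_weight k w ^+ 9.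
  by move=> w01; apply: (le_trans (hf w w01)); rewrite ler_wpM2l// le_Yk.
have af : admissible k f by split => //; exists B.
apply: (le_trans (norm_powE af aY hf')).
rewrite powEZ; last exact: admY.
by rewrite ler_wpM2l// powE_Y9.
Qed.

Lemma powE_lnw : powE k (fun w => - ln w) = k%:R^-1.
Proof.
have cX : continuous (fun w : R => - (w ^+ k.-2 * xlogx w)).
  by move=> x; apply: cvgN; apply: cvgM; [exact: exprn_continuous|exact: continuous_xlogx].
have e : (fun w : R => w ^+ k.-1 * - ln w) = (fun w : R => - (w ^+ k.-2 * xlogx w)).
  by apply/funext => w; rewrite /xlogx; case: k k2 => [|[|j]]//= _; rewrite exprSr; ring.
have mf : measurable_fun setT (fun w : R => - ln w).
  by apply: measurableT_comp => //; exact: measurable_ln.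
have [->|] := powE_closed mf; rewrite e; last by have := continuous_integrable01 cX.
under eq_Rintegral do rewrite -mulN1r.
rewrite RintegralZl//; last first.
  apply: continuous_integrable01 => x.
  by apply: cvgM; [exact: exprn_continuous|exact: continuous_xlogx].
rewrite int_wlogw; case: k k2 => [|[|j]]//= _.
have : j.+2%:R != 0 :> R by rewrite pnatr_eq0.
move: (j.+2%:R : R) => y y0.
by field.
Qed.

(** Read off from [int_wlogw2] with the power [w ^ (k - 3)]; hence [3 <= k], inherited by the
    second-moment estimate of a step. *)
Lemma powE_lnw2 : (3 <= k)%N -> powE k (fun w => ln w ^+ 2) = 2 / k%:R ^+ 2.
Proof.
move=> k3.
have cX : continuous (fun w : R => w ^+ (k - 3) * xlogx w ^+ 2).
  move=> x; apply: cvgM; first exact: exprn_continuous.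
  by apply: (@continuous_comp _ _ _ (@xlogx R) (fun y => y ^+ 2)); [exact: continuous_xlogx|exact: exprn_continuous].
have e : (fun w : R => w ^+ k.-1 * ln w ^+ 2) = (fun w : R => w ^+ (k - 3) * xlogx w ^+ 2).
  apply/funext => w; rewrite /xlogx; case: k k3 => [|[|[|j]]]//= _.
  by rewrite (_ : (j.+3 - 3 = j)%N) ?exprS; [ring|lia].
have mf : measurable_fun setT (fun w : R => ln w ^+ 2).
  by apply: measurable_funX; exact: measurable_ln.
have [->|] := powE_closed mf; rewrite e; last by have := continuous_integrable01 cX.
rewrite int_wlogw2; case: k k3 => [|[|[|j]]]//= _.
have : j.+3%:R != 0 :> R by rewrite pnatr_eq0.
by rewrite (_ : (j.+3 - 3 = j)%N); [|lia]; move: (j.+3%:R : R) => y y0; field.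
Qed.

(* [w ln w] integrated against the law with exponent [k] is an integral for [k + 1]. *)
Lemma powE_wlnw : powE k (fun w => w * - ln w) = k%:R / k.+1%:R ^+ 2.
Proof.
have cX : continuous (fun w : R => - (w ^+ k.-1 * xlogx w)).
  by move=> x; apply: cvgN; apply: cvgM; [exact: exprn_continuous|exact: continuous_xlogx].
have e : (fun w : R => w ^+ k.-1 * (w * - ln w)) = (fun w : R => - (w ^+ k.-1 * xlogx w)).
  by apply/funext => w; rewrite /xlogx; ring.
have mf : measurable_fun setT (fun w : R => w * - ln w).
  by apply: measurable_funM => //; apply: measurableT_comp => //; exact: measurable_ln.
have [->|] := powE_closed mf; rewrite e; last by have := continuous_integrable01 cX.
under eq_Rintegral do rewrite -mulN1r.
rewrite RintegralZl//; last first.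
  apply: continuous_integrable01 => x.
  by apply: cvgM; [exact: exprn_continuous|exact: continuous_xlogx].
rewrite int_wlogw; case: k k2 => [|[|j]]//= _.
have : j.+3%:R != 0 :> R by rewrite pnatr_eq0.
move: (j.+3%:R : R) (j.+2%:R : R) => y z y0.
by field.
Qed.

End expectation.
End power_law.

(** * The leading term of an increment and its moments *)

Section gap_law.
Context {R : realType}.
Implicit Types (k : nat) (w z t : R).

Lemma ln_ge_1BV t : 0 < t -> 1 - t^-1 <= ln t.
Proof.
move=> t0; have : ln t^-1 <= t^-1 - 1.
  have := @le_ln1Dx R (t^-1 - 1); rewrite subrKC; apply.
  by rewrite ltrBDr addrC subrr invr_gt0.
by rewrite lnV ?posrE//; lra.
Qed.

Lemma ln_le_B1 t : 0 < t -> ln t <= t - 1.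
Proof.
by move=> t0; have := @le_ln1Dx R (t - 1); rewrite subrKC; apply; lra.
Qed.

(** By [1 / (k + 1) <= ln (1 + 1 / k) <= 1 / k]; the term [1 / k] in the lower bound makes the
    induction telescope. A harmonic centring is thus a centring by [ln k] up to a bounded error. *)
Lemma harm_ln k : (0 < k)%N -> harm 2 k.+1 - ln (k%:R : R) <= 0 /\
  -1 + k%:R^-1 <= harm 2 k.+1 - ln (k%:R : R).
Proof.
case: k => // k _; elim: k => [|k [IH1 IH2]].
  by rewrite harmnn ln1 invr1; lra.
rewrite harmS//; have y0 : 0 < k.+1%:R :> R by [].
have := @ln_ge_1BV (k.+2%:R / k.+1%:R); have := @ln_le_B1 (k.+2%:R / k.+1%:R).
rewrite ln_div ?posrE// divr_gt0// => /(_ isT) h1 /(_ isT) h2.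
have e1 : k.+2%:R / k.+1%:R - 1 = k.+1%:R^-1 :> R.
  by rewrite -[k.+2%:R]natr1 mulrDl divff ?gt_eqF// mul1r addrC addKr.
have e2 : 1 - (k.+2%:R / k.+1%:R)^-1 = k.+2%:R^-1 :> R.
  rewrite invf_div; apply: (@mulIf _ k.+2%:R); first by rewrite pnatr_eq0.
  by rewrite mulrBl mul1r divfK ?pnatr_eq0// mulVf ?pnatr_eq0// -natr1 addrC addKr.
rewrite e1 in h1; rewrite e2 in h2.
move: (k.+1%:R^-1 : R) (k.+2%:R^-1 : R) (ln (k.+1%:R : R)) (ln (k.+2%:R : R))
  (harm 2 k.+2 : R) IH1 IH2 h1 h2 => a b c d e h3 h4 h1 h2.
by split; lra.
Qed.

Lemma norm_xlogx_le t : 0 <= t -> `|xlogx t| <= 1 + t ^+ 2.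
Proof.
move=> t0; have [->|tn0] := eqVneq t 0.
  by rewrite xlogx_le0// normr0 expr0n addr0.
have {tn0}t0 : 0 < t by rewrite lt_def tn0.
have h1 := ln_le_B1 t0; have h2 := ln_ge_1BV t0.
have h3 : t * (1 - t^-1) <= t * ln t by rewrite ler_wpM2l// ltW.
have h4 : t * ln t <= t * (t - 1) by rewrite ler_wpM2l// ltW.
rewrite mulrBr mulr1 divff ?gt_eqF// in h3.
by rewrite /xlogx ler_norml; apply/andP; split; nra.
Qed.

(** Under [powE k] the mean of [xlogx (1 - w)] is [- harm 2 k.+2] times the mean of [1 - w]. The
    linear term therefore centres [xlogx] up to order [k^-2]. *)
Definition gap_core k z : R := xlogx z + harm 2 k.+1 * z.

(* The increment of the centred gap sum when the maximum of the remaining points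
   drops from [u] to [u w] is, to leading order, [u h(u) gap_lead k w]. *)
Definition gap_lead k w : R := gap_core k (1 - w) + (1 - w) * - ln w.

Lemma betaID (g h : R -> R) k : continuous g -> continuous h ->
  betaI (fun z => g z + h z) k = betaI g k + betaI h k.
Proof.
move=> cg ch; rewrite /betaI -RintegralD//;
  try by apply: continuous_integrable01; exact: continuous_betaI.
by apply: eq_Rintegral => w _; rewrite mulrDl.
Qed.

Lemma betaIZ c (g : R -> R) k : continuous g ->
  betaI (fun z => c * g z) k = c * betaI g k.
Proof.
move=> cg; rewrite /betaI -RintegralZl//;
  try by apply: continuous_integrable01; exact: continuous_betaI.
by apply: eq_Rintegral => w _; rewrite mulrA.
Qed.

Lemma onem_le_lnw w : 0 < w -> 1 - w <= - ln w.
Proof. by move=> w0; have := ln_le_B1 w0; lra. Qed.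

(* With [w = exp (- s)] this is [s - (1 - exp (- s)) <= s^2]. *)
Lemma lnw_onem_le w : 0 < w < 1 -> - ln w - (1 - w) <= ln w ^+ 2.
Proof.
move=> /andP[w0 w1]; set s := - ln w.
have s0 : 0 < s by rewrite /s oppr_gt0 ln_lt0// w0.
have -> : ln w ^+ 2 = s ^+ 2 by rewrite /s sqrrN.
have e : w * expR s = 1 by rewrite /s expRN lnK ?posrE// mulfV// gt_eqF.
have := expR_ge1Dx s => h.
have h2 : w * (1 + s) <= 1 by rewrite -[leRHS]e; apply: ler_wpM2l => //; exact: ltW.
have : w * (1 + s) <= (1 - s + s ^+ 2) * (1 + s) by nra.
by rewrite ler_pM2r; lra.
Qed.

Section bounds.
Variables (k : nat) (w : R).
Hypotheses (k0 : (0 < k)%N) (w01 : 0 < w < 1).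

Let kp : 0 < k%:R :> R. Proof. by rewrite ltr0n. Qed.
Let s := - ln w.
Let Y := log_weight k w.
Let z := 1 - w.
Let ks : k%:R * s = Y - 1. Proof. by rewrite /Y /log_weight /s; ring. Qed.
Let sz : z <= s. Proof. by apply: onem_le_lnw; case/andP: w01. Qed.
Let z0 : 0 < z. Proof. by rewrite /z subr_gt0; case/andP: w01. Qed.
Let Y1 : 1 <= Y. Proof. exact: Yk_ge1. Qed.

Lemma lnw_le_Yk : - ln w <= log_weight k w / k%:R.
Proof. by rewrite -/s -/Y ler_pdivlMr// mulrC ks; lra. Qed.

Let sY : s <= Y / k%:R := lnw_le_Yk.

Lemma pf_le : `|gap_core k (1 - w)| <= log_weight k w ^+ 2 / k%:R.
Proof.
rewrite -/z -/Y ler_pdivlMr// mulrC -[X in X * _](gtr0_norm kp) -normrM.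
(* In units of the typical gap [1 / k], [gap_core] is [xlogx] plus a multiple of the identity that
   [harm_ln] keeps bounded. *)
have -> : k%:R * gap_core k z = xlogx (k%:R * z) + (harm 2 k.+1 - ln k%:R) * (k%:R * z).
  by rewrite /gap_core /xlogx lnM ?posrE//; ring.
have [h1 h2] := harm_ln k0.
have t0 : 0 <= k%:R * z by rewrite mulr_ge0// ltW.
have tY : k%:R * z <= Y - 1 by rewrite -ks ler_wpM2l// ltW.
apply: (le_trans (ler_normD _ _)); rewrite (normrM (harm 2 k.+1 - _)) (ger0_norm t0).
have h3 : `|harm 2 k.+1 - ln (k%:R : R)| <= 1.
  rewrite ler_norml; apply/andP; split; last lra.
  have : 0 < k%:R^-1 :> R by rewrite invr_gt0.
  by lra.
have := norm_xlogx_le t0; have := ler_wpM2r t0 h3; rewrite mul1r.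
move: (`|xlogx (k%:R * z)|) (`|harm 2 k.+1 - ln (k%:R : R)|) (k%:R * z) t0 tY => X c t t0 tY.
by move=> h4 h5; nra.
Qed.

Lemma zs_le : (1 - w) * - ln w <= log_weight k w ^+ 2 / k%:R ^+ 2.
Proof.
rewrite -/s -/z -/Y; apply: (@le_trans _ _ (s * s)).
  by apply: ler_wpM2r sz; exact: le_trans (ltW z0) sz.
have s0 : 0 <= s by exact: le_trans (ltW z0) sz.
by rewrite -expr2 -exprVn -exprMn; apply: lerXn2r; rewrite ?nnegrE// (le_trans s0).
Qed.

Let kge1 : 1 <= k%:R :> R. Proof. by rewrite ler1n. Qed.
Let V : k%:R^-1 <= 1 :> R. Proof. by rewrite invf_le1. Qed.
Let V0 : 0 < k%:R^-1 :> R. Proof. by rewrite invr_gt0. Qed.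

Lemma qf_le : `|gap_lead k w| <= 2 / k%:R * log_weight k w ^+ 2.
Proof.
apply: (le_trans (ler_normD _ _)).
have h1 := pf_le; have h2 := zs_le.
have h3 : 0 <= (1 - w) * - ln w by rewrite mulr_ge0 ?ltW// (lt_le_trans z0).
rewrite (ger0_norm h3).
have : log_weight k w ^+ 2 / k%:R ^+ 2 <= log_weight k w ^+ 2 / k%:R.
  by rewrite ler_wpM2l ?sqr_ge0// -exprVn expr2 ler_piMr// ltW.
by move: h1 h2; move: (`|gap_core _ _|) ((1 - w) * _) (log_weight k w ^+ 2) => a b c; lra.
Qed.

(** [gap_lead] and [gap_core] are of order [k^-1] and differ by a term of order [k^-2]. Second
    moments may thus be computed for [gap_core], for which they are Beta integrals. *)
Lemma qf2_sub_le : `|gap_lead k w ^+ 2 - gap_core k (1 - w) ^+ 2| <= 3 / k%:R ^+ 3 * log_weight k w ^+ 4.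
Proof.
have h1 := pf_le; have h2 := zs_le.
have h3 : 0 <= (1 - w) * - ln w by rewrite mulr_ge0 ?ltW// (lt_le_trans z0).
have -> : gap_lead k w ^+ 2 - gap_core k (1 - w) ^+ 2 =
  ((1 - w) * - ln w) * (2 * gap_core k (1 - w) + (1 - w) * - ln w) by rewrite /gap_lead; ring.
rewrite normrM (ger0_norm h3).
have -> : 3 / k%:R ^+ 3 * log_weight k w ^+ 4 = (log_weight k w ^+ 2 / k%:R ^+ 2) * (3 * (log_weight k w ^+ 2 / k%:R)).
  by field; rewrite gt_eqF.
apply: ler_pM => //; apply: (le_trans (ler_normD _ _)).
rewrite normrM (ger0_norm h3) (@ger0_norm _ 2)//.
have : log_weight k w ^+ 2 / k%:R ^+ 2 <= log_weight k w ^+ 2 / k%:R.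
  by rewrite ler_wpM2l ?sqr_ge0// -exprVn expr2 ler_piMr// ltW.
by move: h1 h2; move: (`|gap_core _ _|) ((1 - w) * _) (log_weight k w ^+ 2) => a b c; lra.
Qed.

Lemma qfs_sub_le : `|gap_lead k w * - ln w - gap_core k (1 - w) * (1 - w)| <= 2 / k%:R ^+ 3 * log_weight k w ^+ 4.
Proof.
have h1 := pf_le; have h2 := zs_le.
have h3 : 0 <= (1 - w) * - ln w by rewrite mulr_ge0 ?ltW// (lt_le_trans z0).
have -> : gap_lead k w * - ln w - gap_core k (1 - w) * (1 - w) =
  gap_core k (1 - w) * (- ln w - (1 - w)) + ((1 - w) * - ln w) * - ln w by rewrite /gap_lead; ring.
apply: (le_trans (ler_normD _ _)); rewrite !normrM.
have s0 : 0 <= - ln w by exact: le_trans (ltW z0) sz.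
have z00 : 0 <= 1 - w by rewrite ltW.
rewrite (ger0_norm s0) (ger0_norm z00) (@ger0_norm _ (- ln w - (1 - w))); last by rewrite subr_ge0.
have -> : 2 / k%:R ^+ 3 * log_weight k w ^+ 4 = (log_weight k w ^+ 2 / k%:R) * (log_weight k w / k%:R) ^+ 2
   + (log_weight k w ^+ 2 / k%:R ^+ 2) * (log_weight k w ^+ 2 / k%:R).
  by field; rewrite gt_eqF.
apply: lerD.
  apply: ler_pM => //; first by rewrite subr_ge0.
  apply: (le_trans (lnw_onem_le w01)); rewrite -sqrrN.
  by apply: lerXn2r; rewrite ?nnegrE// (le_trans s0).
apply: ler_pM => //; apply: (le_trans lnw_le_Yk).
by rewrite ler_wpM2r ?invr_ge0// expr2 ler_peMl// (le_trans ler01).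
Qed.

End bounds.

Lemma measurable_pf k : measurable_fun setT (fun w : R => gap_core k (1 - w)).
Proof.
apply: measurable_funD; last by apply: measurable_funM => //; exact: measurable_funB.
apply: (@measurableT_comp _ _ _ _ _ _ (@xlogx R)); first exact: measurable_xlogx.
exact: measurable_funB.
Qed.

Lemma measurable_lnN : measurable_fun setT (fun w : R => - ln w).
Proof. by apply: measurableT_comp => //; exact: measurable_ln. Qed.

Lemma measurable_qf k : measurable_fun setT (@gap_lead k).
Proof.
apply: measurable_funD; first exact: measurable_pf.
by apply: measurable_funM; [exact: measurable_funB|exact: measurable_lnN].
Qed.

Lemma adm_Y (f : R -> R) k (B : R) (i : nat) : (i <= 9)%N -> 0 <= B ->
  measurable_fun setT f ->
  (forall w, 0 < w < 1 -> `|f w| <= B * log_weight k w ^+ i) -> admissible k f.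
Proof.
move=> i9 B0 mf h; split => //; exists B => w w01.
by apply: (le_trans (h w w01)); rewrite ler_wpM2l// le_Yk.
Qed.

Section moments.
Variable k : nat.
Hypothesis k2 : (2 <= k)%N.
Let k0 : (0 < k)%N. Proof. by case: k k2. Qed.
Let kp : 0 < k%:R :> R. Proof. by rewrite ltr0n. Qed.
Let kV : 0 <= k%:R^-1 :> R. Proof. by rewrite invr_ge0. Qed.

Lemma adm_lnN : admissible k (fun w : R => - ln w).
Proof.
apply: (@adm_Y _ k (k%:R^-1) 1) => //; first exact: measurable_lnN.
move=> w w01; rewrite expr1 ger0_norm.
  by rewrite mulrC; exact: lnw_le_Yk.
by rewrite oppr_ge0 ln_le0// ltW//; case/andP: w01.
Qed.

Lemma adm_qf : admissible k (@gap_lead k).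
Proof.
apply: (@adm_Y _ k (2 / k%:R) 2) => //.
  exact: measurable_qf.
by move=> w w01; exact: qf_le.
Qed.

Lemma adm_pf : admissible k (fun w => gap_core k (1 - w)).
Proof.
apply: (@adm_Y _ k (k%:R^-1) 2) => //; first exact: measurable_pf.
by move=> w w01; rewrite mulrC; exact: pf_le.
Qed.

Lemma adm_mul (f g : R -> R) (B C : R) (i j : nat) : (i + j <= 9)%N -> 0 <= B -> 0 <= C ->
  measurable_fun setT f -> measurable_fun setT g ->
  (forall w, 0 < w < 1 -> `|f w| <= B * log_weight k w ^+ i) ->
  (forall w, 0 < w < 1 -> `|g w| <= C * log_weight k w ^+ j) ->
  admissible k (fun w => f w * g w).
Proof.
move=> ij B0 C0 mf mg hf hg; apply: (@adm_Y _ k (B * C) (i + j)) => //.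
- exact: mulr_ge0.
- exact: measurable_funM.
- move=> w w01; rewrite normrM exprD mulrACA.
  by apply: ler_pM => //; [exact: hf|exact: hg].
Qed.

Let sle w : 0 < w < 1 -> `|- ln w| <= k%:R^-1 * log_weight k w ^+ 1.
Proof.
move=> w01; rewrite expr1 ger0_norm; first by rewrite mulrC; exact: lnw_le_Yk.
by rewrite oppr_ge0 ln_le0// ltW//; case/andP: w01.
Qed.

Lemma adm_qf2 : admissible k (fun w => gap_lead k w ^+ 2).
Proof.
have m2 : 0 <= 2 / k%:R :> R by rewrite mulr_ge0.
have := @adm_mul (@gap_lead k) (@gap_lead k) _ _ 2 2 isT m2 m2 (measurable_qf k) (measurable_qf k)
  (fun w => qf_le k0) (fun w => qf_le k0).
by under eq_fun do rewrite -expr2.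
Qed.

Lemma adm_qfs : admissible k (fun w => gap_lead k w * - ln w).
Proof.
have m2 : 0 <= 2 / k%:R :> R by rewrite mulr_ge0.
exact: (@adm_mul (@gap_lead k) (fun w => - ln w) _ _ 2 1 isT m2 kV (measurable_qf k) measurable_lnN
  (fun w => qf_le k0) sle).
Qed.

Lemma adm_lnN2 : admissible k (fun w => ln w ^+ 2).
Proof.
have := @adm_mul (fun w => - ln w) (fun w => - ln w) _ _ 1 1 isT kV kV
  measurable_lnN measurable_lnN sle sle.
by under eq_fun do rewrite -expr2 sqrrN.
Qed.

Let cpf j : continuous (gap_core j).
Proof.
move=> x; apply: cvgD; first exact: continuous_xlogx.
by apply: cvgM; [exact: cvg_cst|exact: cvg_id].
Qed.

Let adm_w : admissible k (fun w => 1 - w).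
Proof.
apply: (@adm_Y _ k 1 0) => //; first exact: measurable_funB.
by move=> w /andP[w0 w1]; rewrite expr0 mulr1 ger0_norm; lra.
Qed.

Let adm_ws : admissible k (fun w => w * - ln w).
Proof.
apply: (@adm_mul (fun w => w) (fun w => - ln w) 1 _ 0 1 isT _ kV) => //.
- exact: measurable_lnN.
- by move=> w /andP[w0 w1]; rewrite expr0 mulr1 ger0_norm; lra.
Qed.

(** The harmonic sums cancel by the choice of [harm 2 k.+1] in [gap_core]. The exact value matters:
    the mean of [k.+1%:R^-1 + ln w], the other random factor of a step, is its opposite. *)
Lemma powE_qf : powE k (@gap_lead k) = (k%:R * k.+1%:R)^-1.
Proof.
have -> : powE k (@gap_lead k) = powE k (fun w => (xlogx (1 - w) + harm 2 k.+1 * (1 - w))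
   + (- ln w - w * - ln w)).
  by congr powE; apply/funext => w; rewrite /gap_lead /gap_core; ring.
have a1 : admissible k (fun w : R => xlogx (1 - w)).
  have -> : (fun w : R => xlogx (1 - w)) = (fun w => gap_core k (1 - w) - harm 2 k.+1 * (1 - w)).
    by apply/funext => w; rewrite /gap_core; ring.
  by apply: admB; [exact: adm_pf|exact: admZ].
rewrite powED//; last 2 first.
- by apply: admD => //; exact: admZ.
- by apply: admB => //; exact: adm_lnN.
rewrite powED//; last exact: admZ.
rewrite powEB//; last exact: adm_lnN.
rewrite powEZ// powE_lnw// powE_wlnw// powE_beta//; last exact: continuous_xlogx.
rewrite (@powE_beta _ k (fun z => z))//; last by move=> x; exact: cvg_id.
rewrite betaI_xlogx betaI_id prednK// (@harmS _ 2 k.+1)//.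
rewrite !natrM; have : k.+1%:R != 0 :> R by rewrite pnatr_eq0.
have : k%:R != 0 :> R by rewrite gt_eqF.
rewrite -natr1; move: (k%:R : R) (harm 2 k.+1 : R) => x h x0 x1.
by field; rewrite x0 x1.
Qed.

Lemma powE_pf2 : powE k (fun w => gap_core k (1 - w) ^+ 2) =
  2 / (k.+1%:R * k.+2%:R) * ((2^-1 - k.+1%:R^-1 - k.+2%:R^-1) ^+ 2 + harm2 3 k.+3).
Proof.
have cx2 : continuous (fun z : R => xlogx z ^+ 2).
  move=> x; apply: (@continuous_comp _ _ _ (@xlogx R) (fun y => y ^+ 2)).
    exact: continuous_xlogx.
  exact: exprn_continuous.
have czx : continuous (fun z : R => z * xlogx z).
  by move=> x; apply: cvgM; [exact: cvg_id|exact: continuous_xlogx].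
rewrite (@powE_beta _ k (fun z => gap_core k z ^+ 2)); last first.
  move=> x; apply: (@continuous_comp _ _ _ (gap_core k) (fun y => y ^+ 2)).
    exact: cpf.
  exact: exprn_continuous.
set h : R := harm 2 k.+1.
have cs : continuous (fun z : R => z ^+ 2) by exact: exprn_continuous.
have cM (c : R) (g : R -> R) : continuous g -> continuous (fun z : R => c * g z).
  by move=> cg x; apply: cvgM; [exact: cvg_cst|exact: cg].
have -> : betaI (fun z => gap_core k z ^+ 2) k.-1 = betaI (fun z : R => xlogx z ^+ 2) k.-1
   + 2 * h * betaI (fun z => z * xlogx z) k.-1 + h ^+ 2 * betaI (fun z : R => z ^+ 2) k.-1.
  rewrite -!betaIZ// -betaID//; last exact: cM.
  rewrite -betaID; last exact: cM.
    by congr betaI; apply/funext => z; rewrite /gap_core -/h; ring.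
  by move=> x; apply: cvgD; [exact: cx2|apply: cvgM; [exact: cvg_cst|exact: czx]].
rewrite betaI_xlogx2 betaI_zxlogx betaI_sqr prednK//.
have -> : harm 3 k.+3 = h + k.+1%:R^-1 + k.+2%:R^-1 - 2^-1 :> R.
  have : harm 2 k.+3 = 2^-1 + harm 3 k.+3 :> R by rewrite /harm big_ltn.
  rewrite (@harmS _ 2 k.+2)// (@harmS _ 2 k.+1)// -/h.
  by move: (k.+1%:R^-1 : R) (k.+2%:R^-1 : R) (harm 3 k.+3 : R) => a b c; lra.
rewrite !natrM.
have : k%:R != 0 :> R by rewrite gt_eqF.
have : k.+1%:R != 0 :> R by rewrite pnatr_eq0.
have : k.+2%:R != 0 :> R by rewrite pnatr_eq0.
move: (k%:R : R) (k.+1%:R : R) (k.+2%:R : R) (harm2 3 k.+3 : R) => x y u v u0 y0 x0.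
by field; rewrite x0 y0 u0.
Qed.

Lemma powE_pfz : powE k (fun w => gap_core k (1 - w) * (1 - w)) =
  2 / (k.+1%:R * k.+2%:R) * (2^-1 - k.+1%:R^-1 - k.+2%:R^-1).
Proof.
have czx : continuous (fun z : R => z * xlogx z).
  by move=> x; apply: cvgM; [exact: cvg_id|exact: continuous_xlogx].
rewrite (@powE_beta _ k (fun z => gap_core k z * z)); last first.
  by move=> x; apply: cvgM; [exact: cpf|exact: cvg_id].
set h : R := harm 2 k.+1.
have cs : continuous (fun z : R => z ^+ 2) by exact: exprn_continuous.
have -> : betaI (fun z => gap_core k z * z) k.-1 =
   betaI (fun z => z * xlogx z) k.-1 + h * betaI (fun z : R => z ^+ 2) k.-1.
  rewrite -betaIZ// -betaID//; last by move=> x; apply: cvgM; [exact: cvg_cst|exact: cs].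
  by congr betaI; apply/funext => z; rewrite /gap_core -/h; ring.
rewrite betaI_zxlogx betaI_sqr prednK//.
have -> : harm 3 k.+3 = h + k.+1%:R^-1 + k.+2%:R^-1 - 2^-1 :> R.
  have : harm 2 k.+3 = 2^-1 + harm 3 k.+3 :> R by rewrite /harm big_ltn.
  rewrite (@harmS _ 2 k.+2)// (@harmS _ 2 k.+1)// -/h.
  by move: (k.+1%:R^-1 : R) (k.+2%:R^-1 : R) (harm 3 k.+3 : R) => a b c; lra.
rewrite !natrM.
have : k%:R != 0 :> R by rewrite gt_eqF.
have : k.+1%:R != 0 :> R by rewrite pnatr_eq0.
have : k.+2%:R != 0 :> R by rewrite pnatr_eq0.
move: (k%:R : R) (k.+1%:R : R) (k.+2%:R : R) => x y u u0 y0 x0.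
by field; rewrite x0 y0 u0.
Qed.

Lemma powE_qf2_sub : `|powE k (fun w => gap_lead k w ^+ 2) - powE k (fun w => gap_core k (1 - w) ^+ 2)|
  <= 3 / k%:R ^+ 3 * (2 * 27%:R ^+ 9).
Proof.
have ap : admissible k (fun w => gap_core k (1 - w) ^+ 2).
  have hp w : 0 < w < 1 -> `|gap_core k (1 - w)| <= k%:R^-1 * log_weight k w ^+ 2.
    by move=> w01; rewrite mulrC; exact: pf_le.
  have := @adm_mul _ _ _ _ 2 2 isT kV kV (measurable_pf k) (measurable_pf k) hp hp.
  by under eq_fun do rewrite -expr2.
rewrite -powEB//; last exact: adm_qf2.
apply: (@norm_powE_Y _ _ k2 _ _ 4) => //.
- by apply: measurable_funB; apply: measurable_funX; [exact: measurable_qf|exact: measurable_pf].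
- by move=> w w01; exact: qf2_sub_le.
Qed.

Lemma powE_qfs_sub :
  `|powE k (fun w => gap_lead k w * - ln w) - powE k (fun w => gap_core k (1 - w) * (1 - w))|
  <= 2 / k%:R ^+ 3 * (2 * 27%:R ^+ 9).
Proof.
have ap : admissible k (fun w => gap_core k (1 - w) * (1 - w)).
  apply: (@adm_mul (fun w => gap_core k (1 - w)) (fun w => 1 - w) k%:R^-1 1 2 0 isT) => //.
  - exact: measurable_pf.
  - exact: measurable_funB.
  - by move=> w w01; rewrite mulrC; exact: pf_le.
  - by move=> w /andP[w0 w1]; rewrite expr0 mulr1 ger0_norm; lra.
rewrite -powEB//; last exact: adm_qfs.
apply: (@norm_powE_Y _ _ k2 _ _ 4) => //.
- apply: measurable_funB; apply: measurable_funM;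
    [exact: measurable_qf|exact: measurable_lnN|exact: measurable_pf|exact: measurable_funB].
- by move=> w w01; exact: qfs_sub_le.
Qed.

End moments.
End gap_law.

(** * The Basel problem and harmonic sums *)

Section basel.
Context {R : realType}.
Implicit Types (x : R) (m n : nat).

Lemma sin_le_id x : 0 < x -> sin x <= x.
Proof.
move=> x0.
have cs : {within `[0, x], continuous (@sin R)}.
  by apply: continuous_subspaceT => y; exact: continuous_sin.
have [c _] := MVT x0 (fun y _ => is_derive_sin y) cs.
rewrite sin0 !subr0 => ->; have := cos_max c; rewrite ler_norml => /andP[_ h].
by rewrite ler_piMl// ltW.
Qed.

Lemma cos_mul_le_sin x : 0 < x < pi / 2 -> x * cos x <= sin x.
Proof.
move=> /andP[x0 x1].
have cp y : 0 <= y <= x -> 0 < cos y.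
  move=> /andP[y0 yx]; apply: cos_gt0_pihalf.
  have p0 := @pi_gt0 R.
  by apply/andP; split; lra.
have dt (y : R) : y \in `]0, x[%R -> is_derive y 1 (@tan R) ((cos y)^-2).
  rewrite in_itv /= => /andP[y0 yx]; apply: is_derive_tan.
  by rewrite gt_eqF// cp// !ltW.
have ct : {within `[0, x], continuous (@tan R)}.
  apply: continuous_in_subspaceT => y /[1!inE]/=; rewrite in_itv /= => yx.
  by apply: continuous_tan; rewrite gt_eqF// cp.
have [c] := MVT x0 dt ct.
rewrite in_itv /= => /andP[c0 cx]; rewrite subr0 tan0 subr0 => e.
have cc : 0 < cos c by apply: cp; rewrite !ltW.
have c1 : cos c <= 1 by have := cos_max c; rewrite ler_norml => /andP[].
have cx0 : 0 < cos x by apply: cp; rewrite lexx ltW.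
have : x <= tan x.
  rewrite e -[leLHS]mul1r; apply: ler_wpM2r; first exact: ltW.
  have c2 : cos c ^+ 2 <= 1 by rewrite expr2; apply: mulr_ile1 => //; exact: ltW.
  by rewrite invf_ge1// exprn_gt0.
by rewrite /tan ler_pdivlMr.
Qed.

Let csc2 (x : R) : R := (sin x ^+ 2)^-1.

(** With [s], [c] the sine and cosine of [x / 2]: [sin x = 2 s c] and
    [1 / s^2 + 1 / c^2 = 1 / (s c)^2]. Iteration doubles the number of equally spaced angles, which
    gives the elementary proof of the Basel sum. *)
Lemma csc2_half x : 0 < x < pi -> csc2 x = 4^-1 * (csc2 (x / 2) + csc2 (pi / 2 - x / 2)).
Proof.
move=> /andP[x0 x1]; have p0 := @pi_gt0 R.
have s0 : 0 < sin (x / 2) by apply: sin_gt0_pihalf; apply/andP; split; lra.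
have c0 : 0 < cos (x / 2) by apply: cos_gt0_pihalf; apply/andP; split; lra.
rewrite /csc2.
have -> : sin (pi / 2 - x / 2) = cos (x / 2).
  by rewrite addrC sinDpihalf cosN.
have xE : x = (x / 2) *+ 2 by rewrite mulr2n; lra.
have e := cos2Dsin2 (x / 2).
rewrite [in LHS]xE sin_mulr2n.
move: (sin (x / 2)) (cos (x / 2)) s0 c0 e => s c s0 c0 e.
have -> : (s ^+ 2)^-1 + (c ^+ 2)^-1 = (c ^+ 2 + s ^+ 2) / (s ^+ 2 * c ^+ 2).
  by field; rewrite !gt_eqF.
by rewrite e; field; rewrite !gt_eqF.
Qed.

Lemma csc2_bound x : 0 < x < pi / 2 -> csc2 x - 1 <= (x ^+ 2)^-1 <= csc2 x.
Proof.
move=> x01; have /andP[x0 x1] := x01.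
have s0 : 0 < sin x := sin_gt0_pihalf x01.
have c0 : 0 < cos x.
  by apply: cos_gt0_pihalf; have p0 := @pi_gt0 R; apply/andP; split; lra.
have h1 := sin_le_id x0; have h2 := cos_mul_le_sin x01; have e := cos2Dsin2 x.
apply/andP; split; last first.
  by rewrite /csc2 lef_pV2 ?posrE ?exprn_gt0// lerXn2r// nnegrE ltW.
have -> : csc2 x - 1 = cos x ^+ 2 / sin x ^+ 2.
  have -> : cos x ^+ 2 = 1 - sin x ^+ 2 by rewrite -e addrK.
  by rewrite /csc2; field; rewrite gt_eqF.
rewrite ler_pdivrMr ?exprn_gt0// mulrC ler_pdivlMr ?exprn_gt0// -exprMn.
by rewrite [cos x * x]mulrC; apply: lerXn2r => //; rewrite nnegrE ?mulr_ge0// ltW.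
Qed.

(** For [i < 2 ^ m] these are the odd multiples of [pi / 2 ^ (m + 2)] below [pi / 2]. *)
Let ang m i : R := i.*2.+1%:R * (pi / (2 ^ m.+2)%:R).

Let ang_bound m i : (i < 2 ^ m)%N -> 0 < ang m i < pi / 2.
Proof.
move=> im; have p0 := @pi_gt0 R.
have q0 : 0 < (2 ^ m.+2)%:R :> R by rewrite ltr0n expn_gt0.
apply/andP; split; first by rewrite /ang mulr_gt0// divr_gt0.
rewrite /ang mulrA ltr_pdivrMr// mulrC -mulrA ltr_pM2l//.
rewrite mulrC ltr_pdivlMr//  -natrM ltr_nat !expnS; lia.
Qed.

Lemma sum_csc2 m : \sum_(0 <= i < 2 ^ m) csc2 (ang m i) = 2 * (4 ^ m)%:R.
Proof.
have p0 := @pi_gt0 R.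
elim: m => [|m IH].
  rewrite big_nat1 /ang /= mul1r mulr1; have := @csc2_half (pi / 2).
  rewrite /csc2 sin_pihalf expr1n invr1.
  have -> : pi / 2 - pi / 2 / 2 = pi / (2 ^ 2)%:R :> R by field.
  have -> : pi / 2 / 2 = pi / (2 ^ 2)%:R :> R by field.
  have h0 : 0 < (pi : R) / 2 < pi by apply/andP; split; lra.
  move=> /(_ h0) h.
  by lra.
have -> : 2 * (4 ^ m.+1)%:R = 4 * (2 * (4 ^ m)%:R) :> R.
  by rewrite expnS natrM; ring.
rewrite -IH expnS mul2n -addnn (@big_cat_nat _ _ _ (2 ^ m) 0 _ _ _ (leq0n _) (leq_addr _ _))//=.
rewrite -{2}[(2 ^ m)%N]add0n big_addn addnK.
(* Reversing the second half of the sum makes its angles the complements [pi / 2 - ang m i / 2] that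
   [csc2_half] produces. *)
rewrite [X in _ + X]big_nat_rev /= add0n -big_split /= mulr_sumr.
rewrite big_nat_cond [RHS]big_nat_cond; apply: eq_bigr => i /andP[/andP[_ im] _].
have /andP[a0 a1] := ang_bound im.
rewrite (@csc2_half (ang m i)); last by apply/andP; split; lra.
rewrite mulrA divff// mul1r.
have q0 : (2 ^ m)%:R != 0 :> R by rewrite pnatr_eq0 expn_eq0.
have -> : ang m i / 2 = ang m.+1 i.
  rewrite /ang [(2 ^ m.+3)%N]expnS natrM.
  have q1 : (2 ^ m.+2)%:R != 0 :> R by rewrite pnatr_eq0 expn_eq0.
  by field.
congr (_ + csc2 _); rewrite /ang.
have -> : ((2 ^ m - i.+1 + 2 ^ m).*2.+1)%:R = 4 * (2 ^ m)%:R - (i.*2.+1)%:R :> R.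
  rewrite -natrM -natrB; last by lia.
  by congr (_%:R); lia.
have -> : (2 ^ m.+3)%:R = 8 * (2 ^ m)%:R :> R by rewrite !expnS !natrM; ring.
move: ((2 ^ m)%:R : R) (i.*2.+1%:R : R) q0 => q y q0.
by field.
Qed.

Let odds n : R := \sum_(0 <= i < n) (i.*2.+1%:R ^+ 2)^-1.

(** [csc2_bound] places the sum of the inverse squared angles between [2 * 4 ^ m - 2 ^ m] and
    [2 * 4 ^ m]; the squared unit angle [c] rescales these to the two bounds. *)
Lemma odds_bound m : pi ^+ 2 / 8 * (1 - (2 ^ m.+1)%:R^-1) <= odds (2 ^ m) <= pi ^+ 2 / 8.
Proof.
have p0 := @pi_gt0 R.
have q0 : 0 < (2 ^ m.+2)%:R :> R by rewrite ltr0n expn_gt0.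
have q1 : 0 < (2 ^ m)%:R :> R by rewrite ltr0n expn_gt0.
pose c : R := (pi / (2 ^ m.+2)%:R) ^+ 2.
have c0 : 0 < c by rewrite exprn_gt0// divr_gt0.
have oE : odds (2 ^ m) = c * \sum_(0 <= i < 2 ^ m) (ang m i ^+ 2)^-1.
  rewrite mulr_sumr; apply: eq_bigr => i _; rewrite /ang exprMn -/c.
  have i0 : i.*2.+1%:R != 0 :> R by rewrite pnatr_eq0.
  move: (lt0r_neq0 c0) i0; move: (c) (i.*2.+1%:R : R) => d y d0 y0.
  by field; rewrite d0 y0.
have cE : c * (2 * (4 ^ m)%:R) = pi ^+ 2 / 8.
  rewrite /c (_ : (2 ^ m.+2)%:R = 4 * (2 ^ m)%:R); last by rewrite !expnS !natrM; ring.
  rewrite (_ : (4 ^ m)%:R = (2 ^ m)%:R ^+ 2); last first.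
    by rewrite -natrX (_ : 4 = 2 ^ 2)%N// -!expnM mulnC.
  by field; rewrite gt_eqF.
have cE2 : c * (2 ^ m)%:R = pi ^+ 2 / 8 * (2 ^ m.+1)%:R^-1.
  rewrite /c (_ : (2 ^ m.+2)%:R = 4 * (2 ^ m)%:R); last by rewrite !expnS !natrM; ring.
  rewrite (_ : (2 ^ m.+1)%:R = 2 * (2 ^ m)%:R); last by rewrite !expnS !natrM; ring.
  by field; rewrite gt_eqF.
have s1 : \sum_(0 <= i < 2 ^ m) (csc2 (ang m i) - 1) = 2 * (4 ^ m)%:R - (2 ^ m)%:R.
  by rewrite sumrB sum_csc2 sumr_const_nat subn0.
rewrite oE; apply/andP; split.
  rewrite mulrBr mulr1 -cE2 -cE -mulrBr ler_pM2l// -s1.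
  apply: ler_sum_nat => i /andP[_ im].
  by have /andP[] := csc2_bound (ang_bound im).
rewrite -cE ler_pM2l// -sum_csc2.
apply: ler_sum_nat => i /andP[_ im].
by have /andP[] := csc2_bound (ang_bound im).
Qed.

Let Z n : R := harm2 1 n.+1.

(** The even terms are a quarter of the whole sum, so the limit [L] satisfies
    [L = pi^2 / 8 + L / 4]. *)
Let Z_split n : Z n.*2 = odds n + 4^-1 * Z n.
Proof.
elim: n => [|n IH]; first by rewrite /Z /odds harm2nn big_geq// mulr0 addr0.
rewrite doubleS /Z (@harm2S _ 1 n.+1.*2)// (@harm2S _ 1 n.*2.+1)// (@harm2S _ 1 n.+1)//.
rewrite -/(Z n.*2) -/(Z n) IH /odds big_nat_recr//= -!/(odds n).
have -> : n.*2.+2%:R = 2 * n.+1%:R :> R by rewrite -natrM; congr (_%:R); lia.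
have : n.+1%:R != 0 :> R by rewrite pnatr_eq0.
have : n.*2.+1%:R != 0 :> R by rewrite pnatr_eq0.
move: (n.+1%:R : R) (n.*2.+1%:R : R) (odds n) (Z n) => y x o z x0 y0.
by field; rewrite x0 y0.
Qed.

Let Z_nd : nondecreasing_seq Z.
Proof.
apply/nondecreasing_seqP => n; rewrite /Z (@harm2S _ 1 n.+1)// lerDl.
by rewrite invr_ge0 exprn_ge0.
Qed.

Let Z_ub n : Z n.+1 <= 2 - n.+1%:R^-1.
Proof.
elim: n => [|n IH]; first by rewrite /Z (@harm2S _ 1 1)// harm2nn expr1n invr1; lra.
rewrite /Z (@harm2S _ 1 n.+2)// -/(Z n.+1).
apply: (@le_trans _ _ (2 - n.+1%:R^-1 + (n.+2%:R ^+ 2)^-1)); first by rewrite lerD2r.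
have : 0 < n.+1%:R :> R by [].
rewrite -[n.+2%:R]natr1; move: (n.+1%:R : R) => y y0.
rewrite -addrA lerD2l -subr_ge0.
have -> : - (y + 1)^-1 - (- y^-1 + ((y + 1) ^+ 2)^-1) = (y * (y + 1) ^+ 2)^-1.
  by field; rewrite !gt_eqF// addr_gt0.
by rewrite invr_ge0 mulr_ge0 ?sqr_ge0 ?ltW.
Qed.

Let Z_cvg : cvgn Z.
Proof.
apply: nondecreasing_is_cvgn => //; exists 2 => _ [n _ <-].
case: n => [|n]; first by rewrite /Z harm2nn.
by apply: (le_trans (Z_ub n)); rewrite gerDl oppr_le0 invr_ge0.
Qed.

Let cvg_2X : (fun m => 2 ^ m)%N @ \oo --> \oo.
Proof.
move=> A [N _ NA]; exists N => // m /= Nm; apply: NA => /=.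
by apply: (leq_trans Nm); apply: ltnW; exact: ltn_expl.
Qed.

Lemma cvg_harm2 : (harm2 1 n : R) @[n --> \oo] --> pi ^+ 2 / 6.
Proof.
have /cvg_ex[L ZL] := Z_cvg.
have p0 := @pi_gt0 R.
have h1 : Z (2 ^ m)%N @[m --> \oo] --> L by apply: (cvg_comp _ _ cvg_2X).
have h2 : Z (2 ^ m).*2 @[m --> \oo] --> L.
  have e : (fun m => Z (2 ^ m).*2) = (fun m => Z (2 ^ (m + 1))%N).
    by apply/funext => m; rewrite addn1 expnS mul2n.
  by rewrite e (@cvg_shiftn 1 _ (fun m => Z (2 ^ m)%N)).
have h3 : odds (2 ^ m) @[m --> \oo] --> L - 4^-1 * L.
  have -> : (fun m => odds (2 ^ m)) = (fun m => Z (2 ^ m).*2 - 4^-1 * Z (2 ^ m)%N).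
    by apply/funext => m; rewrite Z_split addrK.
  by apply: cvgB => //; apply: cvgM => //; exact: cvg_cst.
have h4 : odds (2 ^ m) @[m --> \oo] --> pi ^+ 2 / 8.
  apply: (@squeeze_cvgr _ _ _ _ (fun m => pi ^+ 2 / 8 * (1 - (2 ^ m.+1)%:R^-1)) (fun=> pi ^+ 2 / 8)).
  - by near=> m; exact: odds_bound.
  - rewrite -[X in _ --> X]mulr1; apply: cvgM; first exact: cvg_cst.
    rewrite -[X in _ --> X]subr0; apply: cvgB; first exact: cvg_cst.
    apply: (@squeeze_cvgr _ _ _ _ (fun=> 0) (@harmonic R)).
    + near=> m; rewrite invr_ge0 ler0n /= /harmonic lef_pV2 ?posrE ?ltr0n ?expn_gt0// ler_nat.
      by apply: (leq_trans (ltn_expl m (isT : 1 < 2)%N)); rewrite leq_exp2l.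
    + exact: cvg_cst.
    + exact: cvg_harmonic.
  - exact: cvg_cst.
have e : L - 4^-1 * L = pi ^+ 2 / 8 by apply: cvg_unique h3 h4.
have -> : pi ^+ 2 / 6 = L by lra.
by have := ZL; rewrite /Z (@cvg_shiftS _ (fun n => harm2 1 n : R)).
Unshelve. all: by end_near. Qed.

(** Seven terms of the series already exceed [3 / 2]. The point is that [pi^2 / 3 - 2] exceeds 1:
    with Cauchy-Schwarz this makes [rest_var] nonnegative and the limit variance positive. *)
Lemma pi2_gt9 : 9 < pi ^+ 2 :> R.
Proof.
have h : harm2 1 8 <= pi ^+ 2 / 6 :> R.
  rewrite -(cvg_lim _ cvg_harm2)//.
  have c : cvgn (fun n => harm2 1 n : R) by apply/cvg_ex; exists (pi ^+ 2 / 6); exact: cvg_harm2.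
  apply: (@nondecreasing_cvgn_le _ (fun n => harm2 1 n : R)) => // m n mn.
  rewrite /harm2; case: m mn => [|m] mn; first by rewrite big_geq// sumr_ge0// => i _; rewrite invr_ge0 exprn_ge0.
  rewrite (@big_cat_nat _ _ _ m.+1 1 n)//= lerDl sumr_ge0// => i _.
move: h; rewrite /harm2 unlock /= => h.
have : (3 / 2 : R) < 1 ^-2 + (2 ^- 2 + (3 ^- 2 + (4 ^- 2 + (5 ^- 2 + (6 ^- 2 + (7 ^- 2 + 0)))))) by lra.
by move=> h2; have := lt_le_trans h2 h; lra.
Qed.

End basel.

(** * Limits of the scaled moments of an increment *)

Section limits.
Context {R : realType}.
Local Notation v := (pi ^+ 2 / 3 - 2 : R).

Let cvgV1 : (k.+1%:R^-1 : R) @[k --> \oo] --> (0 : R).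
Proof. exact: cvg_harmonic. Qed.

Let cvgV2 : (k.+2%:R^-1 : R) @[k --> \oo] --> (0 : R).
Proof. by rewrite (@cvg_shiftS _ (fun k => k.+1%:R^-1 : R)). Qed.

Let cvgV : (k%:R^-1 : R) @[k --> \oo] --> (0 : R).
Proof. by rewrite -(@cvg_shiftS _ (fun k => k%:R^-1 : R)). Qed.

Let ratioE (k : nat) : k%:R ^+ 2 * (2 / (k.+1%:R * k.+2%:R)) =
  2 * (1 - k.+1%:R^-1) * (1 - 2 * k.+2%:R^-1) :> R.
Proof.
have : k.+1%:R != 0 :> R by rewrite pnatr_eq0.
have : k.+2%:R != 0 :> R by rewrite pnatr_eq0.
rewrite -[k.+2%:R]natr1 -[k.+1%:R]natr1; move: (k%:R : R) => x x2 x1.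
by field; rewrite x1 x2.
Qed.

Let cvg_ratio : (2 * (1 - k.+1%:R^-1) * (1 - 2 * k.+2%:R^-1) : R) @[k --> \oo] --> (2 : R).
Proof.
rewrite [X in _ --> X](_ : 2 = 2 * (1 - 0) * (1 - 2 * 0)); last by ring.
apply: cvgM; [apply: cvgM; first exact: cvg_cst|]; apply: cvgB; try exact: cvg_cst.
  exact: cvgV1.
by apply: cvgM; [exact: cvg_cst|exact: cvgV2].
Qed.

Let cvg_half : (2^-1 - k.+1%:R^-1 - k.+2%:R^-1 : R) @[k --> \oo] --> (2^-1 : R).
Proof.
rewrite [X in _ --> X](_ : 2^-1 = 2^-1 - 0 - 0); last by ring.
apply: cvgB; last exact: cvgV2.
by apply: cvgB; [exact: cvg_cst|exact: cvgV1].
Qed.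

Let cvg_diff (C : R) (u : nat -> R) : (forall k, (2 <= k)%N -> `|u k| <= C / k%:R ^+ 3) ->
  k%:R ^+ 2 * u k @[k --> \oo] --> (0 : R).
Proof.
move=> hu; apply/norm_cvg0P.
apply: (@squeeze_cvgr _ _ _ _ (fun=> 0) (fun k => C * k%:R^-1)).
- near=> k; rewrite normr_ge0 /=.
  have k2 : (2 <= k)%N by near: k; exact: nbhs_infty_ge.
  have k0 : 0 < k%:R :> R by rewrite ltr0n; case: (k) k2.
  rewrite normrM ger0_norm ?exprn_ge0//.
  apply: (@le_trans _ _ (k%:R ^+ 2 * (C / k%:R ^+ 3))).
    by rewrite ler_wpM2l ?exprn_ge0// hu.
  by rewrite le_eqVlt; apply/orP; left; apply/eqP; field; rewrite gt_eqF.
- exact: cvg_cst.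
- by rewrite -[X in _ --> X](mulr0 C); apply: cvgM => //; exact: cvg_cst.
Unshelve. all: by end_near. Qed.

Lemma cvg_powE_qf2 : k%:R ^+ 2 * powE k (fun w => gap_lead k w ^+ 2) @[k --> \oo] --> v.
Proof.
(* [mulrAC] merely rearranges the bound into the form [C / k ^ 3] that [cvg_diff] expects. *)
have h1 := cvg_diff (fun k k2 => le_trans (@powE_qf2_sub R k k2)
  (eq_ind _ (fun z => _ <= z) (lexx _) _ (mulrAC 3 (k%:R ^+ 3)^-1 (2 * 27%:R ^+ 9)))).
have h2 : k%:R ^+ 2 * powE k (fun w => gap_core k (1 - w) ^+ 2) @[k --> \oo] --> v.
  have h3 : 2 * (1 - k.+1%:R^-1) * (1 - 2 * k.+2%:R^-1) *
     ((2^-1 - k.+1%:R^-1 - k.+2%:R^-1) ^+ 2 + harm2 3 k.+3) @[k --> \oo] --> v.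
    (* From 3 on, the inverse squares add up to [pi^2 / 6 - 1 - 1 / 4]. *)
    have -> : v = 2 * (2^-1 ^+ 2 + (pi ^+ 2 / 6 - 1 - 4^-1)) by field.
    apply: cvgM; first exact: cvg_ratio.
    apply: cvgD.
      by rewrite expr2; under eq_fun do rewrite expr2; apply: cvgM; exact: cvg_half.
    have -> : (fun k => harm2 3 k.+3) = (fun k => harm2 1 (k + 3) - 1 - 4^-1 : R).
      apply/funext => k; rewrite addn3 /harm2 [X in _ = X - _ - _]big_ltn// (@big_ltn _ _ _ 2)//.
      by rewrite expr1n invr1; lra.
    apply: cvgB; last exact: cvg_cst.
    apply: cvgB; last exact: cvg_cst.
    by rewrite (@cvg_shiftn 3 _ (fun n => harm2 1 n : R)); exact: cvg_harm2.
  apply: cvg_trans h3; apply: near_eq_cvg; near=> k.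
  have k2 : (2 <= k)%N by near: k; exact: nbhs_infty_ge.
  by rewrite powE_pf2// [RHS]mulrA ratioE.
rewrite -[X in _ --> X]addr0.
have -> : (fun k => k%:R ^+ 2 * powE k (fun w => gap_lead k w ^+ 2)) =
  (fun k => k%:R ^+ 2 * powE k (fun w => gap_core k (1 - w) ^+ 2) +
   k%:R ^+ 2 * (powE k (fun w => gap_lead k w ^+ 2) - powE k (fun w => gap_core k (1 - w) ^+ 2)) : R).
  by apply/funext => k; ring.
exact: cvgD.
Unshelve. all: by end_near. Qed.

Lemma cvg_powE_qfs : k%:R ^+ 2 * powE k (fun w => gap_lead k w * - ln w) @[k --> \oo] --> (1 : R).
Proof.
have h1 := cvg_diff (fun k k2 => le_trans (@powE_qfs_sub R k k2)
  (eq_ind _ (fun z => _ <= z) (lexx _) _ (mulrAC 2 (k%:R ^+ 3)^-1 (2 * 27%:R ^+ 9)))).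
have h2 : k%:R ^+ 2 * powE k (fun w => gap_core k (1 - w) * (1 - w)) @[k --> \oo] --> (1 : R).
  have h3 : 2 * (1 - k.+1%:R^-1) * (1 - 2 * k.+2%:R^-1) *
     (2^-1 - k.+1%:R^-1 - k.+2%:R^-1) @[k --> \oo] --> (1 : R).
    rewrite [X in _ --> X](_ : 1 = 2 * 2^-1); last by field.
    by apply: cvgM; [exact: cvg_ratio|exact: cvg_half].
  apply: cvg_trans h3; apply: near_eq_cvg; near=> k.
  have k2 : (2 <= k)%N by near: k; exact: nbhs_infty_ge.
  by rewrite powE_pfz// [RHS]mulrA ratioE.
rewrite -[X in _ --> X]addr0.
have -> : (fun k => k%:R ^+ 2 * powE k (fun w => gap_lead k w * - ln w)) =
  (fun k => k%:R ^+ 2 * powE k (fun w => gap_core k (1 - w) * (1 - w)) +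
   k%:R ^+ 2 * (powE k (fun w => gap_lead k w * - ln w) - powE k (fun w => gap_core k (1 - w) * (1 - w))) : R).
  by apply/funext => k; ring.
exact: cvgD.
Unshelve. all: by end_near. Qed.

(** The last term absorbs corrections of order [k^-3], so that a single null sequence bounds all
    second-order errors of a step. *)
Definition moment_err k : R := `|k%:R ^+ 2 * powE k (fun w => gap_lead k w ^+ 2) - v|
  + `|k%:R ^+ 2 * powE k (fun w => gap_lead k w * - ln w) - 1| + k%:R^-1.

Lemma om_ge0 k : 0 <= moment_err k.
Proof. by rewrite /moment_err !addr_ge0// invr_ge0. Qed.

Lemma cvg_om : moment_err k @[k --> \oo] --> (0 : R).
Proof.
rewrite -[X in _ --> X]addr0 -{1}[X in _ --> X + _]addr0.
apply: cvgD; last exact: cvgV.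
apply: cvgD; apply/norm_cvg0P.
  by rewrite -(subrr v); apply: cvgB; [exact: cvg_powE_qf2|exact: cvg_cst].
by rewrite -(subrr 1); apply: cvgB; [exact: cvg_powE_qfs|exact: cvg_cst].
Qed.

End limits.

(** * One step of the chain *)

(* [h] is a Lipschitz density, [H], [A], [B] the primitives of [h], [h^2] and
   [xlogx h]; only their first-order expansions matter. *)
Record lip_density (R : realType) (h H A B : R -> R) (a b K : R) : Prop := LipDensity {
  ld_a0 : 0 < a;
  ld_K0 : 0 <= K;
  ld_h : forall u, 0 <= u <= 1 -> a <= h u <= b;
  ld_H0 : H 0 = 0;
  ld_A0 : A 0 = 0;
  ld_B0 : B 0 = 0;
  ld_H : forall x u, 0 <= x -> x <= u -> u <= 1 -> a * (u - x) <= H u - H x <= b * (u - x);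
  ld_A : forall x u, 0 <= x -> x <= u -> u <= 1 -> 0 <= A u - A x <= b ^+ 2 * (u - x);
  ld_dH : forall x u, 0 <= x -> x <= u -> u <= 1 ->
    `|H u - H x - h u * (u - x)| <= K * (u - x) ^+ 2;
  ld_dA : forall x u, 0 <= x -> x <= u -> u <= 1 ->
    `|A u - A x - h u ^+ 2 * (u - x)| <= K * (u - x) ^+ 2;
  ld_dB : forall x u, 0 <= x -> x <= u -> u <= 1 ->
    `|B u - B x - xlogx (h u) * (u - x)| <= K * (u - x) ^+ 2;
  ld_CS : forall u, 0 <= u <= 1 -> H u ^+ 2 <= u * A u;
  ld_mH : measurable_fun setT H;
  ld_mA : measurable_fun setT A;
  ld_mB : measurable_fun setT B }.

Lemma xlogx_lip (R : realType) (a b x y : R) : 0 < a -> a <= x <= b -> a <= y <= b ->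
  `|xlogx x - xlogx y| <= (`|ln a| + `|ln b| + 1) * `|x - y|.
Proof.
move=> a0; wlog xy : x y / y <= x.
  move=> wl xb yb; have [yx|/ltW yx] := leP y x; first exact: wl.
  by rewrite distrC [in leRHS]distrC; exact: wl.
move=> /andP[ax xb] /andP[ay yb].
have [c cxy ->] : exists2 c, c \in `[y, x]%R & xlogx x - xlogx y = (ln c + 1) * (x - y).
  apply: (@MVT_segment _ (@xlogx R) (fun c => ln c + 1)) => //.
    move=> z; rewrite in_itv /= => /andP[yz _]; apply: is_derive_xlogx.
    by rewrite (lt_trans _ yz)// (lt_le_trans a0).
  by apply: continuous_subspaceT; exact: continuous_xlogx.
move: cxy; rewrite in_itv /= => /andP[yc cx].
have c0 : 0 < c by rewrite (lt_le_trans a0)// (le_trans ay).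
have b0 : 0 < b by rewrite (lt_le_trans c0)// (le_trans cx).
have h1 : ln a <= ln c by rewrite ler_ln ?posrE// (le_trans ay).
have h2 : ln c <= ln b by rewrite ler_ln ?posrE// (le_trans cx).
rewrite normrM ler_wpM2r// ler_norml.
have := ler_norm (ln b); have := ler_norm (- ln a); rewrite normrN.
have := normr_ge0 (ln b); have := normr_ge0 (ln a).
by move=> *; apply/andP; split; lra.
Qed.

Section one_step.
Context {R : realType}.
Variables (h H A B : R -> R) (a b K : R).
Hypothesis LD : lip_density h H A B a b K.
Local Notation v := (pi ^+ 2 / 3 - 2 : R).
Local Notation c9 := (2 * 27%:R ^+ 9 : R).

Let a0 : 0 < a := ld_a0 LD.
Let K0 : 0 <= K := ld_K0 LD.
Let v1 : 1 <= v. Proof. by have := @pi2_gt9 R; lra. Qed.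
Let c90 : 0 <= c9. Proof. by rewrite mulr_ge0// exprn_ge0. Qed.

Let ab : a <= b.
Proof. by have /andP[] := ld_h LD (u := 0) (introT andP (conj (lexx _) ler01)); exact: le_trans. Qed.
Let b0 : 0 < b. Proof. exact: lt_le_trans ab. Qed.

(* [centering m u] approximates the mean gap sum of [m] uniform points of [[0, u]],
   and [n / m * rest_var u] the variance it still contributes. *)
Definition centering (m : nat) (u : R) : R := B u + H u * (ln u - harm 2 m.+2).

Definition center_step (k : nat) (u w : R) : R :=
  xlogx (H u - H (u * w)) + centering k.-1 (u * w) - centering k u.

Definition rest_var (u : R) : R := v * (u * A u) - H u ^+ 2.

(** The coefficients [v], -2 and 1 are the limits of [k ^ 2] times the second moments of [gap_lead],
    of its cross term with the logarithm, and of [k.+1%:R^-1 + ln w]. *)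
Definition step_var (u : R) : R := v * (u * h u) ^+ 2 - 2 * (u * h u) * H u + H u ^+ 2.

Definition var_step (k : nat) (u w : R) : R := rest_var (u * w) / k.-1%:R - rest_var u / k%:R.

Lemma dstepE k u w : center_step k u w = xlogx (H u - H (u * w)) + centering k.-1 (u * w) - centering k u.
Proof. by []. Qed.

Lemma tstepE k u w : var_step k u w = rest_var (u * w) / k.-1%:R - rest_var u / k%:R.
Proof. by []. Qed.

Let Lp : R := `|ln a| + `|ln b| + 1.
Let Lp0 : 0 <= Lp. Proof. by rewrite /Lp !addr_ge0. Qed.

Definition stepC1 : R := 2 * K + (`|ln a| + `|ln b| + 2) * K.
Let C10 : 0 <= stepC1.
Proof. by rewrite /stepC1 addr_ge0// mulr_ge0// !addr_ge0. Qed.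

Lemma Hbound u : 0 <= u <= 1 -> a * u <= H u <= b * u.
Proof.
by move=> /andP[u0 u1]; have := ld_H LD (lexx 0) u0 u1; rewrite (ld_H0 LD) !subr0.
Qed.

Lemma Abound u : 0 <= u <= 1 -> 0 <= A u <= b ^+ 2 * u.
Proof.
by move=> /andP[u0 u1]; have := ld_A LD (lexx 0) u0 u1; rewrite (ld_A0 LD) !subr0.
Qed.

(** By the Cauchy-Schwarz inequality [ld_CS] and [1 <= v]. Test functions are controlled at
    nonnegative times only, and times along the chain are multiples of [rest_var]. *)
Lemma varQ_ge0 u : 0 <= u <= 1 -> 0 <= rest_var u.
Proof.
move=> u01; have := ld_CS LD u01; rewrite /rest_var.
have : 0 <= u * A u by have /andP[? _] := Abound u01; rewrite mulr_ge0//; case/andP: u01.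
by move: v v1 => w w1; move: (u * A u) (H u ^+ 2) => x y; nra.
Qed.

Section at_k.
Variables (k : nat) (u : R).
Hypotheses (k3 : (3 <= k)%N) (u0 : 0 < u) (u1 : u <= 1).

Let k2 : (2 <= k)%N. Proof. exact: leq_trans k3. Qed.
Let kp : 0 < k%:R :> R. Proof. by rewrite ltr0n; case: k k2. Qed.
Let k0 : (0 < k)%N. Proof. by case: k k2. Qed.
Let u01 : 0 <= u <= 1. Proof. by rewrite u1 ltW. Qed.

(** The first term comes from the removed gap, the second from the shift of [ln u] and of the
    harmonic sum in [centering]; both have order [u / k]. *)
Let main (w : R) : R := u * h u * gap_lead k w + H u * (k.+1%:R^-1 + ln w).

Let uwP w : 0 < w < 1 -> [/\ 0 <= u * w, u * w <= u & u - u * w = u * (1 - w)].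
Proof.
move=> /andP[w0 w1]; split; first by rewrite mulr_ge0// ltW.
  by rewrite ger_pMr// ltW.
by rewrite mulrBr mulr1.
Qed.

(** With [m] the mean slope of [H] over the removed gap, the logarithms cancel identically. What is
    left is [u (m - h u) gap_lead] and the variation [rho] of [xlogx] of the slope, both of second
    order because [h] is Lipschitz. *)
Lemma dstep_main w : 0 < w < 1 ->
  `|center_step k u w - main w| <= stepC1 * (u ^+ 2 / k%:R ^+ 2) * log_weight k w ^+ 3.
Proof.
move=> w01; have [w0 w1] := andP w01; have [x0 xu xE] := uwP w01.
have z0 : 0 < 1 - w by rewrite subr_gt0.
have uz0 : 0 < u * (1 - w) by rewrite mulr_gt0.
have Y1 := Yk_ge1 k w01.
set m := (H u - H (u * w)) / (u * (1 - w)).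
have mE : H u - H (u * w) = u * (1 - w) * m by rewrite /m [RHS]mulrC divfK// gt_eqF.
have /andP[m1 m2] : a <= m <= b.
  have := ld_H LD x0 xu u1; rewrite xE => /andP[h1 h2].
  by rewrite /m ler_pdivlMr// ler_pdivrMr// h1 h2.
clearbody m.
have m0 : 0 < m by exact: lt_le_trans m1.
have mh : `|m - h u| <= K * (u * (1 - w)).
  have := ld_dH LD x0 xu u1; rewrite xE mE.
  have -> : u * (1 - w) * m - h u * (u * (1 - w)) = (u * (1 - w)) * (m - h u) by ring.
  rewrite normrM (gtr0_norm uz0) expr2 mulrCA.
  by rewrite ler_pM2l.
set rho := u * (1 - w) * xlogx m - (B u - B (u * w)).
have dE : center_step k u w - main w = u * (m - h u) * gap_lead k w + rho.
  rewrite /center_step /main /rho mE /centering prednK//.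
  rewrite (@harmS _ 2 k.+1)// /gap_lead /gap_core /xlogx.
  have HE : H (u * w) = H u - u * (1 - w) * m by rewrite -mE; ring.
  rewrite HE !lnM ?posrE//.
  move: (ln u) (ln w) (ln m) (ln (1 - w)) (harm 2 k.+1 : R) (k.+1%:R^-1 : R) (h u) (H u) (B u) (B (u * w)) => *.
  ring.
rewrite dE.
have zY : 1 - w <= log_weight k w / k%:R.
  by apply: (le_trans (onem_le_lnw w0)); exact: lnw_le_Yk.
have rhoB : `|rho| <= (Lp + 1) * K * (u * (1 - w)) ^+ 2.
  have -> : rho = u * (1 - w) * (xlogx m - xlogx (h u))
     - (B u - B (u * w) - xlogx (h u) * (u * (1 - w))) by rewrite /rho; ring.
  apply: (le_trans (ler_normB _ _)).
  have hb := ld_dB LD x0 xu u1; rewrite xE in hb.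
  have h1 : `|xlogx m - xlogx (h u)| <= Lp * `|m - h u|.
    by apply: xlogx_lip; [exact: a0|rewrite m1 m2|exact: (ld_h LD)].
  rewrite normrM (gtr0_norm uz0).
  have h2 : Lp * `|m - h u| <= Lp * (K * (u * (1 - w))) by rewrite ler_wpM2l.
  have h3 := le_trans h1 h2.
  have h4 := ler_wpM2l (ltW uz0) h3.
  apply: (le_trans (lerD h4 hb)).
  by rewrite le_eqVlt; apply/orP; left; apply/eqP; ring.
have qB := qf_le k0 w01.
apply: (le_trans (ler_normD _ _)).
have p1 : `|u * (m - h u) * gap_lead k w| <= 2 * K * (u ^+ 2 / k%:R ^+ 2) * log_weight k w ^+ 3.
  rewrite !normrM (gtr0_norm u0).
  have -> : 2 * K * (u ^+ 2 / k%:R ^+ 2) * log_weight k w ^+ 3 =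
    u * (K * (u * (log_weight k w / k%:R))) * (2 / k%:R * log_weight k w ^+ 2) by field; rewrite gt_eqF.
  apply: ler_pM => //; first by rewrite mulr_ge0// ltW.
  apply: ler_wpM2l; first exact: ltW.
  apply: (le_trans mh); apply: ler_wpM2l => //.
  by apply: ler_wpM2l => //; exact: ltW.
have p2 : `|rho| <= (Lp + 1) * K * (u ^+ 2 / k%:R ^+ 2) * log_weight k w ^+ 3.
  apply: (le_trans rhoB).
  have -> : (Lp + 1) * K * (u ^+ 2 / k%:R ^+ 2) * log_weight k w ^+ 3 =
    (Lp + 1) * K * ((u * (log_weight k w / k%:R)) ^+ 2 * log_weight k w) by field; rewrite gt_eqF.
  apply: ler_wpM2l; first by rewrite mulr_ge0// addr_ge0.
  apply: (@le_trans _ _ ((u * (log_weight k w / k%:R)) ^+ 2)); last first.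
    by rewrite ler_peMr// sqr_ge0.
  apply: lerXn2r; rewrite ?nnegrE ?(ltW uz0)//.
    by apply: (le_trans (ltW uz0)); apply: ler_wpM2l => //; exact: ltW.
  by apply: ler_wpM2l => //; exact: ltW.
apply: (le_trans (lerD p1 p2)).
by rewrite le_eqVlt; apply/orP; left; apply/eqP; rewrite /stepC1 /Lp; ring.
Qed.

Let Hu := Hbound u01.
Let hu := ld_h LD u01.

Let main_le w : 0 < w < 1 -> `|main w| <= 4 * b * (u / k%:R) * log_weight k w ^+ 2.
Proof.
move=> w01; have Y1 := Yk_ge1 k w01.
have [h1 h2] := andP hu; have [H1 H2] := andP Hu.
have H0 : 0 <= H u by apply: le_trans H1; rewrite mulr_ge0// ltW.
apply: (le_trans (ler_normD _ _)); rewrite !normrM (gtr0_norm u0) (ger0_norm H0).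
rewrite (@ger0_norm _ (h u)); last by apply: le_trans h1; exact: ltW.
have qB := qf_le k0 w01.
have sB : - ln w <= log_weight k w / k%:R by exact: lnw_le_Yk.
have s0 : 0 <= - ln w by rewrite oppr_ge0 ln_le0// ltW//; case/andP: w01.
have kV : k.+1%:R^-1 <= k%:R^-1 :> R by rewrite lef_pV2 ?posrE// ler_nat.
have kV0 : 0 <= k.+1%:R^-1 :> R by [].
have kV1 : 0 < k%:R^-1 :> R by rewrite invr_gt0.
have YY : log_weight k w <= log_weight k w ^+ 2 by rewrite expr2 ler_peMl// (le_trans ler01).
have p1 : u * h u * `|gap_lead k w| <= u * b * (2 / k%:R * log_weight k w ^+ 2).
  apply: ler_pM => //; first by rewrite mulr_ge0 ?ltW// (lt_le_trans a0).
  by rewrite ler_wpM2l// ltW.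
have p2 : H u * `|k.+1%:R^-1 + ln w| <= (b * u) * (2 / k%:R * log_weight k w ^+ 2).
  apply: ler_pM => //.
  have h3 : log_weight k w / k%:R <= log_weight k w ^+ 2 / k%:R by rewrite ler_wpM2r// ltW.
  have h4 : k%:R^-1 <= log_weight k w ^+ 2 / k%:R.
    by rewrite ler_peMl// ?(ltW kV1)// (le_trans Y1).
  rewrite (_ : 2 / k%:R * log_weight k w ^+ 2 = 2 * (log_weight k w ^+ 2 / k%:R)); last by ring.
  rewrite ler_norml; apply/andP; move: kV kV0 kV1 sB s0 h3 h4.
  move: (log_weight k w / k%:R) (log_weight k w ^+ 2 / k%:R) (k.+1%:R^-1 : R) (k%:R^-1 : R) (ln w) => e1 e2 e3 e4 e5.
  by move=> *; split; lra.
apply: (le_trans (lerD p1 p2)).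
by rewrite le_eqVlt; apply/orP; left; apply/eqP; ring.
Qed.

Lemma u_le_k : u / k%:R <= 1.
Proof. by rewrite ler_pdivrMr// mul1r (le_trans u1)// ler1n. Qed.

Lemma dstep_le w : 0 < w < 1 -> `|center_step k u w| <= (4 * b + stepC1) * (u / k%:R) * log_weight k w ^+ 3.
Proof.
move=> w01; have Y1 := Yk_ge1 k w01.
have -> : center_step k u w = main w + (center_step k u w - main w) by ring.
apply: (le_trans (ler_normD _ _)).
have uk0 : 0 <= u / k%:R by rewrite divr_ge0// ltW.
have h1 := main_le w01; have h2 := dstep_main w01.
have YY : log_weight k w ^+ 2 <= log_weight k w ^+ 3 by rewrite ler_weXn2l.
have h3 : 4 * b * (u / k%:R) * log_weight k w ^+ 2 <= 4 * b * (u / k%:R) * log_weight k w ^+ 3.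
  by rewrite ler_wpM2l// mulr_ge0// mulr_ge0// ltW.
have h4 : stepC1 * (u ^+ 2 / k%:R ^+ 2) * log_weight k w ^+ 3 <= stepC1 * (u / k%:R) * log_weight k w ^+ 3.
  rewrite ler_wpM2r ?exprn_ge0 ?(le_trans ler01)// ler_wpM2l//.
  by rewrite -exprVn -exprMn expr2 ler_piMr// u_le_k.
have := le_trans h1 h3; have := le_trans h2 h4.
by rewrite [in leRHS]mulrDl [in leRHS]mulrDl; lra.
Qed.

Let measurable_uw : measurable_fun setT (fun w : R => u * w).
Proof. exact: measurable_funM. Qed.

Let mHu : measurable_fun setT (fun w => H (u * w)).
Proof. by apply: (@measurableT_comp _ _ _ _ _ _ H) => //; exact: (ld_mH LD). Qed.
Let mAu : measurable_fun setT (fun w => A (u * w)).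
Proof. by apply: (@measurableT_comp _ _ _ _ _ _ A) => //; exact: (ld_mA LD). Qed.
Let mBu : measurable_fun setT (fun w => B (u * w)).
Proof. by apply: (@measurableT_comp _ _ _ _ _ _ B) => //; exact: (ld_mB LD). Qed.

Lemma measurable_dstep : measurable_fun setT (center_step k u).
Proof.
apply: measurable_funB => //; apply: measurable_funD.
  apply: (@measurableT_comp _ _ _ _ _ _ (@xlogx R)); first exact: measurable_xlogx.
  exact: (measurable_funB (measurable_cst _) mHu).
apply: measurable_funD => //; apply: measurable_funM => //.
apply: measurable_funB => //; exact: (@measurableT_comp _ _ _ _ _ _ (@ln R)).
Qed.

Let mmain : measurable_fun setT main.
Proof.
apply: measurable_funD; apply: measurable_funM => //; first exact: measurable_qf.
by apply: measurable_funD => //; exact: measurable_ln.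
Qed.

Let amain : admissible k main.
Proof.
apply: (@adm_Y _ _ _ (4 * b * (u / k%:R)) 2) => //.
by rewrite !mulr_ge0// ?invr_ge0 ltW.
Qed.

Let cD0 : 0 <= (4 * b + stepC1) * (u / k%:R).
Proof. by rewrite mulr_ge0 ?addr_ge0 ?divr_ge0 ?mulr_ge0 ?(ltW u0) ?(ltW b0). Qed.

Lemma adm_dstep : admissible k (center_step k u).
Proof.
by apply: (@adm_Y _ _ _ ((4 * b + stepC1) * (u / k%:R)) 3) => //; [exact: measurable_dstep|exact: dstep_le].
Qed.

Lemma adm_dstep2 : admissible k (fun w => center_step k u w ^+ 2).
Proof.
have := adm_mul (i := 3) (j := 3) isT cD0 cD0 measurable_dstep measurable_dstep dstep_le dstep_le.
by under eq_fun do rewrite -expr2.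
Qed.

Let admln : admissible k (fun w : R => ln w).
Proof.
have := admN (@adm_lnN R k k2).
by under eq_fun do rewrite opprK.
Qed.

(** The means of the two terms of [main] combine to [(u h(u) - H u) / (k (k + 1))], and [ld_dH]
    started at 0 bounds the numerator by [K u ^ 2]: the drift is one order below the increment. *)
Lemma powE_dstep : `|powE k (center_step k u)| <= (K + stepC1 * c9) * (u ^+ 2 / k%:R ^+ 2).
Proof.
have am := amain.
have ad := adm_dstep.
have -> : powE k (center_step k u) = powE k main + powE k (fun w => center_step k u w - main w).
  by rewrite powEB//; ring.
have uk0 : 0 <= u ^+ 2 / k%:R ^+ 2 by rewrite divr_ge0// exprn_ge0// ltW.
have h2 : `|powE k (fun w => center_step k u w - main w)| <= stepC1 * (u ^+ 2 / k%:R ^+ 2) * c9.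
  apply: (@norm_powE_Y _ _ k2 _ _ 3) => //; first exact: mulr_ge0.
    by apply: measurable_funB => //; exact: measurable_dstep.
  exact: dstep_main.
have mE : powE k main = (u * h u - H u) * (k%:R * k.+1%:R)^-1.
  have aq := @adm_qf R k k2.
  have alp := admD (@adm_cst R k (k.+1%:R^-1)) admln.
  rewrite /main powED//; try exact: admZ.
  rewrite !powEZ// powE_qf// powED//; last exact: adm_cst.
  rewrite powE_cst//.
  have -> : powE k (fun w : R => ln w) = - k%:R^-1.
    rewrite -(@powE_lnw R k k2) -[RHS]mulN1r -powEZ//; last exact: adm_lnN.
    by congr powE; apply/funext => w; ring.
  have n1 : k.+1%:R != 0 :> R by rewrite pnatr_eq0.
  have n0 : k%:R != 0 :> R by rewrite gt_eqF.
  move: n1 n0; rewrite -natr1; move: (k%:R : R) (h u) (H u) => x hx Hx x1 x0.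
  by field; rewrite x0 x1.
have h1 : `|powE k main| <= K * (u ^+ 2 / k%:R ^+ 2).
  have := ld_dH LD (lexx 0) (ltW u0) u1; rewrite (ld_H0 LD) !subr0 => h3.
  rewrite mE normrM distrC [u * h u]mulrC mulrA.
  apply: ler_pM => //.
  rewrite ger0_norm ?invr_ge0 ?mulr_ge0// lef_pV2 ?posrE ?mulr_gt0 ?exprn_gt0//.
  by rewrite expr2 ler_pM2l// ler_nat.
apply: (le_trans (ler_normD _ _)); apply: (le_trans (lerD h1 h2)).
by rewrite le_eqVlt; apply/orP; left; apply/eqP; ring.
Qed.

Let powE_main2 : `|powE k (fun w => main w ^+ 2) - step_var u / k%:R ^+ 2| <=
  6 * b ^+ 2 * (u ^+ 2 / k%:R ^+ 2) * moment_err k.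
Proof.
have aq := @adm_qf R k k2; have aq2 := @adm_qf2 R k k2; have aqs := @adm_qfs R k k2.
have al2 := @adm_lnN2 R k k2; have aln := @adm_lnN R k k2.
set p := u * h u; set Hu' := H u; set y : R := k.+1%:R^-1.
have mE : powE k (fun w => main w ^+ 2) = p ^+ 2 * powE k (fun w => gap_lead k w ^+ 2)
   + 2 * p * Hu' * y * powE k (gap_lead k) - 2 * p * Hu' * powE k (fun w => gap_lead k w * - ln w)
   + Hu' ^+ 2 * y ^+ 2 - 2 * Hu' ^+ 2 * y * powE k (fun w => - ln w)
   + Hu' ^+ 2 * powE k (fun w => ln w ^+ 2).
  rewrite -(@powE_cst R k k2 (Hu' ^+ 2 * y ^+ 2)) -!powEZ//.
  have ac := @adm_cst R k (Hu' ^+ 2 * y ^+ 2).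
  rewrite -powED//; try exact: admZ.
  rewrite -powEB//; try exact: admZ; last by apply: admD; exact: admZ.
  rewrite -powED//; last by apply: admB; [apply: admD; exact: admZ|exact: admZ].
  have a1 : admissible k (fun w : R => p ^+ 2 * gap_lead k w ^+ 2 + 2 * p * Hu' * y * gap_lead k w
     - 2 * p * Hu' * (gap_lead k w * - ln w) + Hu' ^+ 2 * y ^+ 2).
    by apply: admD => //; apply: admB; [apply: admD; exact: admZ|exact: admZ].
  rewrite -powEB//; last exact: admZ.
  rewrite -powED//; [|by apply: admB => //; exact: admZ|exact: admZ].
  by congr powE; apply/funext => w; rewrite /main -/p -/Hu' -/y; ring.
rewrite mE powE_qf// powE_lnw// powE_lnw2//.
set E2 := powE k (fun w => gap_lead k w ^+ 2); set Es := powE k (fun w => gap_lead k w * - ln w).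
have omE : moment_err k = `|k%:R ^+ 2 * E2 - v| + `|k%:R ^+ 2 * Es - 1| + k%:R^-1 by [].
set X := k%:R ^+ 2 * E2 - v in omE *; set Z := k%:R ^+ 2 * Es - 1 in omE *.
have kn0 : k%:R != 0 :> R by rewrite gt_eqF.
have E2E : E2 = (X + v) / k%:R ^+ 2 by rewrite /X subrK mulrC mulKf// expf_neq0.
have EsE : Es = (Z + 1) / k%:R ^+ 2 by rewrite /Z subrK mulrC mulKf// expf_neq0.
have x0 : 0 < k%:R^-1 :> R by rewrite invr_gt0.
have y0 : 0 < y by rewrite /y invr_gt0.
have yx : y <= k%:R^-1 by rewrite /y lef_pV2 ?posrE// ler_nat.
have xyE : k%:R^-1 - y = k%:R^-1 * y.
  have n1 : k.+1%:R != 0 :> R by rewrite pnatr_eq0.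
  by rewrite /y; move: n1 kn0; rewrite -natr1; move: (k%:R : R) => t t1 t0; field; rewrite t0 t1.
(* Each surviving term carries [X], [Z] or an extra factor of order [1 / k], the three ingredients
   of [moment_err]. *)
have -> : p ^+ 2 * E2 + 2 * p * Hu' * y * (k%:R * k.+1%:R)^-1 - 2 * p * Hu' * Es
   + Hu' ^+ 2 * y ^+ 2 - 2 * Hu' ^+ 2 * y * k%:R^-1 + Hu' ^+ 2 * (2 / k%:R ^+ 2) - step_var u / k%:R ^+ 2
  = k%:R^-1 ^+ 2 * (p ^+ 2 * X - 2 * p * Hu' * Z) + 2 * p * Hu' * (y ^+ 2 * k%:R^-1)
    + Hu' ^+ 2 * (k%:R^-1 * y) ^+ 2.
  have xyE2 : (k%:R * k.+1%:R)^-1 = k%:R^-1 * y by rewrite invfM.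
  rewrite xyE2 (_ : (k%:R^-1 * y) ^+ 2 = (k%:R^-1 - y) ^+ 2); last by rewrite xyE.
  rewrite E2E EsE /step_var -/p -/Hu' -!exprVn; ring.
have [h1 h2] := andP hu; have [H1 H2] := andP Hu.
have Hp : 0 <= Hu' by apply: le_trans H1; rewrite mulr_ge0// ltW.
have p0 : 0 <= p by rewrite mulr_ge0 ?ltW// (lt_le_trans a0).
have pb : p <= b * u by rewrite /p [u * _]mulrC ler_wpM2r// ltW.
set M := b * u in pb H2 *.
have M0 : 0 <= M by rewrite mulr_ge0// ltW.
have pp : p ^+ 2 <= M ^+ 2 by apply: lerXn2r; rewrite ?nnegrE.
have HH : Hu' ^+ 2 <= M ^+ 2 by apply: lerXn2r; rewrite ?nnegrE.
have pH : p * Hu' <= M ^+ 2 by rewrite expr2; apply: ler_pM.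
have pH0 : 0 <= p * Hu' by rewrite mulr_ge0.
have -> : 6 * b ^+ 2 * (u ^+ 2 / k%:R ^+ 2) * moment_err k = k%:R^-1 ^+ 2 * (6 * M ^+ 2 * moment_err k).
  by rewrite /M exprVn; ring.
clearbody M p Hu'.
have x1 : k%:R^-1 <= 1 :> R by rewrite invf_le1// ler1n.
have -> : k%:R^-1 ^+ 2 * (p ^+ 2 * X - 2 * p * Hu' * Z) + 2 * p * Hu' * (y ^+ 2 * k%:R^-1)
    + Hu' ^+ 2 * (k%:R^-1 * y) ^+ 2 =
    k%:R^-1 ^+ 2 * (p ^+ 2 * X - 2 * (p * Hu') * Z + Hu' ^+ 2 * y ^+ 2) + 2 * (p * Hu') * (y ^+ 2 * k%:R^-1) by ring.
have t1 : `|p ^+ 2 * X| <= M ^+ 2 * `|X| by rewrite normrM ger0_norm ?sqr_ge0// ler_wpM2r.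
have t2 : `|2 * (p * Hu') * Z| <= 2 * (M ^+ 2 * `|Z|).
  rewrite normrM ger0_norm ?mulr_ge0//.
  by rewrite -mulrA; apply: ler_wpM2l => //; rewrite ler_wpM2r.
have t3 : 0 <= Hu' ^+ 2 * y ^+ 2 <= M ^+ 2 * k%:R^-1.
  rewrite mulr_ge0 ?sqr_ge0//=; apply: ler_pM; rewrite ?sqr_ge0//.
  apply: (le_trans _ yx); rewrite expr2; apply: ler_piMl; first exact: ltW.
  exact: (le_trans yx x1).
have t4 : 0 <= 2 * (p * Hu') * (y ^+ 2 * k%:R^-1) <= k%:R^-1 ^+ 2 * (2 * M ^+ 2 * k%:R^-1).
  have y00 := ltW y0; have x00 := ltW x0.
  rewrite (mulr_ge0 (mulr_ge0 (ler0n _ 2) pH0) (mulr_ge0 (sqr_ge0 y) x00)) /=.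
  have -> : k%:R^-1 ^+ 2 * (2 * M ^+ 2 * k%:R^-1) = 2 * (M ^+ 2) * (k%:R^-1 ^+ 2 * k%:R^-1) :> R by ring.
  apply: ler_pM; [exact: mulr_ge0|exact: mulr_ge0 (sqr_ge0 y) x00| |].
    by rewrite ler_wpM2l.
  by rewrite ler_wpM2r// lerXn2r// nnegrE.
have q0 : 0 <= k%:R^-1 ^+ 2 :> R by rewrite sqr_ge0.
rewrite omE; set q := k%:R^-1 ^+ 2 in q0 t4 *.
have inner : `|p ^+ 2 * X - 2 * (p * Hu') * Z + Hu' ^+ 2 * y ^+ 2| <=
   M ^+ 2 * `|X| + 2 * (M ^+ 2 * `|Z|) + M ^+ 2 * k%:R^-1.
  apply: (le_trans (ler_normD _ _)); apply: lerD.
    by apply: (le_trans (ler_normB _ _)); exact: lerD.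
  by case/andP: t3 => ? ?; rewrite ger0_norm.
apply: (le_trans (ler_normD _ _)).
case/andP: t4 => t40 t4; rewrite (ger0_norm t40) normrM (ger0_norm q0).
apply: (le_trans (lerD (ler_wpM2l q0 inner) t4)).
rewrite -mulrDr; apply: ler_wpM2l => //.
have n1 : 0 <= M ^+ 2 * `|X| by rewrite mulr_ge0// sqr_ge0.
have n2 : 0 <= M ^+ 2 * `|Z| by rewrite mulr_ge0// sqr_ge0.
have n3 : 0 <= M ^+ 2 * k%:R^-1 by rewrite mulr_ge0// ?sqr_ge0// ltW.
rewrite !mulrDr -!mulrA; lra.
Qed.

Lemma powE_dstep2 : `|powE k (fun w => center_step k u w ^+ 2) - step_var u / k%:R ^+ 2| <=
  (6 * b ^+ 2 + stepC1 * (8 * b + stepC1) * c9) * (u ^+ 2 / k%:R ^+ 2) * moment_err k.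
Proof.
have uk0 : 0 <= u / k%:R by rewrite divr_ge0// ltW.
have c0 : 0 <= 4 * b * (u / k%:R) by rewrite !mulr_ge0// ?invr_ge0 ltW.
have am2 : admissible k (fun w => main w ^+ 2).
  have := adm_mul (i := 2) (j := 2) isT c0 c0 mmain mmain main_le main_le.
  by under eq_fun do rewrite -expr2.
have ad2 := adm_dstep2.
have -> : powE k (fun w => center_step k u w ^+ 2) - step_var u / k%:R ^+ 2 =
  (powE k (fun w => main w ^+ 2) - step_var u / k%:R ^+ 2)
   + powE k (fun w => center_step k u w ^+ 2 - main w ^+ 2).
  by rewrite powEB//; ring.
have h2 : `|powE k (fun w => center_step k u w ^+ 2 - main w ^+ 2)| <=
    stepC1 * (8 * b + stepC1) * (u ^+ 2 / k%:R ^+ 2 * k%:R^-1) * c9.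
  apply: (@norm_powE_Y _ _ k2 _ _ 6) => //.
  - by rewrite !mulr_ge0 ?addr_ge0 ?invr_ge0 ?exprn_ge0 ?mulr_ge0 ?(ltW u0) ?(ltW b0).
  - by apply: measurable_funB; apply: measurable_funX => //; exact: measurable_dstep.
  - move=> w w01; have Y1 := Yk_ge1 k w01.
    have e1 := dstep_main w01; have e2 := main_le w01.
    rewrite subr_sqr normrM.
    have uk1 := u_le_k.
    have e3 : `|center_step k u w + main w| <= (8 * b + stepC1) * (u / k%:R) * log_weight k w ^+ 3.
      have -> : center_step k u w + main w = 2 * main w + (center_step k u w - main w) by ring.
      apply: (le_trans (ler_normD _ _)); rewrite normrM (@ger0_norm _ 2)//.
      have YY : log_weight k w ^+ 2 <= log_weight k w ^+ 3 by rewrite ler_weXn2l.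
      have h3 := ler_wpM2l c0 YY.
      have h4 : stepC1 * (u ^+ 2 / k%:R ^+ 2) * log_weight k w ^+ 3 <= stepC1 * (u / k%:R) * log_weight k w ^+ 3.
        rewrite ler_wpM2r ?exprn_ge0 ?(le_trans ler01)// ler_wpM2l//.
        by rewrite -exprVn -exprMn expr2 ler_piMr// u_le_k.
      have := le_trans e2 h3; have := le_trans e1 h4.
      by rewrite [in leRHS]mulrDl [in leRHS]mulrDl -!mulrA; lra.
    have -> : stepC1 * (8 * b + stepC1) * (u ^+ 2 / k%:R ^+ 2 * k%:R^-1) * log_weight k w ^+ 6 =
      (stepC1 * (u ^+ 2 / k%:R ^+ 2) * log_weight k w ^+ 3) * ((8 * b + stepC1) * k%:R^-1 * log_weight k w ^+ 3) by ring.
    apply: ler_pM => //; apply: (le_trans e3).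
    rewrite ler_wpM2r ?exprn_ge0 ?(le_trans ler01)// ler_wpM2l ?addr_ge0 ?mulr_ge0 ?(ltW b0)//.
    by rewrite ler_piMl// invr_ge0.
apply: (le_trans (ler_normD _ _)); apply: (le_trans (lerD powE_main2 h2)).
have -> : (6 * b ^+ 2 + stepC1 * (8 * b + stepC1) * c9) * (u ^+ 2 / k%:R ^+ 2) * moment_err k =
  6 * b ^+ 2 * (u ^+ 2 / k%:R ^+ 2) * moment_err k + stepC1 * (8 * b + stepC1) * (u ^+ 2 / k%:R ^+ 2 * moment_err k) * c9 by ring.
rewrite lerD2l ler_wpM2r// ler_wpM2l ?mulr_ge0 ?addr_ge0 ?mulr_ge0 ?(ltW b0)//.
rewrite ler_wpM2l ?divr_ge0 ?exprn_ge0 ?(ltW u0)//.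
by rewrite /moment_err lerDr addr_ge0.
Qed.

(** The derivative of [rest_var] at [u], as [A' = h ^ 2] and [H' = h]. *)
Let varQ1 : R := v * (A u + u * h u ^+ 2) - 2 * h u * H u.

Definition stepC2 : R := v * (K + b ^+ 2) + 2 * b * K + b ^+ 2.

Let C20 : 0 <= stepC2.
Proof.
have v0 : 0 <= v by exact: le_trans v1.
rewrite /stepC2; move: (v) v0 => w w0.
by rewrite !addr_ge0 ?mulr_ge0 ?addr_ge0 ?sqr_ge0 ?(ltW b0).
Qed.

Let varQ_expand w : 0 < w < 1 ->
  `|rest_var (u * w) - rest_var u + varQ1 * (u * (1 - w))| <= stepC2 * (u * (1 - w)) ^+ 2.
Proof.
move=> w01; have [x0 xu xE] := uwP w01; have v0 : 0 <= v by exact: le_trans v1.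
have uz0 : 0 <= u * (1 - w).
  by rewrite mulr_ge0 ?(ltW u0)// subr_ge0; case/andP: w01 => _ /ltW.
have dA := ld_dA LD x0 xu u1; have dH := ld_dH LD x0 xu u1.
have bA := ld_A LD x0 xu u1; have bH := ld_H LD x0 xu u1.
rewrite xE in dA dH bA bH; have [H1 H2] := andP Hu.
set t := u * (1 - w) in uz0 dA dH bA bH *.
have uwE : u * w = u - t by rewrite /t; ring.
clearbody t.
set DA := A u - A (u * w) in dA bA *; set DH := H u - H (u * w) in dH bH *.
have -> : rest_var (u * w) - rest_var u + varQ1 * t =
  v * (- u * (DA - h u ^+ 2 * t) + t * DA) + (2 * H u * (DH - h u * t) - DH ^+ 2).
  have AE : A (u * w) = A u - DA by rewrite /DA; ring.
  have HE : H (u * w) = H u - DH by rewrite /DH; ring.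
  by rewrite /rest_var /varQ1 AE HE uwE; ring.
have Hp : 0 <= H u by apply: le_trans H1; rewrite mulr_ge0// ltW.
have Hb : H u <= b by apply: (le_trans H2); rewrite ger_pMr.
have p1 : `|- u * (DA - h u ^+ 2 * t)| <= K * t ^+ 2.
  rewrite normrM normrN (gtr0_norm u0); apply: le_trans dA.
  by rewrite ler_piMl.
have p2 : `|t * DA| <= b ^+ 2 * t ^+ 2.
  case/andP: bA => bA0 bA1; rewrite ger0_norm ?mulr_ge0//.
  by rewrite expr2 mulrCA; apply: ler_wpM2l.
have p3 : `|2 * H u * (DH - h u * t)| <= 2 * b * K * t ^+ 2.
  rewrite normrM ger0_norm ?mulr_ge0//.
  rewrite -[leRHS]mulrA; apply: ler_pM; rewrite ?mulr_ge0//.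
  by rewrite ler_wpM2l.
have p4 : `|DH ^+ 2| <= b ^+ 2 * t ^+ 2.
  case/andP: bH => bH0 bH1; have DH0 : 0 <= DH by apply: le_trans bH0; rewrite mulr_ge0// ltW.
  rewrite ger0_norm ?sqr_ge0// -exprMn; apply: lerXn2r => //.
  by rewrite nnegrE; exact: (mulr_ge0 (ltW b0) uz0).
apply: (le_trans (ler_normD _ _)).
have q1 : `|v * (- u * (DA - h u ^+ 2 * t) + t * DA)| <= v * (K * t ^+ 2 + b ^+ 2 * t ^+ 2).
  rewrite normrM (ger0_norm v0) ler_wpM2l//.
  by apply: (le_trans (ler_normD _ _)); exact: lerD.
have q2 : `|2 * H u * (DH - h u * t) - DH ^+ 2| <= 2 * b * K * t ^+ 2 + b ^+ 2 * t ^+ 2.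
  by apply: (le_trans (ler_normB _ _)); exact: lerD.
apply: (le_trans (lerD q1 q2)).
by rewrite le_eqVlt; apply/orP; left; apply/eqP; rewrite /stepC2; ring.
Qed.

Let k1p : 0 < k.-1%:R :> R. Proof. by rewrite ltr0n; case: k k2 => [|[]]. Qed.

Let k1E : k.-1%:R = k%:R - 1 :> R.
Proof. by rewrite -[in RHS](prednK k0) -natr1 addrK. Qed.

Let k1V : k.-1%:R^-1 <= 2 * k%:R^-1 :> R.
Proof.
rewrite -[X in X * _]invrK -invfM lef_pV2 ?posrE ?mulr_gt0// k1E.
have : 2 <= k%:R :> R by rewrite ler_nat.
by lra.
Qed.

Let varQ1_le : `|u * varQ1| <= (2 * v + 2) * b ^+ 2 * u ^+ 2.
Proof.
have v0 : 0 <= v by exact: le_trans v1.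
have [h1 h2] := andP hu; have [H1 H2] := andP Hu; have [A1 A2] := andP (Abound u01).
have h0 : 0 <= h u by apply: le_trans h1; exact: ltW.
have H0 : 0 <= H u by apply: le_trans H1; rewrite mulr_ge0// ltW.
have -> : u * varQ1 = v * (u * A u + (u * h u) ^+ 2) - 2 * ((u * h u) * H u) by rewrite /varQ1; ring.
have uh0 : 0 <= u * h u by rewrite mulr_ge0// ltW.
have uhb : u * h u <= b * u by rewrite mulrC ler_wpM2r// ltW.
have p1 : u * A u <= b ^+ 2 * u ^+ 2 by rewrite expr2 mulrCA ler_wpM2l// ltW.
have p2 : (u * h u) ^+ 2 <= b ^+ 2 * u ^+ 2.
  by rewrite -exprMn; apply: lerXn2r => //; rewrite nnegrE ?mulr_ge0 ?(ltW b0) ?(ltW u0).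
have p3 : u * h u * H u <= b ^+ 2 * u ^+ 2 by rewrite -exprMn expr2; apply: ler_pM.
have p4 : 0 <= u * A u by rewrite mulr_ge0// ltW.
apply: (le_trans (ler_normB _ _)).
rewrite (@ger0_norm _ (2 * (u * h u * H u))); last by rewrite mulr_ge0// mulr_ge0.
rewrite normrM (ger0_norm v0).
rewrite ger0_norm; last by rewrite addr_ge0// sqr_ge0.
have q1 := ler_wpM2l v0 (lerD p1 p2).
apply: (@le_trans _ _ (v * (b ^+ 2 * u ^+ 2 + b ^+ 2 * u ^+ 2) + 2 * (b ^+ 2 * u ^+ 2))).
  by apply: lerD => //; rewrite ler_wpM2l.
by rewrite le_eqVlt; apply/orP; left; apply/eqP; ring.
Qed.

Let varQ_le : 0 <= rest_var u <= v * b ^+ 2 * u ^+ 2.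
Proof.
rewrite varQ_ge0//= /rest_var.
have v0 : 0 <= v by exact: le_trans v1.
have [A1 A2] := andP (Abound u01).
have p1 : u * A u <= b ^+ 2 * u ^+ 2 by rewrite [u ^+ 2]expr2 mulrCA ler_wpM2l// ltW.
have := ler_wpM2l v0 p1; have := sqr_ge0 (H u).
by move: (v * (u * A u)) => x; rewrite mulrA; lra.
Qed.

Definition stepC3 : R := 2 * (v * b ^+ 2) + 2 * ((2 * v + 2) * b ^+ 2) + 2 * (v * (K + b ^+ 2) + 2 * b * K + b ^+ 2).

Let tstepE w : var_step k u w = rest_var u / (k%:R * k.-1%:R) - varQ1 * u * (1 - w) / k.-1%:R
  + (rest_var (u * w) - rest_var u + varQ1 * (u * (1 - w))) / k.-1%:R.
Proof.
rewrite /var_step; have : k%:R != 0 :> R by rewrite gt_eqF.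
have : k.-1%:R != 0 :> R by rewrite gt_eqF.
have kE : k%:R = k.-1%:R + 1 :> R by rewrite k1E subrK.
rewrite kE; move: (k.-1%:R : R) => y y0 y1.
by field; rewrite y0 y1.
Qed.

Let u2 : 0 <= u ^+ 2. Proof. exact: sqr_ge0. Qed.

Let onem_le (w : R) : 0 < w < 1 -> 0 <= 1 - w <= log_weight k w / k%:R.
Proof.
move=> w01; have [w0 w1] := andP w01; rewrite subr_ge0 ltW//=.
by apply: (le_trans (onem_le_lnw w0)); exact: lnw_le_Yk.
Qed.

Let tp_le w : 0 < w < 1 -> `|rest_var u / (k%:R * k.-1%:R) - varQ1 * u * (1 - w) / k.-1%:R| <=
   (2 * (v * b ^+ 2) + 2 * ((2 * v + 2) * b ^+ 2)) * (u ^+ 2 / k%:R ^+ 2) * log_weight k w.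
Proof.
move=> w01; have /andP[z0 zY] := onem_le w01; have Y1 := Yk_ge1 k w01.
have [q0 q1] := andP varQ_le; have q2 := varQ1_le.
have x0 : 0 <= k%:R^-1 :> R by [].
have p1 : `|rest_var u / (k%:R * k.-1%:R)| <= (2 * (v * b ^+ 2)) * (u ^+ 2 / k%:R ^+ 2) * log_weight k w.
  rewrite ger0_norm ?divr_ge0 ?mulr_ge0// invfM.
  apply: (@le_trans _ _ (v * b ^+ 2 * u ^+ 2 * (k%:R^-1 * (2 * k%:R^-1)))).
    by apply: ler_pM; rewrite ?mulr_ge0// ler_wpM2l.
  have -> : v * b ^+ 2 * u ^+ 2 * (k%:R^-1 * (2 * k%:R^-1)) = 2 * (v * b ^+ 2) * (u ^+ 2 / k%:R ^+ 2).
    by rewrite -exprVn; ring.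
  rewrite ler_peMr// mulr_ge0 ?divr_ge0 ?exprn_ge0 ?(ltW u0)//.
  by rewrite mulr_ge0// mulr_ge0 ?sqr_ge0// (le_trans _ v1).
have p2 : `|varQ1 * u * (1 - w) / k.-1%:R| <= (2 * ((2 * v + 2) * b ^+ 2)) * (u ^+ 2 / k%:R ^+ 2) * log_weight k w.
  rewrite normrM normrM [varQ1 * u]mulrC (ger0_norm z0) (@ger0_norm _ _^-1) ?invr_ge0//.
  apply: (@le_trans _ _ ((2 * v + 2) * b ^+ 2 * u ^+ 2 * (log_weight k w / k%:R) * (2 * k%:R^-1))).
    by apply: ler_pM; rewrite ?mulr_ge0// ler_pM.
  by rewrite le_eqVlt; apply/orP; left; apply/eqP; rewrite -exprVn; ring.
apply: (le_trans (ler_normB _ _)); apply: (le_trans (lerD p1 p2)).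
by rewrite le_eqVlt; apply/orP; left; apply/eqP; ring.
Qed.

Let tr_le w : 0 < w < 1 ->
  `|(rest_var (u * w) - rest_var u + varQ1 * (u * (1 - w))) / k.-1%:R| <=
  2 * stepC2 * (u ^+ 2 / k%:R ^+ 3) * log_weight k w ^+ 2.
Proof.
move=> w01; have /andP[z0 zY] := onem_le w01; have Y1 := Yk_ge1 k w01.
rewrite normrM (@ger0_norm _ _^-1) ?invr_ge0//.
apply: (@le_trans _ _ (stepC2 * (u * (log_weight k w / k%:R)) ^+ 2 * (2 * k%:R^-1))).
  apply: ler_pM => //; apply: (le_trans (varQ_expand w01)).
  rewrite ler_wpM2l//; apply: lerXn2r; rewrite ?nnegrE ?mulr_ge0 ?(ltW u0)//.
    by rewrite (le_trans ler01).
  by rewrite ler_wpM2l// ltW.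
by rewrite le_eqVlt; apply/orP; left; apply/eqP; rewrite -!exprVn; ring.
Qed.

Lemma tstep_le w : 0 < w < 1 -> `|var_step k u w| <= stepC3 * (u ^+ 2 / k%:R ^+ 2) * log_weight k w.
Proof.
move=> w01; have /andP[z0 zY] := onem_le w01; have Y1 := Yk_ge1 k w01.
have z1 : 1 - w <= 1 by case/andP: w01 => ? _; lra.
rewrite tstepE; apply: (le_trans (ler_normD _ _)).
have p2 : `|(rest_var (u * w) - rest_var u + varQ1 * (u * (1 - w))) / k.-1%:R| <=
  2 * stepC2 * (u ^+ 2 / k%:R ^+ 2) * log_weight k w.
  rewrite normrM (@ger0_norm _ _^-1) ?invr_ge0//.
  apply: (@le_trans _ _ (stepC2 * (u ^+ 2 * (log_weight k w / k%:R)) * (2 * k%:R^-1))).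
    apply: ler_pM => //; apply: (le_trans (varQ_expand w01)).
    rewrite ler_wpM2l// exprMn ler_wpM2l//.
    by apply: le_trans zY; rewrite expr2 ler_piMl.
  by rewrite le_eqVlt; apply/orP; left; apply/eqP; rewrite -!exprVn; ring.
apply: (le_trans (lerD (tp_le w01) p2)).
by rewrite le_eqVlt; apply/orP; left; apply/eqP; rewrite /stepC3 /stepC2; ring.
Qed.

Let mtp : measurable_fun setT (fun w : R => rest_var u / (k%:R * k.-1%:R) - varQ1 * u * (1 - w) / k.-1%:R).
Proof.
apply: measurable_funB => //; apply: measurable_funM => //.
by apply: measurable_funM => //; exact: measurable_funB.
Qed.

Lemma measurable_varQu : measurable_fun setT (fun w => rest_var (u * w)).
Proof.
apply: measurable_funB; last exact: measurable_funX.
by apply: measurable_funM => //; apply: measurable_funM.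
Qed.

Let mtr : measurable_fun setT
  (fun w => (rest_var (u * w) - rest_var u + varQ1 * (u * (1 - w))) / k.-1%:R).
Proof.
apply: measurable_funM => //; apply: measurable_funD.
  by apply: measurable_funB => //; exact: measurable_varQu.
by apply: measurable_funM => //; apply: measurable_funM => //; exact: measurable_funB.
Qed.

Lemma measurable_tstep : measurable_fun setT (var_step k u).
Proof.
by apply: measurable_funB => //; apply: measurable_funM => //; exact: measurable_varQu.
Qed.

Let uk20 : 0 <= u ^+ 2 / k%:R ^+ 2. Proof. by rewrite divr_ge0// exprn_ge0. Qed.
Let C30 : 0 <= stepC3.
Proof.
have v0 : 0 <= v by exact: le_trans v1.
rewrite /stepC3.
have q1 : 0 <= v * b ^+ 2 := mulr_ge0 v0 (sqr_ge0 b).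
have q2 : 0 <= (2 * v + 2) * b ^+ 2 by apply: mulr_ge0; [lra|exact: sqr_ge0].
by rewrite -/stepC2; have q3 := C20; lra.
Qed.

Lemma adm_tstep : admissible k (var_step k u).
Proof.
apply: (@adm_Y _ _ _ (stepC3 * (u ^+ 2 / k%:R ^+ 2)) 1) => //.
- exact: (mulr_ge0 C30 uk20).
- exact: measurable_tstep.
- by move=> w w01; rewrite expr1; exact: tstep_le.
Qed.

(** To first order in [1 - w], whose mean is [1 / (k + 1)], the change of [rest_var / k] has mean
    [(rest_var u - u * varQ1) / k ^ 2], and [u * varQ1 - rest_var u] is exactly [step_var u]. *)
Lemma powE_tstep : `|powE k (var_step k u) + step_var u / k%:R ^+ 2| <=
  (stepC3 + 2 * stepC2 * c9) * (u ^+ 2 / k%:R ^+ 3).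
Proof.
have v0 : 0 <= v by exact: le_trans v1.
have atr : admissible k (fun w => (rest_var (u * w) - rest_var u + varQ1 * (u * (1 - w))) / k.-1%:R).
  apply: (@adm_Y _ _ _ (2 * stepC2 * (u ^+ 2 / k%:R ^+ 3)) 2) => //.
  by rewrite !mulr_ge0 ?invr_ge0 ?exprn_ge0 ?C20 ?(ltW u0).
have aw : admissible k (fun w : R => 1 - w).
  apply: (@adm_Y _ _ _ 1 1) => //; first exact: measurable_funB.
  move=> w w01; have /andP[z0 zY] := onem_le w01.
  rewrite mul1r expr1 ger0_norm// (le_trans _ (Yk_ge1 k w01))//.
  by case/andP: w01 => ? _; lra.
have -> : powE k (var_step k u) = rest_var u / (k%:R * k.-1%:R) - varQ1 * u / k.-1%:R * k.+1%:R^-1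
   + powE k (fun w => (rest_var (u * w) - rest_var u + varQ1 * (u * (1 - w))) / k.-1%:R).
  have -> : k.+1%:R^-1 = powE k (fun w : R => 1 - w).
    rewrite (@powE_beta _ k (fun z => z)); last by move=> x; exact: cvg_id.
    rewrite betaI_id prednK// natrM.
    have n1 : k.+1%:R != 0 :> R by rewrite pnatr_eq0.
    have n0 : k%:R != 0 :> R by rewrite gt_eqF.
    by move: n0 n1; move: (k%:R : R) (k.+1%:R : R) => x y x0 y0; field; rewrite x0 y0.
  rewrite -powEZ// -(@powE_cst R k k2 (rest_var u / _)).
  have ac := @adm_cst R k (rest_var u / (k%:R * k.-1%:R)).
  rewrite -powEB//; last exact: admZ.
  rewrite -powED//; last by apply: admB => //; exact: admZ.
  by congr powE; apply/funext => w; rewrite tstepE; ring.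
have h2 : `|powE k (fun w => (rest_var (u * w) - rest_var u + varQ1 * (u * (1 - w))) / k.-1%:R)| <=
    2 * stepC2 * (u ^+ 2 / k%:R ^+ 3) * c9.
  apply: (@norm_powE_Y _ _ k2 _ _ 2) => //.
  by rewrite !mulr_ge0 ?invr_ge0 ?exprn_ge0 ?C20 ?(ltW u0).
set Tr := powE k _ in h2 *.
have [q0 q1] := andP varQ_le; have q2 := varQ1_le.
have VE : step_var u = u * varQ1 - rest_var u by rewrite /step_var /varQ1 /rest_var; ring.
set x : R := k%:R^-1; set y : R := k.-1%:R^-1; set z : R := k.+1%:R^-1.
have x0 : 0 <= x by rewrite /x.
have e1 : (k%:R * k.-1%:R)^-1 - x ^+ 2 = x ^+ 2 * y.
  rewrite /x /y; have n0 : k%:R != 0 :> R by rewrite gt_eqF.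
  have n1 : k.-1%:R != 0 :> R by rewrite gt_eqF.
  have kE : k%:R = k.-1%:R + 1 :> R by rewrite k1E subrK.
  by move: n0 n1; rewrite kE; move: (k.-1%:R : R) => t t1 t0; field; rewrite t0 t1.
have e2 : y * z - x ^+ 2 = x ^+ 2 * (y * z).
  rewrite /x /y /z; have n0 : k%:R != 0 :> R by rewrite gt_eqF.
  have n1 : k.-1%:R != 0 :> R by rewrite gt_eqF.
  have n2 : k.+1%:R != 0 :> R by rewrite pnatr_eq0.
  have kE : k%:R = k.-1%:R + 1 :> R by rewrite k1E subrK.
  move: n0 n1 n2; rewrite -natr1 kE; move: (k.-1%:R : R) => t t1 t0 t2.
  by field; rewrite t0 t1 t2.
have -> : rest_var u / (k%:R * k.-1%:R) - varQ1 * u / k.-1%:R * k.+1%:R^-1 + Tr + step_var u / k%:R ^+ 2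
  = rest_var u * (x ^+ 2 * y) - u * varQ1 * (x ^+ 2 * (y * z)) + Tr.
  by rewrite -e1 -e2 VE -exprVn -/x -/y -/z; ring.
have yx : y <= 2 * x by exact: k1V.
have y0 : 0 <= y by rewrite /y.
have z0 : 0 <= z by rewrite /z.
have z1 : z <= 1 by rewrite /z invf_le1// ler1n.
have p1 : `|rest_var u * (x ^+ 2 * y)| <= v * b ^+ 2 * u ^+ 2 * (x ^+ 2 * (2 * x)).
  rewrite ger0_norm ?mulr_ge0 ?sqr_ge0//; apply: ler_pM; rewrite ?mulr_ge0 ?sqr_ge0//.
  by rewrite ler_wpM2l// sqr_ge0.
have p2 : `|u * varQ1 * (x ^+ 2 * (y * z))| <= (2 * v + 2) * b ^+ 2 * u ^+ 2 * (x ^+ 2 * (2 * x)).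
  rewrite normrM (@ger0_norm _ (x ^+ 2 * _)) ?mulr_ge0 ?sqr_ge0//.
  apply: ler_pM; rewrite ?mulr_ge0 ?sqr_ge0//.
  rewrite ler_wpM2l ?sqr_ge0//; apply: le_trans yx.
  by rewrite ler_piMr.
apply: (le_trans (ler_normD _ _)).
apply: (le_trans (lerD (le_trans (ler_normB _ _) (lerD p1 p2)) h2)).
have -> : v * b ^+ 2 * u ^+ 2 * (x ^+ 2 * (2 * x)) + (2 * v + 2) * b ^+ 2 * u ^+ 2 * (x ^+ 2 * (2 * x))
   + 2 * stepC2 * (u ^+ 2 / k%:R ^+ 3) * c9 =
  (2 * (v * b ^+ 2) + 2 * ((2 * v + 2) * b ^+ 2) + 2 * stepC2 * c9) * (u ^+ 2 / k%:R ^+ 3).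
  by rewrite -!exprVn -/x; ring.
rewrite ler_wpM2r ?divr_ge0 ?exprn_ge0 ?(ltW u0)//.
by rewrite lerD2r /stepC3 -/stepC2 lerDl mulr_ge0.
Qed.

End at_k.
End one_step.

(** * Lindeberg replacement along the chain *)

(* First order in [tau], second order in [y]: the heat operator is built in. *)
Record test_fun (R : realType) (psi py pyy : R -> R -> R) (K : R) : Prop := TestFun {
  tf_K0 : 0 <= K;
  tf_m : measurable_fun [set: R * R] (fun z => psi z.1 z.2);
  tf_taylor : forall t y t' y', 0 <= t -> 0 <= t' ->
    `|psi t' y' - psi t y - py t y * (y' - y) - pyy t y / 2 * ((y' - y) ^+ 2 + (t' - t))|
    <= K * (`|y' - y| ^+ 3 + (t' - t) ^+ 2 + `|t' - t| * `|y' - y|);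
  tf_y : forall t y, 0 <= t -> `|py t y| <= K * (1 + `|y|);
  tf_yy : forall t y, 0 <= t -> `|pyy t y| <= K }.

Section lindeberg_step.
Context {R : realType}.
Variables (h H A B : R -> R) (a b K : R).
Hypothesis LD : lip_density h H A B a b K.
Variables (psi py pyy : R -> R -> R) (L : R).
Hypothesis TF : test_fun psi py pyy L.
Local Notation c9 := (2 * 27%:R ^+ 9 : R).
Local Notation center_step := (center_step H B).
Local Notation rest_var := (rest_var H A).
Local Notation var_step := (var_step H A).
Local Notation centering := (centering H B).
Local Notation C1 := (stepC1 a b K).
Local Notation C2 := (stepC2 b K).
Local Notation C3 := (stepC3 b K).

Let c1 : R := 4 * b + C1.
Let c2 : R := K + C1 * c9.
Let c3 : R := 6 * b ^+ 2 + C1 * (8 * b + C1) * c9.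
Let c4 : R := C3 + 2 * C2 * c9.
Definition Cstep : R := c9 * L * (c1 ^+ 3 + C3 ^+ 2 + C3 * c1) + L * c2 + (L * c2) ^+ 2
  + L * (c3 + c4).
Definition Csq : R := 9 * c2 ^+ 2 + 3 * (c9 * c1 ^+ 2).

Let K0 : 0 <= K := ld_K0 LD.
Let b0 : 0 <= b.
Proof.
have /andP[h1 h2] := ld_h LD (u := 0) (introT andP (conj (lexx _) ler01)).
by rewrite (le_trans _ (le_trans h1 h2))// ltW// (ld_a0 LD).
Qed.
Let C10 : 0 <= C1.
Proof. by rewrite /stepC1 addr_ge0// mulr_ge0// !addr_ge0. Qed.
Let v2 : 1 <= pi ^+ 2 / 3 - 2 :> R. Proof. by have := @pi2_gt9 R; lra. Qed.
Let C20 : 0 <= C2.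
Proof.
have v0 := le_trans ler01 v2.
by rewrite /stepC2 !addr_ge0 ?sqr_ge0// !mulr_ge0// addr_ge0// sqr_ge0.
Qed.
Let C3_ge0 : 0 <= C3.
Proof.
have v0 := le_trans ler01 v2; rewrite /stepC3 -/C2.
rewrite (addr_ge0 (addr_ge0 _ _))//; last exact: mulr_ge0.
  by rewrite !mulr_ge0// sqr_ge0.
by rewrite !mulr_ge0// ?sqr_ge0// addr_ge0// mulr_ge0.
Qed.
Let c1_ge0 : 0 <= c1. Proof. by rewrite addr_ge0// mulr_ge0. Qed.
Let c90 : 0 <= c9. Proof. by rewrite mulr_ge0// exprn_ge0. Qed.
Let c2_ge0 : 0 <= c2. Proof. by rewrite addr_ge0// mulr_ge0. Qed.
Let c3_ge0 : 0 <= c3.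
Proof. by rewrite addr_ge0 ?mulr_ge0 ?sqr_ge0// addr_ge0// mulr_ge0. Qed.
Let c4_ge0 : 0 <= c4. Proof. by rewrite addr_ge0// !mulr_ge0. Qed.

Lemma Cstep_ge0 : 0 <= Cstep.
Proof.
have L0 := tf_K0 TF; have C30 : 0 <= C3 := C3_ge0.
rewrite /Cstep; apply: addr_ge0; first apply: addr_ge0; first apply: addr_ge0.
- by rewrite !mulr_ge0// !addr_ge0 ?mulr_ge0 ?exprn_ge0.
- exact: mulr_ge0.
- exact: sqr_ge0.
- by rewrite mulr_ge0// addr_ge0.
Qed.

Lemma Csq_ge0 : 0 <= Csq.
Proof. by rewrite /Csq addr_ge0// !mulr_ge0 ?sqr_ge0. Qed.

(** A Taylor expansion at [(tau, y)]. The linear term is small since the step is nearly centred; in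
    the second-order term the second moment of the step cancels the drift of the time. In use
    [r ^ 2 = n], and [s = n u / k] is the scale in which the errors are homogeneous. *)
Lemma lindeberg_step (k : nat) (r u y : R) : (3 <= k)%N -> 0 < u <= 1 -> 1 <= r ->
  let s := r ^+ 2 * (u / k%:R) in
  let tau := r ^+ 2 * rest_var u / k%:R in
  admissible k (fun w => psi (tau + r ^+ 2 * var_step k u w) (y + r * center_step k u w)) /\
  `|powE k (fun w => psi (tau + r ^+ 2 * var_step k u w) (y + r * center_step k u w)) - psi tau y|
   <= y ^+ 2 / r ^+ 3 + Cstep * (1 + s ^+ 4) * ((r ^+ 3)^-1 + moment_err k / r ^+ 2).
Proof.
move=> k3 /andP[u0 u1] r1 s tau.
have r0 : 0 < r by rewrite (lt_le_trans ltr01).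
have k0 : (0 : R) < k%:R by rewrite ltr0n (leq_trans _ k3).
have k2 : (2 <= k)%N := ltnW k3.
pose z := u / k%:R; have z0 : 0 <= z by rewrite divr_ge0// ltW.
have tau0 : 0 <= tau.
  by rewrite /tau divr_ge0 ?(ltW k0)// mulr_ge0 ?sqr_ge0// (varQ_ge0 LD)// ltW.
have u201 : 0 <= u <= 1 by rewrite ltW.
pose d w := center_step k u w; pose t w := var_step k u w.
have ad : admissible k d := adm_dstep LD k3 u0 u1.
have ad2 : admissible k (fun w => d w ^+ 2) := adm_dstep2 LD k3 u0 u1.
have at_ : admissible k t := adm_tstep LD k3 u0 u1.
pose f w := psi (tau + r ^+ 2 * t w) (y + r * d w).
have mf : measurable_fun setT f.
  have m1 : measurable_fun setT (fun w => tau + r ^+ 2 * t w).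
    by apply: measurable_funD => //; apply: measurable_funM => //; case: at_.
  have m2 : measurable_fun setT (fun w => y + r * d w).
    by apply: measurable_funD => //; apply: measurable_funM => //; case: ad.
  exact: (measurableT_comp (tf_m TF) (measurable_fun_pair m1 m2)).
pose g w := psi tau y + (py tau y * r * d w + pyy tau y / 2 * r ^+ 2 * (d w ^+ 2 + t w)).
have ag : admissible k g.
  by apply: admD; [exact: adm_cst|apply: admD; [exact: admZ|apply: admZ; exact: admD]].
have tau'0 w : 0 < w < 1 -> 0 <= tau + r ^+ 2 * t w.
  move=> /andP[w0 w1]; have -> : tau + r ^+ 2 * t w = r ^+ 2 * rest_var (u * w) / k.-1%:R.
    by rewrite /tau /t tstepE; ring.
  rewrite divr_ge0// mulr_ge0 ?sqr_ge0// (varQ_ge0 LD)//.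
  by rewrite mulr_ge0 ?(ltW u0) ?(ltW w0)//= mulr_ile1 ?(ltW u0) ?(ltW w0) ?(ltW w1).
have L0 : 0 <= L := tf_K0 TF.
have c10 : 0 <= c1 by exact: c1_ge0.
have C30 : 0 <= C3 by exact: C3_ge0.
pose B1 := L * (c1 ^+ 3 + C3 ^+ 2 + C3 * c1) * (1 + s ^+ 4) / r ^+ 3.
have B10 : 0 <= B1.
  apply: divr_ge0; last by rewrite exprn_ge0// ltW.
  apply: mulr_ge0; last by rewrite addr_ge0// exprn_even_ge0.
  by rewrite mulr_ge0// !addr_ge0 ?mulr_ge0 ?exprn_ge0.
(* Taylor remainder: [d] is bounded through [Y ^ 3], so its cube needs [Y ^ 9]. *)
have fg w : 0 < w < 1 -> `|f w - g w| <= B1 * log_weight k w ^+ 9.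
  move=> w01; have Y1 := Yk_ge1 k w01; set Y := log_weight k w in Y1 *.
  have hd : `|d w| <= c1 * z * Y ^+ 3 := dstep_le LD k3 u0 u1 w01.
  have ht : `|t w| <= C3 * z ^+ 2 * Y.
    by have := tstep_le LD k3 u0 u1 w01; rewrite -expr_div_n.
  have := tf_taylor TF y (y + r * d w) tau0 (tau'0 w w01).
  rewrite -/(f w).
  have -> : f w - psi tau y - py tau y * (y + r * d w - y) - pyy tau y / 2 *
    ((y + r * d w - y) ^+ 2 + (tau + r ^+ 2 * t w - tau)) = f w - g w by rewrite /g; ring.
  move=> /le_trans; apply.
  have -> : y + r * d w - y = r * d w by ring.
  have -> : tau + r ^+ 2 * t w - tau = r ^+ 2 * t w by ring.
  rewrite -[X in _ + X + _]real_normK ?num_real//.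
  have -> : `|r * d w| = r * `|d w| by rewrite normrM (ger0_norm (ltW r0)).
  have -> : `|r ^+ 2 * t w| = r ^+ 2 * `|t w| by rewrite normrM (ger0_norm (sqr_ge0 r)).
  have -> : B1 * Y ^+ 9 = L * ((c1 ^+ 3 + C3 ^+ 2 + C3 * c1) * ((1 + s ^+ 4) / r ^+ 3 * Y ^+ 9)).
    by rewrite /B1; ring.
  apply: ler_wpM2l => //.
  have E3 : (r * z) ^+ 3 <= (1 + s ^+ 4) / r ^+ 3.
    rewrite ler_pdivlMr ?exprn_gt0//.
    have -> : (r * z) ^+ 3 * r ^+ 3 = s ^+ 3 by rewrite /s -/z; ring.
    have : 0 <= s by rewrite /s mulr_ge0 ?sqr_ge0.
    by move: (s) => q q0; have [q1|q1] := leP q 1; nra.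
  have E4 : (r * z) ^+ 4 <= (1 + s ^+ 4) / r ^+ 3.
    rewrite ler_pdivlMr ?exprn_gt0//.
    have e : s ^+ 4 = (r * z) ^+ 4 * r ^+ 3 * r by rewrite /s -/z; ring.
    rewrite e; have : 0 <= (r * z) ^+ 4 * r ^+ 3.
      by apply: mulr_ge0; rewrite exprn_ge0// ?mulr_ge0// ltW.
    by move: (_ * _) => q; nra.
  have rd : r * `|d w| <= c1 * (r * z) * Y ^+ 3.
    by have := ler_wpM2l (ltW r0) hd; congr (_ <= _); ring.
  have rt : r ^+ 2 * `|t w| <= C3 * (r * z) ^+ 2 * Y.
    by have := ler_wpM2l (sqr_ge0 r) ht; congr (_ <= _); ring.
  have rd0 : 0 <= r * `|d w| by rewrite mulr_ge0// ltW.
  have rt0 : 0 <= r ^+ 2 * `|t w| by rewrite mulr_ge0// sqr_ge0.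
  move: rd rt rd0 rt0; move: (r * `|d w|) (r ^+ 2 * `|t w|) => D T rd rt D0 T0.
  have e0 : 0 <= r * z by rewrite mulr_ge0// ltW.
  move: E3 E4 rd rt e0; move: (r * z) ((1 + s ^+ 4) / r ^+ 3) => e E E3 E4 rd rt e0.
  have Y0 : 0 <= Y by rewrite (le_trans ler01).
  have E0 : 0 <= E by apply: le_trans E3; rewrite exprn_ge0.
  have Y9 i : (i <= 9)%N -> Y ^+ i <= Y ^+ 9 by move=> i9; rewrite ler_weXn2l.
  have h1 : D ^+ 3 <= c1 ^+ 3 * (E * Y ^+ 9).
    apply: (@le_trans _ _ ((c1 * e * Y ^+ 3) ^+ 3)); first by rewrite lerXn2r ?nnegrE// (le_trans D0).
    have -> : (c1 * e * Y ^+ 3) ^+ 3 = c1 ^+ 3 * (e ^+ 3 * Y ^+ 9) by ring.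
    by rewrite ler_wpM2l ?exprn_ge0// ler_wpM2r ?exprn_ge0.
  have h2 : T ^+ 2 <= C3 ^+ 2 * (E * Y ^+ 9).
    apply: (@le_trans _ _ ((C3 * e ^+ 2 * Y) ^+ 2)); first by rewrite lerXn2r ?nnegrE// (le_trans T0).
    have -> : (C3 * e ^+ 2 * Y) ^+ 2 = C3 ^+ 2 * (e ^+ 4 * Y ^+ 2) by ring.
    rewrite ler_wpM2l ?sqr_ge0// ler_pM ?exprn_ge0//; exact: Y9.
  have h3 : T * D <= C3 * c1 * (E * Y ^+ 9).
    apply: (@le_trans _ _ ((C3 * e ^+ 2 * Y) * (c1 * e * Y ^+ 3))); first exact: ler_pM.
    have -> : (C3 * e ^+ 2 * Y) * (c1 * e * Y ^+ 3) = C3 * c1 * (e ^+ 3 * Y ^+ 4) by ring.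
    rewrite ler_wpM2l ?mulr_ge0// ler_pM ?exprn_ge0//; exact: Y9.
  by move: h1 h2 h3; lra.
have af : admissible k f.
  have -> : f = fun w => (f w - g w) + g w by apply/funext => w; rewrite subrK.
  apply: admD => //; apply: (adm_le (g := fun w => B1 * log_weight k w ^+ 9)).
  - by apply: measurable_funB => //; case: ag.
  - by apply: admZ; exact: admY.
  - by move=> w w01; rewrite (le_trans (fg w w01))// ler_norm.
split => //.
have pX : `|powE k (fun w => f w - g w)| <= B1 * c9.
  apply: (norm_powE_Y k2 (i := 9)) => //.
  by apply: measurable_funB => //; case: ag.
have pg : powE k g = psi tau y + (py tau y * r * powE k d + pyy tau y / 2 * r ^+ 2 *
    (powE k (fun w => d w ^+ 2) + powE k t)).
  have ad2t : admissible k (fun w => d w ^+ 2 + t w) by exact: admD.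
  rewrite /g powED//; [|exact: adm_cst|by apply: admD; exact: admZ].
  rewrite powE_cst// powED//; [|exact: admZ|exact: admZ].
  by rewrite (powEZ k2 (py tau y * r) ad) (powEZ k2 (pyy tau y / 2 * r ^+ 2) ad2t) (powED k2 ad2 at_).
have -> : powE k f - psi tau y = powE k (fun w => f w - g w) + py tau y * r * powE k d
    + pyy tau y / 2 * r ^+ 2 * (powE k (fun w => d w ^+ 2) + powE k t).
  by rewrite (powEB k2 af ag) pg; ring.
(* Linear term: [py] grows like [1 + |y|], and Young's inequality separates [|y|] from its
   coefficient, which is the origin of [y ^ 2 / r ^ 3]. *)
have F2 : `|py tau y * r * powE k d| <= (y ^+ 2 + (L * c2 + (L * c2) ^+ 2) * (1 + s ^+ 4)) / r ^+ 3.
  have hd : `|powE k d| <= c2 * z ^+ 2.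
    by have := powE_dstep LD k3 u0 u1; rewrite -expr_div_n.
  rewrite !normrM (ger0_norm (ltW r0)).
  apply: (@le_trans _ _ (L * (1 + `|y|) * r * (c2 * z ^+ 2))).
    by apply: ler_pM => //; [rewrite mulr_ge0// ltW|apply: ler_wpM2r; [exact: ltW|exact: (tf_y TF)]].
  rewrite ler_pdivlMr ?exprn_gt0//.
  have -> : L * (1 + `|y|) * r * (c2 * z ^+ 2) * r ^+ 3 = L * c2 * s ^+ 2 + L * c2 * s ^+ 2 * `|y|.
    by rewrite /s -/z; ring.
  have c20 : 0 <= L * c2.
    by apply: mulr_ge0 => //; exact: c2_ge0.
  rewrite -(real_normK (num_real y)); move: (normr_ge0 y) c20; move: `|y| (L * c2) (s) => Y l q Y0 l0.
  have := sqr_ge0 (q ^+ 2 - 1); have := sqr_ge0 (Y - l * q ^+ 2); have := sqr_ge0 q.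
  move=> h1 h2 h3.
  have h4 : q ^+ 2 <= 1 + q ^+ 4 by nra.
  have h5 := ler_wpM2l l0 h4; have := sqr_ge0 l; have := sqr_ge0 Y; have := sqr_ge0 (l * q ^+ 2).
  by move=> *; nra.
(* Second-order term: the two occurrences of [step_var] have opposite signs and drop out. *)
have F3 : `|pyy tau y / 2 * r ^+ 2 * (powE k (fun w => d w ^+ 2) + powE k t)|
    <= L * (c3 + c4) * (1 + s ^+ 4) * (moment_err k / r ^+ 2).
  have h2 := powE_dstep2 LD k3 u0 u1; have ht := powE_tstep LD k3 u0 u1.
  have komk : (k%:R^-1 : R) <= moment_err k by rewrite /moment_err lerDr addr_ge0.
  have c40 : 0 <= c4 by exact: c4_ge0.
  have hs : `|powE k (fun w => d w ^+ 2) + powE k t| <= (c3 + c4) * z ^+ 2 * moment_err k.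
    have -> : powE k (fun w => d w ^+ 2) + powE k t = (powE k (fun w => d w ^+ 2) - step_var h H u / k%:R ^+ 2)
      + (powE k t + step_var h H u / k%:R ^+ 2) by ring.
    apply: (le_trans (ler_normD _ _)).
    apply: (le_trans (lerD h2 ht)).
    have -> : (c3 + c4) * z ^+ 2 * moment_err k = c3 * z ^+ 2 * moment_err k + c4 * (z ^+ 2 * moment_err k) by ring.
    apply: lerD; first by rewrite /z expr_div_n.
    have -> : u ^+ 2 / k%:R ^+ 3 = z ^+ 2 * k%:R^-1 by rewrite /z; field; rewrite gt_eqF.
    by apply: ler_wpM2l => //; apply: ler_wpM2l => //; exact: sqr_ge0.
  rewrite [`|_|]normrM [`|_ * r ^+ 2|]normrM [`|r ^+ 2|](ger0_norm (sqr_ge0 r)).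
  apply: (@le_trans _ _ (L * r ^+ 2 * ((c3 + c4) * z ^+ 2 * moment_err k))).
    apply: ler_pM => //; first by apply: mulr_ge0 => //; exact: sqr_ge0.
    apply: ler_wpM2r; first exact: sqr_ge0.
    rewrite normrM [`|2^-1|]ger0_norm// ler_pdivrMr//; have := tf_yy TF y tau0; lra.
  have -> : L * r ^+ 2 * ((c3 + c4) * z ^+ 2 * moment_err k) = L * (c3 + c4) * s ^+ 2 * (moment_err k / r ^+ 2).
    by rewrite /s -/z; field; rewrite gt_eqF.
  apply: ler_wpM2r; first by rewrite divr_ge0 ?om_ge0 ?sqr_ge0.
  apply: ler_wpM2l; first by rewrite mulr_ge0// addr_ge0// c3_ge0.
  by have := sqr_ge0 (s ^+ 2 - 1); have := sqr_ge0 s; nra.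
apply: (le_trans (ler_normD _ _)); apply: (le_trans (lerD (ler_normD _ _) (lexx _))).
apply: (le_trans (lerD (lerD pX F2) F3)).
have rest : 0 <= moment_err k / r ^+ 2 by rewrite divr_ge0 ?om_ge0 ?sqr_ge0.
have IR0 : 0 <= (r ^+ 3)^-1 by rewrite invr_ge0 exprn_ge0// ltW.
have s40 : 0 <= 1 + s ^+ 4 by rewrite addr_ge0// exprn_ge0// /s mulr_ge0 ?sqr_ge0.
have -> : Cstep = c9 * L * (c1 ^+ 3 + C3 ^+ 2 + C3 * c1) + (L * c2 + (L * c2) ^+ 2) + L * (c3 + c4).
  by rewrite /Cstep; ring.
rewrite /B1.
have p1 : 0 <= c9 * L * (c1 ^+ 3 + C3 ^+ 2 + C3 * c1).
  by rewrite !mulr_ge0// ?exprn_ge0// !addr_ge0// ?exprn_ge0// mulr_ge0.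
have p2 : 0 <= L * c2 + (L * c2) ^+ 2.
  by rewrite addr_ge0 ?sqr_ge0// mulr_ge0// c2_ge0.
have p3 : 0 <= L * (c3 + c4) by rewrite mulr_ge0// addr_ge0 ?c3_ge0 ?c4_ge0.
move: p1 p2 p3 rest IR0 s40.
have -> : L * (c1 ^+ 3 + C3 ^+ 2 + C3 * c1) * (1 + s ^+ 4) / r ^+ 3 * c9
 = c9 * L * (c1 ^+ 3 + C3 ^+ 2 + C3 * c1) * (1 + s ^+ 4) * (r ^+ 3)^-1 by ring.
move: (c9 * L * _) (L * c2 + _) (L * (c3 + c4)) (moment_err k / r ^+ 2) ((r ^+ 3)^-1) (1 + s ^+ 4)
  => P1 P2 P3 o I S p1 p2 p3 o0 I0 S0.
have q1 := mulr_ge0 (mulr_ge0 p1 S0) o0; have q2 := mulr_ge0 (mulr_ge0 p2 S0) o0.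
have q3 := mulr_ge0 (mulr_ge0 p3 S0) I0.
lra.
Qed.

(** Carries the error [th * y ^ 2] of an induction hypothesis through one step; the drift is again
    separated from [y] by Young's inequality, using [th <= 3 / r]. *)
Lemma powE_sqr_step (k : nat) (r u y : R) : (3 <= k)%N -> 0 < u <= 1 -> 1 <= r ->
  let s := r ^+ 2 * (u / k%:R) in
  admissible k (fun w => (y + r * center_step k u w) ^+ 2) /\
  forall th, 0 <= th <= 3 / r ->
   th * powE k (fun w => (y + r * center_step k u w) ^+ 2)
   <= th * y ^+ 2 + y ^+ 2 / r ^+ 3 + Csq * (1 + s ^+ 4) / r ^+ 3.
Proof.
move=> k3 /andP[u0 u1] r1 s.
have r0 : 0 < r by rewrite (lt_le_trans ltr01).
have k0 : (0 : R) < k%:R by rewrite ltr0n (leq_trans _ k3).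
have k2 : (2 <= k)%N := ltnW k3.
pose z := u / k%:R; have z0 : 0 <= z by rewrite divr_ge0// ltW.
pose d w := center_step k u w.
have ad : admissible k d := adm_dstep LD k3 u0 u1.
have ad2 : admissible k (fun w => d w ^+ 2) := adm_dstep2 LD k3 u0 u1.
have E : (fun w => (y + r * d w) ^+ 2) = fun w => y ^+ 2 + (2 * y * r * d w + r ^+ 2 * d w ^+ 2).
  by apply/funext => w; ring.
rewrite -/(d _) E; split.
  by apply: admD; [exact: adm_cst|apply: admD; exact: admZ].
move=> th /andP[th0 th3].
rewrite powED//; [|exact: adm_cst|by apply: admD; exact: admZ].
rewrite powE_cst// powED//; [|exact: admZ|exact: admZ].
rewrite !powEZ//.
have hd : `|powE k d| <= c2 * z ^+ 2.
  by have := powE_dstep LD k3 u0 u1; rewrite -expr_div_n.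
have hd2 : powE k (fun w => d w ^+ 2) <= c9 * c1 ^+ 2 * z ^+ 2.
  apply: (le_trans (ler_norm _)).
  have -> : c9 * c1 ^+ 2 * z ^+ 2 = (c1 ^+ 2 * z ^+ 2) * c9 by ring.
  apply: (norm_powE_Y k2 (i := 6)) => //; first by rewrite mulr_ge0// sqr_ge0.
    by case: ad2.
  move=> w w01; rewrite ger0_norm ?sqr_ge0//.
  have hw := dstep_le LD k3 u0 u1 w01.
  rewrite -(real_normK (num_real (d w))).
  have -> : c1 ^+ 2 * z ^+ 2 * log_weight k w ^+ 6 = (c1 * z * log_weight k w ^+ 3) ^+ 2 by ring.
  by rewrite lerXn2r ?nnegrE// (le_trans _ hw).
have step1 : th * (2 * y * r * powE k d) <= y ^+ 2 / r ^+ 3 + 9 * c2 ^+ 2 * (1 + s ^+ 4) / r ^+ 3.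
  apply: (le_trans (ler_norm _)); rewrite !normrM (ger0_norm (ltW r0)) (ger0_norm th0) ger0_norm//.
  apply: (@le_trans _ _ (3 / r * (2 * `|y| * r * (c2 * z ^+ 2)))).
    apply: ler_pM => //; first by rewrite !mulr_ge0// ltW.
    by apply: ler_wpM2l => //; rewrite !mulr_ge0// ltW.
  rewrite -mulrDl ler_pdivlMr ?exprn_gt0//.
  have -> : 3 / r * (2 * `|y| * r * (c2 * z ^+ 2)) * r ^+ 3 = 2 * `|y| * (3 * c2 * s ^+ 2) / r.
    by rewrite /s -/z; field; rewrite gt_eqF.
  rewrite ler_pdivrMr//.
  have -> : 9 * c2 ^+ 2 = (3 * c2) ^+ 2 by ring.
  rewrite -(real_normK (num_real y)); move: (`|y|) (3 * c2) (s) => Y c q.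
  have h1 := sqr_ge0 (Y - c * q ^+ 2); have h2 := sqr_ge0 c; have h3 := sqr_ge0 Y.
  have h4 := sqr_ge0 (c * q ^+ 2).
  have h5 : 2 * Y * (c * q ^+ 2) <= Y ^+ 2 + c ^+ 2 * (1 + q ^+ 4) by nra.
  apply: (le_trans h5); rewrite ler_peMr// addr_ge0// mulr_ge0// addr_ge0//.
  by rewrite (_ : q ^+ 4 = (q ^+ 2) ^+ 2) ?sqr_ge0//; ring.
have step2 : th * (r ^+ 2 * powE k (fun w => d w ^+ 2)) <= 3 * (c9 * c1 ^+ 2) * (1 + s ^+ 4) / r ^+ 3.
  apply: (@le_trans _ _ (3 / r * (r ^+ 2 * (c9 * c1 ^+ 2 * z ^+ 2)))).
    apply: (@le_trans _ _ (th * (r ^+ 2 * (c9 * c1 ^+ 2 * z ^+ 2)))).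
      by apply: ler_wpM2l => //; apply: ler_wpM2l => //; exact: sqr_ge0.
    apply: ler_wpM2r => //; apply: mulr_ge0; first exact: sqr_ge0.
    by apply: mulr_ge0; [apply: mulr_ge0|] => //; exact: sqr_ge0.
  rewrite ler_pdivlMr ?exprn_gt0//.
  have -> : 3 / r * (r ^+ 2 * (c9 * c1 ^+ 2 * z ^+ 2)) * r ^+ 3 = 3 * (c9 * c1 ^+ 2) * s ^+ 2.
    by rewrite /s -/z; field; rewrite gt_eqF.
  apply: ler_wpM2l; first by rewrite mulr_ge0// mulr_ge0// sqr_ge0.
  by have := sqr_ge0 (s ^+ 2 - 1); have := sqr_ge0 s; nra.
rewrite mulrDr mulrDr -addrA lerD2l.
apply: (le_trans (lerD step1 step2)).
by rewrite /Csq [(_ + _) * (1 + _)]mulrDl [(_ + _) / _]mulrDl addrA.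
Qed.

End lindeberg_step.

(** * A martingale dominating the fourth power of [n u / k] *)

Section martingale.
Context {R : realType}.
Implicit Types u : R.

(* [quartic_mart n k] is an exact martingale:
   [powE k (fun w => quartic_mart n k.-1 (u * w)) = quartic_mart n k u]. *)
Definition quartic_mart (n k : nat) (u : R) : R :=
  120 * (n%:R * u) ^+ 4 / (k.+1%:R * k.+2%:R * k.+3%:R * k.+4%:R).

Let admX4 k : admissible k (fun w : R => w ^+ 4).
Proof.
apply: (adm_le (g := fun=> 1)); [exact: measurable_funX|exact: adm_cst|].
by move=> w /andP[w0 w1]; rewrite normr1 ger0_norm ?exprn_ge0 ?exprn_ile1 ?ltW.
Qed.

(** The factor [w ^ 4] only raises the exponent: [k w^(k-1) w^4] is [k / (k + 4)] times the density
    with exponent [k + 4]. *)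
Lemma powE_X4 k (c : R) : (2 <= k)%N -> powE k (fun w => c * w ^+ 4) = c * (k%:R / k.+4%:R).
Proof.
move=> k2; have k4 : (2 <= k.+4)%N by [].
rewrite powEZ//; congr (_ * _).
transitivity (powE k.+4 (fun=> (k%:R / k.+4%:R : R))); last by rewrite powE_cst.
rewrite /powE; apply: eq_Rintegral => w _.
case: k k2 {k4} => // k _ /=.
have -> : w ^+ k.+4 = w ^+ k * w ^+ 4 by rewrite -exprD addn4.
have : (k.+1.+4%:R : R) != 0 by rewrite pnatr_eq0.
by move: (k.+1.+4%:R : R) (w ^+ k) (w ^+ 4) => x p q x0; field.
Qed.

Lemma Mk_ge0 n k u : 0 <= quartic_mart n k u.
Proof.
by apply: divr_ge0; [apply: mulr_ge0 => //; exact: exprn_even_ge0|rewrite !mulr_ge0].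
Qed.

Lemma powE_Mk n k u : (2 <= k)%N ->
  admissible k (fun w => quartic_mart n k.-1 (u * w)) /\ powE k (fun w => quartic_mart n k.-1 (u * w)) = quartic_mart n k u.
Proof.
case: k => // k k2 /=.
have E : (fun w : R => quartic_mart n k (u * w)) = fun w => (120 * (n%:R * u) ^+ 4 / (k.+1%:R * k.+2%:R * k.+3%:R * k.+4%:R)) * w ^+ 4.
  by apply/funext => w; rewrite /quartic_mart mulrA exprMn; ring.
rewrite E; split; first exact: admZ.
rewrite powE_X4// /quartic_mart.
have k1 : (k.+1%:R : R) != 0 by rewrite pnatr_eq0.
have k2' : (k.+2%:R : R) != 0 by rewrite pnatr_eq0.
have k3 : (k.+3%:R : R) != 0 by rewrite pnatr_eq0.
have k4 : (k.+4%:R : R) != 0 by rewrite pnatr_eq0.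
have : (k.+1.+4%:R : R) != 0 by rewrite pnatr_eq0.
move: (_ ^+ 4) k1 k2' k3 k4 => q; move: (k.+1%:R : R) (k.+2%:R : R) (k.+3%:R : R) (k.+4%:R : R) (k.+1.+4%:R : R).
by move=> x1 x2 x3 x4 x5 *; field; repeat (apply/andP; split => //).
Qed.

(** With [Mk1_le], this bounds the mean of [(n u / k) ^ 4] along the chain by 120. The factor 120
    more than compensates the ratio of [(k + 1)(k + 2)(k + 3)(k + 4)] to [k ^ 4]. *)
Lemma Mk_ge n k u : (3 <= k)%N -> (n%:R * (u / k%:R)) ^+ 4 <= quartic_mart n k u.
Proof.
move=> k3; rewrite /quartic_mart mulrA expr_div_n ler_pdivlMr; last by rewrite !mulr_gt0.
have k0 : (0 : R) < k%:R by rewrite ltr0n (leq_trans _ k3).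
rewrite mulrAC ler_pdivrMr ?exprn_gt0// [120 * _]mulrC -[leRHS]mulrA.
apply: ler_wpM2l; first by rewrite exprn_even_ge0.
have k1 : (3 : R) <= k%:R by rewrite ler_nat.
rewrite -[k.+4]addn4 -[k.+3]addn3 -[k.+2]addn2 -[k.+1]addn1 !natrD.
move: (k%:R : R) k1 => x x3.
have x1 : x + 1 <= 2 * x by lra.
have x2 : x + 2 <= 2 * x by lra.
have x4 : x + 3 <= 2 * x by lra.
have x5 : x + 4 <= 3 * x by lra.
have -> : 120 * x ^+ 4 = 5 * ((2 * x) * (2 * x) * (2 * x) * (3 * x)) by ring.
have h : (x + 1) * (x + 2) * (x + 3) * (x + 4) <= (2 * x) * (2 * x) * (2 * x) * (3 * x).
  by do 3 (apply: ler_pM => //; try by rewrite ?mulr_ge0//; lra).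
have := mulr_ge0 (mulr_ge0 (mulr_ge0 (_ : 0 <= 2 * x) (_ : 0 <= 2 * x)) (_ : 0 <= 2 * x)) (_ : 0 <= 3 * x).
by move=> /(_ ltac:(lra) ltac:(lra) ltac:(lra) ltac:(lra)); lra.
Qed.

Lemma Mk1_le n : quartic_mart n n 1 <= 120.
Proof.
rewrite /quartic_mart mulr1 ler_pdivrMr ?mulr_gt0// ler_wpM2l//.
have h i : (n%:R : R) <= (n + i)%:R by rewrite ler_nat leq_addr.
have -> : (n%:R : R) ^+ 4 = n%:R * n%:R * n%:R * n%:R by ring.
rewrite -[n.+4]addn4 -[n.+3]addn3 -[n.+2]addn2 -[n.+1]addn1.
by do 3 (apply: ler_pM => //; try by rewrite ?mulr_ge0).
Qed.

End martingale.

(** * Summation of the replacement errors along the chain *)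

Section lindeberg.
Context {R : realType}.
Variables (h H A B : R -> R) (a b K : R).
Hypothesis LD : lip_density h H A B a b K.
Variables (psi py pyy : R -> R -> R) (L : R).
Hypothesis TF : test_fun psi py pyy L.
Local Notation center_step := (center_step H B).
Local Notation var_step := (var_step H A).
Local Notation rest_var := (rest_var H A).
Local Notation centering := (centering H B).
Variables (n : nat) (chain_mean : nat -> R -> R -> R) (c0 S2 : R).
Hypothesis n1 : (1 <= n)%N.
Hypothesis S20 : 0 <= S2.
Let r : R := Num.sqrt n%:R.
Let gap u x := xlogx (H u - H x).
Let Cs : R := Cstep a b K L + Csq a b K.
(** Each step adds [2 / r ^ 3] to the weight of [y ^ 2]: one half from the replacement error, one
    from [powE_sqr_step]. Since [k <= n = r ^ 2], the weight stays below [3 / r]. *)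
Let th (k : nat) : R := r^-1 + 2 * k%:R / r ^+ 3.
Let sg (k : nat) : R := S2 + \sum_(3 <= j < k.+1) Cs * ((r ^+ 3)^-1 + moment_err j / r ^+ 2).
Hypothesis ah_rec : forall k (u l : R), (3 <= k <= n)%N -> 0 < u <= 1 ->
  measurable_fun setT (fun w : R => chain_mean k.-1 (u * w) (l + gap u (u * w))) /\
  chain_mean k u l = powE k (fun w : R => chain_mean k.-1 (u * w) (l + gap u (u * w))).
Hypothesis ah_base : forall u l y : R, 0 < u <= 1 -> y = r * (l + centering 2 u - c0) ->
  `|chain_mean 2 u l - psi (r ^+ 2 * rest_var u / 2) y| <= r^-1 * y ^+ 2 + S2 * (1 + quartic_mart n 2 u).

(** The error has the two shapes that survive a conditional expectation: [y ^ 2], reproduced by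
    [powE_sqr_step], and the martingale, reproduced exactly by [powE_Mk]. *)
Lemma lindeberg k u l y : (2 <= k <= n)%N -> 0 < u <= 1 -> y = r * (l + centering k u - c0) ->
  `|chain_mean k u l - psi (r ^+ 2 * rest_var u / k%:R) y| <= th k * y ^+ 2 + sg k * (1 + quartic_mart n k u).
Proof.
have rn : r ^+ 2 = n%:R by rewrite sqr_sqrtr.
have r1 : 1 <= r by rewrite -(@sqrtr1 R) ler_wsqrtr// ler1n.
have r0 : 0 < r by rewrite (lt_le_trans ltr01).
have IR0 : 0 <= (r ^+ 3)^-1 by rewrite invr_ge0 exprn_ge0// ltW.
have Cs0 : 0 <= Cs by rewrite addr_ge0 ?(Cstep_ge0 LD TF)// (Csq_ge0 LD).
have src0 j : 0 <= Cs * ((r ^+ 3)^-1 + moment_err j / r ^+ 2).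
  by rewrite mulr_ge0// addr_ge0// divr_ge0 ?om_ge0 ?sqr_ge0.
have sg0 k' : 0 <= sg k' by rewrite addr_ge0// sumr_ge0.
have th0 k' : 0 <= th k' by rewrite addr_ge0 ?invr_ge0 ?(ltW r0)// mulr_ge0// mulr_ge0.
elim: k u l y => // k IH u l y /andP[k2 kn] u01 yE.
have [k1|k3] := leqP k 1.
  have k1E : k = 1%N by lia.
  rewrite k1E in yE *.
  have := ah_base u01 yE; rewrite /th /sg big_geq// addr0 => /le_trans; apply.
  by rewrite lerD2r; apply: ler_wpM2r; [exact: sqr_ge0|rewrite lerDl mulr_ge0].
have k3' : (3 <= k.+1)%N by [].
have [mg ->] := ah_rec l (introT andP (conj k3' kn)) u01.
set g := fun w => _ in mg *.
have /andP[u0 u1] := u01.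
have [aF hF] := lindeberg_step LD TF y k3' u01 r1.
have [aq hq] := powE_sqr_step LD y k3' u01 r1.
have [aM hM] := powE_Mk n u (ltnW k3').
rewrite /= in aM hM.
set tau := r ^+ 2 * rest_var u / k.+1%:R in aF hF *.
set F := fun w => psi _ _ in aF hF.
pose err w := th k * (y + r * center_step k.+1 u w) ^+ 2 + sg k * (1 + quartic_mart n k (u * w)).
have a1M : admissible k.+1 (fun w => 1 + quartic_mart n k (u * w)) by apply: admD => //; exact: adm_cst.
have aerr : admissible k.+1 err by apply: admD; exact: admZ.
have gF w : 0 < w < 1 -> `|g w - F w| <= err w.
  move=> /andP[w0 w1].
  have uw : 0 < u * w <= 1.
    by rewrite mulr_gt0//= mulr_ile1 ?(ltW u0) ?(ltW w0) ?(ltW w1).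
  have := IH (u * w) (l + gap u (u * w)) _ (introT andP (conj k3 (ltnW kn))) uw erefl.
  rewrite -/(g w) /err /F.
  have -> : r * (l + gap u (u * w) + centering k (u * w) - c0) = y + r * center_step k.+1 u w.
    by rewrite yE dstepE /gap /=; ring.
  have -> : tau + r ^+ 2 * var_step k.+1 u w = r ^+ 2 * rest_var (u * w) / k%:R.
    by rewrite /tau tstepE /=; ring.
  by [].
have aGF : admissible k.+1 (fun w => g w - F w).
  apply: (adm_le (g := err)) => //; first by apply: measurable_funB => //; case: aF.
  by move=> w w01; rewrite (le_trans (gF w w01))// ler_norm.
have ag : admissible k.+1 g.
  have -> : g = fun w => (g w - F w) + F w by apply/funext => w; rewrite subrK.
  exact: admD.
have kk : (2 <= k.+1)%N := ltnW k3'.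
have e1 : `|powE k.+1 g - powE k.+1 F| <= powE k.+1 err.
  by rewrite -powEB//; apply: norm_powE.
have e2 : powE k.+1 err = th k * powE k.+1 (fun w => (y + r * center_step k.+1 u w) ^+ 2) + sg k * (1 + quartic_mart n k.+1 u).
  rewrite /err powED//; [|exact: admZ|exact: admZ].
  by rewrite !powEZ// powED// ?powE_cst ?hM//; exact: adm_cst.
have thk : 0 <= th k <= 3 / r.
  rewrite th0 /= /th.
  have -> : 3 / r = r^-1 + 2 * n%:R / r ^+ 3 by rewrite -rn; field; rewrite gt_eqF.
  by rewrite lerD2l; apply: ler_wpM2r => //; rewrite ler_wpM2l// ler_nat ltnW.
have := hq _ thk; move: hF.
set s4 := (r ^+ 2 * (u / k.+1%:R)) ^+ 4.
have s4M : 1 + s4 <= 1 + quartic_mart n k.+1 u.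
  by rewrite lerD2l /s4 rn; exact: Mk_ge.
move=> hF hq'.
have e3 : `|powE k.+1 g - psi tau y| <= `|powE k.+1 g - powE k.+1 F| + `|powE k.+1 F - psi tau y|.
  by rewrite (le_trans _ (ler_normD _ _))// le_eqVlt; apply/orP; left; apply/eqP; congr `|_|; ring.
apply: (le_trans e3); apply: (le_trans (lerD e1 hF)); rewrite e2.
have -> : th k.+1 = th k + 2 * (r ^+ 3)^-1 by rewrite /th -natr1; ring.
have -> : sg k.+1 = sg k + Cs * ((r ^+ 3)^-1 + moment_err k.+1 / r ^+ 2).
  by rewrite /sg big_nat_recr//= addrA.
have p1 : Cstep a b K L * (1 + s4) * ((r ^+ 3)^-1 + moment_err k.+1 / r ^+ 2) <=
    Cstep a b K L * (1 + quartic_mart n k.+1 u) * ((r ^+ 3)^-1 + moment_err k.+1 / r ^+ 2).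
  apply: ler_wpM2r; first by rewrite addr_ge0// divr_ge0 ?om_ge0 ?sqr_ge0.
  by apply: ler_wpM2l => //; exact: (Cstep_ge0 LD TF).
have p2 : Csq a b K * (1 + s4) / r ^+ 3 <= Csq a b K * (1 + quartic_mart n k.+1 u) * ((r ^+ 3)^-1 + moment_err k.+1 / r ^+ 2).
  apply: ler_pM => //.
  - by rewrite mulr_ge0 ?(Csq_ge0 LD)// addr_ge0// /s4 exprn_even_ge0.
  - by apply: ler_wpM2l => //; exact: (Csq_ge0 LD).
  - by rewrite lerDl divr_ge0 ?om_ge0 ?sqr_ge0.
by rewrite /Cs; move: p1 p2 hq'; lra.
Qed.

(** This [c0] makes the chain start at [y = 0], so the term in [y ^ 2] vanishes; 121 bounds
    [1 + quartic_mart n n 1]. *)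
Lemma lindeberg_end : (2 <= n)%N -> c0 = centering n 1 ->
  `|chain_mean n 1 0 - psi (rest_var 1) 0| <= 121 * (S2 + Cs * (r^-1 + n%:R^-1 * \sum_(3 <= j < n.+1) moment_err j)).
Proof.
move=> n2 c0E.
have rn : r ^+ 2 = n%:R by rewrite sqr_sqrtr.
have n0 : (0 : R) < n%:R by rewrite ltr0n.
have r0 : 0 < r by rewrite sqrtr_gt0.
have u1 : (0 : R) < (1 : R) <= 1 by rewrite ltr01/=.
have := @lindeberg n 1 0 _ (introT andP (conj n2 (leqnn n))) u1 erefl.
rewrite add0r c0E subrr mulr0 expr0n /= mulr0 add0r.
have -> : r ^+ 2 * rest_var 1 / n%:R = rest_var 1 by rewrite rn mulrAC mulfV ?mul1r// gt_eqF.
have Cs0 : 0 <= Cs by rewrite addr_ge0 ?(Cstep_ge0 LD TF)// (Csq_ge0 LD).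
move=> /le_trans; apply; rewrite mulrC; apply: ler_pM.
- by rewrite addr_ge0// Mk_ge0.
- rewrite addr_ge0// sumr_ge0// => j _; rewrite mulr_ge0// addr_ge0 ?invr_ge0 ?exprn_ge0 ?(ltW r0)//.
  by rewrite mulr_ge0 ?om_ge0// invr_ge0 sqr_ge0.
- by have := @Mk1_le R n; lra.
rewrite /sg lerD2l -mulr_sumr ler_wpM2l// big_split/= -mulr_suml rn mulrC lerD2r.
rewrite sumr_const_nat -mulr_natl.
have -> : r^-1 = n%:R * (r ^+ 3)^-1 by rewrite -rn; field; rewrite gt_eqF.
by rewrite ler_wpM2r ?invr_ge0 ?exprn_ge0 ?(ltW r0)// ler_nat; lia.
Qed.

End lindeberg.

(** * Samples and product laws *)

Section tuple_power.
Context {R : realType} (mu : probability R R).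
Local Open Scope ereal_scope.

Definition mseq (n : nat) (F : seq R -> \bar R) :=
  measurable_fun [set: n.-tuple R] (fun t : n.-tuple R => F t).

Definition tcons (n : nat) (z : R * n.-tuple R) : n.+1.-tuple R :=
  [the n.+1.-tuple R of z.1 :: z.2].

Lemma measurable_tcons n : measurable_fun [set: R * n.-tuple R] (@tcons n).
Proof. by apply: measurable_cons. Qed.

HB.instance Definition _ n := isMeasurableFun.Build _ _ _ _ (@tcons n) (@measurable_tcons n).

(** Built by adjoining an independent head, so that every later conditioning on one point is
    Tonelli's theorem for a product of two measures. *)
Definition tpowS (n : nat) (Q : probability (n.-tuple R) R) :
  probability (n.+1.-tuple R) R := distribution (mu \x Q) (@tcons n).

Fixpoint tpow (n : nat) : probability (n.-tuple R) R :=
  if n is n'.+1 then tpowS (tpow n') else \d_([tuple] : 0.-tuple R).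

Lemma tpow0 (F : seq R -> \bar R) : \int[tpow 0]_t F t = F [::].
Proof.
rewrite /= (eq_integral (fun=> F [::])); last first.
  by move=> t _; rewrite (tuple0 t).
by rewrite integral_dirac//= diracT mul1e.
Qed.

Lemma mseq_tcons n (F : seq R -> \bar R) : mseq n.+1 F ->
  measurable_fun [set: R * n.-tuple R] (fun z => F (z.1 :: z.2)).
Proof.
move=> mF.
exact: (@measurableT_comp _ _ _ _ _ _ (fun t : n.+1.-tuple R => F t) _ (@tcons n)).
Qed.

Lemma mseq_cons n (F : seq R -> \bar R) (x : R) : mseq n.+1 F -> mseq n (fun s => F (x :: s)).
Proof.
move=> mF; apply: (@measurableT_comp _ _ _ _ _ _ (fun t : n.+1.-tuple R => F t) _
  (fun t : n.-tuple R => tcons (x, t))) => //.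
by apply: (@measurableT_comp _ _ _ _ _ _ (@tcons n)).
Qed.

Lemma tpowS_int n (F : seq R -> \bar R) : mseq n.+1 F -> (forall s, 0 <= F s) ->
  \int[tpow n.+1]_t F t = \int[mu]_x \int[tpow n]_t F (x :: t).
Proof.
move=> mF F0 /=; rewrite /tpowS.
rewrite (@ge0_integral_pushforward _ _ _ _ _ _ _ _ setT (fun t : n.+1.-tuple R => F t))//.
by rewrite preimage_setT (@fubini_tonelli1 _ _ _ _ _ mu (tpow n) (fun z => F (z.1 :: z.2)) (mseq_tcons mF)).
Qed.

Lemma measurable_tpow_cons n (F : seq R -> \bar R) : mseq n.+1 F -> (forall s, 0 <= F s) ->
  measurable_fun [set: R] (fun x => \int[tpow n]_t F (x :: t)).
Proof.
move=> mF F0.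
exact: (@measurable_fun_fubini_tonelli_F _ _ _ _ _ (tpow n) (fun z => F (z.1 :: z.2)) (mseq_tcons mF)).
Qed.

(* An [n]-fold box, with sides indexed by all naturals. *)
Definition tbox (n : nat) (C : nat -> set R) : set (n.-tuple R) :=
  [set t | forall i : 'I_n, C i (tnth t i)].

Lemma measurable_tbox n C : (forall i, measurable (C i)) -> measurable (@tbox n C).
Proof.
move=> mC.
have -> : @tbox n C = \bigcap_(i in [set: 'I_n]) ((fun t : n.-tuple R => tnth t i) @^-1` C i).
  by apply/seteqP; split => t tC i; [move=> _|]; exact: tC.
apply: fin_bigcap_measurable => // i _.
by rewrite -[X in measurable X]setTI; exact: measurable_tnth.
Qed.

Lemma tpow_tbox n C : (forall i, measurable (C i)) ->
  tpow n (@tbox n C) = \prod_(i < n) mu (C i).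
Proof.
elim: n C => [|n IH] C mC.
  rewrite big_ord0 /= diracE mem_set// => -[] //.
rewrite big_ord_recl /= -(IH (fun i => C i.+1))//.
rewrite -product_measure1E//; last exact: measurable_tbox.
rewrite /tpowS /distribution /pushforward; congr (_ _).
apply/seteqP; split => -[x t] /=.
  move=> tC; split => /=; first exact: (tC ord0).
  by move=> i; have := tC (lift ord0 i); rewrite tnthS.
move=> [Cx tC] i; have [j ->|->] := unliftP ord0 i; first by rewrite tnthS; exact: tC.
exact: Cx.
Qed.

(** Boxes are stable under intersection and generate the product sigma-algebra, because the preimage
    of a set under one coordinate is a box whose other sides are full. *)
Lemma tuple_measure_unique n (m1 m2 : {measure set (n.-tuple R) -> \bar R}) :
  m1 setT < +oo ->
  (forall C, (forall i, measurable (C i)) -> m1 (@tbox n C) = m2 (tbox C)) ->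
  forall A, measurable A -> m1 A = m2 A.
Proof.
move=> m1oo m12 A mA.
pose G := [set A | exists2 C : nat -> set R, (forall i, measurable (C i)) & A = @tbox n C].
have GT : G setT by exists (fun=> setT) => //; apply/seteqP; split.
apply: (@measure_unique _ _ _ G (fun=> setT)) => //.
- apply/seteqP; split.
    apply: smallest_sub; first exact: smallest_sigma_algebra.
    rewrite /g_sigma_preimage; apply: (big_ind (fun B => B `<=` <<s G >>)) => //.
      by move=> B C BG CG D [/BG|/CG].
    move=> i _ B [D mD <-]; apply: sub_sigma_algebra.
    exists (fun j => if j == i :> nat then D else setT).
      by move=> j; case: ifP.
    apply/seteqP; split => t /=.
      move=> [_ Dt] j /=; case: ifPn => [/eqP ji|//].
      by rewrite (_ : j = i)//; exact: val_inj.
    by move=> /(_ i) /=; rewrite eqxx.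
  apply: smallest_sub; first exact: sigma_algebra_measurable.
  by move=> _ [C mC ->]; exact: measurable_tbox.
- move=> _ _ [C mC ->] [D mD ->]; exists (fun i => C i `&` D i).
    by move=> i; exact: measurableI.
  apply/seteqP; split => t /=.
    by move=> [tC tD] i; split; [exact: tC|exact: tD].
  by move=> tCD; split => i; have [] := tCD i.
- by rewrite bigcup_const.
- by move=> _ [C mC ->]; exact: m12.
Qed.
End tuple_power.

Section iid.
Context {R : realType} d (T : measurableType d) (P : probability T R) (mu : probability R R).
Local Open Scope ereal_scope.

Definition iid (U : nat -> T -> R) : Prop :=
  (forall i, measurable_fun setT (U i)) /\
  forall (s : seq nat) (B : nat -> set R), uniq s -> (forall i, measurable (B i)) ->
    P (\bigcap_(i in [set` s]) (U i @^-1` B i)) = \prod_(i <- s) mu (B i).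

Variable U : nat -> T -> R.
Hypothesis HU : iid U.

Definition sample (s : seq nat) (w : T) : seq R := [seq U i w | i <- s].

Lemma measurable_sample (s : seq nat) (F : seq R -> \bar R) :
  mseq (size s) F -> measurable_fun setT (fun w => F (sample s w)).
Proof.
move=> mF; pose Z w := [the (size s).-tuple R of map (fun i => U i w) (in_tuple s)].
apply: (@measurableT_comp _ _ _ _ _ _ (fun t : (size s).-tuple R => F t) _ Z) => //.
apply/measurable_fun_tnthP => i /=; rewrite (_ : _ \o _ = U (tnth (in_tuple s) i)).
  exact: HU.1.
by apply/funext => w /=; rewrite tnth_map.
Qed.

Lemma iid_int (s : seq nat) (F : seq R -> \bar R) : uniq s -> mseq (size s) F ->
  (forall t, 0 <= F t) -> \int[P]_w F (sample s w) = \int[tpow mu (size s)]_t F t.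
Proof.
move=> us mF F0; pose Z w := [the (size s).-tuple R of map (fun i => U i w) (in_tuple s)].
have mZ : measurable_fun setT Z.
  apply/measurable_fun_tnthP => i /=; rewrite (_ : _ \o _ = U (tnth (in_tuple s) i)).
    exact: HU.1.
  by apply/funext => w /=; rewrite tnth_map.
pose Zm : {mfun T >-> (size s).-tuple R} := HB.pack Z (isMeasurableFun.Build _ _ _ _ _ mZ).
have PZ A : measurable A -> distribution P Zm A = tpow mu (size s) A.
  apply: tuple_measure_unique => [|C mC].
    by rewrite /distribution/= probability_setT ltry.
  have E := @tpow_tbox _ mu (size s) C mC.
  transitivity (\prod_(i < size s) mu (C i)); last first.
    exact/esym.
  rewrite /= /distribution /pushforward.
  (* The sides of the box are numbered by positions, the variables by their names in [s]; [index]
     translates. *)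
  have -> : Zm @^-1` @tbox R (size s) C = \bigcap_(i in [set` s]) (U i @^-1` C (index i s)).
    apply/seteqP; split => w /=.
      move=> tC i /= si; have ls : (index i s < size s)%N by rewrite index_mem.
      have := tC (Ordinal ls); rewrite tnth_map (tnth_nth 0%N) /=.
      by rewrite nth_index.
    move=> tC i; rewrite tnth_map.
    have /tC /= : tnth (in_tuple s) i \in s by rewrite mem_tnth.
    have -> : index (tnth (in_tuple s) i) s = i by rewrite (tnth_nth 0%N) index_uniq.
    by [].
  rewrite (HU.2 s (fun i => C (index i s)))//.
  by rewrite (big_nth 0%N) big_mkord; apply: eq_bigr => i _; rewrite index_uniq.
rewrite (@eq_measure_integral _ _ _ setT (distribution P Zm) (tpow mu (size s)))//.
  by rewrite (@ge0_integral_pushforward _ _ _ _ _ _ _ _ setT (fun t : (size s).-tuple R => F t)).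
by move=> A mA _; apply/esym; exact: PZ.
Qed.

End iid.

(** * Gap sums of sorted samples and their measurability *)

Section gapsum.
Context {R : realType}.
Implicit Types (f : R -> R -> R) (a u x : R) (s : seq R).

(** The endpoints [a] and [u] count as points, so both extreme gaps are included and the sum is
    additive under cutting at a point. *)
Fixpoint gsum f a s u : R := if s is x :: s' then f a x + gsum f x s' u else f a u.

Definition gapsum f u s : R := gsum f 0 (sort <=%R s) u.

Lemma gsum_cat f a s x (t : seq R) u :
  gsum f a (s ++ x :: t) u = gsum f a s x + gsum f x t u.
Proof. by elim: s a => //= y s IH a; rewrite IH addrA. Qed.

Lemma gsum_rcons f a s x u : gsum f a (rcons s x) u = gsum f a s x + f x u.
Proof. by rewrite -cats1 gsum_cat. Qed.

Lemma gsum_nth f a s u :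
  gsum f a s u = \sum_(i < (size s).+1) f (nth 0 (a :: s) i) (nth u s i).
Proof.
elim: s a => [|x s IH] a /=; first by rewrite big_ord1.
by rewrite big_ord_recl /= IH.
Qed.

Lemma sort_cons_max x s : all (<= x) s -> sort <=%R (x :: s) = rcons (sort <=%R s) x.
Proof.
move=> sx; apply: (@sorted_eq _ <=%R).
- exact: le_trans.
- exact: le_anti.
- exact/sort_sorted/le_total.
- have : sorted <=%R (sort <=%R s) by exact/sort_sorted/le_total.
  case: (sort <=%R s) (mem_sort <=%R s) => //= y r mr ps.
  rewrite rcons_path ps /=.
  by apply: (allP sx); rewrite -mr mem_last.
- rewrite perm_sort perm_sym -cats1 perm_catC /= perm_cons perm_sort.
  exact: perm_refl.
Qed.

Lemma gapsum_cons_max f u x s : all (<= x) s ->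
  gapsum f u (x :: s) = gapsum f x s + f x u.
Proof. by move=> sx; rewrite /gapsum sort_cons_max// gsum_rcons. Qed.

(** Turns an event about an order statistic into one about a sum of indicators, from which
    measurability is plain. *)
Lemma nth_sorted_le s k x : sorted <=%R s -> (k < size s)%N ->
  (nth 0 s k <= x) = (k < count (<= x) s)%N.
Proof.
elim: s k => // y s IH k /= ys ks.
have lts i : x < y -> (i < size s)%N -> (nth 0 s i <= x) = false.
  move=> xy si; apply/negbTE; rewrite -ltNge (lt_le_trans xy)//.
  have /allP := order_path_min le_trans ys.
  by apply; rewrite mem_nth.
have cnt : x < y -> count (<= x) s = 0%N.
  move=> xy; apply/eqP; rewrite -leqn0 leqNgt -has_count; apply/hasPn => z.
  by move=> /(nthP 0)[i si <-] /=; rewrite lts.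
case: k ks => [_|k ks] /=.
  have [yx|xy] := leP y x; first by [].
  by rewrite cnt.
rewrite ltnS in ks.
have [yx|xy] := leP y x; first by rewrite IH ?(path_sorted ys).
by rewrite cnt// lts.
Qed.

Lemma measurable_bool d (T : measurableType d) (b : T -> bool) :
  measurable_fun setT b -> measurable_fun setT (fun t => (b t)%:R : R).
Proof.
move=> mb; have -> : (fun t => (b t)%:R : R) = fun t => if b t then 1 else 0.
  by apply/funext => t; case: (b t).
by apply: measurable_fun_if => //; apply: measurable_funTS.
Qed.

Lemma measurable_nth_sort n k :
  measurable_fun [set: n.-tuple R] (fun t : n.-tuple R => nth 0 (sort <=%R t) k).
Proof.
have [kn|nk] := ltnP k n; last first.
  rewrite (_ : (fun _ => _) = cst 0)//; apply/funext => t.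
  by rewrite nth_default// size_sort size_tuple.
apply: (measurability _ (RGenOInfty.measurableE R)) => //= _ [_ [x ->] <-].
pose c (t : n.-tuple R) : R := \sum_(i < n) (tnth t i <= x)%R%:R.
have cE t : c t = (count (<= x) t)%:R.
  rewrite /c -sum1_count natr_sum [RHS]big_mkcond/= [RHS]big_tuple.
  by apply: eq_bigr => i _; case: ifP.
have mc : measurable_fun setT c.
  apply: measurable_sum => i; apply: measurable_bool; apply: measurable_fun_ler => //.
  exact: measurable_tnth.
rewrite setTI (_ : _ @^-1` _ = setT `&` c @^-1` `]-oo, k%:R]); first exact: mc.
rewrite setTI; apply/seteqP; split => t /=; rewrite !in_itv/= andbT cE ler_nat.
  by rewrite ltNge nth_sorted_le ?size_sort ?size_tuple// -?leqNgt ?count_sort//; exact/sort_sorted/le_total.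
by rewrite ltNge nth_sorted_le ?size_sort ?size_tuple// -?leqNgt ?count_sort//; exact/sort_sorted/le_total.
Qed.

Lemma measurable_gapsum f u n : measurable_fun [set: R * R] (fun z => f z.1 z.2) ->
  measurable_fun [set: n.-tuple R] (fun t : n.-tuple R => gapsum f u t).
Proof.
move=> mf; have -> : (fun t : n.-tuple R => gapsum f u t) = fun t : n.-tuple R =>
    \sum_(i < n.+1) f (if val i is i'.+1 then nth 0 (sort <=%R t) i' else 0)
      (if (i < n)%N then nth 0 (sort <=%R t) i else u).
  apply/funext => t; rewrite /gapsum gsum_nth size_sort size_tuple; apply: eq_bigr => i _.
  have -> : nth 0 (0 :: sort <=%R t) i = if val i is i'.+1 then nth 0 (sort <=%R t) i' else 0.
    by case: i => -[].
  congr (f _ _).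
  case: ltnP => [i_n|ni]; last by rewrite nth_default// size_sort size_tuple.
  by apply: set_nth_default; rewrite size_sort size_tuple.
apply: measurable_sum => i.
pose e1 (t : n.-tuple R) := if val i is i'.+1 then nth 0 (sort <=%R t) i' else 0.
pose e2 (t : n.-tuple R) := if (i < n)%N then nth 0 (sort <=%R t) i else u.
have m1 : measurable_fun setT e1.
  by rewrite /e1; case: (val i) => [|j]; [exact: measurable_cst|exact: measurable_nth_sort].
have m2 : measurable_fun setT e2.
  by rewrite /e2; case: ltnP => _; [exact: measurable_nth_sort|exact: measurable_cst].
exact: (measurableT_comp mf (measurable_fun_pair m1 m2)).
Qed.

Lemma all_prodE n (t : n.-tuple R) x : (all (<= x) t)%:R = \prod_(i < n) (tnth t i <= x)%R%:R :> R.
Proof.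
rewrite -(big_tuple _ _ t xpredT (fun y => (y <= x)%R%:R : R)).
elim: (tval t) => [|y s IH] /=; first by rewrite big_nil.
by rewrite big_cons -IH; case: (y <= x)%R; rewrite ?mul1r ?mul0r.
Qed.

Lemma measurable_all n x :
  measurable_fun [set: n.-tuple R] (fun t : n.-tuple R => (all (<= x) t)%:R : R).
Proof.
under eq_fun do rewrite all_prodE.
apply: measurable_prod => i _; apply: measurable_bool; apply: measurable_fun_ler => //.
exact: measurable_tnth.
Qed.

Lemma measurable_all_head n :
  measurable_fun [set: n.+1.-tuple R] (fun t : n.+1.-tuple R => (all (<= head 0 t) t)%:R : R).
Proof.
under eq_fun do rewrite all_prodE.
apply: measurable_prod => i _; apply: measurable_bool; apply: measurable_fun_ler.
  exact: measurable_tnth.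
rewrite (_ : (fun _ => _) = (fun t : n.+1.-tuple R => tnth t ord0)); first exact: measurable_tnth.
by apply/funext => t; rewrite (tnth_nth 0) nth0.
Qed.
End gapsum.

(** * Decomposition of a sample at its maximum *)

Section max_decomposition.
Context {R : realType} d (T : measurableType d) (P : probability T R) (mu : probability R R).
Variables (U : nat -> T -> R).
Hypothesis HU : iid P mu U.
Hypothesis mu1 : forall x, mu [set x] = 0%E.

Lemma iid_neq i j : i != j -> {ae P, forall w, U i w != U j w}.
Proof.
move=> ij; pose F (s : seq R) : \bar R := ((head 0 s == head 0 (behead s))%:R)%:E.
have mF : mseq 2 F.
  apply/measurable_EFinP; apply: measurable_bool; apply: measurable_fun_eqr.
    rewrite (_ : (fun _ => _) = (fun t : 2.-tuple R => tnth t ord0)); first exact: measurable_tnth.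
    by apply/funext => t; rewrite (tnth_nth 0) nth0.
  rewrite (_ : (fun _ => _) = (fun t : 2.-tuple R => tnth t (lift ord0 ord0))); first exact: measurable_tnth.
  by apply/funext => t; rewrite (tnth_nth 0) /= -nth0 nth_behead.
have F0 s : (0 <= F s)%E by rewrite lee_fin ler0n.
have I2 : (\int[tpow mu 2]_t F t = 0)%E.
  rewrite (tpowS_int mu mF F0) (eq_integral (fun=> 0%E)) ?integral0// => x _.
  rewrite (tpowS_int mu (mseq_cons x mF)) => [|s]; last exact: F0.
  rewrite (eq_integral (fun y => (\1_[set x] y)%:E)); last first.
    move=> y _; rewrite (tpow0 mu (fun s => F [:: x, y & s])) /F /= indicE eq_sym; congr (_%:R%:E).
    by case: eqP => yx; [rewrite mem_set|rewrite memNset].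
  rewrite integral_indic ?setIT//; exact: mu1.
have I0 : (\int[P]_w F (sample U [:: i; j] w) = 0)%E.
  by rewrite (iid_int HU (s := [:: i; j]) _ mF F0)//= inE ij.
have mD : measurable [set w | U i w == U j w].
  rewrite -[X in measurable X]setTI; have := measurable_fun_eqr (HU.1 i) (HU.1 j).
  by move=> /(_ measurableT [set true]); apply.
exists [set w | U i w == U j w]; split => //; last by move=> w /= /negP; rewrite negbK.
transitivity (\int[P]_w (\1_[set w | U i w == U j w] w)%:E)%E; first by rewrite integral_indic// setIT.
transitivity (\int[P]_w F (sample U [:: i; j] w))%E; last exact: I0.
apply: eq_integral => w _.
rewrite /F /= indicE; congr (_%:R%:E).
by congr nat_of_bool; apply/idP/idP; rewrite inE.
Qed.

(** Almost surely exactly one of the [k.+1] points is the largest. Moving it to the head leaves the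
    symmetric [F] unchanged, so by exchangeability the [k.+1] cases contribute equally. *)
Lemma tpow_max k (F : seq R -> \bar R) : mseq k.+1 F -> (forall s, 0 <= F s)%E ->
  (forall s s', perm_eq s s' -> F s = F s') ->
  (\int[tpow mu k.+1]_t F t =
   k.+1%:R%:E * \int[mu]_x \int[tpow mu k]_t (F (x :: t) * (all (<= x) t)%:R%:E))%E.
Proof.
move=> mF F0 Fs; pose F1 s := (F s * (all (<= head 0%R s) s)%:R%:E)%E.
have mF1 : mseq k.+1 F1.
  by apply: emeasurable_funM => //; apply/measurable_EFinP; exact: measurable_all_head.
have F10 s : (0 <= F1 s)%E by rewrite mule_ge0// lee_fin.
pose s0 := iota 0 k.+1.
have s0k : size s0 = k.+1 by rewrite size_iota.
(* The same indices, with [i] moved to the front. *)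
pose si (i : 'I_k.+1) := val i :: rem (val i) s0.
have is0 (i : 'I_k.+1) : val i \in s0 by rewrite mem_iota /= add0n ltn_ord.
have psi i : perm_eq s0 (si i) by exact: perm_to_rem.
have usi i : uniq (si i) by rewrite -(perm_uniq (psi i)) iota_uniq.
have zsi i : size (si i) = k.+1 by rewrite -(perm_size (psi i)).
have <- : (\int[P]_w F (sample U s0 w) = \int[tpow mu k.+1]_t F t)%E.
  by rewrite (iid_int HU)// ?iota_uniq ?s0k.
have <- : (\int[P]_w (\sum_(i < k.+1) F1 (sample U (si i) w)) = \int[P]_w F (sample U s0 w))%E.
  apply: ae_eq_integral => //.
  - by apply: emeasurable_sum => i; apply: (measurable_sample HU); rewrite zsi.
  - by apply: (measurable_sample HU); rewrite s0k.
  have : {ae P, forall w, forall i j : nat, i != j -> U i w != U j w}.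
    apply/ae_foralln => i; apply/ae_foralln => j; have [->|ij] := eqVneq i j.
      by apply: aeW => w /=; rewrite eqxx.
    by apply: filterS (iid_neq ij) => w Uw.
  apply: filterS => w dist _.
  have E i : F1 (sample U (si i) w) =
      (F (sample U s0 w) * ([forall j : 'I_k.+1, U j w <= U i w]%R)%:R%:E)%E.
    rewrite /F1; congr (_ * _%:R%:E)%E.
      by apply: Fs; rewrite perm_sym; apply: perm_map; exact: psi.
    congr nat_of_bool.
    rewrite (@perm_all _ _ (sample U s0 w)); last by rewrite perm_sym; exact/perm_map/psi.
    rewrite all_map; apply/allP/forallP => [h j|h j]; first exact: (h _ (is0 j)).
    by rewrite mem_iota /= add0n => jk; exact: (h (Ordinal jk)).
  under eq_bigr do rewrite E.
  have [i0 _ i0P] := @arg_maxP _ _ _ ord0 xpredT (fun i : 'I_k.+1 => U i w) isT.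
  rewrite (bigD1 i0)//= big1 ?adde0.
    by rewrite (_ : [forall j, _])%B ?mule1//; apply/forallP => j; exact: i0P.
  move=> i ii0; rewrite (_ : [forall j, _]%B = false) ?mule0//.
  apply/negbTE/negP => /forallP /(_ i0) h.
  have := dist i i0 ii0; rewrite /= => /negP; apply; apply/eqP/le_anti.
  by rewrite h andbT; exact: i0P.
rewrite ge0_integral_sum//; last first.
  by move=> i; apply: (measurable_sample HU); rewrite zsi.
rewrite (eq_bigr (fun=> \int[tpow mu k.+1]_t F1 t)%E); last first.
  by move=> i _; rewrite (iid_int HU)// zsi.
have sumc (x : \bar R) m : (0 <= x -> \sum_(i < m) x = m%:R%:E * x)%E.
  move=> x0; elim: m => [|m IH]; first by rewrite big_ord0 mul0e.
  by rewrite big_ord_recl IH -natr1 EFinD ge0_muleDl// ?lee_fin// mul1e addeC.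
transitivity (k.+1%:R%:E * \int[tpow mu k.+1]_t F1 t)%E.
  by apply: sumc; apply: integral_ge0 => t _; exact: F10.
congr (_ * _)%E.
apply: (etrans (tpowS_int mu mF1 F10)).
apply: eq_integral => x _; apply: eq_integral => t _.
by rewrite /F1 /= lexx.
Qed.

End max_decomposition.

(** * The chain of maxima for gap sums *)

Section lebesgue_scale.
Context {R : realType}.
Local Notation leb := (@lebesgue_measure R).
Local Open Scope ereal_scope.

Lemma lebesgue_scale (u : R) (phi : R -> \bar R) : (0 < u)%R ->
  measurable_fun setT phi -> (forall x, 0 <= phi x) ->
  \int[leb]_x phi x = u%:E * \int[leb]_x phi (u * x)%R.
Proof.
move=> u0 mphi phi0.
have mu_ : measurable_fun setT (fun x : measurableTypeR R => (u * x)%R : measurableTypeR R).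
  exact: measurable_funM.
pose S : {mfun measurableTypeR R >-> measurableTypeR R} :=
  HB.pack (fun x : measurableTypeR R => (u * x)%R : measurableTypeR R)
    (isMeasurableFun.Build _ _ _ _ _ mu_).
pose m0 : {measure set (measurableTypeR R) -> \bar R} := pushforward leb S.
pose m : {measure set (measurableTypeR R) -> \bar R} := m0 mu_.
pose m' : {measure set (measurableTypeR R) -> \bar R} := mscale (NngNum (ltW u0)) m.
have mE A : measurable A -> leb A = m' A.
  apply: lebesgue_measure_unique => _ [[x y] _ <-] /=.
  rewrite /m' /mscale /= /m /pushforward /=.
  have -> : (fun x0 : R => (u * x0)%R) @^-1` `]x, y] = `](x / u)%R, (y / u)%R]%classic.
    apply/seteqP; split => z /=; rewrite !in_itv /= ltr_pdivrMr// ler_pdivlMr//; by rewrite (mulrC z).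
  rewrite !lebesgue_measure_itv /= !lte_fin ltr_pM2r ?invr_gt0//.
  case: ifPn => _; rewrite ?mule0// -!EFinB -EFinM; congr EFin.
  by field; rewrite gt_eqF.
transitivity (\int[m']_x phi x).
  by apply: eq_measure_integral => A mA _; exact: mE.
rewrite /m' ge0_integral_mscale//=; congr (_ * _).
exact: (ge0_integral_pushforward mu_ leb measurableT mphi (fun x _ => phi0 x)).
Qed.

Lemma lebesgue_scale01 (u : R) (g : R -> \bar R) : (0 < u)%R -> (u <= 1)%R ->
  measurable_fun setT g -> (forall x, 0 <= g x) ->
  \int[leb]_(x in `[0%R, 1%R]) (g x * (x <= u)%R%:R%:E) =
  u%:E * \int[leb]_(w in `[0%R, 1%R]) g (u * w)%R.
Proof.
move=> u0 u1 mg g0; rewrite integral_mkcond [X in _ = _ * X]integral_mkcond.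
pose phi := fun x => g x * (0 <= x <= u)%R%:R%:E.
have mphi : measurable_fun setT phi.
  apply: emeasurable_funM => //; apply/measurable_EFinP; apply: measurable_bool.
  by apply: measurable_and; apply: measurable_fun_ler.
have phi0 x : 0 <= phi x by rewrite mule_ge0// lee_fin.
transitivity (\int[leb]_x phi x).
  apply: eq_integral => x _; rewrite patchE /phi.
  case: ifPn; rewrite ?inE/= ?notin_setE/= in_itv/=.
    by move=> /andP[-> _].
  move=> /negP; rewrite negb_and => /orP[/negbTE->|x1] /=; first by rewrite mule0.
  by rewrite (_ : (x <= u)%R = false) ?andbF ?mule0//; apply: contraNF x1 => xu; exact: le_trans u1.
rewrite (lebesgue_scale u0 mphi phi0); congr (_ * _); apply: eq_integral => x _.
rewrite patchE /phi pmulr_rge0// (ger_pMr _ u0).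
case: ifPn; rewrite ?inE/= ?notin_setE/= in_itv/=; first by move=> ->; rewrite mule1.
by move=> /negP/negbTE->; rewrite mule0.
Qed.
End lebesgue_scale.

Section measurable_inv.
Context {R : realType}.

Lemma measurable_invr : measurable_fun setT (fun x : R => x^-1).
Proof.
have -> : (fun x : R => x^-1) = fun x : R => if 0 <= x then x `^ (-1) else - ((- x) `^ (-1)).
  apply/funext => x; case: ifPn => x0; first by rewrite powR_inv1.
  by rewrite powR_inv1 ?invrN ?opprK// oppr_ge0 ltW// ltNge.
apply: measurable_fun_if => //; first exact: measurable_fun_ler.
  by apply: measurable_funTS; exact: measurable_powR.
apply: measurable_funTS.
have m1 : measurable_fun setT (fun x : R => (- x) `^ (-1)).
  exact: (measurableT_comp (measurable_powR (-1))).
exact: measurableT_comp.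
Qed.

End measurable_inv.

Section xlogx_bound.
Context {R : realType}.
Lemma norm_xlogx_sqr (x : R) : `|xlogx x| <= 2 + x ^+ 2.
Proof.
have [x0|x0] := leP x 0; first by rewrite xlogx_le0// normr0 addr_ge0// sqr_ge0.
have [x1|/ltW x1] := leP x 1.
  apply: (le_trans (norm_xlogx_sqrt (ltW x0) x1)).
  have : Num.sqrt x <= 1 by rewrite -sqrtr1 ler_wsqrtr.
  by have := sqr_ge0 x; lra.
rewrite /xlogx normrM (ger0_norm (ltW x0)) ger0_norm ?ln_ge0//.
have := ln_sublinear x0; nra.
Qed.
End xlogx_bound.

Section chain.
Context {R : realType} d (T : measurableType d) (P : probability T R) (mu : probability R R).
Local Notation leb := (@lebesgue_measure R).
Variables (U : nat -> T -> R).
Hypothesis HU : iid P mu U.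
Hypothesis mu1 : forall x, mu [set x] = 0%E.
Hypothesis muE : forall phi : R -> \bar R, measurable_fun setT phi -> (forall x, 0 <= phi x)%E ->
  (\int[mu]_x phi x = \int[leb]_(x in `[0%R, 1%R]) phi x)%E.
Variables (H : R -> R) (b : R) (Psi : R -> R).
Hypothesis mH : measurable_fun setT H.
Hypothesis Hb : forall x, 0 <= H x <= b.
Hypothesis mPsi : measurable_fun setT Psi.
Hypothesis Psi0 : forall y, 0 <= Psi y.
Hypothesis Psib : forall M, exists C, forall y, `|y| <= M -> Psi y <= C.

Definition gapx (x y : R) : R := xlogx (H y - H x).

Lemma measurable_gapx : measurable_fun [set: R * R] (fun z => gapx z.1 z.2).
Proof.
apply: (measurableT_comp measurable_xlogx); apply: measurable_funB.
  exact: (measurableT_comp mH).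
exact: (measurableT_comp mH).
Qed.

Let Mg : R := 2 + b ^+ 2.

Lemma gapx_bound x y : `|gapx x y| <= Mg.
Proof.
apply: (le_trans (norm_xlogx_sqr _)); rewrite lerD2l.
by have := Hb x; have := Hb y; move: (H x) (H y) => p q; nra.
Qed.

Lemma gapsum_bound u s : `|gapsum gapx u s| <= (size s).+1%:R * Mg.
Proof.
rewrite /gapsum -(size_sort <=%R s); move: (0 : R) (sort _ _) => p t.
elim: t p => [|x t IH] p /=; first by rewrite mul1r gapx_bound.
rewrite (le_trans (ler_normD _ _))// -natr1 mulrDl mul1r addrC.
by apply: lerD; [exact: IH|exact: gapx_bound].
Qed.

(** [l] is the part of the gap sum already collected above [u]. The indicator is that of an event of
    probability [u ^ k], the normalisation used in [chain_mean]. *)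
Definition chain_int (k : nat) (u l : R) : \bar R :=
  (\int[tpow mu k]_t (Psi (l + gapsum gapx u t) * (all (<= u) t)%:R)%:E)%E.

(* Conditional mean, given that all [k] points lie below [u]. *)
Definition chain_mean (k : nat) (u l : R) : R := fine (chain_int k u l) / u ^+ k.

Let G (l u : R) (s : seq R) : \bar R := (Psi (l + gapsum gapx u s) * (all (<= head 0 s) s)%:R)%:E.

Let mG k l u : mseq k.+1 (G l u).
Proof.
apply/measurable_EFinP; apply: measurable_funM; last exact: measurable_all_head.
apply: (measurableT_comp mPsi); apply: measurable_funD => //.
by apply: measurable_gapsum; exact: measurable_gapx.
Qed.

Let G0 l u s : (0 <= G l u s)%E. Proof. by rewrite lee_fin mulr_ge0. Qed.

Let GE l u x s : G l u (x :: s) =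
  (Psi (l + gapx x u + gapsum gapx x s) * (all (<= x) s)%:R)%:E.
Proof.
rewrite /G /= lexx /=; case: (boolP (all _ s)) => [sx|]; last by rewrite !mulr0.
by rewrite gapsum_cons_max// addrAC addrA.
Qed.

Lemma ak_cons k l u x : chain_int k x (l + gapx x u) = (\int[tpow mu k]_t G l u (x :: t))%E.
Proof. by apply: eq_integral => t _; rewrite GE. Qed.

Lemma measurable_ak k l u : measurable_fun setT (fun x => chain_int k x (l + gapx x u)).
Proof.
under eq_fun do rewrite ak_cons.
by apply: measurable_tpow_cons.
Qed.

Lemma ak_fin k u l : (0 <= chain_int k u l < +oo)%E.
Proof.
apply/andP; split; first by apply: integral_ge0 => t _; rewrite lee_fin mulr_ge0.
have [C hC] := Psib (`|l| + k.+1%:R * Mg).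
apply: (@le_lt_trans _ _ (\int[tpow mu k]_t (C%:E))%E).
  apply: ge0_le_integral => //.
  - by move=> t _; rewrite lee_fin mulr_ge0.
  - apply/measurable_EFinP; apply: measurable_funM; last exact: measurable_all.
    apply: (measurableT_comp mPsi); apply: measurable_funD => //.
    by apply: measurable_gapsum; exact: measurable_gapx.
  - move=> t _; rewrite lee_fin.
    have h : Psi (l + gapsum gapx u t) <= C.
      apply: hC; rewrite (le_trans (ler_normD _ _))// lerD2l.
      by have := gapsum_bound u t; rewrite size_tuple.
    case: (all _ t); rewrite ?mulr1// mulr0.
    exact: le_trans h.
have E : (\int[tpow mu k]_t C%:E = C%:E * tpow mu k setT)%E by exact: integral_cst.
by rewrite E probability_setT mule1 ltry.
Qed.

(** Once the maximum [x <= u] is known, the other points are constrained only to lie below [x], and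
    the gap from [x] to [u] moves into [l]. *)
Lemma ak_chain k u l : (chain_int k.+1 u l = k.+1%:R%:E *
  \int[mu]_x (chain_int k x (l + gapx x u) * (x <= u)%R%:R%:E))%E.
Proof.
pose F s : \bar R := (Psi (l + gapsum gapx u s) * (all (<= u) s)%:R)%:E.
have mF : mseq k.+1 F.
  apply/measurable_EFinP; apply: measurable_funM; last exact: measurable_all.
  apply: (measurableT_comp mPsi); apply: measurable_funD => //.
  by apply: measurable_gapsum; exact: measurable_gapx.
have F0 s : (0 <= F s)%E by rewrite lee_fin mulr_ge0.
have Fs s s' : perm_eq s s' -> F s = F s'.
  move=> ss'; rewrite /F /gapsum (perm_all _ ss').
  by have /perm_sortP -> := ss'; [|exact: le_total|exact: le_trans|exact: le_anti].
apply: (etrans (tpow_max HU mu1 mF F0 Fs)); congr (_ * _)%E.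
apply: eq_integral => x _.
rewrite ak_cons -ge0_integralZr//; last exact: mseq_cons.
apply: eq_integral => t _; rewrite GE /F -!EFinM; congr EFin.
case: (boolP (all (<= x) t)) => [tx|]; last by rewrite !mulr0 mul0r.
rewrite !mulr1 gapsum_cons_max//= addrAC addrA; congr (_ * _).
case: (boolP (x <= u)) => //= xu.
suff -> : all (<= u) t by [].
by apply/allP => y /(allP tx) /= yx; exact: le_trans xu.
Qed.

(** The substitution [x = u w] in [ak_chain] produces a factor [u]; with the normalisations
    [u ^ k.+1] and [(u w) ^ k] this leaves the density [k.+1 w ^ k]. *)
Lemma ah_rec k (u l : R) : 0 < u <= 1 ->
  measurable_fun setT (fun w : R => chain_mean k (u * w) (l + gapx (u * w) u)) /\
  chain_mean k.+1 u l = powE k.+1 (fun w : R => chain_mean k (u * w) (l + gapx (u * w) u)).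
Proof.
move=> /andP[u0 u1].
have mw : measurable_fun setT (fun w : R => u * w) by exact: measurable_funM.
have ma := measurable_ak k l u.
have m1 : measurable_fun setT (fun w : R => chain_int k (u * w) (l + gapx (u * w) u)).
  exact: (measurableT_comp ma mw).
split.
  apply: measurable_funM.
    by rewrite (_ : (fun _ => _) = fine \o (fun w : R => chain_int k (u * w) (l + gapx (u * w) u)))//; exact: measurableT_comp.
  by apply: (measurableT_comp measurable_invr); exact: measurable_funX.
have akf x := ak_fin k x (l + gapx x u).
have ak0 x : (0 <= chain_int k x (l + gapx x u))%E by have /andP[] := akf x.
rewrite /chain_mean ak_chain muE; last 2 first.
- apply: emeasurable_funM => //; apply/measurable_EFinP; apply: measurable_bool.
  exact: measurable_fun_ler.
- by move=> x; rewrite mule_ge0// lee_fin.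
rewrite (lebesgue_scale01 u0 u1 ma)//.
have -> : (\int[leb]_(w in `[0%R, 1%R]) chain_int k (u * w) (l + gapx (u * w) u) =
    \int[leb]_(w in `]0%R, 1%R[) chain_int k (u * w) (l + gapx (u * w) u))%E.
  by rewrite integral_itv_bndoo//; exact: measurable_funTS.
rewrite /powE /Rintegral.
have -> : (\int[leb]_(w in `]0%R, 1%R[) (k.+1%:R * w ^+ k.+1.-1 *
      (fine (chain_int k (u * w) (l + gapx (u * w) u)) / (u * w) ^+ k))%:E =
    (k.+1%:R / u ^+ k)%:E * \int[leb]_(w in `]0%R, 1%R[) chain_int k (u * w) (l + gapx (u * w) u))%E.
  rewrite -ge0_integralZl//; last 2 first.
  - exact: measurable_funTS.
  - by rewrite lee_fin divr_ge0// exprn_ge0// ltW.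
  apply: eq_integral => w; rewrite inE/= in_itv/= => /andP[w0 w1].
  rewrite -[in RHS](@fineK _ (chain_int k _ _)); last by rewrite ge0_fin_numE//; have /andP[] := akf (u * w).
  rewrite -EFinM; congr EFin => /=; rewrite exprMn.
  have uk : u ^+ k != 0 by rewrite expf_neq0// gt_eqF.
  have wk : w ^+ k != 0 by rewrite expf_neq0// gt_eqF.
  by field; rewrite uk wk.
have : (0 <= \int[leb]_(w in `]0%R, 1%R[) chain_int k (u * w) (l + gapx (u * w) u))%E.
  exact: integral_ge0.
have uk : 0 < u ^+ k by rewrite exprn_gt0.
case: (\int[leb]_(w in _) _)%E => [r||] //= r0.
  by rewrite exprS; field; rewrite !gt_eqF.
(* If the integral were infinite, [fine] would give 0 on both sides. *)
by rewrite !gt0_muley ?lte_fin ?divr_gt0 ?ltr0n//= !mul0r.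
Qed.
End chain.

(** * The end of the chain: two points left *)

Section base_case.
Context {R : realType}.

Lemma gsum_map (H : R -> R) p s u :
  gsum (gapx H) p s u = gsum (fun x y => xlogx (y - x)) (H p) (map H s) (H u).
Proof. by elim: s p => //= x s IH p; rewrite IH. Qed.

(** [xlogx x - x * ln S] is [S * xlogx (x / S)], and [|xlogx| <= 2] on [[0, 1]]. Over gaps of total
    length [S] the subtracted terms add up to [xlogx S]. *)
Lemma xlogx_scale (S x : R) : 0 < S -> 0 <= x -> x <= S -> `|xlogx x - x * ln S| <= 2 * S.
Proof.
move=> S0; rewrite le_eqVlt => /predU1P[<- _|x0 xS].
  by rewrite xlogx_le0// mul0r subrr normr0 mulr_ge0// ltW.
have z0 : 0 < x / S by rewrite divr_gt0.
have z1 : x / S <= 1 by rewrite ler_pdivrMr// mul1r.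
have -> : xlogx x - x * ln S = S * xlogx (x / S).
  by rewrite /xlogx ln_div ?posrE//; field; rewrite gt_eqF.
rewrite normrM (ger0_norm (ltW S0)) mulrC ler_pM2r//.
apply: (le_trans (norm_xlogx_sqrt (ltW z0) z1)).
rewrite -[leRHS]mulr1 ler_wpM2l//.
by have := ler_wsqrtr z1; rewrite sqrtr1.
Qed.

Lemma gsum_scale (S p q : R) s : 0 < S -> path <=%R p (rcons s q) -> q - p <= S ->
  `|gsum (fun x y => xlogx (y - x)) p s q - (q - p) * ln S| <= (size s).+1%:R * (2 * S).
Proof.
move=> S0; elim: s p => [|x s IH] p /=.
  by rewrite andbT mul1r => pq qp; apply: xlogx_scale; rewrite // subr_ge0.
move=> /andP[px pxs] qp.
have xq : x <= q.
  have /allP := order_path_min le_trans pxs.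
  by apply; rewrite mem_rcons inE eqxx.
have -> : xlogx (x - p) + gsum (fun x y => xlogx (y - x)) x s q - (q - p) * ln S =
  (xlogx (x - p) - (x - p) * ln S) + (gsum (fun x y => xlogx (y - x)) x s q - (q - x) * ln S) by ring.
apply: (le_trans (ler_normD _ _)); rewrite -[(size s).+2%:R]natr1 [leRHS]mulrDl [1 * _]mul1r [leRHS]addrC.
apply: lerD; last by apply: IH => //; lra.
by apply: xlogx_scale => //; lra.
Qed.

Lemma gapsum_scale (H : R -> R) (u : R) s : {homo H : x y / x <= y} -> H 0 = 0 ->
  (forall x, 0 <= H x) -> 0 < H u -> all (<= u) s ->
  `|gapsum (gapx H) u s - xlogx (H u)| <= (size s).+1%:R * (2 * H u).
Proof.
move=> Hh H0 Hp Hu su; rewrite /gapsum gsum_map H0.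
have := @gsum_scale (H u) 0 (H u) (map H (sort <=%R s)) Hu.
rewrite size_map size_sort subr0; apply => //.
have hs : sorted <=%R (sort <=%R s) by exact/sort_sorted/le_total.
have su' : all (<= u) (sort <=%R s) by rewrite all_sort.
case: (sort <=%R s) hs su' => [|x t] /=; first by rewrite Hp.
move=> xt /andP[xu tu]; rewrite Hp /=.
elim: t x xt xu tu => [|y t IH] x /=; first by rewrite andbT => _ /Hh.
by move=> /andP[xy yt] xu /andP[yu tu]; rewrite Hh//= IH.
Qed.

End base_case.

Lemma le_1DX4 (R : realDomainType) (s : R) : 0 <= s ->
  [/\ s <= 1 + s ^+ 4, s ^+ 2 <= 1 + s ^+ 4 & s ^+ 3 <= 1 + s ^+ 4].
Proof.
move=> s0; have s40 : 0 <= s ^+ 4 by rewrite exprn_ge0.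
have [s1|/ltW s1] := leP s 1.
  have p i : s ^+ i <= 1 + s ^+ 4 by rewrite (@le_trans _ _ 1)// ?exprn_ile1// lerDl.
  by split; [have := p 1%N; rewrite expr1|exact: p|exact: p].
have p i : (i <= 4)%N -> s ^+ i <= 1 + s ^+ 4.
  by move=> i4; rewrite (@le_trans _ _ (s ^+ 4))// ?ler_weXn2l// lerDr.
by split; [have := p 1%N isT; rewrite expr1|exact: p|exact: p].
Qed.

Section mass.
Context {R : realType} d (T : measurableType d) (P : probability T R) (mu : probability R R).
Local Notation leb := (@lebesgue_measure R).
Hypothesis muE : forall phi : R -> \bar R, measurable_fun setT phi -> (forall x, 0 <= phi x)%E ->
  (\int[mu]_x phi x = \int[leb]_(x in `[0%R, 1%R]) phi x)%E.
Variables (H : R -> R) (b : R) (Psi : R -> R).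
Hypothesis mH : measurable_fun setT H.
Hypothesis Hb : forall x, 0 <= H x <= b.
Hypothesis mPsi : measurable_fun setT Psi.
Hypothesis Psi0 : forall y, 0 <= Psi y.
Hypothesis Psib : forall M, exists C, forall y, `|y| <= M -> Psi y <= C.

Lemma uniform_ray (u : R) : 0 < u <= 1 -> mu `]-oo, u]%classic = u%:E.
Proof.
move=> /andP[u0 u1].
have -> : mu `]-oo, u]%classic = (\int[mu]_x ((1 * (x <= u)%R%:R%:E)))%E.
  transitivity (\int[mu]_x (\1_(`]-oo, u]%classic) x)%:E)%E; first by rewrite integral_indic// setIT.
  apply: eq_integral => x _.
  rewrite mul1e indicE; congr (_%:R%:E); congr nat_of_bool.
  by apply/idP/idP; rewrite inE/= in_itv.
rewrite muE; last 2 first.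
- apply: emeasurable_funM => //; apply/measurable_EFinP; apply: measurable_bool.
  exact: measurable_fun_ler.
- by move=> x; rewrite mul1e lee_fin.
rewrite (lebesgue_scale01 u0 u1 (g := fun=> 1%E))// integral_cst//= mul1e.
by rewrite lebesgue_measure_itv/= lte_fin ltr01 oppr0 adde0 mule1.
Qed.

Lemma tpow_mass k (u : R) : 0 < u <= 1 ->
  (\int[tpow mu k]_t (all (<= u) t)%:R%:E = (u ^+ k)%:E)%E.
Proof.
move=> u01.
have mi : measurable (`]-oo, u] : set R) by exact: measurable_itv.
have E : tpow mu k (@tbox R k (fun=> `]-oo, u]%classic)) = (u ^+ k)%:E.
  rewrite tpow_tbox// (eq_bigr (fun=> u%:E)); last by move=> i _; exact: uniform_ray.
  elim: k => [|k IH]; first by rewrite big_ord0.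
  by rewrite big_ord_recl IH -EFinM exprS.
rewrite -E.
transitivity (\int[tpow mu k]_t (\1_(@tbox R k (fun=> `]-oo, u]%classic)) t)%:E)%E; last first.
  by rewrite integral_indic ?setIT//; exact: measurable_tbox.
apply: eq_integral => t _; rewrite indicE; congr (_%:R%:E); congr nat_of_bool.
apply/allP/idP => [h|].
  by rewrite inE => i /=; rewrite in_itv/=; apply: h; exact: mem_tnth.
rewrite inE => h x /tnthP[i ->].
by have := h i; rewrite /= in_itv.
Qed.

(** An average over the samples below [u] lies between bounds of [Psi] on them; [tpow_mass] says
    that [u ^ k] is the mass of these samples. *)
Lemma ah_sandwich k (u l c1 c2 : R) : 0 < u <= 1 ->
  (forall t, size t = k -> all (<= u) t -> c1 <= Psi (l + gapsum (gapx H) u t) <= c2) ->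
  0 <= c2 -> c1 <= chain_mean mu H Psi k u l <= c2.
Proof.
move=> u01 hc c20; have uk : 0 < u ^+ k by rewrite exprn_gt0//; have /andP[] := u01.
have mF : measurable_fun setT (fun t : k.-tuple R => (Psi (l + gapsum (gapx H) u t) * (all (<= u) t)%:R)%:E).
  apply/measurable_EFinP; apply: measurable_funM; last exact: measurable_all.
  apply: (measurableT_comp mPsi); apply: measurable_funD => //.
  by apply: measurable_gapsum; exact: measurable_gapx.
have ma : measurable_fun setT (fun t : k.-tuple R => ((all (<= u) t)%:R%:E : \bar R)).
  by apply/measurable_EFinP; exact: measurable_all.
have /andP[ak0 akoo] := ak_fin mu mH Hb mPsi Psi0 Psib k u l.
have akE : chain_int mu H Psi k u l = (fine (chain_int mu H Psi k u l))%:E by rewrite fineK// ge0_fin_numE.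
have massZ c : 0 <= c -> (\int[tpow mu k]_t (c * (all (<= u) t)%:R)%:E = (c * u ^+ k)%:E)%E.
  move=> c0; rewrite EFinM -tpow_mass// -ge0_integralZl//.
rewrite /chain_mean ler_pdivlMr// ler_pdivrMr//.
rewrite -!lee_fin -akE; apply/andP; split.
  have [c10|c10] := leP 0 c1; last first.
    by apply: le_trans ak0; rewrite lee_fin nmulr_rle0// ltW.
  rewrite -massZ//; apply: ge0_le_integral => //.
  - by move=> t _; rewrite lee_fin mulr_ge0.
  - by apply/measurable_EFinP; apply: measurable_funM => //; exact: measurable_all.
  - move=> t _; rewrite lee_fin; case: (boolP (all _ _)) => [tu|]; last by rewrite !mulr0.
    by rewrite ler_wpM2r//; have /andP[] := hc t (size_tuple t) tu.
rewrite -massZ//; apply: ge0_le_integral => //.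
- by move=> t _; rewrite lee_fin mulr_ge0.
- by apply/measurable_EFinP; apply: measurable_funM => //; exact: measurable_all.
- move=> t _; rewrite lee_fin; case: (boolP (all _ _)) => [tu|]; last by rewrite !mulr0.
  by rewrite ler_wpM2r//; have /andP[] := hc t (size_tuple t) tu.
Qed.

End mass.

Section psi0.
Context {R : realType} (psi py pyy : R -> R -> R) (L : R).
Hypothesis TF : test_fun psi py pyy L.

Lemma measurable_psi0 (r c0 : R) : measurable_fun setT (fun z : R => psi 0 (r * (z - c0))).
Proof.
have m1 : measurable_fun setT (fun z : R => r * (z - c0)).
  by apply: measurable_funM => //; exact: measurable_funB.
exact: (measurableT_comp (tf_m TF) (measurable_fun_pair (measurable_cst (0 : R)) m1)).
Qed.

(** Local boundedness is all that the finiteness of [chain_int] asks of [Psi], because gap sums of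
    [k] points are bounded. *)
Lemma psi0_bounded (r c0 : R) : 0 <= r ->
  forall M, exists C, forall z, `|z| <= M -> psi 0 (r * (z - c0)) <= C.
Proof.
move=> r0 M; pose N := r * (M + `|c0|); have L0 := tf_K0 TF.
exists (psi 0 0 + (`|py 0 0| * N + `|pyy 0 0 / 2| * N ^+ 2 + L * N ^+ 3)) => z zM.
set q := r * (z - c0).
have qN : `|q| <= N.
  rewrite /q normrM (ger0_norm r0) ler_wpM2l//.
  by rewrite (le_trans (ler_normB _ _))// lerD2r.
have := tf_taylor TF 0 q (lexx 0) (lexx 0).
rewrite !subr0 normr0 mul0r expr0n/= !addr0 => hT.
have N0 : 0 <= N by rewrite (le_trans _ qN).
have h3 : `|q| ^+ 3 <= N ^+ 3 by rewrite lerXn2r.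
have h2 : q ^+ 2 <= N ^+ 2 by rewrite -(real_normK (num_real q)) lerXn2r.
have e1 := ler_norm (psi 0 q - psi 0 0 - py 0 0 * q - pyy 0 0 / 2 * q ^+ 2).
have e2 : py 0 0 * q <= `|py 0 0| * N.
  by rewrite (le_trans (ler_norm _))// normrM ler_wpM2l.
have e3 : pyy 0 0 / 2 * q ^+ 2 <= `|pyy 0 0 / 2| * N ^+ 2.
  rewrite (le_trans (ler_norm _))// normrM [`|q ^+ 2|]ger0_norm ?sqr_ge0//.
  by rewrite ler_wpM2l.
have e4 := ler_wpM2l L0 h3.
by lra.
Qed.

End psi0.

Section base_bound.
Context {R : realType} (mu : probability R R).
Local Notation leb := (@lebesgue_measure R).
Hypothesis muE : forall phi : R -> \bar R, measurable_fun setT phi -> (forall x, 0 <= phi x)%E ->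
  (\int[mu]_x phi x = \int[leb]_(x in `[0%R, 1%R]) phi x)%E.
Variables (h H A B : R -> R) (a b K : R).
Hypothesis LD : lip_density h H A B a b K.
Hypothesis Hb : forall x, 0 <= H x <= b.
Hypothesis Hh : {homo H : x y / x <= y}.
Variables (psi py pyy : R -> R -> R) (L : R).
Hypothesis TF : test_fun psi py pyy L.
Hypothesis psi0 : forall y, 0 <= psi 0 y.

(** [6 * b] stands for three gaps at a cost of [2 * H u] each in [gapsum_scale], and [harm 2 4] is
    the harmonic sum in the centring of two points. *)
Definition Dbase : R := 6 * b + b * (`|ln a| + `|ln b| + harm 2 4) + (2 + b ^+ 2) + K.
Let V : R := (pi ^+ 2 / 3 - 2) * b ^+ 2 / 2.
Definition Cbase : R := 3 * (L * (Dbase + (Dbase ^+ 2 + V) / 2 + Dbase ^+ 3 + V ^+ 2 + V * Dbase)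
   + (L * Dbase) ^+ 2).

Let a0 : 0 < a := ld_a0 LD.
Let K0 : 0 <= K := ld_K0 LD.
Let b0 : 0 < b.
Proof.
have /andP[h1 h2] := ld_h LD (u := 0) (introT andP (conj (lexx _) ler01)).
by rewrite (lt_le_trans a0)// (le_trans h1).
Qed.
Let harm4 : 0 <= (harm 2 4 : R). Proof. by rewrite /harm sumr_ge0. Qed.
Let v0 : 0 <= pi ^+ 2 / 3 - 2 :> R. Proof. by have := @pi2_gt9 R; lra. Qed.

Lemma Dbase_ge0 : 0 <= Dbase.
Proof.
rewrite /Dbase addr_ge0// addr_ge0//; last by rewrite addr_ge0 ?sqr_ge0.
by rewrite addr_ge0 ?mulr_ge0 ?(ltW b0)// !addr_ge0.
Qed.

Let V0 : 0 <= V.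
Proof. by apply: mulr_ge0 => //; apply: mulr_ge0 => //; exact: sqr_ge0. Qed.

Lemma Cbase_ge0 : 0 <= Cbase.
Proof.
have L0 := tf_K0 TF; have D0 := Dbase_ge0.
rewrite /Cbase; move: (V) V0 (Dbase) D0 => W W0 D D0.
rewrite mulr_ge0// addr_ge0 ?sqr_ge0// mulr_ge0//.
by rewrite !addr_ge0 ?mulr_ge0 ?addr_ge0 ?sqr_ge0 ?exprn_ge0.
Qed.

Lemma gapsum_base (u : R) s : 0 < u <= 1 -> size s = 2%N -> all (<= u) s ->
  `|gapsum (gapx H) u s - centering H B 2 u| <= Dbase * u.
Proof.
move=> /andP[u0 u1] s2 su; have u01 : 0 <= u <= 1 by rewrite ltW.
have /andP[Hl Hr] := Hbound LD u01.
have Hu : 0 < H u by rewrite (lt_le_trans _ Hl)// mulr_gt0.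
have g1 : `|gapsum (gapx H) u s - xlogx (H u)| <= 6 * b * u.
  have H0 x : 0 <= H x by have /andP[] := Hb x.
  have := gapsum_scale Hh (ld_H0 LD) H0 Hu su; rewrite s2 => /le_trans; apply.
  have -> : 3%:R * (2 * H u) = 6 * H u by ring.
  by rewrite -mulrA ler_wpM2l.
have g2 : `|B u| <= (2 + b ^+ 2 + K) * u.
  have := ld_dB LD (lexx 0) (ltW u0) u1; rewrite (ld_B0 LD) !subr0 => hB.
  have /andP[ha hb] := ld_h LD u01.
  have hx : `|xlogx (h u)| <= 2 + b ^+ 2.
    apply: (le_trans (norm_xlogx_sqr _)); rewrite lerD2l.
    by rewrite lerXn2r// nnegrE ?(ltW b0)// (le_trans (ltW a0)).
  have -> : B u = (B u - xlogx (h u) * u) + xlogx (h u) * u by ring.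
  apply: (le_trans (ler_normD _ _)); rewrite normrM (ger0_norm (ltW u0)).
  have h1 : K * u ^+ 2 <= K * u by rewrite ler_wpM2l// expr2 ger_pMr.
  have := ler_wpM2r (ltW u0) hx; lra.
have lnH : `|ln (H u / u)| <= `|ln a| + `|ln b|.
  have q1 : a <= H u / u by rewrite ler_pdivlMr.
  have q2 : H u / u <= b by rewrite ler_pdivrMr.
  have q0 : 0 < H u / u by rewrite divr_gt0.
  have l1 : ln a <= ln (H u / u) by rewrite ler_ln ?posrE.
  have l2 : ln (H u / u) <= ln b by rewrite ler_ln ?posrE.
  have := ler_norm (ln b); have := ler_norm (- ln a); rewrite normrN.
  have := normr_ge0 (ln b); have := normr_ge0 (ln a).
  by move=> *; rewrite ler_norml; apply/andP; split; lra.
have -> : gapsum (gapx H) u s - centering H B 2 u = (gapsum (gapx H) u s - xlogx (H u)) - B u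
   + H u * (ln (H u / u) + harm 2 4).
  by rewrite /centering /xlogx ln_div ?posrE//; ring.
apply: (le_trans (ler_normD _ _)); apply: (le_trans (lerD (ler_normB _ _) (lexx _))).
have g3 : `|H u * (ln (H u / u) + harm 2 4)| <= b * u * (`|ln a| + `|ln b| + harm 2 4).
  rewrite normrM (ger0_norm (ltW Hu)); apply: ler_pM => //; first exact: ltW.
  by rewrite (le_trans (ler_normD _ _))// lerD// ger0_norm.
by apply: (le_trans (lerD (lerD g1 g2) g3)); rewrite /Dbase; lra.
Qed.

Lemma ah_base (n : nat) (c0 u l y : R) : (1 <= n)%N -> 0 < u <= 1 ->
  let r := Num.sqrt n%:R in
  y = r * (l + centering H B 2 u - c0) ->
  `|chain_mean mu H (fun z => psi 0 (r * (z - c0))) 2 u l - psi (r ^+ 2 * rest_var H A u / 2) y|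
   <= r^-1 * y ^+ 2 + Cbase / r * (1 + quartic_mart n 2 u).
Proof.
move=> n1 u01 r yE; have /andP[u0 u1] := u01.
have u201 : 0 <= u <= 1 by rewrite ltW.
have rn : r ^+ 2 = n%:R by rewrite sqr_sqrtr.
have r1 : 1 <= r by rewrite -(@sqrtr1 R) ler_wsqrtr// ler1n.
have r0 : 0 < r by rewrite (lt_le_trans ltr01).
have L0 := tf_K0 TF; have D0 := Dbase_ge0.
set tau := r ^+ 2 * rest_var H A u / 2.
have q0 : 0 <= rest_var H A u by apply: (varQ_ge0 LD).
have tau0 : 0 <= tau by rewrite /tau divr_ge0// mulr_ge0// sqr_ge0.
set e := r^-1 * y ^+ 2 + Cbase / r * (1 + quartic_mart n 2 u).
have e0 : 0 <= e.
  apply: addr_ge0; first by apply: mulr_ge0; [rewrite invr_ge0 ltW|exact: sqr_ge0].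
  apply: mulr_ge0; first by apply: divr_ge0; [exact: Cbase_ge0|exact: ltW].
  by rewrite addr_ge0// Mk_ge0.
have tauV : tau <= V * (r * u) ^+ 2.
  have /andP[A0 Au] := Abound LD u201.
  have : rest_var H A u <= (pi ^+ 2 / 3 - 2) * (b ^+ 2 * u ^+ 2).
    rewrite /rest_var lerBlDr ler_wpDr ?sqr_ge0// ler_wpM2l//.
    by have := ler_wpM2l (ltW u0) Au; congr (_ <= _); ring.
  rewrite /tau /V; move: (rest_var H A u) => q hq.
  have -> : (pi ^+ 2 / 3 - 2) * b ^+ 2 / 2 * (r * u) ^+ 2 = r ^+ 2 * ((pi ^+ 2 / 3 - 2) * (b ^+ 2 * u ^+ 2)) / 2.
    by field.
  by rewrite ler_pM2r ?invr_gt0//; apply: ler_wpM2l => //; exact: sqr_ge0.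
have key t : size t = 2%N -> all (<= u) t ->
    `|psi 0 (r * (l + gapsum (gapx H) u t - c0)) - psi tau y| <= e.
  move=> t2 tu; have hg := gapsum_base u01 t2 tu.
  set y1 := r * _.
  pose dl := y1 - y.
  have dlE : dl = r * (gapsum (gapx H) u t - centering H B 2 u) by rewrite /dl /y1 yE; ring.
  have hd : `|dl| <= Dbase * (r * u).
    rewrite dlE normrM (ger0_norm (ltW r0)).
    by have := ler_wpM2l (ltW r0) hg; congr (_ <= _); ring.
  have := tf_taylor TF y y1 tau0 (lexx 0).
  rewrite -/dl sub0r sqrrN normrN (ger0_norm tau0) => hT.
  have hy := tf_y TF y tau0; have hyy := tf_yy TF y tau0.
  have h1 : `|py tau y * dl| <= L * (1 + `|y|) * `|dl|.
    by rewrite normrM ler_wpM2r.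
  have h2 : `|pyy tau y / 2 * (dl ^+ 2 - tau)| <= L / 2 * (dl ^+ 2 + tau).
    rewrite normrM normrM [`|2^-1|]ger0_norm//; apply: ler_pM => //.
      by rewrite ler_pM2r.
    rewrite (le_trans (ler_normB _ _))// (ger0_norm tau0) ger0_norm ?sqr_ge0//.
  have hsum : `|psi 0 y1 - psi tau y| <= L * (`|dl| ^+ 3 + tau ^+ 2 + tau * `|dl|)
      + L * (1 + `|y|) * `|dl| + L / 2 * (dl ^+ 2 + tau).
    have -> : psi 0 y1 - psi tau y = (psi 0 y1 - psi tau y - py tau y * dl - pyy tau y / 2 * (dl ^+ 2 - tau))
      + py tau y * dl + pyy tau y / 2 * (dl ^+ 2 - tau) by ring.
    apply: (le_trans (ler_normD _ _)); apply: lerD => //.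
    by apply: (le_trans (ler_normD _ _)); apply: lerD.
  apply: (le_trans hsum).
  (* [120 / (3 * 4 * 5 * 6) = 1 / 3], the origin of the factor 3 in [Cbase]. *)
  have MkE : quartic_mart n 2 u = (r ^+ 2 * u) ^+ 4 / 3 by rewrite /quartic_mart rn; field.
  rewrite /e MkE -[dl ^+ 2](real_normK (num_real _)) -[y ^+ 2](real_normK (num_real _)).
  set s := r ^+ 2 * u; have ru : r * u = s / r by rewrite /s; field; rewrite gt_eqF.
  rewrite ru in hd tauV.
  have s0 : 0 <= s by rewrite /s mulr_ge0 ?sqr_ge0// ltW.
  have ir0 : 0 < r^-1 by rewrite invr_gt0.
  have ir1 : r^-1 <= 1 by rewrite invf_le1.
  rewrite /Cbase.
  move: (normr_ge0 dl) (normr_ge0 y) hd tauV ir0 ir1 s0 D0 L0 V0 tau0.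
  move: (r^-1) (`|dl|) (`|y|) (tau) (s) (Dbase) (L) (V) => i D Y tt s' Db LL VV.
  move=> {}D0 Y0 {}hd ht i0 i1 {}s0 Db0 LL0 VV0 tt0.
  have s4 : 0 <= 1 + s' ^+ 4 by rewrite addr_ge0// exprn_ge0.
  have [hs1 hs2 hs3] := le_1DX4 s0.
  have i2 : i ^+ 2 <= i by rewrite -[leRHS]expr1 ler_wiXn2l// ltW.
  have i3 : i ^+ 3 <= i by rewrite -[leRHS]expr1 ler_wiXn2l// ltW.
  have i4 : i ^+ 4 <= i by rewrite -[leRHS]expr1 ler_wiXn2l// ltW.
  set S := (1 + s' ^+ 4) in s4 hs1 hs2 hs3 *.
  have s40 : 0 <= s' ^+ 4 by rewrite exprn_ge0.
  have s4S : s' ^+ 4 <= S by rewrite /S; lra.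
  have q1 : D <= Db * (i * S).
    by apply: (le_trans hd); rewrite ler_wpM2l// mulrC ler_wpM2l// ltW.
  have q2 : D ^+ 2 <= Db ^+ 2 * (i * S).
    apply: (@le_trans _ _ ((Db * (s' * i)) ^+ 2)); first by rewrite lerXn2r ?nnegrE// mulr_ge0// mulr_ge0// ltW.
    have -> : (Db * (s' * i)) ^+ 2 = Db ^+ 2 * (i ^+ 2 * s' ^+ 2) by ring.
    by rewrite ler_wpM2l ?sqr_ge0// ler_pM ?sqr_ge0.
  have q3 : D ^+ 3 <= Db ^+ 3 * (i * S).
    apply: (@le_trans _ _ ((Db * (s' * i)) ^+ 3)); first by rewrite lerXn2r ?nnegrE// mulr_ge0// mulr_ge0// ltW.
    have -> : (Db * (s' * i)) ^+ 3 = Db ^+ 3 * (i ^+ 3 * s' ^+ 3) by ring.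
    by rewrite ler_wpM2l ?exprn_ge0// ler_pM ?exprn_ge0 ?(ltW i0).
  have t1 : tt <= VV * (i * S).
    apply: (le_trans ht); rewrite ler_wpM2l//.
    have -> : (s' * i) ^+ 2 = i ^+ 2 * s' ^+ 2 by ring.
    by rewrite ler_pM ?sqr_ge0.
  have t2' : tt ^+ 2 <= VV ^+ 2 * (i * S).
    apply: (@le_trans _ _ ((VV * (s' * i) ^+ 2) ^+ 2)); first by rewrite lerXn2r ?nnegrE// mulr_ge0// sqr_ge0.
    have -> : (VV * (s' * i) ^+ 2) ^+ 2 = VV ^+ 2 * (i ^+ 4 * s' ^+ 4) by ring.
    by rewrite ler_wpM2l ?sqr_ge0// ler_pM ?exprn_ge0 ?(ltW i0).
  have td : tt * D <= VV * Db * (i * S).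
    apply: (@le_trans _ _ ((VV * (s' * i) ^+ 2) * (Db * (s' * i)))); first exact: ler_pM.
    have -> : (VV * (s' * i) ^+ 2) * (Db * (s' * i)) = VV * Db * (i ^+ 3 * s' ^+ 3) by ring.
    by rewrite ler_wpM2l ?mulr_ge0// ler_pM ?exprn_ge0 ?(ltW i0).
  have yd : LL * Y * D <= i * Y ^+ 2 + (LL * Db) ^+ 2 * (i * S).
    have z1 : LL * Y * D <= LL * Y * (Db * (s' * i)) by rewrite ler_wpM2l// mulr_ge0.
    apply: (le_trans z1).
    have z2 := sqr_ge0 (Y - LL * Db * s'); have z3 := sqr_ge0 Y; have z4 := sqr_ge0 (LL * Db * s').
    have z5 : LL * Y * (Db * s') <= Y ^+ 2 + (LL * Db) ^+ 2 * s' ^+ 2 by nra.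
    have z6 := ler_wpM2l (ltW i0) z5.
    have z7 : (LL * Db) ^+ 2 * (i * s' ^+ 2) <= (LL * Db) ^+ 2 * (i * S).
      by rewrite ler_wpM2l ?sqr_ge0// ler_wpM2l// ltW.
    by lra.
  have iS0 : 0 <= i * S by rewrite mulr_ge0// ltW.
  have iS3 : i * S <= 3 * (i * (1 + s' ^+ 4 / 3)) by rewrite /S; nra.
  move: q1 q2 q3 t1 t2' td yd.
  have -> : 3 * (LL * (Db + (Db ^+ 2 + VV) / 2 + Db ^+ 3 + VV ^+ 2 + VV * Db) + (LL * Db) ^+ 2) * i * (1 + s' ^+ 4 / 3)
    = (LL * (Db + (Db ^+ 2 + VV) / 2 + Db ^+ 3 + VV ^+ 2 + VV * Db) + (LL * Db) ^+ 2) * (3 * (i * (1 + s' ^+ 4 / 3))) by ring.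
  move=> q1 q2 q3 t1 t2' td yd.
  have p0 : 0 <= LL * (Db + (Db ^+ 2 + VV) / 2 + Db ^+ 3 + VV ^+ 2 + VV * Db) + (LL * Db) ^+ 2.
    rewrite addr_ge0 ?sqr_ge0// mulr_ge0//.
    by rewrite !addr_ge0 ?mulr_ge0 ?addr_ge0 ?sqr_ge0 ?exprn_ge0.
  have p1 := ler_wpM2l p0 iS3.
  apply: (le_trans _ (lerD (lexx (i * Y ^+ 2)) p1)).
  have w1 := ler_wpM2l LL0 q1; have w2 := ler_wpM2l LL0 q2; have w3 := ler_wpM2l LL0 q3.
  have w4 := ler_wpM2l LL0 t1; have w5 := ler_wpM2l LL0 t2'; have w6 := ler_wpM2l LL0 td.
  by lra.
have mPsi := measurable_psi0 TF r c0.
have Psib := psi0_bounded TF c0 (ltW r0).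
have mid t : size t = 2%N -> all (<= u) t ->
    psi tau y - e <= psi 0 (r * (l + gapsum (gapx H) u t - c0)) <= psi tau y + e.
  move=> t2 tu; have := key t t2 tu; rewrite ler_norml => /andP[h1 h2].
  by apply/andP; split; lra.
have mH : measurable_fun setT H := ld_mH LD.
rewrite ler_norml; suff : psi tau y - e <= chain_mean mu H (fun z => psi 0 (r * (z - c0))) 2 u l <= psi tau y + e.
  by move=> /andP[h1 h2]; apply/andP; split; lra.
apply: (ah_sandwich muE mH Hb mPsi (fun z => psi0 _) Psib u01 mid).
have [t0 t02 t0u] : exists2 t, size t = 2%N & all (<= u) t by exists [:: u; u]; rewrite //= lexx.
have /andP[_] := mid _ t02 t0u; apply: le_trans; exact: psi0.
Qed.
End base_bound.

Section cvg_rates.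
Context {R : realType}.

Lemma cvg_invsqrt : (Num.sqrt (n%:R : R))^-1 @[n --> \oo] --> (0 : R).
Proof.
have -> : (fun n => (Num.sqrt (n%:R : R))^-1) = fun n => Num.sqrt (n%:R^-1 : R).
  by apply/funext => n; rewrite sqrtrV.
rewrite -[X in _ --> X](@sqrtr0 R).
apply: (continuous_cvg _ (@sqrt_continuous R 0)).
apply/cvgr0Pnorm_lt => e e0; near=> n.
rewrite normfV ger0_norm// invf_plt ?posrE//; last by rewrite ltr0n; near: n; exists 1%N.
by near: n; exact: nbhs_infty_gtr.
Unshelve. all: by end_near. Qed.

(** Cesaro's theorem for [moment_err]; the factor 2 compares the denominators [n] and [n.+1]. *)
Lemma cvg_mean_om : n%:R^-1 * (\sum_(3 <= j < n.+1) moment_err j) @[n --> \oo] --> (0 : R).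
Proof.
have h := cesaro (@cvg_om R).
have h2 : 2 * arithmetic_mean (moment_err : nat -> R) n @[n --> \oo] --> (0 : R).
  by rewrite -[X in _ --> X](mulr0 2); apply: cvgM; [exact: cvg_cst|exact: h].
apply: (@squeeze_cvgr _ _ _ _ (fun=> 0) (fun n => 2 * arithmetic_mean (moment_err : nat -> R) n)) => //; last exact: cvg_cst.
near=> n.
have n2 : (2 < n)%N by near: n; exists 3%N.
have n0 : (0 : R) < n%:R by rewrite ltr0n (leq_trans _ n2).
apply/andP; split.
  by rewrite mulr_ge0 ?invr_ge0// sumr_ge0// => j _; exact: om_ge0.
rewrite /arithmetic_mean /= seriesEnat /= mulrA.
apply: ler_pM; rewrite ?invr_ge0//.
- by rewrite sumr_ge0// => j _; exact: om_ge0.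
- by rewrite ler_pdivlMr// mulrC ler_pdivrMr// -natr1; have : (1 : R) <= n%:R; [rewrite ler1n (leq_trans _ n2)|lra].
- rewrite [leRHS](@big_cat_nat _ _ _ 3)//=; last exact: (leq_trans n2).
  by rewrite lerDr sumr_ge0// => j _; exact: om_ge0.
Unshelve. all: by end_near. Qed.
End cvg_rates.

(** * Limits of test functions for Lipschitz densities *)

Section lip_clt.
Context {R : realType} d (T : measurableType d) (P : probability T R) (mu : probability R R).
Local Notation leb := (@lebesgue_measure R).
Variables (U : nat -> T -> R).
Hypothesis HU : iid P mu U.
Hypothesis muE : forall phi : R -> \bar R, measurable_fun setT phi -> (forall x, 0 <= phi x)%E ->
  (\int[mu]_x phi x = \int[leb]_(x in `[0%R, 1%R]) phi x)%E.
Hypothesis U1 : forall i w, U i w <= 1.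
Variables (h H A B : R -> R) (a b K : R).
Hypothesis LD : lip_density h H A B a b K.
Hypothesis Hb : forall x, 0 <= H x <= b.
Hypothesis Hh : {homo H : x y / x <= y}.

Lemma uniform_atomless x : mu [set x] = 0%E.
Proof.
transitivity (\int[mu]_y (\1_[set x] y)%:E)%E; first by rewrite integral_indic// setIT.
rewrite muE//; last first.
  by apply/measurable_EFinP; exact: measurable_indic.
rewrite integral_indic//; apply/eqP; rewrite eq_le measure_ge0 andbT.
have <- : leb [set x] = 0%E by rewrite lebesgue_measure_set1.
by apply: le_measure; rewrite ?inE//; exact: measurableI.
Qed.

Variables (psi py pyy : R -> R -> R) (L : R).
Hypothesis TF : test_fun psi py pyy L.
Hypothesis psi0 : forall y, 0 <= psi 0 y.

Lemma sampleE n c0 r : chain_mean mu H (fun z => psi 0 (r * (z - c0))) n 1 0 =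
  fine (\int[P]_w (psi 0 (r * (gapsum (gapx H) 1 (sample U (iota 0 n) w) - c0)))%:E).
Proof.
rewrite /chain_mean expr1n divr1; congr fine; rewrite /chain_int.
pose F s : \bar R := (psi 0 (r * (gapsum (gapx H) 1 s - c0)) * (all (<= 1) s)%:R)%:E.
have mF m : mseq m F.
  apply/measurable_EFinP; apply: measurable_funM; last exact: measurable_all.
  apply: (measurableT_comp (measurable_psi0 TF r c0)).
  by apply: measurable_gapsum; apply: measurable_gapx; exact: ld_mH LD.
have F0 s : (0 <= F s)%E by rewrite lee_fin mulr_ge0.
under eq_integral do rewrite add0r.
have := iid_int HU (iota_uniq 0 n) (mF _) F0.
rewrite size_iota => <-; apply: eq_integral => w _; rewrite /F.
have -> : all (<= 1) (sample U (iota 0 n) w) by apply/allP => _ /mapP[i _ ->] /=; exact: U1.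
by rewrite mulr1.
Qed.

Lemma lip_clt_bound n : (2 <= n)%N ->
  `|fine (\int[P]_w (psi 0 (Num.sqrt n%:R *
       (gapsum (gapx H) 1 (sample U (iota 0 n) w) - centering H B n 1)))%:E) - psi (rest_var H A 1) 0|
  <= 121 * (Cbase a b K L / Num.sqrt n%:R +
      (Cstep a b K L + Csq a b K) *
         ((Num.sqrt n%:R)^-1 + n%:R^-1 * \sum_(3 <= j < n.+1) moment_err j)).
Proof.
move=> n2; rewrite -sampleE.
have n1 : (1 <= n)%N := ltnW n2.
have r0 : 0 <= Num.sqrt (n%:R : R) by exact: sqrtr_ge0.
have CS0 : 0 <= Cbase a b K L / Num.sqrt n%:R by rewrite divr_ge0// (Cbase_ge0 LD TF).
apply: (lindeberg_end LD TF n1 CS0 _ _ n2 erefl).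
- case=> // k u l /andP[k3 kn] u01.
  exact: (ah_rec HU uniform_atomless muE (ld_mH LD) Hb (measurable_psi0 TF _ _) (fun z => psi0 _) (psi0_bounded TF _ r0) k l u01).
- move=> u l y u01 yE.
  exact: (ah_base muE LD Hb Hh TF psi0 n1 u01 yE).
Qed.

(** The limit is where the heat flow carries [psi 0] in time [rest_var 1], that is, a Gaussian mean
    with this variance. *)
Lemma lip_clt : fine (\int[P]_w (psi 0 (Num.sqrt n%:R *
       (gapsum (gapx H) 1 (sample U (iota 0 n) w) - centering H B n 1)))%:E) @[n --> \oo]
  --> psi (rest_var H A 1) 0.
Proof.
set e := fun n => fine _.
pose D n : R := 121 * (Cbase a b K L / Num.sqrt n%:R +
      (Cstep a b K L + Csq a b K) *
         ((Num.sqrt n%:R)^-1 + n%:R^-1 * \sum_(3 <= j < n.+1) moment_err j)).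
have D0 : D n @[n --> \oo] --> 0.
  have -> : 0 = 121 * (Cbase a b K L * 0 + (Cstep a b K L + Csq a b K) * (0 + 0)) :> R by ring.
  apply: cvgM; first exact: cvg_cst.
  apply: cvgD; first by apply: cvgM; [exact: cvg_cst|exact: cvg_invsqrt].
  apply: cvgM; first exact: cvg_cst.
  by apply: cvgD; [exact: cvg_invsqrt|exact: cvg_mean_om].
have h0 : (fun n => psi (rest_var H A 1) 0 + (e n - psi (rest_var H A 1) 0)) n @[n --> \oo] --> psi (rest_var H A 1) 0 + 0.
  apply: cvgD; first exact: cvg_cst.
  apply/norm_cvg0P.
  apply: (@squeeze_cvgr _ _ _ _ (fun=> 0) D) => //; last exact: cvg_cst.
  by near=> n; rewrite normr_ge0/=; apply: lip_clt_bound; near: n; exists 2%N.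
rewrite addr0 in h0.
have -> : e = fun n => psi (rest_var H A 1) 0 + (e n - psi (rest_var H A 1) 0) by apply/funext => n; ring.
exact: h0.
Unshelve. all: by end_near. Qed.
End lip_clt.

(** * The heat semigroup *)

Section taylor.
Context {R : realType}.
Implicit Types (f df : R -> R) (x y c : R).

Lemma MVT_le f df x y : x <= y ->
  (forall c, x <= c <= y -> is_derive c 1 f (df c)) ->
  exists2 c, x <= c <= y & f y - f x = df c * (y - x).
Proof.
move=> xy fd.
have [c cxy fE] : exists2 c, c \in `[x, y]%R & f y - f x = df c * (y - x).
  apply: (@MVT_segment _ f df x y xy).
    by move=> c; rewrite in_itv/= => /andP[xc cy]; apply: fd; rewrite !ltW.
  apply/continuous_in_subspaceT => c; rewrite inE/= in_itv/= => cxy.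
  by apply: differentiable_continuous; apply/derivable1_diffP; have [] := fd c cxy.
by exists c => //; move: cxy; rewrite in_itv.
Qed.

(** [D] is an arbitrary interval: the whole line for the space variable, the half-line of
    nonnegative times for the other, where alone derivatives are available. *)
Lemma MVT_bound (D : R -> Prop) f df x y M :
  (forall p q c, D p -> D q -> p <= c <= q -> D c) -> D x -> D y ->
  (forall c, D c -> is_derive c 1 f (df c)) ->
  (forall c, D c -> `|c - x| <= `|y - x| -> `|df c| <= M) ->
  `|f y - f x| <= M * `|y - x|.
Proof.
move=> Dc Dx Dy fd dM.
have [xy|/ltW yx] := leP x y.
  have [c cxy ->] := MVT_le xy (fun c cxy => fd c (Dc _ _ _ Dx Dy cxy)).
  rewrite normrM ler_wpM2r// dM//; first exact: Dc cxy.
  by have /andP[? ?] := cxy; rewrite !ger0_norm ?subr_ge0// lerD2r.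
have [c cxy fE] := MVT_le yx (fun c cxy => fd c (Dc _ _ _ Dy Dx cxy)).
rewrite distrC fE normrM distrC ler_wpM2r// dM//; first exact: Dc cxy.
by have /andP[? ?] := cxy; rewrite !ler0_norm ?subr_le0// lerN2 lerD2r.
Qed.

Section orders.
Variable D : R -> Prop.
Hypothesis Dc : forall p q c, D p -> D q -> p <= c <= q -> D c.

Lemma taylor2 f f1 x y M : D x -> D y ->
  (forall c, D c -> is_derive c 1 f (f1 c)) ->
  (forall c, D c -> `|f1 c - f1 x| <= M * `|c - x|) ->
  `|f y - f x - f1 x * (y - x)| <= M * `|y - x| ^+ 2.
Proof.
move=> Dx Dy fd fM.
pose F z := f z - f1 x * (z - x).
have dF c : D c -> is_derive c 1 F (f1 c - f1 x).
  move=> cD; have fc := fd c cD.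
  apply: is_derive_eq; by rewrite /GRing.scale/= subr0 mulr1.
have -> : f y - f x - f1 x * (y - x) = F y - F x by rewrite /F; ring.
rewrite expr2 mulrA; apply: (MVT_bound Dc Dx Dy dF) => c cD cxy.
apply: (le_trans (fM c cD)).
have [M0|M0] := leP 0 M; first by rewrite ler_wpM2l.
have := fM y Dy; have := normr_ge0 (f1 y - f1 x).
move: cxy (normr_ge0 (y - x)) (normr_ge0 (c - x)).
move: `|y - x| `|c - x| `|_| => p q r qp p0 q0 r0 h.
have : M * p <= 0 by nra.
nra.
Qed.

Lemma taylor3 f f1 f2 x y M : 0 <= M -> D x -> D y ->
  (forall c, D c -> is_derive c 1 f (f1 c)) ->
  (forall c, D c -> is_derive c 1 f1 (f2 c)) ->
  (forall c, D c -> `|f2 c - f2 x| <= M * `|c - x|) ->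
  `|f y - f x - f1 x * (y - x) - f2 x / 2 * (y - x) ^+ 2| <= M * `|y - x| ^+ 3.
Proof.
move=> M0 Dx Dy fd f1d fM.
pose F z := f z - f1 x * (z - x) - f2 x / 2 * (z - x) ^+ 2.
have dF c : D c -> is_derive c 1 F (f1 c - f1 x - f2 x * (c - x)).
  move=> cD; have fc := fd c cD.
  have d2 : is_derive c 1 (fun z : R => (z - x) ^+ 2) (2%:R * (c - x) ^+ 1 * 1).
    by apply: is_derive_pow; apply: is_derive_eq; rewrite subr0.
  apply: is_derive_eq; by rewrite /GRing.scale/=; field.
have -> : f y - f x - f1 x * (y - x) - f2 x / 2 * (y - x) ^+ 2 = F y - F x by rewrite /F; ring.
rewrite exprSr mulrA; apply: (MVT_bound Dc Dx Dy dF) => c cD cxy.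
apply: (le_trans (taylor2 Dx cD f1d fM)).
by rewrite ler_wpM2l// lerXn2r// nnegrE.
Qed.
End orders.
End taylor.

Section is_derive_ops.
Context {R : realType}.
Implicit Types (f g : R -> R) (x : R).

Lemma is_derive_conv f x d d' : is_derive x 1 f d -> d = d' -> is_derive x 1 f d'.
Proof. by move=> fd <-. Qed.

Lemma is_derive_addc c x : is_derive x 1 (fun u : R => c + u) 1.
Proof.
apply: (is_derive_conv (is_deriveD (is_derive_cst c x 1) (is_derive_id x (1 : R)))).
by rewrite add0r.
Qed.

Lemma is_derive_mul f g x df dg : is_derive x 1 f df -> is_derive x 1 g dg ->
  is_derive x 1 (fun u => f u * g u) (df * g x + f x * dg).
Proof.
move=> fd gd; apply: (is_derive_conv (is_deriveM fd gd)).
by rewrite /GRing.scale/= addrC (mulrC (g x)).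
Qed.

Lemma is_derive_comp f g x df dg : is_derive (g x) 1 f df -> is_derive x 1 g dg ->
  is_derive x 1 (fun u => f (g u)) (df * dg).
Proof. by move=> fd gd; exact: is_derive1_comp. Qed.

Lemma is_derive_inv f x df : f x != 0 -> is_derive x 1 f df ->
  is_derive x 1 (fun u => (f u)^-1) (- df / f x ^+ 2).
Proof.
move=> f0 fd; apply: (is_derive_conv (is_deriveV f0 fd)).
by rewrite /GRing.scale/= mulNr mulrC -mulNr.
Qed.

Lemma is_derive_neg f x df : is_derive x 1 f df -> is_derive x 1 (fun u => - f u) (- df).
Proof. by move=> fd; exact: is_deriveN. Qed.

End is_derive_ops.

Section gauss.
Context {R : realType}.
Implicit Types x y z t : R.

Definition stdnormal z : R := normal_peak 1 * expR (- (z ^+ 2 / 2)).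
Definition Phi z : R := fine (normal_prob (0 : R) 1 `]-oo, z]).

Lemma stdnormalE : @normal_pdf R 0 1 = stdnormal.
Proof.
apply/funext => z; rewrite normal_pdfE ?oner_eq0// /stdnormal /normal_fun subr0 expr1n.
by rewrite mulNr.
Qed.

Lemma stdnormal_ge0 z : 0 <= stdnormal z.
Proof. by rewrite /stdnormal mulr_ge0 ?normal_peak_ge0 ?expR_ge0. Qed.

Lemma is_derive_Phi z : is_derive z 1 Phi (stdnormal z).
Proof.
have i1 : (@lebesgue_measure R).-integrable `]-oo, (z + 1)] (EFin \o normal_pdf 0 1).
  by apply: (integrableS _ _ (subsetT _)) => //; exact: integrable_normal_pdf.
have z1 : z < z + 1 by rewrite ltrDl.
have c1 : {for z, continuous (@normal_pdf R 0 1)} by apply: continuous_normal_pdf; exact: oner_neq0.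
have [dF FE] := @continuous_FTC1 R (normal_pdf 0 1) -oo%O z (z + 1) z1 i1 (ltNyr _) c1.
by apply: DeriveDef => //; rewrite -derive1E FE stdnormalE.
Qed.

Lemma Phi_ge0 z : 0 <= Phi z. Proof. by rewrite fine_ge0. Qed.

Lemma Phi_le1 z : Phi z <= 1.
Proof.
have := probability_le1 (normal_prob (0 : R) 1) (measurable_itv `]-oo, z]).
by rewrite /Phi -lee_fin fineK// fin_num_measure.
Qed.

Lemma Phi_homo : {homo Phi : x y / x <= y}.
Proof.
move=> x y xy; rewrite /Phi fine_le ?fin_num_measure//.
by apply: le_measure; rewrite ?inE//; exact: subitvPr.
Qed.

Let mid : measurable_fun setT (fun x : measurableTypeR R => x : R).
Proof. exact: measurable_id. Qed.
Let idR : {mfun measurableTypeR R >-> R} := HB.pack (fun x : measurableTypeR R => x : R)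
  (isMeasurableFun.Build _ _ _ _ _ mid).

Let PhiE z : Phi z = fine (cdf (idR : {RV (normal_prob (0 : R) 1) >-> R}) z).
Proof. by []. Qed.

Lemma Phi_tail : Phi (- n%:R) @[n --> \oo] --> (0 : R).
Proof.
under eq_fun do rewrite PhiE.
apply: (@fine_cvg _ _ _ _ _ (0 : R)).
apply: (cvg_comp _ _ _ (cvg_cdfNy0 (idR : {RV (normal_prob (0 : R) 1) >-> R}))).
by apply/cvgNry; rewrite opprK; exact: cvgr_idn.
Qed.

Lemma Phi_cotail : Phi n%:R @[n --> \oo] --> (1 : R).
Proof.
under eq_fun do rewrite PhiE.
apply: (@fine_cvg _ _ _ _ _ (1 : R)).
apply: (cvg_comp _ _ _ (cvg_cdfy1 (idR : {RV (normal_prob (0 : R) 1) >-> R}))).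
exact: cvgr_idn.
Qed.

Lemma normal_prob_Phi (s x : R) : 0 < s -> normal_prob (0 : R) s `]-oo, x] = (Phi (x / s))%:E.
Proof.
move=> s0; rewrite /Phi fineK ?fin_num_measure//.
pose p0 : R -> \bar R := fun y => (normal_pdf 0 s y * (y <= x)%R%:R)%:E.
have mp : measurable_fun setT p0.
  apply/measurable_EFinP; apply: measurable_funM; first exact: measurable_normal_pdf.
  by apply: measurable_bool; exact: measurable_fun_ler.
have p00 y : (0 <= p0 y)%E by rewrite lee_fin mulr_ge0// normal_pdf_ge0.
have E (s' x' : R) : normal_prob 0 s' `]-oo, x'] = (\int[lebesgue_measure]_y (normal_pdf 0 s' y * (y <= x')%R%:R)%:E)%E.
  rewrite /normal_prob integral_mkcond; apply: eq_integral => y _; rewrite patchE.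
  case: ifPn; rewrite ?inE ?notin_setE/= in_itv/=; first by move=> ->; rewrite mulr1.
  by move=> /negP/negbTE ->; rewrite mulr0.
have ms : measurable_fun setT (fun y : R => s * y) by exact: measurable_funM.
have mps : measurable_fun setT (fun y : R => p0 (s * y)) by exact: (measurableT_comp mp ms).
rewrite !E (lebesgue_scale s0 mp p00) -ge0_integralZl//; last by rewrite lee_fin ltW.
apply: eq_integral => y _; rewrite /p0 -EFinM; congr EFin.
rewrite ler_pdivlMr// [y * s]mulrC mulrA; congr (_ * _).
rewrite !normal_pdfE ?oner_eq0 ?gt_eqF// /normal_fun /normal_peak !subr0 mulrA.
congr (_ * expR _).
  rewrite -mulrnAr sqrtrM ?sqr_ge0// sqrtr_sqr (ger0_norm (ltW s0)) expr1n mul1r.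
  by rewrite invfM mulrA mulfV ?mul1r// gt_eqF.
by rewrite expr1n exprMn; field; rewrite gt_eqF.
Qed.

(** For [k <= 4]: [|z| ^ k <= 1 + z ^ 4 <= 17 (1 + z ^ 2 / 4) ^ 2 <= 17 exp (z ^ 2 / 2)]. *)
Definition gbound : R := 17 * normal_peak 1.

Lemma stdnormal_bound k z : (k <= 4)%N -> `|z| ^+ k * stdnormal z <= gbound.
Proof.
move=> k4; rewrite /stdnormal mulrCA /gbound mulrC; apply: ler_wpM2r; first exact: normal_peak_ge0.
rewrite expRN ler_pdivrMr ?expR_gt0//.
have z2 : 0 <= z ^+ 2 by exact: sqr_ge0.
have e1 : (1 + z ^+ 2 / 4) ^+ 2 <= expR (z ^+ 2 / 2).
  have -> : z ^+ 2 / 2 = z ^+ 2 / 4 + z ^+ 2 / 4 by field.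
  rewrite expRD -expr2 lerXn2r ?nnegrE ?expR_ge0//; first by rewrite addr_ge0// divr_ge0.
  exact: expR_ge1Dx.
have h0 : `|z| ^+ k <= 1 + `|z| ^+ 4.
  have [z1|/ltW z1] := leP `|z| 1.
    by rewrite (@le_trans _ _ 1)// ?exprn_ile1// lerDl exprn_ge0.
  by rewrite (@le_trans _ _ (`|z| ^+ 4))// ?ler_weXn2l// lerDr.
apply: (le_trans h0); rewrite (_ : `|z| ^+ 4 = (z ^+ 2) ^+ 2); last first.
  by rewrite -(real_normK (num_real z)); ring.
by move: (z ^+ 2) (expR _) z2 e1 => q E q0; nra.
Qed.

Lemma is_derive_stdnormal z : is_derive z 1 stdnormal (- z * stdnormal z).
Proof.
have d2 : is_derive z 1 (fun x : R => - (x ^+ 2 / 2)) (- z).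
  have dz := is_derive_exprn 2 z.
  by apply: is_derive_eq; rewrite /GRing.scale/=; field.
have de : is_derive z 1 (fun x : R => expR (- (x ^+ 2 / 2))) (expR (- (z ^+ 2 / 2)) * - z).
  by apply: is_derive1_comp.
rewrite /stdnormal; apply: is_derive_eq.
by rewrite /GRing.scale/=; ring.
Qed.

Section heat.
Variables (x0 s : R).
Hypothesis s0 : 0 < s.

Let sg t : R := Num.sqrt (s ^+ 2 + t).
Let zz t y : R := (x0 - y) / sg t.
(** The probability that [y] plus a centred Gaussian of variance [s ^ 2 + t] is at most [x0]: the
    indicator of a ray, smoothed at width [s] and then run through the heat flow. Smoothing first
    keeps all derivatives bounded down to [t = 0]. *)
Definition heat t y : R := Phi (zz t y).
Definition heat_y t y : R := - (stdnormal (zz t y) / sg t).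
Definition heat_yy t y : R := - (zz t y * stdnormal (zz t y) / sg t ^+ 2).

Let sg_gt0 t : 0 <= t -> 0 < sg t.
Proof. by move=> t0; rewrite sqrtr_gt0 ltr_wpDr// exprn_gt0. Qed.

Let sg_ge t : 0 <= t -> s <= sg t.
Proof.
by move=> t0; rewrite -[leLHS](ger0_norm (ltW s0)) -sqrtr_sqr ler_wsqrtr// lerDl.
Qed.

Let isg t k : 0 <= t -> 0 <= (sg t ^+ k)^-1 <= (s ^+ k)^-1.
Proof.
move=> t0; rewrite invr_ge0 exprn_ge0 ?(ltW (sg_gt0 t0))//=.
by rewrite lef_pV2 ?posrE ?exprn_gt0// ?sg_gt0// lerXn2r ?nnegrE ?(ltW s0)// ?(ltW (sg_gt0 t0))// sg_ge.
Qed.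

Let dzz_y t y : 0 <= t -> is_derive y 1 (zz t) (- (sg t)^-1).
Proof.
move=> t0; rewrite /zz.
have d1 : is_derive y 1 (fun u : R => x0 - u) (- 1).
  apply: (is_derive_conv (is_deriveB (is_derive_cst x0 y 1) (is_derive_id y (1 : R)))).
  by rewrite sub0r.
apply: (is_derive_conv (is_derive_mul d1 (is_derive_cst (sg t)^-1 y 1))).
by rewrite mulr0 addr0 mulN1r.
Qed.

Let dsg t : 0 <= t -> is_derive t 1 sg (2 * sg t)^-1.
Proof.
move=> t0.
have dr := is_derive1_sqrt (x := s ^+ 2 + t) (ltr_wpDr t0 (exprn_gt0 2 s0)).
apply: (is_derive_conv (is_derive_comp dr (is_derive_addc (s ^+ 2) t))).
by rewrite mulr1.
Qed.

Let disg t : 0 <= t -> is_derive t 1 (fun u => (sg u)^-1) (- (2 * sg t ^+ 3)^-1).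
Proof.
move=> t0; have sn : sg t != 0 by rewrite gt_eqF// sg_gt0.
by apply: (is_derive_conv (is_derive_inv sn (dsg t0))); field.
Qed.

Let dzz_t t y : 0 <= t -> is_derive t 1 (fun u => zz u y) (- (zz t y / (2 * sg t ^+ 2))).
Proof.
move=> t0; have sn : sg t != 0 by rewrite gt_eqF// sg_gt0.
apply: (is_derive_conv (is_derive_mul (is_derive_cst (x0 - y) t 1) (disg t0))).
by rewrite /zz /cst; field.
Qed.

Let d_y t y : 0 <= t -> is_derive y 1 (heat t) (heat_y t y).
Proof.
move=> t0; apply: (is_derive_conv (is_derive_comp (is_derive_Phi (zz t y)) (dzz_y y t0))).
by rewrite /heat_y mulrN.
Qed.

Let d_yy t y : 0 <= t -> is_derive y 1 (heat_y t) (heat_yy t y).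
Proof.
move=> t0; have sn : sg t != 0 by rewrite gt_eqF// sg_gt0.
have dn := is_derive_comp (is_derive_stdnormal (zz t y)) (dzz_y y t0).
apply: (is_derive_conv (is_derive_neg (is_derive_mul dn (is_derive_cst (sg t)^-1 y 1)))).
by rewrite /heat_yy /cst; field.
Qed.

Let d_yyy t y : 0 <= t -> is_derive y 1 (heat_yy t)
  ((1 - zz t y ^+ 2) * stdnormal (zz t y) / sg t ^+ 3).
Proof.
move=> t0; have sn : sg t != 0 by rewrite gt_eqF// sg_gt0.
have dz := dzz_y y t0.
have dn := is_derive_comp (is_derive_stdnormal (zz t y)) dz.
apply: (is_derive_conv (is_derive_neg (is_derive_mul (is_derive_mul dz dn)
  (is_derive_cst (sg t ^+ 2)^-1 y 1)))).
by rewrite /cst; field.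
Qed.

(** The heat equation, which lets one function [pyy] serve both variables in [test_fun]. *)
Let d_t t y : 0 <= t -> is_derive t 1 (fun u => heat u y) (heat_yy t y / 2).
Proof.
move=> t0; have sn : sg t != 0 by rewrite gt_eqF// sg_gt0.
apply: (is_derive_conv (@is_derive_comp _ Phi (fun u => zz u y) t _ _ (is_derive_Phi (zz t y)) (dzz_t y t0))).
by rewrite /heat_yy; field.
Qed.

Let d_tt t y : 0 <= t -> is_derive t 1 (fun u => heat_yy u y / 2)
  (zz t y * (3 - zz t y ^+ 2) * stdnormal (zz t y) / (4 * sg t ^+ 4)).
Proof.
move=> t0; have sn : sg t != 0 by rewrite gt_eqF// sg_gt0.
have dz := dzz_t y t0.
have dn := @is_derive_comp _ stdnormal (fun u => zz u y) t _ _ (is_derive_stdnormal (zz t y)) dz.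
have di := is_derive_pow 2 (disg t0).
have E : (fun u => heat_yy u y / 2) = fun u => - (zz u y * stdnormal (zz u y) * ((sg u)^-1 ^+ 2)) / 2.
  by apply/funext => u; rewrite /heat_yy exprVn.
rewrite E.
apply: (is_derive_conv (is_derive_mul (is_derive_neg (is_derive_mul (is_derive_mul dz dn) di))
  (is_derive_cst (2^-1 : R) t 1))).
by rewrite /cst /=; field.
Qed.

Definition Kheat : R := gbound * (s^-1 + (s ^+ 2)^-1 + (s ^+ 3)^-1 + (s ^+ 4)^-1) * 4.

Lemma test_fun_heat : test_fun heat heat_y heat_yy Kheat.
Proof.
have g0 : 0 <= gbound by rewrite /gbound mulr_ge0// normal_peak_ge0.
have is0 k : 0 <= (s ^+ k)^-1 by rewrite invr_ge0 exprn_ge0// ltW.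
have is1 : 0 <= s^-1 by rewrite invr_ge0 ltW.
have bnd j (c : R) t (e : R) : 0 <= t -> 0 <= c -> `|e| <= c * gbound ->
    `|e / sg t ^+ j| <= c * gbound * (s ^+ j)^-1.
  move=> t0 c0 he; have /andP[i0 i1] := isg j t0.
  by rewrite normrM [X in _ * X]ger0_norm//; apply: ler_pM.
have zb k t y : (k <= 4)%N -> `|zz t y| ^+ k * stdnormal (zz t y) <= gbound by exact: stdnormal_bound.
have by_ t y : 0 <= t -> `|heat_y t y| <= gbound * s^-1.
  move=> t0; rewrite /heat_y normrN; have := @bnd 1%N 1 t (stdnormal (zz t y)) t0 ler01.
  rewrite !expr1 !mul1r; apply; rewrite ger0_norm ?stdnormal_ge0//.
  by have := zb 0%N t y isT; rewrite expr0 mul1r.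
have byy t y : 0 <= t -> `|heat_yy t y| <= gbound * (s ^+ 2)^-1.
  move=> t0; rewrite /heat_yy normrN; have := @bnd 2%N 1 t (zz t y * stdnormal (zz t y)) t0 ler01.
  rewrite !mul1r; apply; rewrite normrM [`|stdnormal _|]ger0_norm ?stdnormal_ge0//.
  by have := zb 1%N t y isT; rewrite expr1.
have byyy t y : 0 <= t -> `|(1 - zz t y ^+ 2) * stdnormal (zz t y) / sg t ^+ 3| <= 2 * gbound * (s ^+ 3)^-1.
  move=> t0; apply: bnd => //.
  have z0 := zb 0%N t y isT; have z2 := zb 2%N t y isT; rewrite expr0 mul1r in z0.
  rewrite normrM [`|stdnormal _|]ger0_norm ?stdnormal_ge0//.
  have h : `|1 - zz t y ^+ 2| <= 1 + `|zz t y| ^+ 2.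
    by rewrite (le_trans (ler_normB _ _))// normr1 normrX.
  by have := ler_wpM2r (stdnormal_ge0 (zz t y)) h; lra.
have btt t y : 0 <= t -> `|zz t y * (3 - zz t y ^+ 2) * stdnormal (zz t y) / (4 * sg t ^+ 4)| <= gbound * (s ^+ 4)^-1.
  move=> t0; rewrite invfM mulrA; have := @bnd 4%N 1 t (zz t y * (3 - zz t y ^+ 2) * stdnormal (zz t y) / 4) t0 ler01.
  rewrite !mul1r; apply.
  have z1 := zb 1%N t y isT; have z3 := zb 3%N t y isT; rewrite expr1 in z1.
  rewrite normrM [`|4^-1|]ger0_norm// ler_pdivrMr// normrM [`|stdnormal _|]ger0_norm ?stdnormal_ge0//.
  have h : `|zz t y * (3 - zz t y ^+ 2)| <= 3 * `|zz t y| + `|zz t y| ^+ 3.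
    rewrite normrM (_ : 3 * _ + _ = `|zz t y| * (3 + `|zz t y| ^+ 2)); last by ring.
    apply: ler_wpM2l => //; rewrite (le_trans (ler_normB _ _))// normrX.
    by rewrite (@ger0_norm _ 3).
  by have := ler_wpM2r (stdnormal_ge0 (zz t y)) h; lra.
have i1 : 0 <= gbound * s^-1 by rewrite mulr_ge0.
have i2 : 0 <= gbound * (s ^+ 2)^-1 by rewrite mulr_ge0.
have i3 : 0 <= gbound * (s ^+ 3)^-1 by rewrite mulr_ge0.
have i4 : 0 <= gbound * (s ^+ 4)^-1 by rewrite mulr_ge0.
have KE : Kheat = 4 * (gbound * s^-1 + gbound * (s ^+ 2)^-1 + gbound * (s ^+ 3)^-1 + gbound * (s ^+ 4)^-1).
  by rewrite /Kheat; ring.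
have K0 : 0 <= Kheat by rewrite KE; lra.
split => //.
- have mq : measurable_fun [set: R * R] (fun z : R * R => (sg z.1)^-1).
    apply: (measurableT_comp measurable_invr); apply: (measurableT_comp (continuous_measurable_fun (@sqrt_continuous R))).
    exact: measurable_funD.
  have mPhi : measurable_fun setT Phi by apply: nondecreasing_measurable => //; exact: Phi_homo.
  have mzz : measurable_fun [set: R * R] (fun z : R * R => zz z.1 z.2).
    by apply: measurable_funM => //; exact: measurable_funB.
  exact: (measurableT_comp mPhi mzz).
- move=> t y t' y' t0 t'0.
  pose DT (c : R) := True; pose D0 (c : R) := is_true (0 <= c).
  have DTc p q c : DT p -> DT q -> p <= c <= q -> DT c by [].
  have D0c p q c : D0 p -> D0 q -> p <= c <= q -> D0 c.
    by move=> p0 _ /andP[pc _]; exact: le_trans pc.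
  have lipyy c : `|heat_yy t c - heat_yy t y| <= 2 * gbound * (s ^+ 3)^-1 * `|c - y|.
    exact: (@MVT_bound _ DT (heat_yy t) _ y c _ DTc I I (fun q _ => d_yyy q t0) (fun q _ _ => byyy t q t0)).
  have M30 : 0 <= 2 * gbound * (s ^+ 3)^-1 by rewrite -mulrA mulr_ge0.
  have ty := @taylor3 _ DT DTc (heat t) (heat_y t) (heat_yy t) y y' _ M30 I I
    (fun c _ => d_y c t0) (fun c _ => d_yy c t0) (fun c _ => lipyy c).
  have liptt c : D0 c -> `|heat_yy c y' / 2 - heat_yy t y' / 2| <= gbound * (s ^+ 4)^-1 * `|c - t|.
    move=> c0; exact: (@MVT_bound _ D0 (fun u => heat_yy u y' / 2) _ t c _ D0c t0 c0
      (fun q q0 => d_tt y' q0) (fun q q0 _ => btt q y' q0)).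
  have tt := @taylor2 _ D0 D0c (fun u => heat u y') (fun u => heat_yy u y' / 2) t t' _ t0 t'0
    (fun c c0 => d_t y' c0) liptt.
  have mixed : `|(heat_yy t y' - heat_yy t y) / 2 * (t' - t)| <= gbound * (s ^+ 3)^-1 * (`|t' - t| * `|y' - y|).
    rewrite !normrM [`|2^-1|]ger0_norm//.
    have := ler_wpM2r (normr_ge0 (t' - t)) (lipyy y').
    by move: (`|t' - t|) (`|y' - y|) (`|_ - _|) => p q r; lra.
  (* Expand in time at the new place [y'] and in space at the old time [t]; the middle term moves
     [heat_yy] from [y'] back to [y] and yields the mixed error. *)
  have -> : heat t' y' - heat t y - heat_y t y * (y' - y) - heat_yy t y / 2 * ((y' - y) ^+ 2 + (t' - t)) =
    (heat t' y' - heat t y' - heat_yy t y' / 2 * (t' - t)) + (heat_yy t y' - heat_yy t y) / 2 * (t' - t)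
    + (heat t y' - heat t y - heat_y t y * (y' - y) - heat_yy t y / 2 * (y' - y) ^+ 2) by field.
  apply: (le_trans (ler_normD _ _)); apply: (le_trans (lerD (ler_normD _ _) (lexx _))).
  apply: (le_trans (lerD (lerD tt mixed) ty)).
  rewrite -[`|t' - t| ^+ 2]normrX [`|(t' - t) ^+ 2|]ger0_norm ?sqr_ge0// KE.
  have e1 : 0 <= (t' - t) ^+ 2 by exact: sqr_ge0.
  have e2 : 0 <= `|t' - t| * `|y' - y| by exact: mulr_ge0.
  have e3 : 0 <= `|y' - y| ^+ 3 by exact: exprn_ge0.
  move: i1 i2 i3 i4 e1 e2 e3; rewrite -(mulrA 2).
  move: (gbound * s^-1) (gbound * (s ^+ 2)^-1) (gbound * (s ^+ 3)^-1) (gbound * (s ^+ 4)^-1)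
     ((t' - t) ^+ 2) (`|t' - t| * `|y' - y|) (`|y' - y| ^+ 3) => A B C D p q r a0 b0 c0 d0 p0 q0 r0.
  have := mulr_ge0 a0 p0; have := mulr_ge0 a0 q0; have := mulr_ge0 a0 r0.
  have := mulr_ge0 b0 p0; have := mulr_ge0 b0 q0; have := mulr_ge0 b0 r0.
  have := mulr_ge0 c0 p0; have := mulr_ge0 c0 q0; have := mulr_ge0 c0 r0.
  have := mulr_ge0 d0 p0; have := mulr_ge0 d0 q0; have := mulr_ge0 d0 r0.
  lra.
- move=> t y t0; apply: (le_trans (by_ t y t0)).
  apply: (@le_trans _ _ Kheat); first by rewrite KE; lra.
  by rewrite ler_peMr// lerDl.
- by move=> t y t0; apply: (le_trans (byy t y t0)); rewrite KE; lra.
Qed.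
End heat.
End gauss.

(** * Efron-Stein inequality for gap sums *)

Section bounded_expectation.
Context d (T : measurableType d) (R : realType) (P : probability T R).
Implicit Types (f g : T -> R) (c : R).

Definition bm f := measurable_fun setT f /\ exists C, forall w, `|f w| <= C.

Lemma bm_cst c : bm (fun=> c). Proof. by split => //; exists `|c|. Qed.

Lemma bmD f g : bm f -> bm g -> bm (fun w => f w + g w).
Proof.
move=> [mf [C hC]] [mg [D hD]]; split; first exact: measurable_funD.
by exists (C + D) => w; rewrite (le_trans (ler_normD _ _))// lerD.
Qed.

Lemma bmZ c f : bm f -> bm (fun w => c * f w).
Proof.
move=> [mf [C hC]]; split; first exact: measurable_funM.
by exists (`|c| * C) => w; rewrite normrM ler_wpM2l.
Qed.

Lemma bmB f g : bm f -> bm g -> bm (fun w => f w - g w).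
Proof.
move=> [mf [C hC]] [mg [D hD]]; split; first exact: measurable_funB.
by exists (C + D) => w; rewrite (le_trans (ler_normB _ _))// lerD.
Qed.

Lemma bmM f g : bm f -> bm g -> bm (fun w => f w * g w).
Proof.
move=> [mf [C hC]] [mg [D hD]]; split; first exact: measurable_funM.
by exists (C * D) => w; rewrite normrM ler_pM.
Qed.

Lemma bm_sqr f : bm f -> bm (fun w => f w ^+ 2).
Proof. by move=> bf; have := bmM bf bf. Qed.

Lemma bm_int f : bm f -> P.-integrable setT (EFin \o f).
Proof.
move=> [mf [C hC]]; apply: (@bdd_integrable _ _ _ _ _ _ C) => //.
exact: (le_lt_trans (probability_le1 P measurableT) (ltry 1)).
Qed.

Definition Ex f : R := \int[P]_w f w.

Lemma Ex_cst c : Ex (fun=> c) = c.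
Proof.
apply: (etrans (Rintegral_cst P measurableT c)).
exact: (etrans (congr1 (fun z => c * fine z) (probability_setT P)) (mulr1 c)).
Qed.

Lemma ExD f g : bm f -> bm g -> Ex (fun w => f w + g w) = Ex f + Ex g.
Proof. by move=> bf bg; rewrite /Ex RintegralD//; exact: bm_int. Qed.

Lemma ExB f g : bm f -> bm g -> Ex (fun w => f w - g w) = Ex f - Ex g.
Proof. by move=> bf bg; rewrite /Ex RintegralB//; exact: bm_int. Qed.

Lemma ExZ c f : bm f -> Ex (fun w => c * f w) = c * Ex f.
Proof. by move=> bf; rewrite /Ex RintegralZl//; exact: bm_int. Qed.

Lemma le_Ex f g : bm f -> bm g -> (forall w, f w <= g w) -> Ex f <= Ex g.
Proof. by move=> bf bg fg; apply: le_Rintegral => //; exact: bm_int. Qed.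

Lemma Ex_ge0 f : bm f -> (forall w, 0 <= f w) -> 0 <= Ex f.
Proof. by move=> bf f0; rewrite -(Ex_cst 0); apply: le_Ex => //; exact: bm_cst. Qed.

Lemma ExE f : bm f -> (\int[P]_w (f w)%:E)%E = (Ex f)%:E.
Proof.
by move=> bf; rewrite /Ex /Rintegral fineK//; apply: integrable_fin_num => //; exact: bm_int.
Qed.

Lemma eq_Ex f g : f =1 g -> Ex f = Ex g.
Proof. by move=> fg; congr Ex; exact/funext. Qed.

Lemma Ex_sqrB f c : bm f -> Ex (fun w => (f w - c) ^+ 2) = Ex (fun w => f w ^+ 2) - 2 * c * Ex f + c ^+ 2.
Proof.
move=> bf.
rewrite (eq_Ex (g := fun w => (f w ^+ 2 - 2 * c * f w) + c ^+ 2)); last by move=> w; ring.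
have b2 := bm_sqr bf; have b1 := bmZ (2 * c) bf.
by rewrite (ExD (bmB b2 b1) (bm_cst _)) (ExB b2 b1) (ExZ _ bf) Ex_cst.
Qed.

Definition Vr f : R := Ex (fun w => f w ^+ 2) - Ex f ^+ 2.

Lemma VrE f : bm f -> Vr f = Ex (fun w => (f w - Ex f) ^+ 2).
Proof. by move=> bf; rewrite Ex_sqrB// /Vr; ring. Qed.

Lemma Vr_ge0 f : bm f -> 0 <= Vr f.
Proof.
move=> bf; rewrite VrE//; apply: Ex_ge0; last by move=> w; exact: sqr_ge0.
by apply: bm_sqr; apply: bmB => //; exact: bm_cst.
Qed.

Lemma Ex_sqr_le f : bm f -> Ex f ^+ 2 <= Ex (fun w => f w ^+ 2).
Proof. by move=> bf; rewrite -subr_ge0; exact: Vr_ge0. Qed.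

Lemma Vr_le f c : bm f -> Vr f <= Ex (fun w => (f w - c) ^+ 2).
Proof. by move=> bf; rewrite Ex_sqrB// /Vr; have := sqr_ge0 (Ex f - c); nra. Qed.

Lemma Ex_sum I (r : seq I) (F : I -> T -> R) : (forall i, bm (F i)) ->
  bm (fun w => \sum_(i <- r) F i w) /\ Ex (fun w => \sum_(i <- r) F i w) = \sum_(i <- r) Ex (F i).
Proof.
move=> bF; elim: r => [|i r [IHb IH]].
  split; first by under eq_fun do rewrite big_nil; exact: bm_cst.
  by under eq_Ex do rewrite big_nil; rewrite Ex_cst big_nil.
split; first by under eq_fun do rewrite big_cons; exact: bmD.
by under eq_Ex do rewrite big_cons; rewrite ExD// IH big_cons.
Qed.

End bounded_expectation.
Arguments bm {d T R} f.

Section tensorization.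
Context {R : realType} (mu : probability R R).
Implicit Types F G : seq R -> R.

Definition bseq n F := bm (fun t : n.-tuple R => F t).
Definition tmean n F : R := Ex (tpow mu n) (fun t : n.-tuple R => F t).

Lemma tmean0 F : tmean 0 F = F [::].
Proof.
rewrite /tmean -[RHS](Ex_cst (tpow mu 0)); congr Ex; apply/funext => t.
by rewrite (tuple0 t).
Qed.

Lemma bseq_cons n F x : bseq n.+1 F -> bseq n (fun s => F (x :: s)).
Proof.
move=> [mF [C hC]]; split; last by exists C => t; exact: (hC (tcons (x, t))).
by apply/measurable_EFinP; apply: (@mseq_cons _ _ (fun s => (F s)%:E)); exact/measurable_EFinP.
Qed.

Lemma tmeanS n F : bseq n.+1 F -> bm (fun x => tmean n (fun s => F (x :: s))) /\
  tmean n.+1 F = Ex mu (fun x => tmean n (fun s => F (x :: s))).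
Proof.
move=> bF; have [mF [C hC]] := bF.
(* Shifting by the bound [C] makes the function nonnegative on tuples, as Tonelli's theorem
   requires; the absolute value extends this to all sequences. *)
pose G s : \bar R := (`|F s + C|)%:E.
have mG : mseq n.+1 G.
  by apply/measurable_EFinP; apply: measurableT_comp => //; exact: measurable_funD.
have G0 s : (0 <= G s)%E by rewrite lee_fin.
have inner x : (\int[tpow mu n]_t G (x :: t))%E = (tmean n (fun s => F (x :: s)) + C)%:E.
  rewrite -[X in (_ + X)%:E](Ex_cst (tpow mu n) C) -ExD; last 2 first.
    exact: bseq_cons.
    exact: bm_cst.
  rewrite -ExE; last by apply: bmD; [exact: bseq_cons|exact: bm_cst].
  apply: eq_integral => t _; rewrite /G ger0_norm//.
  have := hC (tcons (x, t)); rewrite ler_norml => /andP[h _].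
  by rewrite -lerBlDr sub0r.
have b1 : bm (fun x => tmean n (fun s => F (x :: s)) + C).
  split.
    apply/measurable_EFinP; rewrite (_ : EFin \o _ = fun x => (\int[tpow mu n]_t G (x :: t))%E).
      exact: measurable_tpow_cons.
    by apply/funext => x; rewrite inner.
  exists (C + C) => x; rewrite ler_norml; apply/andP; split.
    rewrite (@le_trans _ _ 0)//; first by rewrite oppr_le0 addr_ge0// (le_trans _ (hC (tcons (x, [tuple of nseq n 0])))).
    by rewrite -lee_fin -inner; apply: integral_ge0 => t _; exact: G0.
  rewrite lerD2r -[leRHS](Ex_cst (tpow mu n) C); apply: le_Ex.
  - exact: bseq_cons.
  - exact: bm_cst.
  - by move=> t; rewrite (le_trans (ler_norm _))//; exact: (hC (tcons (x, t))).
have b2 : bm (fun x => tmean n (fun s => F (x :: s))).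
  have bC : bm (fun _ : R => C) by exact: bm_cst.
  by have := bmB b1 bC; congr bm; apply/funext => x; ring.
split => //.
have : (tmean n.+1 F + C)%:E = (Ex mu (fun x => tmean n (fun s => F (x :: s))) + C)%:E.
  rewrite -[X in _ = (_ + X)%:E](Ex_cst mu C) -ExD//; last exact: bm_cst.
  rewrite -ExE//.
  transitivity (\int[tpow mu n.+1]_t G t)%E; last first.
    rewrite (tpowS_int mu mG G0); apply: eq_integral => x _; exact: inner.
  rewrite -[X in (_ + X)%:E](Ex_cst (tpow mu n.+1) C) -ExD//; last exact: bm_cst.
  rewrite -ExE; last by apply: bmD => //; exact: bm_cst.
  apply: eq_integral => t _; rewrite /G ger0_norm//.
  by have := hC t; rewrite ler_norml => /andP[h _]; rewrite -lerBlDr sub0r.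
by move=> [] /addIr.
Qed.

Definition punct i (s : seq R) := take i s ++ drop i.+1 s.

Lemma bseq_punct n i G : bseq n G -> (i <= n)%N -> bseq n.+1 (fun s => G (punct i s)).
Proof.
move=> [mG [C hC]] i_n; pose i' : 'I_n.+1 := Ordinal (i_n : (i < n.+1)%N).
pose Pn (s : n.+1.-tuple R) : n.-tuple R := [tuple tnth s (lift i' j) | j < n].
have PnE (s : n.+1.-tuple R) : punct i s = Pn s.
  apply: (@eq_from_nth _ 0); rewrite /punct size_cat size_take size_drop !size_tuple.
    by case: ifP => h; lia.
  move=> j jn; have {}jn : (j < n)%N by move: jn; case: ifP => h; lia.
  rewrite -[RHS](tnth_nth 0 (Pn s) (Ordinal jn)) tnth_mktuple (tnth_nth 0) /= /bump.
  rewrite nth_cat size_take size_tuple ltnS i_n.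
  have [ji|ij] := ltnP j i; first by rewrite nth_take.
  by rewrite nth_drop add1n; congr (nth _ _ _); lia.
split; last by exists C => s; rewrite PnE; exact: hC.
rewrite (_ : (fun _ => _) = (fun t : n.-tuple R => G t) \o Pn); last by apply/funext => s; rewrite PnE.
apply: measurableT_comp => //; apply/measurable_fun_tnthP => j.
rewrite (_ : _ \o Pn = fun s => tnth s (lift i' j)); first exact: measurable_tnth.
by apply/funext => s /=; rewrite tnth_mktuple.
Qed.

(* Tensorization of the variance, by conditioning on the head of the tuple. *)
Lemma tensor_variance n F G : bseq n F -> bseq n.-1 G ->
  tmean n (fun s => F s ^+ 2) - tmean n F ^+ 2 <=
  \sum_(0 <= i < n) tmean n (fun s => (F s - G (punct i s)) ^+ 2).
Proof.
elim: n F G => [|n IH] F G bF bG.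
  by rewrite big_geq// !tmean0 subrr.
have bF2 : bseq n.+1 (fun s => F s ^+ 2) by exact: bm_sqr.
have bD i : (i <= n)%N -> bseq n.+1 (fun s => (F s - G (punct i s)) ^+ 2).
  by move=> i_n; apply: bm_sqr; apply: bmB => //; exact: bseq_punct.
have [be mF] := tmeanS bF; have [bF2' mF2] := tmeanS bF2.
set e := fun x => tmean n _ in be mF.
pose S i x := tmean n (fun s => (F (x :: s) - G (x :: punct i s)) ^+ 2).
(* The tail coordinates: the induction hypothesis at a fixed head. *)
have IHx x : tmean n (fun s => F (x :: s) ^+ 2) <= e x ^+ 2 + \sum_(0 <= i < n) S i x.
  rewrite -lerBlDl; have [n0|n0] := posnP n.
    by subst n; rewrite big_geq// /e !tmean0 subrr.
  apply: (IH (fun s => F (x :: s)) (fun s => G (x :: s))); first exact: bseq_cons.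
  by case: n bG n0 {IH bF bF2 bD be mF bF2' mF2 e S} => // n bG _; exact: bseq_cons.
have bS i : (i < n)%N -> bm (S i) /\ tmean n.+1 (fun s => (F s - G (punct i.+1 s)) ^+ 2) = Ex mu (S i).
  by move=> i_n; exact: tmeanS (bD i.+1 i_n).
pose S' i := if (i < n)%N then S i else fun=> 0.
have bS' i : bm (S' i).
  by rewrite /S'; case: ltnP => [i_n|_]; [case: (bS i i_n)|exact: bm_cst].
have [bsum Esum] := Ex_sum mu (index_iota 0 n) bS'.
have be2 := bm_sqr be.
have step1 : tmean n.+1 (fun s => F s ^+ 2) <= Ex mu (fun x => e x ^+ 2) + \sum_(0 <= i < n) Ex mu (S' i).
  rewrite mF2 -Esum -ExD//; apply: le_Ex => //; first exact: bmD.
  move=> x; apply: (le_trans (IHx x)); rewrite lerD2l big_nat [leRHS]big_nat.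
  by apply: ler_sum => i /andP[_ i_n]; rewrite /S' i_n.
(* The head coordinate: a variance is at most the mean square distance to any constant, here the
   mean of [G], and Jensen's inequality then undoes the averaging over the tail. *)
have step2 : Ex mu (fun x => e x ^+ 2) - Ex mu e ^+ 2 <= tmean n.+1 (fun s => (F s - G (punct 0 s)) ^+ 2).
  pose c := tmean n G.
  apply: (le_trans (Vr_le mu c be)).
  have [b0 ->] := tmeanS (bD 0%N isT).
  apply: le_Ex => //; first by apply: bm_sqr; apply: bmB => //; exact: bm_cst.
  move=> x; have bx := bseq_cons x bF.
  rewrite /e /c /tmean -ExB//.
  have -> : (fun s : n.-tuple R => (F (x :: s) - G (punct 0 (x :: s))) ^+ 2) =
    (fun s : n.-tuple R => (F (x :: s) - G s) ^+ 2) by apply/funext => s; rewrite /punct /= drop0.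
  by apply: Ex_sqr_le; exact: bmB.
rewrite big_nat_recl//= mF.
have -> : \sum_(0 <= i < n) tmean n.+1 (fun s => (F s - G (punct i.+1 s)) ^+ 2) = \sum_(0 <= i < n) Ex mu (S' i).
  rewrite big_nat [RHS]big_nat; apply: eq_bigr => i /andP[_ i_n].
  by have [_ ->] := bS i i_n; rewrite /S' i_n.
by move: step1 step2; lra.
Qed.
End tensorization.

(** * The effect of inserting one point into a sample *)

Section insertion.
Context {R : realType}.
Implicit Types (f : R -> R -> R) (a u x : R) (s : seq R).

Lemma gsum_insert f a s1 x s2 u :
  gsum f a (s1 ++ x :: s2) u - gsum f a (s1 ++ s2) u =
  f (last a s1) x + f x (head u s2) - f (last a s1) (head u s2).
Proof.
elim: s1 a => [|y s1 IH] a /=; last by rewrite opprD addrACA subrr add0r IH.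
by case: s2 => [|y s2] /=; ring.
Qed.

Lemma sorted_split x s : sorted <=%R s -> s = [seq y <- s | y <= x] ++ [seq y <- s | x < y].
Proof.
elim: s => // y s IH /= ys; have hs := path_sorted ys.
have [yx|xy] := leP y x; first by rewrite /= -IH.
have -> : [seq z <- s | z <= x] = [::].
  apply/eqP; rewrite -(negbK (_ == _)) -has_filter; apply/hasPn => z zs.
  rewrite -ltNge (lt_le_trans xy)//.
  by have /allP := order_path_min le_trans ys; exact.
rewrite /=; congr cons; apply/esym/all_filterP/allP => z zs.
by rewrite (lt_le_trans xy)//; have /allP := order_path_min le_trans ys; exact.
Qed.

Lemma sort_insert x s : sort <=%R (x :: s) =
  [seq y <- sort <=%R s | y <= x] ++ x :: [seq y <- sort <=%R s | x < y].
Proof.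
have ss : sorted <=%R (sort <=%R s) by exact/sort_sorted/le_total.
apply: (@sorted_eq _ <=%R).
- exact: le_trans.
- exact: le_anti.
- exact/sort_sorted/le_total.
- rewrite (sorted_pairwise le_trans) pairwise_cat /= -!(sorted_pairwise le_trans) !sorted_filter//; try exact: le_trans.
  rewrite allrel_consr !andbT; apply/and3P; split.
  + apply/andP; split; first exact: filter_all.
    apply/allrelP => y z; rewrite !mem_filter => /andP[yx _] /andP[xz _].
    by rewrite (le_trans yx)// ltW.
  + by [].
  + by apply/allP => y; rewrite mem_filter => /andP[/ltW].
- rewrite perm_sort perm_sym -cat1s perm_catCA /= perm_cons -sorted_split//.
  by rewrite perm_sort perm_refl.
Qed.

End insertion.

Section eta.
Context {R : realType}.
Implicit Types x y a b : R.

(** From [1 + y <= (1 + sqrt y) ^ 2] and [ln (1 + t) <= t]. *)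
Lemma ln1D_sqr y : 0 <= y -> ln (1 + y) ^+ 2 <= 4 * y.
Proof.
move=> y0; have q0 := sqrtr_ge0 y.
have yE : y = Num.sqrt y ^+ 2 by rewrite sqr_sqrtr.
have l0 : 0 <= ln (1 + y) by rewrite ln_ge0// lerDl.
have h : ln (1 + y) <= 2 * Num.sqrt y.
  apply: (@le_trans _ _ (ln ((1 + Num.sqrt y) ^+ 2))).
    rewrite ler_ln ?posrE ?exprn_gt0 ?ltr_wpDr//.
    by rewrite {1}yE; nra.
  have q1 : 0 < 1 + Num.sqrt y by rewrite ltr_wpDr.
  have -> : ln ((1 + Num.sqrt y) ^+ 2) = 2 * ln (1 + Num.sqrt y) by rewrite lnXn// mulr_natl.
  rewrite ler_pM2l//.
  have := @ln_le_B1 R (1 + Num.sqrt y).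
  by move=> /(_ q1); lra.
rewrite [in leRHS]yE; have -> : 4 * Num.sqrt y ^+ 2 = (2 * Num.sqrt y) ^+ 2 by ring.
by rewrite lerXn2r// nnegrE mulr_ge0.
Qed.

(** Minus the change of a gap sum when a gap of size [x + y] is split into [x] and [y]. *)
Definition eta x y : R := xlogx (x + y) - xlogx x - xlogx y.

Lemma etaC x y : eta x y = eta y x. Proof. by rewrite /eta (addrC x) addrAC. Qed.

(** The derivative in [x] is [ln (1 + y / x)], and [y / x] is at most [b / a] times the ratio of the
    underlying lengths. *)
Lemma eta_lip (a b d1 d2 x x' y : R) : 0 < a -> a <= b -> 0 < d1 -> 0 < d2 ->
  a * d1 <= x <= b * d1 -> a * d1 <= x' <= b * d1 -> a * d2 <= y <= b * d2 ->
  `|eta x y - eta x' y| <= ln (1 + b / a * (d2 / d1)) * `|x - x'|.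
Proof.
move=> a0 ab d10 d20 /andP[x1 x2] /andP[x1' x2'] /andP[y1 y2].
have b0 := lt_le_trans a0 ab.
pose D (c : R) := is_true (a * d1 <= c).
have ad1 : 0 < a * d1 by rewrite mulr_gt0.
have y0 : 0 < y by rewrite (lt_le_trans _ y1)// mulr_gt0.
have Dc p q c : D p -> D q -> p <= c <= q -> D c.
  by move=> pD _ /andP[pc _]; exact: le_trans pc.
have c0 c : D c -> 0 < c by move=> Dc'; exact: lt_le_trans Dc'.
apply: (@MVT_bound _ D (fun c => eta c y) (fun c => ln (c + y) - ln c) x' x _ Dc x1' x1) => c cD.
  have cp := c0 c cD; have cy : 0 < c + y by rewrite addr_gt0.
  have d1' := is_derive_xlogx cp; have d2' := is_derive_xlogx cy.
  have dcy : is_derive c 1 (fun u : R => u + y) 1.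
    have := is_derive_addc y c; congr is_derive; apply/funext => u; exact: addrC.
  have dd := @is_derive_comp _ (@xlogx R) (fun u => u + y) c _ _ d2' dcy.
  apply: (is_derive_conv (is_deriveB (is_deriveB dd d1') (is_derive_cst (xlogx y) c 1))).
  by rewrite subr0 mulr1; ring.
move=> _; have cp := c0 c cD; have cy : 0 < c + y by rewrite addr_gt0.
have q0 : 0 <= b / a * (d2 / d1) by rewrite mulr_ge0// divr_ge0// ltW.
rewrite -ln_div ?posrE// ger0_norm; last first.
  by rewrite ln_ge0// ler_pdivlMr// mul1r lerDl ltW.
rewrite ler_ln ?posrE ?divr_gt0//; last by rewrite ltr_wpDr.
rewrite mulrDl mulfV ?gt_eqF// lerD2l ler_pdivrMr//.
apply: (le_trans y2); have -> : b / a * (d2 / d1) * c = b * d2 * (c / (a * d1)).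
  by field; rewrite !gt_eqF.
by rewrite ler_peMr ?mulr_ge0 ?(ltW b0) ?(ltW d20)// ler_pdivlMr// mul1r.
Qed.

(** By [ln1D_sqr] the squared Lipschitz constant in [x] is a multiple of [d2 / d1], and
    [(x - x') ^ 2 <= d1 * I1] cancels the denominator; likewise in [y]. Gaps of length 0 are treated
    apart, [eta] vanishing there. *)
Lemma eta_sqr (a b d1 d2 x x' y y' I1 I2 : R) : 0 < a -> a <= b -> 0 <= d1 -> 0 <= d2 ->
  a * d1 <= x <= b * d1 -> a * d1 <= x' <= b * d1 ->
  a * d2 <= y <= b * d2 -> a * d2 <= y' <= b * d2 ->
  0 <= I1 -> 0 <= I2 -> (x - x') ^+ 2 <= d1 * I1 -> (y - y') ^+ 2 <= d2 * I2 ->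
  (eta x y - eta x' y') ^+ 2 <= 8 * (b / a) * (d2 * I1 + d1 * I2).
Proof.
move=> a0 ab.
have C0 : 0 <= b / a by apply: divr_ge0; [exact: le_trans (ltW a0) ab|exact: ltW].
have C8 : 0 <= 8 * (b / a) by rewrite mulr_ge0.
rewrite le_eqVlt => /predU1P[<-|d10].
  move=> d20; rewrite !mulr0 => /le_anti <- /le_anti <- _ _ I10 I20 _ _.
  have e0 z : eta 0 z = 0 by rewrite /eta add0r (@xlogx_le0 _ 0)// subr0 subrr.
  by rewrite !e0 subrr expr0n/= mulr_ge0// mul0r addr0 mulr_ge0.
rewrite le_eqVlt => /predU1P[<-|d20].
  rewrite !mulr0 => _ _ /le_anti <- /le_anti <- I10 I20 _ _.
  have e0 z : eta z 0 = 0 by rewrite etaC /eta add0r (@xlogx_le0 _ 0)// subr0 subrr.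
  by rewrite !e0 subrr expr0n/= mulr_ge0// mul0r add0r mulr_ge0// ltW.
move=> xb xb' yb yb' I10 I20 hx hy.
have r12 : 0 <= b / a * (d2 / d1) by rewrite mulr_ge0// divr_ge0// ltW.
have r21 : 0 <= b / a * (d1 / d2) by rewrite mulr_ge0// divr_ge0// ltW.
have e1 := eta_lip a0 ab d10 d20 xb xb' yb.
have e2 : `|eta x' y - eta x' y'| <= ln (1 + b / a * (d1 / d2)) * `|y - y'|.
  by rewrite ![eta x' _]etaC; exact: (eta_lip a0 ab d20 d10 yb yb' xb').
have s1 : (eta x y - eta x' y) ^+ 2 <= 4 * (b / a) * (d2 * I1).
  rewrite -(real_normK (num_real _)).
  apply: (@le_trans _ _ ((ln (1 + b / a * (d2 / d1)) * `|x - x'|) ^+ 2)).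
    by rewrite lerXn2r// nnegrE (le_trans _ e1).
  rewrite exprMn (real_normK (num_real _)).
  apply: (@le_trans _ _ (4 * (b / a * (d2 / d1)) * (d1 * I1))).
    by apply: ler_pM; rewrite ?sqr_ge0//; exact: ln1D_sqr.
  by rewrite le_eqVlt; apply/orP; left; apply/eqP; field; rewrite !gt_eqF.
have s2 : (eta x' y - eta x' y') ^+ 2 <= 4 * (b / a) * (d1 * I2).
  rewrite -(real_normK (num_real _)).
  apply: (@le_trans _ _ ((ln (1 + b / a * (d1 / d2)) * `|y - y'|) ^+ 2)).
    by rewrite lerXn2r// nnegrE (le_trans _ e2).
  rewrite exprMn (real_normK (num_real _)).
  apply: (@le_trans _ _ (4 * (b / a * (d1 / d2)) * (d2 * I2))).
    by apply: ler_pM; rewrite ?sqr_ge0//; exact: ln1D_sqr.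
  by rewrite le_eqVlt; apply/orP; left; apply/eqP; field; rewrite !gt_eqF.
have -> : eta x y - eta x' y' = (eta x y - eta x' y) + (eta x' y - eta x' y') by ring.
move: s1 s2; move: (eta x y - eta x' y) (eta x' y - eta x' y') => p q.
by have := sqr_ge0 (p - q); nra.
Qed.

End eta.

Section insertion_bound.
Context {R : realType} (mu : probability R R).
Hypothesis muE : forall phi : R -> \bar R, measurable_fun setT phi -> (forall x, 0 <= phi x)%E ->
  (\int[mu]_x phi x = \int[lebesgue_measure]_(x in `[0%R, 1%R]) phi x)%E.
Variables (a b : R) (H H' dl : R -> R).
Hypothesis a0 : 0 < a.
Hypothesis ab : a <= b.
Hypothesis Hab : forall x u, 0 <= x -> x <= u -> u <= 1 -> a * (u - x) <= H u - H x <= b * (u - x).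
Hypothesis Hab' : forall x u, 0 <= x -> x <= u -> u <= 1 -> a * (u - x) <= H' u - H' x <= b * (u - x).
Hypothesis mdl : measurable_fun setT dl.
Hypothesis dl0 : forall x, 0 <= dl x.

(** In the application [dl] is [(h - h') ^ 2], and the hypothesis that follows is the Cauchy-Schwarz
    inequality on [[p, x]]. *)
Definition dmass (p x : R) : R := \int[mu]_v (dl v * (p <= v <= x)%R%:R).

Hypothesis HH' : forall p x, 0 <= p -> p <= x -> x <= 1 ->
  ((H x - H p) - (H' x - H' p)) ^+ 2 <= (x - p) * dmass p x.

Definition gapdiff (s : seq R) : R := gapsum (gapx H) 1 s - gapsum (gapx H') 1 s.

(** The left and right neighbours of [x] in the sample; the defaults 0 and 1 are the endpoints of
    the interval. *)
Definition lower x (s : seq R) : R := last 0 [seq y <- sort <=%R s | y <= x].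
Definition upper x (s : seq R) : R := head 1 [seq y <- sort <=%R s | x < y].

Let I0 p x : 0 <= dmass p x.
Proof. by rewrite /dmass Rintegral_ge0// => v _; rewrite mulr_ge0. Qed.

Lemma lower_upper x s : 0 <= x <= 1 -> all (fun y => 0 <= y <= 1) s ->
  0 <= lower x s <= x /\ x <= upper x s <= 1.
Proof.
move=> /andP[x0 x1] /allP s01.
have ss : forall y, y \in sort <=%R s -> 0 <= y <= 1 by move=> y; rewrite mem_sort; exact: s01.
split.
  rewrite /lower; have : {in [seq y <- sort <=%R s | y <= x], forall y, 0 <= y <= x}.
    by move=> y; rewrite mem_filter => /andP[-> /ss/andP[-> _]].
  case: [seq y <- _ | y <= x] => [_|y t h] /=; first by rewrite lexx.
  by apply: h; exact: mem_last.
rewrite /upper; have : {in [seq y <- sort <=%R s | x < y], forall y, x <= y <= 1}.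
  by move=> y; rewrite mem_filter => /andP[/ltW -> /ss/andP[_ ->]].
case: [seq y <- _ | x < y] => [_|y t h] /=; first by rewrite x1 lexx.
by apply: h; exact: mem_head.
Qed.

(** Replaces the random neighbours of [x] by fixed [v] and [r]: that no point falls strictly between
    these is an event factorising over independent points. *)
Lemma gap_empty x s v r : lower x s <= v -> r <= upper x s ->
  all (fun y => ~~ (v < y < r)) s.
Proof.
move=> pv rq; apply/allP => y ys.
have yss : y \in sort <=%R s by rewrite mem_sort.
have hs : sorted <=%R (sort <=%R s) by exact/sort_sorted/le_total.
have [yx|xy] := leP y x.
  have : y \in [seq z <- sort <=%R s | z <= x] by rewrite mem_filter yx.
  move: pv; rewrite /lower; have := sorted_filter le_trans (fun z => z <= x) hs.
  case: [seq z <- _ | z <= x] => // z t zt /= pv.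
  move=> yt; rewrite negb_and -leNgt; apply/orP; left; apply: le_trans pv.
  move: yt; rewrite inE => /predU1P[->|yt].
    by case/lastP: t zt => //= t w; rewrite last_rcons => /(order_path_min le_trans)/allP; apply; rewrite mem_rcons mem_head.
  elim: t z zt yt => //= w t IH z /andP[_ wt]; rewrite inE => /predU1P[->|yt]; last exact: IH wt yt.
  by case/lastP: t wt {IH} => //= t w'; rewrite last_rcons => /(order_path_min le_trans)/allP; apply; rewrite mem_rcons mem_head.
have : y \in [seq z <- sort <=%R s | x < z] by rewrite mem_filter xy.
move: rq; rewrite /upper; have := sorted_filter le_trans (fun z => x < z) hs.
case: [seq z <- _ | x < z] => // z t zt /= rq.
rewrite inE negb_and -[~~ (y < r)]leNgt => yt; apply/orP; right; apply: (le_trans rq).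
case/predU1P: yt => [->//|yt].
by have /allP := order_path_min le_trans zt; exact.
Qed.

Lemma gapdiff_insert x s : 0 <= x <= 1 -> all (fun y => 0 <= y <= 1) s ->
  (gapdiff (x :: s) - gapdiff s) ^+ 2 <=
  8 * (b / a) * ((upper x s - x) * dmass (lower x s) x + (x - lower x s) * dmass x (upper x s)).
Proof.
move=> x01 s01; have [/andP[p0 px] /andP[xq q1]] := lower_upper x01 s01.
have E K : gapsum (gapx K) 1 (x :: s) - gapsum (gapx K) 1 s =
   - eta (K x - K (lower x s)) (K (upper x s) - K x).
  have st : sorted <=%R (sort <=%R s) by exact/sort_sorted/le_total.
  rewrite /gapsum sort_insert; have := sorted_split x st.
  set s1 := [seq y <- _ | y <= x]; set s2 := [seq y <- _ | x < y] => ->; rewrite gsum_insert /eta /gapx -/(lower x s) -/(upper x s).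
  by rewrite [K x - _ + _]addrC addrA subrK; ring.
have -> : gapdiff (x :: s) - gapdiff s =
  - (eta (H x - H (lower x s)) (H (upper x s) - H x) - eta (H' x - H' (lower x s)) (H' (upper x s) - H' x)).
  by rewrite /gapdiff opprB -(opprK (eta (H x - _) _)) -!E; ring.
have /andP[x0 x1] := x01.
rewrite sqrrN; apply: eta_sqr; rewrite ?subr_ge0 ?I0//.
- exact: Hab.
- exact: Hab'.
- exact: Hab.
- exact: Hab'.
- exact: HH'.
- exact: HH'.
Qed.

End insertion_bound.

Section FTC_interval.
Context {R : realType}.
Local Notation leb := (@lebesgue_measure R).

Lemma integral_FTC (f F : R -> R) (p q : R) : p <= q -> continuous f -> continuous F ->
  (forall x : R, is_derive x 1 F (f x)) ->
  (\int[leb]_(x in `[p, q]) (f x)%:E = (F q - F p)%:E)%E.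
Proof.
rewrite le_eqVlt => /predU1P[<- _ _ _|pq cf cF dF].
  rewrite subrr set_itv1 integral_set1//.
rewrite (@continuous_FTC2 _ f F)//.
- exact: continuous_subspaceT.
- split=> [x _||]; first by have [] := dF x.
    by apply: cvg_at_right_filter; exact: cF.
  by apply: cvg_at_left_filter; exact: cF.
- by move=> x _; rewrite derive1E; have [_ ->] := dF x.
Qed.

Variable m : nat.
(** For an interval of length [y] in [[0, 1]], the probability that one given uniform point falls
    inside and [m] others do not. *)
Let bt (y : R) : R := y * (1 - y) ^+ m.
Let BT (y : R) : R := (1 - y) ^+ m.+2 / m.+2%:R - (1 - y) ^+ m.+1 / m.+1%:R.

Let dBT (y : R) : is_derive y 1 BT (bt y).
Proof.
have d1 : is_derive y 1 (fun u : R => 1 - u) (- 1).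
  apply: (is_derive_conv (is_deriveB (is_derive_cst (1 : R) y 1) (is_derive_id y (1 : R)))).
  by rewrite sub0r.
have dp k := is_derive_pow k d1.
apply: (is_derive_conv (is_deriveB (is_derive_mul (dp m.+2) (is_derive_cst (m.+2%:R^-1 : R) y 1))
  (is_derive_mul (dp m.+1) (is_derive_cst (m.+1%:R^-1 : R) y 1)))).
rewrite /cst /bt /= !mulr0 !addr0 exprS.
have m1 : (m.+1%:R : R) != 0 by rewrite pnatr_eq0.
have m2 : (m.+2%:R : R) != 0 by rewrite pnatr_eq0.
by move: (m.+1%:R : R) (m.+2%:R : R) m1 m2 => u v u0 v0; field; rewrite u0 v0.
Qed.

Let cbt : continuous bt.
Proof.
move=> y; apply: differentiable_continuous; apply/derivable1_diffP.
have d1 : is_derive y 1 (fun u : R => 1 - u) (0 - 1).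
  exact: (is_deriveB (is_derive_cst (1 : R) y 1) (is_derive_id y (1 : R))).
by have [] := is_derive_mul (is_derive_id y (1 : R)) (is_derive_pow m d1).
Qed.

Let cBT : continuous BT.
Proof.
by move=> y; apply: differentiable_continuous; apply/derivable1_diffP; have [] := dBT y.
Qed.

(** The Beta integral of [bt] over [[0, 1]]. *)
Definition cbeta : R := (m.+1%:R * m.+2%:R)^-1.

Let BT0 : - BT 0 = cbeta.
Proof.
rewrite /BT /cbeta subr0 !expr1n.
have m1 : (m.+1%:R : R) != 0 by rewrite pnatr_eq0.
have m2 : (m.+2%:R : R) != 0 by rewrite pnatr_eq0.
have e : (m.+2%:R : R) = m.+1%:R + 1 by rewrite natr1.
by move: m2; rewrite e; move: (m.+1%:R : R) m1 => u u0 v0; field; rewrite u0 v0.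
Qed.

Let BT_le0 y : 0 <= y <= 1 -> BT y <= 0.
Proof.
move=> /andP[y0 y1]; rewrite /BT subr_le0.
have z0 : 0 <= 1 - y by rewrite subr_ge0.
apply: ler_pM; rewrite ?exprn_ge0 ?invr_ge0//.
  by rewrite ler_wiXn2l// gerBl.
by rewrite lef_pV2 ?posrE// ler_nat.
Qed.

Lemma beta_right (v : R) : 0 <= v <= 1 ->
  (\int[leb]_(r in `[0%R, 1%R]) ((v <= r)%R%:R * bt (r - v))%:E <= cbeta%:E)%E.
Proof.
move=> /andP[v0 v1].
have -> : (\int[leb]_(r in `[0%R, 1%R]) ((v <= r)%R%:R * bt (r - v))%:E =
   \int[leb]_(r in `[v, 1%R]) (bt (r - v))%:E)%E.
  rewrite integral_mkcond [RHS]integral_mkcond; apply: eq_integral => r _; rewrite !patchE.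
  case: ifPn; rewrite ?inE ?notin_setE/= in_itv/= => r01.
    case: ifPn; rewrite ?inE ?notin_setE/= in_itv/=; first by move=> /andP[-> _]; rewrite mul1r.
    by move/andP: r01 => [_ ->]; rewrite andbT => /negP/negbTE->; rewrite mul0r.
  case: ifPn => //; rewrite inE/= in_itv/= => /andP[vr r1]; exfalso; apply: r01.
  by rewrite r1 (le_trans v0).
have cs : continuous (fun r : R => r - v).
  by move=> r; apply: (@continuousB _ R^o); [exact: cvg_id|exact: cst_continuous].
have ds (r : R) : is_derive r 1 (fun u : R => u - v) 1.
  by have := is_derive_addc (- v) r; congr is_derive; apply/funext => u; exact: addrC.
have c1 : continuous (fun r => bt (r - v)).
  by move=> r; apply: (@continuous_comp _ _ _ (fun u : R => u - v) bt); [exact: cs|exact: cbt].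
have c2 : continuous (fun r => BT (r - v)).
  by move=> r; apply: (@continuous_comp _ _ _ (fun u : R => u - v) BT); [exact: cs|exact: cBT].
have d1 (r : R) : is_derive r 1 (fun u => BT (u - v)) (bt (r - v)).
  apply: (is_derive_conv (@is_derive_comp _ BT (fun u => u - v) r _ _ (dBT _) (ds r))).
  by rewrite mulr1.
rewrite (integral_FTC v1 c1 c2 d1) lee_fin subrr -BT0 gerDr BT_le0// subr_ge0 v1/=; lra.
Qed.

Lemma beta_left (r : R) : 0 <= r <= 1 ->
  (\int[leb]_(v in `[0%R, 1%R]) ((v <= r)%R%:R * bt (r - v))%:E <= cbeta%:E)%E.
Proof.
move=> /andP[r0 r1].
have -> : (\int[leb]_(v in `[0%R, 1%R]) ((v <= r)%R%:R * bt (r - v))%:E =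
   \int[leb]_(v in `[0%R, r]) (bt (r - v))%:E)%E.
  rewrite integral_mkcond [RHS]integral_mkcond; apply: eq_integral => v _; rewrite !patchE.
  case: ifPn; rewrite ?inE ?notin_setE/= in_itv/= => v01.
    case: ifPn; rewrite ?inE ?notin_setE/= in_itv/=; first by move=> /andP[_ ->]; rewrite mul1r.
    by move/andP: v01 => [-> _] /= => /negP/negbTE->; rewrite mul0r.
  case: ifPn => //; rewrite inE/= in_itv/= => /andP[v0 vr]; exfalso; apply: v01.
  by rewrite v0 (le_trans vr).
have cs : continuous (fun v : R => r - v).
  by move=> v; apply: (@continuousB _ R^o); [exact: cst_continuous|exact: cvg_id].
have ds (v : R) : is_derive v 1 (fun u : R => r - u) (- 1).
  apply: (is_derive_conv (is_deriveB (is_derive_cst r v 1) (is_derive_id v (1 : R)))).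
  by rewrite sub0r.
have c1 : continuous (fun v => bt (r - v)).
  by move=> v; apply: (@continuous_comp _ _ _ (fun u : R => r - u) bt); [exact: cs|exact: cbt].
have d1 (v : R) : is_derive v 1 (fun u => - BT (r - u)) (bt (r - v)).
  apply: (is_derive_conv (is_derive_neg (@is_derive_comp _ BT (fun u => r - u) v _ _ (dBT _) (ds v)))).
  by rewrite mulrN mulr1 opprK.
have c2 : continuous (fun v => - BT (r - v)).
  by move=> v; apply: differentiable_continuous; apply/derivable1_diffP; have [] := d1 v.
rewrite (integral_FTC r0 c1 c2 d1) lee_fin subrr subr0 BT0 opprK gerDl BT_le0// r0 r1//.
Qed.
End FTC_interval.

Section uniform_law.
Context {R : realType} (mu : probability R R).
Local Notation leb := (@lebesgue_measure R).
Hypothesis muE : forall phi : R -> \bar R, measurable_fun setT phi -> (forall x, 0 <= phi x)%E ->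
  (\int[mu]_x phi x = \int[leb]_(x in `[0%R, 1%R]) phi x)%E.

Lemma uniform_sub (A : set R) : measurable A -> A `<=` `[0, 1]%classic -> mu A = leb A.
Proof.
move=> mA A01.
transitivity (\int[mu]_x (\1_A x)%:E)%E; first by rewrite integral_indic// setIT.
rewrite muE//; last by apply/measurable_EFinP; exact: measurable_indic.
rewrite integral_indic//.
have -> : A `&` `[0, 1]%classic = A by exact: setIidl.
by [].
Qed.

Lemma uniform_cc (p q : R) : 0 <= p -> p <= q -> q <= 1 -> mu `[p, q]%classic = (q - p)%:E.
Proof.
move=> p0 pq q1; rewrite uniform_sub//; last first.
  by move=> x /=; rewrite !in_itv/= => /andP[px xq]; rewrite (le_trans p0)//= (le_trans xq).
rewrite lebesgue_measure_itv/= lte_fin; move: pq; rewrite le_eqVlt => /predU1P[->|->].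
  by rewrite ltxx subrr.
by rewrite EFinB.
Qed.

Lemma uniform_oo (p q : R) : 0 <= p -> p <= q -> q <= 1 -> mu (~` `]p, q[%classic) = (1 - (q - p))%:E.
Proof.
move=> p0 pq q1; rewrite probability_setC// uniform_sub//; last first.
  by move=> x /=; rewrite !in_itv/= => /andP[px xq]; rewrite (le_trans p0 (ltW px))//= (le_trans (ltW xq)).
rewrite lebesgue_measure_itv/= lte_fin; move: pq; rewrite le_eqVlt => /predU1P[->|->].
  by rewrite ltxx subrr subr0 sube0.
by rewrite -!EFinB.
Qed.

Lemma Ex_uniform_cc (p q : R) : 0 <= p -> p <= q -> q <= 1 ->
  Ex mu (fun r => (p <= r <= q)%R%:R) = q - p.
Proof.
move=> p0 pq q1.
have mi : measurable (`[p, q] : set R) by exact: measurable_itv.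
rewrite (@eq_Ex _ _ _ mu _ (fun r => \1_(`[p, q]%classic) r)); last first.
  move=> r; rewrite indicE; congr (_%:R); congr nat_of_bool.
  by apply/idP/idP; rewrite inE/= in_itv.
rewrite /Ex /Rintegral integral_indic// setIT.
exact: (congr1 fine (uniform_cc p0 pq q1)).
Qed.

End uniform_law.

(** * The mean square cost of an insertion *)

Section tonelli.
Context {R : realType} d (T : measurableType d) (P : probability T R) (mu : probability R R).
Local Notation leb := (@lebesgue_measure R).
Hypothesis muE : forall phi : R -> \bar R, measurable_fun setT phi -> (forall x, 0 <= phi x)%E ->
  (\int[mu]_x phi x = \int[leb]_(x in `[0%R, 1%R]) phi x)%E.
Variables (U : nat -> T -> R).
Hypothesis HU : iid P mu U.
Hypothesis U01 : forall i w, 0 <= U i w <= 1.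
Variables (a b : R) (H H' dl : R -> R) (Cd : R).
Hypothesis a0 : 0 < a.
Hypothesis ab : a <= b.
Hypothesis Hab : forall x u, 0 <= x -> x <= u -> u <= 1 -> a * (u - x) <= H u - H x <= b * (u - x).
Hypothesis Hab' : forall x u, 0 <= x -> x <= u -> u <= 1 -> a * (u - x) <= H' u - H' x <= b * (u - x).
Hypothesis mH : measurable_fun setT H.
Hypothesis mH' : measurable_fun setT H'.
Hypothesis mdl : measurable_fun setT dl.
Hypothesis dl0 : forall x, 0 <= dl x.
Hypothesis dlC : forall x, dl x <= Cd.
Hypothesis HH' : forall p x, 0 <= p -> p <= x -> x <= 1 ->
  ((H x - H p) - (H' x - H' p)) ^+ 2 <= (x - p) * dmass mu dl p x.

Variable m : nat.
Let rest : seq nat := iota 1 m.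
Let bdl : bm dl.
Proof. by split => //; exists Cd => x; rewrite ger0_norm. Qed.

Let J (w : T) (v r : R) : bool := (v <= U 0 w <= r) && all (fun y => ~~ (v < y < r)) (sample U rest w).

Let mJ : measurable_fun [set: T * (R * R)] (fun z => J z.1 z.2.1 z.2.2).
Proof.
have mv : measurable_fun [set: T * (R * R)] (fun z => z.2.1) by exact: measurableT_comp.
have mr : measurable_fun [set: T * (R * R)] (fun z => z.2.2) by exact: measurableT_comp.
have mU i : measurable_fun [set: T * (R * R)] (fun z => U i z.1).
  exact: (measurableT_comp (HU.1 i)).
apply: measurable_and; first by apply: measurable_and; exact: measurable_fun_ler.
elim: rest => [|i s IH] /=; first exact: measurable_cst.
apply: measurable_and => //; apply: measurable_neg.
by apply: measurable_and; exact: measurable_fun_ltr.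
Qed.

(** Writing the lengths [q - x] and [x - p] as integrals over a second uniform variable merges the
    two terms of [gapdiff_insert] into one double integral over [v <= x <= r]. *)
Let g (w : T) (z : R * R) : \bar R := ((dl z.1 + dl z.2) * (J w z.1 z.2)%:R)%:E.

Let g0 w z : (0 <= g w z)%E. Proof. by rewrite lee_fin mulr_ge0// addr_ge0. Qed.

Let mg : measurable_fun [set: T * (R * R)] (fun q => g q.1 q.2).
Proof.
apply/measurable_EFinP; apply: measurable_funM; last exact: measurable_bool.
apply: measurable_funD.
  have mv : measurable_fun [set: T * (R * R)] (fun z => z.2.1) by exact: measurableT_comp.
  exact: (measurableT_comp mdl mv).
have mr : measurable_fun [set: T * (R * R)] (fun z => z.2.2) by exact: measurableT_comp.
exact: (measurableT_comp mdl mr).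
Qed.

Let phi0 (z : R * R) : \bar R := (\int[P]_w (J w z.1 z.2)%:R%:E)%E.

Let mphi0 : measurable_fun setT phi0.
Proof.
have mj : measurable_fun [set: T * (R * R)] (fun q => ((J q.1 q.2.1 q.2.2)%:R%:E : \bar R)).
  by apply/measurable_EFinP; exact: measurable_bool.
have j0 q : (0 <= ((J q.1 q.2.1 q.2.2)%:R%:E : \bar R))%E by rewrite lee_fin.
exact: (@measurable_fun_fubini_tonelli_G _ _ _ _ _ P _ mj j0).
Qed.

Let phi00 z : (0 <= phi0 z)%E. Proof. by apply: integral_ge0 => w _; rewrite lee_fin. Qed.

Lemma hit_probability (v r : R) : 0 <= v <= 1 -> 0 <= r <= 1 ->
  (phi0 (v, r) <= ((v <= r)%R%:R * ((r - v) * (1 - (r - v)) ^+ m))%:E)%E.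
Proof.
move=> /andP[v0 v1] /andP[r0 r1]; rewrite /phi0 /=.
have [vr|rv] := leP v r; last first.
  rewrite mul0r (eq_integral (fun=> 0%E)) ?integral0// => w _.
  rewrite /J; case: (boolP (v <= _ <= r)) => // /andP[h1 h2].
  by have := lt_le_trans rv (le_trans h1 h2); rewrite ltxx.
rewrite mul1r.
pose B (i : nat) : set R := if i == 0%N then `[v, r]%classic else ~` `]v, r[%classic.
have mB i : measurable (B i).
  by rewrite /B; case: ifP => _; [exact: measurable_itv|apply: measurableC; exact: measurable_itv].
have := HU.2 (0%N :: rest) B _ mB; rewrite /= iota_uniq andbT mem_iota/= => /(_ isT).
rewrite big_cons /= [B 0%N]/B eqxx (uniform_cc muE v0 vr r1).
have -> : (\prod_(j <- rest) mu (B j))%E = ((1 - (r - v)) ^+ m)%:E.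
  rewrite -(size_iota 1 m) -/rest.
  have : 0%N \notin rest by rewrite mem_iota.
  elim: rest => [_|j s IH]; first by rewrite big_nil expr0.
  rewrite inE negb_or => /andP[j0 s0].
  by rewrite big_cons IH// /B eq_sym (negbTE j0) (uniform_oo muE v0 vr r1) -EFinM exprS.
rewrite -EFinM => <-.
set S := \bigcap_(i in _) _.
have mS : measurable S.
  apply: fin_bigcap_measurable => // i _.
  by rewrite -[X in measurable X]setTI; exact: HU.1.
rewrite (eq_integral (fun w => (\1_S w)%:E)) ?integral_indic ?setIT// => w _.
rewrite indicE; congr (_%:R%:E); congr nat_of_bool; apply/idP/idP.
  move=> /andP[h1 /allP h2]; rewrite inE => i /=; rewrite inE => /predU1P[->|ir].
    by rewrite /B eqxx /= in_itv.
  have i0 : i != 0%N by apply: contraTneq ir => ->; rewrite mem_iota.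
  rewrite /B (negbTE i0) /= in_itv/=; apply/negP; apply: h2.
  by apply/mapP; exists i.
rewrite inE => hS; apply/andP; split.
  by have := hS 0%N (mem_head _ _); rewrite /B eqxx /= in_itv.
apply/allP => _ /mapP[i ir ->].
have i0 : i != 0%N by apply: contraTneq ir => ->; rewrite mem_iota.
have := hS i; rewrite /= inE ir orbT => /(_ isT); rewrite /B (negbTE i0) /= in_itv/=.
by move/negP.
Qed.

Let D : R := Ex mu dl.
Let mm : probability (R * R)%type R := (mu \x mu)%E.
Let cb : R := cbeta m.
Let cb0 : 0 <= cb. Proof. by rewrite /cb /cbeta invr_ge0 mulr_ge0. Qed.

Let slice (v : R) : 0 <= v <= 1 -> (\int[mu]_r phi0 (v, r) <= cb%:E)%E.
Proof.
move=> v01; have mv := measurable_fun_pair2 v mphi0.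
rewrite muE//; apply: le_trans (beta_right m v01).
apply: ge0_le_integral => //.
- exact: measurable_funTS.
- apply/measurable_EFinP; apply: measurable_funTS; apply: measurable_funM.
    by apply: measurable_bool; exact: measurable_fun_ler.
  apply: measurable_funM; first exact: measurable_funB.
  by apply: measurable_funX; apply: measurable_funB => //; exact: measurable_funB.
- by move=> r; rewrite /= in_itv/= => r01; exact: hit_probability.
Qed.

Let slice' (r : R) : 0 <= r <= 1 -> (\int[mu]_v phi0 (v, r) <= cb%:E)%E.
Proof.
move=> r01; have mv := measurable_fun_pair1 r mphi0.
rewrite muE//; apply: le_trans (beta_left m r01).
apply: ge0_le_integral => //.
- exact: measurable_funTS.
- apply/measurable_EFinP; apply: measurable_funTS; apply: measurable_funM.
    by apply: measurable_bool; exact: measurable_fun_ler.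
  apply: measurable_funM; first exact: measurable_funB.
  by apply: measurable_funX; apply: measurable_funB => //; exact: measurable_funB.
- by move=> v; rewrite /= in_itv/= => v01; exact: hit_probability.
Qed.

Let weighted (psi : R -> \bar R) : measurable_fun setT psi -> (forall v, 0 <= psi v)%E ->
  (forall v : R, (0 <= v <= 1)%R -> psi v <= (cb)%:E)%E ->
  (\int[mu]_v ((dl v)%:E * psi v) <= (cb * D)%:E)%E.
Proof.
move=> mpsi psi0 hpsi.
have md : measurable_fun setT (fun v => (dl v)%:E) by exact/measurable_EFinP.
rewrite muE; last 2 first.
- exact: emeasurable_funM.
- by move=> v; rewrite mule_ge0// lee_fin.
apply: (@le_trans _ _ (\int[leb]_(v in `[0%R, 1%R]) ((cb)%:E * (dl v)%:E))%E).
  apply: ge0_le_integral => //.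
  - by move=> v _; rewrite mule_ge0// lee_fin.
  - by apply: measurable_funTS; exact: emeasurable_funM.
  - by apply: measurable_funTS; exact: emeasurable_funM.
  - move=> v; rewrite /= in_itv/= => v01; rewrite muleC; apply: lee_wpmul2r; last exact: hpsi.
    by rewrite lee_fin.
rewrite -(muE (phi := fun v => ((cb)%:E * (dl v)%:E)%E)); last 2 first.
- exact: emeasurable_funM.
- by move=> v; rewrite mule_ge0// lee_fin.
have -> : (\int[mu]_v (cb%:E * (dl v)%:E) = cb%:E * \int[mu]_v (dl v)%:E)%E.
  by apply: ge0_integralZl => // *; rewrite lee_fin.
by rewrite (ExE mu bdl).
Qed.

(** After exchanging integrals, the weight [dl] depends on one endpoint only; the integral of the
    hitting probability over the other is at most [cbeta m], whatever the position. *)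
Lemma insertion_mean : (\int[P]_w \int[mu]_v \int[mu]_r g w (v, r) <= (2 * cb * D)%:E)%E.
Proof.
have E1 : (\int[P]_w \int[mu]_v \int[mu]_r g w (v, r) = \int[P]_w \int[mm]_z g w z)%E.
  apply: eq_integral => w _; rewrite fubini_tonelli1//.
  exact: (measurable_fun_pair2 w mg).
rewrite E1 (@fubini_tonelli _ _ _ _ _ P mm (fun q => g q.1 q.2) mg (fun q => g0 q.1 q.2)) /=.
have md1 : measurable_fun setT (fun z : R * R => (dl z.1)%:E).
  by apply/measurable_EFinP; exact: (measurableT_comp mdl).
have md2 : measurable_fun setT (fun z : R * R => (dl z.2)%:E).
  by apply/measurable_EFinP; exact: (measurableT_comp mdl).
have f1 : measurable_fun setT (fun z : R * R => (dl z.1)%:E * phi0 z)%E by exact: emeasurable_funM.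
have f2 : measurable_fun setT (fun z : R * R => (dl z.2)%:E * phi0 z)%E by exact: emeasurable_funM.
have f10 (z : R * R) : (0 <= (dl z.1)%:E * phi0 z)%E by rewrite mule_ge0// lee_fin.
have f20 (z : R * R) : (0 <= (dl z.2)%:E * phi0 z)%E by rewrite mule_ge0// lee_fin.
have -> : (\int[mm]_z \int[P]_w g w z = \int[mm]_z ((dl z.1)%:E * phi0 z + (dl z.2)%:E * phi0 z))%E.
  apply: eq_integral => z _; rewrite /phi0 -ge0_muleDl ?lee_fin// -EFinD -ge0_integralZl//.
  - have mj := measurable_fun_pair1 z mJ.
    by apply/measurable_EFinP; exact: measurable_bool.
  - by rewrite lee_fin addr_ge0.
rewrite ge0_integralD//.
rewrite (@fubini_tonelli1 _ _ _ _ _ mu mu (fun z => (dl z.1)%:E * phi0 z)%E f1 f10).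
rewrite (@fubini_tonelli2 _ _ _ _ _ mu mu (fun z => (dl z.2)%:E * phi0 z)%E f2 f20) /fubini_F /fubini_G /=.
have -> : 2 * cb * D = cb * D + cb * D by ring.
rewrite EFinD; apply: leeD.
  rewrite (eq_integral (fun v => (dl v)%:E * \int[mu]_r phi0 (v, r))%E); last first.
    move=> v _; rewrite ge0_integralZl ?lee_fin//.
    exact: (measurable_fun_pair2 v mphi0).
  apply: weighted => //; first exact: (@measurable_fun_fubini_tonelli_F _ _ _ _ _ mu phi0 mphi0).
  by move=> v; exact: integral_ge0.
rewrite (eq_integral (fun r => (dl r)%:E * \int[mu]_v phi0 (v, r))%E); last first.
  move=> r _; rewrite ge0_integralZl ?lee_fin//.
  exact: (measurable_fun_pair1 r mphi0).
apply: weighted => //; first exact: (@measurable_fun_fubini_tonelli_G _ _ _ _ _ mu phi0 mphi0).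
by move=> v; exact: integral_ge0.
Qed.

Let gapdiff_le w : (((gapdiff H H' (sample U (0%N :: rest) w) - gapdiff H H' (sample U rest w)) ^+ 2)%:E
  <= (8 * (b / a))%:E * \int[mu]_v \int[mu]_r g w (v, r))%E.
Proof.
have s01 : all (fun y => 0 <= y <= 1) (sample U rest w).
  by apply/allP => _ /mapP[i _ ->]; exact: U01.
set x := U 0 w; set s := sample U rest w.
have x01 : 0 <= x <= 1 := U01 0 w.
have [/andP[p0 px] /andP[xq q1]] := lower_upper x01 s01.
have /andP[x0 x1] := x01.
have C0 : 0 <= 8 * (b / a).
  by rewrite mulr_ge0// divr_ge0 ?(le_trans (ltW a0) ab)// ltW.
have := gapdiff_insert a0 ab Hab Hab' dl0 HH' x01 s01.
set p := lower x s in p0 px *; set q := upper x s in xq q1 *.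
rewrite -/s => hI.
apply: (@le_trans _ _ (8 * (b / a) * ((q - x) * dmass mu dl p x + (x - p) * dmass mu dl x q))%:E).
  by rewrite lee_fin.
rewrite EFinM; apply: lee_wpmul2l; first by rewrite lee_fin.
pose Av (v : R) : R := (p <= v <= x)%R%:R; pose Br (r : R) : R := (x <= r <= q)%R%:R.
have bmi (y z : R) : bm (fun v : R => ((y <= v <= z)%R%:R : R)).
  split; last by exists 1 => v; case: (_ && _); rewrite ?normr1 ?normr0.
  by apply: measurable_bool; apply: measurable_and; exact: measurable_fun_ler.
have bA : bm Av := bmi p x; have bB : bm Br := bmi x q.
have bdA := bmM bdl bA; have bdB := bmM bdl bB.
have inner v : (\int[mu]_r ((dl v + dl r) * (Av v * Br r))%:E =
    ((dl v * Av v) * (q - x) + Av v * dmass mu dl x q)%:E)%E.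
  have -> : (fun r => ((dl v + dl r) * (Av v * Br r))%:E) =
    (fun r => (dl v * Av v * Br r + Av v * (dl r * Br r))%:E).
    by apply/funext => r; congr EFin; ring.
  have b1 := bmZ (dl v * Av v) bB; have b2 := bmZ (Av v) bdB.
  rewrite ExE; last exact: bmD.
  by rewrite (ExD mu b1 b2) (ExZ mu _ bB) (ExZ mu _ bdB) (Ex_uniform_cc muE).
have outer : (\int[mu]_v ((dl v * Av v) * (q - x) + Av v * dmass mu dl x q)%:E =
    ((q - x) * dmass mu dl p x + (x - p) * dmass mu dl x q)%:E)%E.
  have -> : (fun v => ((dl v * Av v) * (q - x) + Av v * dmass mu dl x q)%:E) =
    (fun v => ((q - x) * (dl v * Av v) + dmass mu dl x q * Av v)%:E).
    by apply/funext => v; congr EFin; ring.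
  have b1 := bmZ (q - x) bdA; have b2 := bmZ (dmass mu dl x q) bA.
  rewrite ExE; last exact: bmD.
  rewrite (ExD mu b1 b2) (ExZ mu _ bdA) (ExZ mu _ bA) (Ex_uniform_cc muE)//.
  by congr EFin; rewrite [in RHS](mulrC (x - p)).
rewrite -outer; under eq_integral do rewrite -inner.
have mgw : measurable_fun setT (g w) := measurable_fun_pair2 w mg.
apply: ge0_le_integral => //.
- by move=> v _; apply: integral_ge0 => r _; rewrite lee_fin !mulr_ge0// addr_ge0.
- under eq_fun do rewrite inner.
  apply/measurable_EFinP; apply: measurable_funD; apply: measurable_funM => //; first by case: bdA.
  by case: bA.
- exact: (@measurable_fun_fubini_tonelli_F _ _ _ _ _ mu (g w) mgw).
move=> v _; apply: ge0_le_integral => //.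
- by move=> r _; rewrite lee_fin !mulr_ge0// addr_ge0.
- apply/measurable_EFinP; apply: measurable_funM; first exact: measurable_funD.
  by apply: measurable_funM => //; case: bB.
- exact: (measurable_fun_pair2 v mgw).
move=> r _; rewrite lee_fin; apply: ler_wpM2l; first by rewrite addr_ge0.
rewrite /Av /Br -natrM ler_nat mulnb.
case: (boolP (_ && _)) => //= /andP[/andP[pv vx] /andP[xr rq]].
by rewrite /J -/x vx xr /= (gap_empty (x := x)).
Qed.

Lemma gamma_bound :
  (\int[P]_w ((gapdiff H H' (sample U (0%N :: rest) w) - gapdiff H H' (sample U rest w)) ^+ 2)%:E
  <= (16 * (b / a) * cb * D)%:E)%E.
Proof.
have C0 : 0 <= 8 * (b / a).
  by rewrite mulr_ge0// divr_ge0 ?(le_trans (ltW a0) ab)// ltW.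
have mI : measurable_fun setT (fun w => \int[mu]_v \int[mu]_r g w (v, r))%E.
  rewrite (_ : (fun _ => _) = fun w => (\int[mm]_z g w z)%E).
    exact: (@measurable_fun_fubini_tonelli_F _ _ _ _ _ mm (fun q => g q.1 q.2) mg).
  apply/funext => w; rewrite fubini_tonelli1//.
  exact: (measurable_fun_pair2 w mg).
have I0 w : (0 <= \int[mu]_v \int[mu]_r g w (v, r))%E.
  by apply: integral_ge0 => v _; apply: integral_ge0.
apply: (@le_trans _ _ (\int[P]_w ((8 * (b / a))%:E * \int[mu]_v \int[mu]_r g w (v, r)))%E).
  apply: ge0_le_integral => //.
  - by move=> w _; rewrite lee_fin sqr_ge0.
  - have ms K r : measurable_fun setT K -> measurable_fun setT (fun w => gapsum (gapx K) 1 (sample U r w)).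
      move=> mK; apply/measurable_EFinP.
      apply: (measurable_sample HU (F := fun s => (gapsum (gapx K) 1 s)%:E)).
      by apply/measurable_EFinP; apply: measurable_gapsum; exact: measurable_gapx.
    apply/measurable_EFinP; apply: measurable_funX.
    by apply: measurable_funB; apply: measurable_funB; exact: ms.
  - exact: emeasurable_funM.
have -> : (\int[P]_w ((8 * (b / a))%:E * \int[mu]_v \int[mu]_r g w (v, r)) =
    (8 * (b / a))%:E * \int[P]_w \int[mu]_v \int[mu]_r g w (v, r))%E.
  by apply: ge0_integralZl => //; rewrite lee_fin.
have -> : 16 * (b / a) * cb * D = 8 * (b / a) * (2 * cb * D) by ring.
have -> : ((8 * (b / a) * (2 * cb * D))%:E = (8 * (b / a))%:E * (2 * cb * D)%:E)%E by rewrite -EFinM.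
by apply: lee_wpmul2l; [rewrite lee_fin|exact: insertion_mean].
Qed.

End tonelli.

Section iid_mean.
Context {R : realType} d (T : measurableType d) (P : probability T R) (mu : probability R R).
Variables (U : nat -> T -> R).
Hypothesis HU : iid P mu U.

Lemma Ex_sample (s : seq nat) (F : seq R -> R) : uniq s -> bseq (size s) F ->
  bm (fun w => F (sample U s w)) /\ Ex P (fun w => F (sample U s w)) = tmean mu (size s) F.
Proof.
move=> us bF; have [mF [C hC]] := bF.
have mS : measurable_fun setT (fun w => F (sample U s w)).
  apply/measurable_EFinP; apply: (measurable_sample HU (F := fun t => (F t)%:E)).
  exact/measurable_EFinP.
have hS w : `|F (sample U s w)| <= C.
  exact: (hC [the (size s).-tuple R of map (fun i => U i w) (in_tuple s)]).
have bS : bm (fun w => F (sample U s w)) by split => //; exists C.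
split => //.
pose G t : \bar R := (`|F t + C|)%:E.
have mG : mseq (size s) G.
  by apply/measurable_EFinP; apply: measurableT_comp => //; exact: measurable_funD.
have G0 t : (0 <= G t)%E by rewrite lee_fin.
have bC : bm (fun _ : T => C) by exact: bm_cst.
have bC' : bm (fun _ : (size s).-tuple R => C) by exact: bm_cst.
have pos x : `|x| <= C -> `|x + C| = x + C.
  by rewrite ler_norml => /andP[h _]; rewrite ger0_norm// -lerBlDr sub0r.
have : (Ex P (fun w => F (sample U s w)) + C)%:E = (tmean mu (size s) F + C)%:E.
  rewrite -[X in (_ + X)%:E = _](Ex_cst P C) -ExD// -[X in _ = (_ + X)%:E](Ex_cst (tpow mu (size s)) C) -ExD//.
  rewrite -ExE; last exact: bmD.
  rewrite -ExE; last exact: bmD.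
  transitivity (\int[P]_w G (sample U s w))%E.
    by apply: eq_integral => w _; rewrite /G pos.
  rewrite (iid_int HU us mG G0); apply: eq_integral => t _.
  by rewrite /G pos.
by move=> [] /addIr.
Qed.

End iid_mean.

Section efron_stein.
Context {R : realType} d (T : measurableType d) (P : probability T R) (mu : probability R R).
Hypothesis muE : forall phi : R -> \bar R, measurable_fun setT phi -> (forall x, 0 <= phi x)%E ->
  (\int[mu]_x phi x = \int[lebesgue_measure]_(x in `[0%R, 1%R]) phi x)%E.
Variables (U : nat -> T -> R).
Hypothesis HU : iid P mu U.
Hypothesis U01 : forall i w, 0 <= U i w <= 1.
Variables (a b : R) (H H' dl : R -> R) (Cd : R).
Hypothesis a0 : 0 < a.
Hypothesis ab : a <= b.
Hypothesis Hab : forall x u, 0 <= x -> x <= u -> u <= 1 -> a * (u - x) <= H u - H x <= b * (u - x).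
Hypothesis Hab' : forall x u, 0 <= x -> x <= u -> u <= 1 -> a * (u - x) <= H' u - H' x <= b * (u - x).
Hypothesis Hb : forall x, 0 <= H x <= b.
Hypothesis Hb' : forall x, 0 <= H' x <= b.
Hypothesis mH : measurable_fun setT H.
Hypothesis mH' : measurable_fun setT H'.
Hypothesis mdl : measurable_fun setT dl.
Hypothesis dl0 : forall x, 0 <= dl x.
Hypothesis dlC : forall x, dl x <= Cd.
Hypothesis HH' : forall p x, 0 <= p -> p <= x -> x <= 1 ->
  ((H x - H p) - (H' x - H' p)) ^+ 2 <= (x - p) * dmass mu dl p x.

Lemma bseq_gapsum (K : R -> R) n : measurable_fun setT K -> (forall x, 0 <= K x <= b) ->
  bseq n (gapsum (gapx K) 1).
Proof.
move=> mK Kb; split; first by apply: measurable_gapsum; exact: measurable_gapx.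
by exists (n.+1%:R * (2 + b ^+ 2)) => t; have := gapsum_bound Kb 1 t; rewrite size_tuple.
Qed.

Lemma bseq_gapdiff n : bseq n (gapdiff H H').
Proof. by apply: bmB; exact: bseq_gapsum. Qed.

Lemma gapdiff_perm s s' : perm_eq s s' -> gapdiff H H' s = gapdiff H H' s'.
Proof.
by move=> ss; rewrite /gapdiff /gapsum; have /perm_sortP -> := ss;
  [|exact: le_total|exact: le_trans|exact: le_anti].
Qed.

(** Each variable is compared with the same functional of the sample without it. By exchangeability
    the [n] terms agree; each is the mean square cost of one insertion, of order [n^-2] by
    [gamma_bound]. *)
Lemma efron_stein n : (0 < n)%N ->
  Vr P (fun w => gapdiff H H' (sample U (iota 0 n) w)) <= 16 * (b / a) * Ex mu dl / n%:R.
Proof.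
case: n => // m _; set n := m.+1; pose F := gapdiff H H'.
have bF k : bseq k F := bseq_gapdiff k.
pose K i s : R := (F s - F (punct i s)) ^+ 2.
have bK i : (i <= m)%N -> bseq n (K i).
  by move=> im; have b2 := bseq_punct (bF m) im; exact: (bm_sqr (bmB (bF n) b2)).
have un : uniq (iota 0 n) by exact: iota_uniq.
have sn : size (iota 0 n) = n by rewrite size_iota.
have KE i : (i <= m)%N -> tmean mu n (K i) = tmean mu n (K 0%N).
  move=> im; pose si := i :: (take i (iota 0 n) ++ drop i.+1 (iota 0 n)).
  have psi : perm_eq (iota 0 n) si.
    have e : iota 0 n = take i (iota 0 n) ++ [:: i] ++ drop i.+1 (iota 0 n).
      rewrite -{1}(cat_take_drop i (iota 0 n)); congr (_ ++ _).
      by rewrite (drop_nth 0%N) ?sn// nth_iota.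
    by rewrite {1}e /si -cat1s perm_catCA.
  have usi : uniq si by rewrite -(perm_uniq psi).
  have ssi : size si = n by rewrite -(perm_size psi).
  have bKi : bseq (size (iota 0 n)) (K i) by rewrite sn; exact: bK.
  have bK0 : bseq (size si) (K 0%N) by rewrite ssi; exact: bK.
  have [_] := Ex_sample HU un bKi; rewrite sn => <-.
  have [_] := Ex_sample HU usi bK0; rewrite ssi => <-.
  apply: eq_Ex => w; rewrite /K; congr ((_ - _) ^+ 2).
    by apply: gapdiff_perm; exact: perm_map.
  by rewrite /si /sample /= {2}/punct /= drop0 /punct map_cat map_take map_drop.
have bF' : bseq (size (iota 0 n)) F by rewrite sn.
have bF2 : bseq (size (iota 0 n)) (fun s => F s ^+ 2) by exact: bm_sqr.
have [_ E1] := Ex_sample HU un bF'; have [_ E2] := Ex_sample HU un bF2.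
rewrite /Vr E1 E2 sn.
apply: (le_trans (tensor_variance mu (bF n) (bF n.-1))).
rewrite big_nat (eq_bigr (fun=> tmean mu n (K 0%N))); last by move=> i /andP[_ im]; exact: KE.
rewrite -big_nat sumr_const_nat subn0 -[leLHS]mulr_natl.
have bK0 : bseq (size (iota 0 n)) (K 0%N) by rewrite sn; exact: bK.
have [bKS] := Ex_sample HU un bK0; rewrite sn => <-.
have hG : Ex P (fun w => K 0%N (sample U (iota 0 n) w)) <= 16 * (b / a) * cbeta m * Ex mu dl.
  rewrite -lee_fin -ExE//.
  have := gamma_bound muE HU U01 a0 ab Hab Hab' mH mH' mdl dl0 dlC HH' m.
  apply: le_trans; rewrite le_eqVlt; apply/orP; left; apply/eqP.
  by apply: eq_integral => w _; rewrite /K /F /punct /= drop0.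
apply: (le_trans (ler_wpM2l (ler0n _ _) hG)).
have Ed0 : 0 <= Ex mu dl.
  by apply: Ex_ge0 => //; split => //; exists Cd => x; rewrite ger0_norm.
have C0 : 0 <= 16 * (b / a) by rewrite mulr_ge0// divr_ge0 ?(le_trans (ltW a0) ab)// ltW.
have -> : n%:R * (16 * (b / a) * cbeta m * Ex mu dl) = 16 * (b / a) * Ex mu dl * (m.+2%:R)^-1.
  rewrite /cbeta /n; have m1 : (m.+1%:R : R) != 0 by rewrite pnatr_eq0.
  have m2 : (m.+2%:R : R) != 0 by rewrite pnatr_eq0.
  by move: (m.+1%:R : R) (m.+2%:R : R) m1 m2 => u v u0 v0; field; rewrite u0 v0 gt_eqF.
by apply: ler_wpM2l; [exact: mulr_ge0|rewrite lef_pV2 ?posrE// ler_nat].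
Qed.

End efron_stein.

(** * Primitives and Steklov averages *)

Section cauchy_schwarz.
Context d (T : measurableType d) (R : realType) (P : probability T R).

Lemma Ex_CS (f g : T -> R) : bm f -> bm g ->
  Ex P (fun w => f w * g w) ^+ 2 <= Ex P (fun w => f w ^+ 2) * Ex P (fun w => g w ^+ 2).
Proof.
move=> bf bg; set x := Ex P (fun w => f w * g w); set p := Ex P _; set q := Ex P _.
have b1 := bm_sqr bf; have b2 := bmM bf bg; have b3 := bm_sqr bg.
have quad l : 0 <= p + (2 * l) * x + l ^+ 2 * q.
  have b4 := bmZ (2 * l) b2; have b5 := bmZ (l ^+ 2) b3.
  rewrite -(ExZ P _ b2) -(ExZ P _ b3) -(ExD P b1 b4) -(ExD P (bmD b1 b4) b5).
  apply: Ex_ge0; first exact: (bmD (bmD b1 b4) b5).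
  by move=> w; have := sqr_ge0 (f w + l * g w); lra.
have q0 : 0 <= q by apply: Ex_ge0 => // w; exact: sqr_ge0.
move: q0; rewrite le_eqVlt => /predU1P[q0|q0].
  rewrite -q0 mulr0; have [->|x0] := eqVneq x 0; first by rewrite expr0n.
  (* With [q = 0] the polynomial is affine, and at this point it would equal -1. *)
  have := quad (- (p + 1) / (2 * x)); rewrite -q0 mulr0 addr0.
  have -> : 2 * (- (p + 1) / (2 * x)) * x = - (p + 1) by field.
  by lra.
have := quad (- x / q).
have -> : p + 2 * (- x / q) * x + (- x / q) ^+ 2 * q = (p * q - x ^+ 2) / q.
  by field; rewrite gt_eqF.
by rewrite pmulr_lge0 ?invr_gt0// subr_ge0.
Qed.

Lemma Ex_norm_sqr f : bm f -> Ex P (fun w => `|f w|) ^+ 2 <= Ex P (fun w => f w ^+ 2).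
Proof.
move=> [mf [C hC]]; have b1 : bm (fun w => `|f w|).
  split; first exact: measurableT_comp.
  by exists C => w; rewrite normr_id.
rewrite (@eq_Ex _ _ _ P (fun w => f w ^+ 2) (fun w => `|f w| ^+ 2)); last by move=> w; rewrite real_normK// num_real.
exact: Ex_sqr_le.
Qed.

Lemma norm_Ex f : bm f -> `|Ex P f| <= Ex P (fun w => `|f w|).
Proof.
move=> bf; have [mf [C hC]] := bf; have b1 : bm (fun w => `|f w|).
  split; first exact: measurableT_comp.
  by exists C => w; rewrite normr_id.
rewrite ler_norml; apply/andP; split; last by apply: le_Ex => // w; exact: ler_norm.
rewrite -mulN1r -ExZ//; apply: le_Ex => //; first exact: bmZ.
by move=> w; rewrite mulN1r lerNl; have := ler_norm (- f w); rewrite normrN.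
Qed.

End cauchy_schwarz.

Section primitive.
Context {R : realType} (mu : probability R R).
Local Notation leb := (@lebesgue_measure R).
Hypothesis muE : forall phi : R -> \bar R, measurable_fun setT phi -> (forall x, 0 <= phi x)%E ->
  (\int[mu]_x phi x = \int[leb]_(x in `[0%R, 1%R]) phi x)%E.
Implicit Types f h : R -> R.

(** Under the uniform law this is the integral of [f] from 0 to [x], continued by constants outside
    [[0, 1]]. *)
Definition primv f x : R := Ex mu (fun v => f v * (v <= x)%R%:R).

Let bcst (c : R) : bm (fun _ : R => c). Proof. exact: bm_cst. Qed.

Lemma bm_bool (c : R -> bool) : measurable_fun setT c -> bm (fun v => (c v)%:R : R).
Proof.
move=> mc; split; first exact: measurable_bool.
by exists 1 => v; case: (c v); rewrite ?normr1 ?normr0.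
Qed.

Lemma bm_le x : bm (fun v : R => (v <= x)%R%:R : R).
Proof. by apply: bm_bool; exact: measurable_fun_ler. Qed.

Lemma bm_oc p x : bm (fun v : R => (p < v <= x)%R%:R : R).
Proof.
by apply: bm_bool; apply: measurable_and; [exact: measurable_fun_ltr|exact: measurable_fun_ler].
Qed.

Lemma primvB f p x : bm f -> p <= x ->
  primv f x - primv f p = Ex mu (fun v => f v * (p < v <= x)%R%:R).
Proof.
move=> bf px; rewrite /primv -(ExB mu (bmM bf (bm_le x)) (bmM bf (bm_le p))).
apply: eq_Ex => v; rewrite -mulrBr; congr (_ * _).
have [vp|pv] /= := leP v p; first by rewrite (le_trans vp px) subrr.
by rewrite subr0.
Qed.

Lemma Ex_uniform_oc p x : 0 <= p -> p <= x -> x <= 1 ->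
  Ex mu (fun v => (p < v <= x)%R%:R) = x - p.
Proof.
move=> p0 px x1.
have mi : measurable (`]p, x] : set R) by exact: measurable_itv.
rewrite (@eq_Ex _ _ _ mu _ (fun r => \1_(`]p, x]%classic) r)); last first.
  move=> r; rewrite indicE; congr (_%:R); congr nat_of_bool.
  by apply/idP/idP; rewrite inE/= in_itv.
have e : mu `]p, x]%classic = (x - p)%:E.
  rewrite (uniform_sub muE)//; last first.
    by move=> v /=; rewrite !in_itv/= => /andP[pv vx]; rewrite (le_trans p0 (ltW pv))//= (le_trans vx).
  rewrite lebesgue_measure_itv/= lte_fin; move: px; rewrite le_eqVlt => /predU1P[->|->] //.
  by rewrite ltxx subrr.
by rewrite /Ex /Rintegral integral_indic// setIT; exact: (congr1 fine e).
Qed.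

Lemma primv_bounds f a b p x : bm f -> (forall v, a <= f v <= b) ->
  0 <= p -> p <= x -> x <= 1 -> a * (x - p) <= primv f x - primv f p <= b * (x - p).
Proof.
move=> bf fab p0 px x1; rewrite primvB// -(Ex_uniform_oc p0 px x1).
have b1 := bm_oc p x; rewrite -!ExZ//.
by apply/andP; split; apply: le_Ex; (try exact: bmZ); (try exact: bmM);
  move=> v; apply: ler_wpM2r => //; have /andP[] := fab v.
Qed.

Lemma primv_taylor f K p x : bm f -> (forall v u, 0 <= v <= 1 -> 0 <= u <= 1 -> `|f v - f u| <= K * `|v - u|) -> 0 <= K ->
  0 <= p -> p <= x -> x <= 1 -> `|primv f x - primv f p - f x * (x - p)| <= K * (x - p) ^+ 2.
Proof.
move=> bf fK K0 p0 px x1; rewrite primvB//.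
have b1 := bm_oc p x; have x0 := le_trans p0 px.
have e : Ex mu (fun v => f x * (p < v <= x)%R%:R) = f x * (x - p).
  by rewrite ExZ// (Ex_uniform_oc p0 px x1).
have e' : Ex mu (fun v => (K * (x - p)) * (p < v <= x)%R%:R) = K * (x - p) ^+ 2.
  by rewrite ExZ// (Ex_uniform_oc p0 px x1); ring.
have b2 := bmM bf b1; have b3 := bmZ (f x) b1; have b4 := bmB b2 b3.
rewrite -e -e' -ExB//; apply: (le_trans (norm_Ex _ b4)).
apply: le_Ex.
- have [m4 [C hC]] := b4; split; first exact: measurableT_comp.
  by exists C => w; rewrite normr_id.
- exact: bmZ.
move=> v; have [/andP[pv vx]|_] := boolP (p < v <= x); last by rewrite !mulr0 subrr normr0.
rewrite !mulr1 (le_trans (fK v x _ _))//.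
- by rewrite (le_trans p0 (ltW pv)) (le_trans vx).
- by rewrite x0.
by apply: ler_wpM2l => //; rewrite ler0_norm ?opprB ?subr_le0// lerD2l lerN2 ltW.
Qed.

Lemma Ex_uniform_le0 f : bm f -> Ex mu (fun v => f v * (v <= 0)%R%:R) = 0.
Proof.
move=> bf; have := Ex_CS mu bf (bm_le 0).
have -> : Ex mu (fun v => ((v <= 0)%R%:R : R) ^+ 2) = 0.
  have e : (\int[mu]_v (((v <= 0)%R%:R : R) ^+ 2)%:E = 0)%E.
    rewrite muE//; last first.
      by apply/measurable_EFinP; case: (bm_sqr (bm_le 0)).
    transitivity (\int[leb]_(v in `[0%R, 1%R]) (\1_[set (0 : R)] v)%:E)%E.
      apply: eq_integral => v; rewrite inE/= in_itv/= => /andP[v0 _].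
      rewrite indicE in_set1 eq_le v0 andbT.
      by case: (v <= 0); rewrite ?expr1n ?expr0n.
    rewrite integral_indic//; apply/eqP; rewrite eq_le measure_ge0 andbT.
    rewrite -[X in (_ <= X)%E](lebesgue_measure_set1 (0 : R)).
    by apply: le_measure; rewrite ?inE//; exact: measurableI.
  by rewrite /Ex /Rintegral e.
by rewrite mulr0 => h; apply/eqP; rewrite -sqrf_eq0 eq_le h sqr_ge0.
Qed.

Lemma primv0 f : bm f -> primv f 0 = 0. Proof. exact: Ex_uniform_le0. Qed.

Lemma primv1 f : bm f -> primv f 1 = Ex mu f.
Proof.
move=> bf; have := primvB bf ler01; rewrite primv0// subr0 => ->.
have b1 := bm_oc 0 1.
have b2 := bmB (bcst 1) b1.
have := Ex_CS mu bf b2.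
have -> : Ex mu (fun v => (1 - (0 < v <= 1)%R%:R) ^+ 2) = 0.
  rewrite (@eq_Ex _ _ _ mu _ (fun v => 1 - (0 < v <= 1)%R%:R)).
    by rewrite (ExB mu (bcst 1) b1) Ex_cst (Ex_uniform_oc (lexx 0) ler01 (lexx 1)); ring.
  by move=> v; case: (0 < v <= 1); rewrite ?subrr ?expr0n// subr0 expr1n.
rewrite mulr0 => h.
have {}h : Ex mu (fun v => f v * (1 - (0 < v <= 1)%R%:R)) = 0.
  by apply/eqP; rewrite -sqrf_eq0 eq_le h sqr_ge0.
have := ExB mu bf (bmM bf b2); rewrite h subr0 => <-; apply: eq_Ex => v.
by rewrite mulrBr mulr1 subKr.
Qed.

Lemma primv_homo f : bm f -> (forall v, 0 <= f v) -> {homo primv f : x y / x <= y}.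
Proof.
move=> bf f0 x y xy; rewrite -subr_ge0 primvB//; apply: Ex_ge0; first exact: (bmM bf (bm_oc x y)).
by move=> v; rewrite mulr_ge0.
Qed.

Lemma primv_range f b x : bm f -> (forall v, 0 <= f v <= b) -> 0 <= primv f x <= b.
Proof.
move=> bf fb; have bx := bmM bf (bm_le x); apply/andP; split.
  by apply: Ex_ge0 => // v; rewrite mulr_ge0//; have /andP[] := fb v.
rewrite -[leRHS](Ex_cst mu b); apply: le_Ex => //; 
by move=> v; have /andP[h1 h2] := fb v; case: (v <= x); rewrite ?mulr1 ?mulr0// (le_trans h1).
Qed.

(** Adding a constant to [f] makes it nonnegative, so the primitive is a difference of two monotone
    functions. *)
Lemma measurable_primv f : bm f -> measurable_fun setT (primv f).
Proof.
move=> bf; have [mf [C hC]] := bf.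
have C0 : 0 <= C := le_trans (normr_ge0 _) (hC 0).
have b1 := bmD bf (bcst C); have b2 := bcst C.
have -> : primv f = fun x => primv (fun v => f v + C) x - primv (fun _ => C) x.
  apply/funext => x; rewrite /primv -(ExB mu (bmM b1 (bm_le x)) (bmM b2 (bm_le x))).
  by apply: eq_Ex => v; ring.
apply: measurable_funB; apply: nondecreasing_measurable => //; apply: primv_homo => // v.
by have := hC v; rewrite ler_norml => /andP[? _]; rewrite -lerBlDr sub0r.
Qed.

(** The last constant collects the factors by which [K] grows for [h ^ 2], namely [2 * b], for
    [xlogx h], by [xlogx_lip], and for [h] itself. *)
Lemma lipschitz_density h a b K : 0 < a -> 0 <= K -> measurable_fun setT h ->
  (forall v, a <= h v <= b) ->
  (forall v u, 0 <= v <= 1 -> 0 <= u <= 1 -> `|h v - h u| <= K * `|v - u|) ->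
  lip_density h (primv h) (primv (fun v => h v ^+ 2)) (primv (fun v => xlogx (h v))) a b
    (K * (2 * b + (`|ln a| + `|ln b| + 1) + 1)).
Proof.
move=> a0 K0 mh hab hK.
have ab : a <= b by have /andP[] := hab 0; exact: le_trans.
have b0 : 0 < b := lt_le_trans a0 ab.
have h0 v : 0 <= h v by have /andP[/(le_trans (ltW a0))] := hab v.
have bh : bm h by split => //; exists b => v; rewrite ger0_norm//; have /andP[] := hab v.
have bh2 := bm_sqr bh.
have bx : bm (fun v => xlogx (h v)).
  split; first exact: (measurableT_comp measurable_xlogx).
  exists (2 + b ^+ 2) => v; apply: (le_trans (norm_xlogx_sqr _)); rewrite lerD2l.
  by rewrite ler_sqr ?nnegrE ?h0 ?(ltW b0)//; have /andP[] := hab v.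
set c := `|ln a| + `|ln b| + 1.
have c0 : 0 <= c by rewrite /c !addr_ge0.
have K'0 : 0 <= K * (2 * b + c + 1) by rewrite mulr_ge0// !addr_ge0// mulr_ge0// ltW.
have wk f L p x : 0 <= p -> p <= x -> x <= 1 -> L <= 2 * b + c + 1 -> bm f -> 0 <= L ->
  (forall v u, 0 <= v <= 1 -> 0 <= u <= 1 -> `|f v - f u| <= (K * L) * `|v - u|) ->
  `|primv f x - primv f p - f x * (x - p)| <= K * (2 * b + c + 1) * (x - p) ^+ 2.
  move=> p0 px x1 LL bf L0 fL; apply: (le_trans (primv_taylor bf fL _ p0 px x1)).
    exact: mulr_ge0.
  by rewrite ler_wpM2r ?sqr_ge0// ler_wpM2l.
split => //; try exact: measurable_primv; try exact: primv0.
- by move=> x u x0 xu u1; exact: primv_bounds.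
- move=> x u x0 xu u1; have := @primv_bounds _ 0 (b ^+ 2) x u bh2 _ x0 xu u1; rewrite mul0r; apply.
  by move=> v; rewrite sqr_ge0 ler_sqr ?nnegrE ?h0 ?(ltW b0)//; have /andP[] := hab v.
- move=> x u x0 xu u1; apply: (wk h 1) => //; first by move: b0 c0; lra.
  by move=> v v' hv hv'; rewrite mulr1; exact: hK.
- move=> x u x0 xu u1; apply: (wk (fun v => h v ^+ 2) (2 * b)) => //; first by move: c0; lra.
    by rewrite mulr_ge0// ltW.
  move=> v v' hv hv'; rewrite subr_sqr normrM [leRHS]mulrAC.
  apply: ler_pM => //; first exact: hK.
  rewrite ger0_norm; last by rewrite addr_ge0.
  by have /andP[_] := hab v; have /andP[_] := hab v'; lra.
- move=> x u x0 xu u1; apply: (wk (fun v => xlogx (h v)) c) => //; first by move: b0; lra.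
  move=> v v' hv hv'; apply: (le_trans (xlogx_lip a0 (hab v) (hab v'))).
  by rewrite -/c (mulrC K) -mulrA ler_wpM2l//; exact: hK.
move=> u /andP[u0 u1].
have b1 := bm_oc 0 u.
have := primvB bh u0; rewrite primv0// subr0 => ->.
have := primvB bh2 u0; rewrite (primv0 bh2) subr0 => ->.
have e : Ex mu (fun v => ((0 < v <= u)%R%:R : R) ^+ 2) = u.
  rewrite -[RHS]subr0 -(Ex_uniform_oc (lexx 0) u0 u1); apply: eq_Ex => v.
  by case: (_ && _); rewrite ?expr1n ?expr0n.
have := Ex_CS mu (bmM bh b1) b1; rewrite e mulrC; congr (_ <= _).
  by congr (_ ^+ 2); apply: eq_Ex => v; case: (_ && _); rewrite ?mulr1 ?mulr0.
by congr (_ * _); apply: eq_Ex => v; case: (_ && _); rewrite ?mulr1 ?mulr0 ?expr0n.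
Qed.

Lemma primv_diff_sqr h h' p x : bm h -> bm h' -> 0 <= p -> p <= x -> x <= 1 ->
  ((primv h x - primv h p) - (primv h' x - primv h' p)) ^+ 2 <=
  (x - p) * dmass mu (fun v => (h v - h' v) ^+ 2) p x.
Proof.
move=> bh bh' p0 px x1; have b1 := bm_oc p x.
have bd := bmB bh bh'; have bb : bm (fun v : R => (p <= v <= x)%R%:R : R).
  by apply: bm_bool; apply: measurable_and; apply: measurable_fun_ler.
rewrite !primvB// -(ExB mu (bmM bh b1) (bmM bh' b1)) -(Ex_uniform_oc p0 px x1).
rewrite (@eq_Ex _ _ _ mu _ (fun v => ((p < v <= x)%R%:R) * ((h v - h' v) * (p < v <= x)%R%:R))).
  apply: (le_trans (Ex_CS mu b1 (bmM bd b1))).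
  rewrite (@eq_Ex _ _ _ mu (fun v => ((p < v <= x)%R%:R : R) ^+ 2) (fun v => (p < v <= x)%R%:R)); last first.
    by move=> v; case: (_ && _); rewrite ?expr1n ?expr0n.
  apply: ler_wpM2l; first by apply: Ex_ge0.
  apply: le_Ex; first exact: (bm_sqr (bmM bd b1)).
    exact: (bmM (bm_sqr bd) bb).
  move=> v; rewrite exprMn; apply: ler_wpM2l; first exact: sqr_ge0.
  have [/ltW ->/=|_] := ltP p v; last by rewrite expr0n ler0n.
  by case: (v <= x); rewrite ?expr1n ?expr0n.
by move=> v; case: (_ && _); rewrite ?mulr1 ?mulr0 ?mul1r// subrr.
Qed.

End primitive.

(** * Approximation by Steklov averages *)

Section steklov.
Context {R : realType} (mu : probability R R).
Local Notation leb := (@lebesgue_measure R).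
Hypothesis muE : forall phi : R -> \bar R, measurable_fun setT phi -> (forall x, 0 <= phi x)%E ->
  (\int[mu]_x phi x = \int[leb]_(x in `[0%R, 1%R]) phi x)%E.

Lemma Ex_cvg (f_ : nat -> R -> R) (f : R -> R) (C : R) :
  (forall m, measurable_fun setT (f_ m)) -> measurable_fun setT f ->
  (forall m x, `|f_ m x| <= C) -> (forall x, `|f x| <= C) ->
  {ae leb, forall x : R, 0 < x < 1 -> f_ m x @[m --> \oo] --> f x} ->
  Ex mu (f_ m) @[m --> \oo] --> Ex mu f.
Proof.
move=> mf_ mf fC_ fC [N [mN N0 hN]].
have b_ m : bm (f_ m) by split => //; exists C.
have bf : bm f by split => //; exists C.
have bC : bm (fun _ : R => C) by exact: bm_cst.
have mi : measurable (`]0, 1[ : set R) by exact: measurable_itv.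
have ae : {ae mu, forall x : R, setT x -> (f_ m x)%:E @[m --> \oo] --> (f x)%:E}.
  (* Points outside the open unit interval, where convergence is not assumed, join the null set:
     [mu] does not charge them. *)
  exists (N `|` ~` `]0, 1[%classic); split; first by apply: measurableU => //; exact: measurableC.
    apply/eqP; rewrite eq_le measure_ge0 andbT.
    apply: (le_trans (measureU2 mu mN (measurableC mi))).
    have eC := uniform_oo muE (lexx 0) ler01 (lexx 1); rewrite !subr0 subrr in eC.
    have eN : (mu N <= 0)%E.
      have -> : mu N = (\int[mu]_x (\1_N x)%:E)%E by rewrite integral_indic// setIT.
      rewrite muE//; last by apply/measurable_EFinP; exact: measurable_indic.
      rewrite integral_indic//.
      rewrite -N0; apply: le_measure; rewrite ?inE//.
      by apply: measurableI => //; exact: measurable_itv.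
    rewrite -[leRHS]adde0; apply: leeD => //.
    by rewrite le_eqVlt; apply/orP; left; apply/eqP; exact: eC.
  move=> x /= nx; have [x01|x01] := boolP (0 < x < 1); last by right; rewrite /= in_itv/=; exact/negP.
  left; apply: hN => h; apply: nx => _; apply: cvg_EFin; last exact: h.
  exact: nearW.
have [_ _] := dominated_convergence measurableT
  (fun m => (measurable_EFinP setT (f_ m)).2 (mf_ m)) ((measurable_EFinP setT f).2 mf) ae (bm_int mu bC)
  (aeW _ (fun x m _ => (fC_ m x : (`|(f_ m x)%:E| <= C%:E)%E))).
rewrite ExE// => /fine_cvg /=; apply: cvg_trans; apply: near_eq_cvg.
by near=> m; rewrite /= ExE.
Unshelve. all: by end_near. Qed.

Definition clip (a b x : R) := Num.max a (Num.min b x).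

Lemma clip_range a b x : a <= b -> a <= clip a b x <= b.
Proof. by move=> ab; rewrite /clip le_max lexx/= ge_max ab ge_min lexx. Qed.

Lemma clip_id a b x : a <= x <= b -> clip a b x = x.
Proof. by move=> /andP[ax xb]; rewrite /clip min_r// max_r. Qed.

Lemma clip_lip a b x y : `|clip a b x - clip a b y| <= `|x - y|.
Proof.
wlog xy : x y / y <= x.
  move=> wl; have [yx|/ltW yx] := leP y x; first exact: wl.
  by rewrite distrC [leRHS]distrC; exact: wl.
rewrite (ger0_norm (x := x - y)) ?subr_ge0//.
have : 0 <= Num.min b x - Num.min b y <= x - y.
  by case: (leP b x) => ?; case: (leP b y) => ?; lra.
rewrite /clip; move: (Num.min b x) (Num.min b y) => x' y' /andP[h1 h2].
by case: (leP a x') => ?; case: (leP a y') => ?; rewrite ger0_norm; lra.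
Qed.

Variables (h : R -> R) (a b : R).
Hypothesis a0 : 0 < a.
Hypothesis mh : measurable_fun setT h.
Hypothesis hab : forall v, a <= h v <= b.

Let ab : a <= b. Proof. by have /andP[] := hab 0; exact: le_trans. Qed.
Let b0 : 0 < b. Proof. exact: lt_le_trans ab. Qed.
Let h0 v : 0 <= h v. Proof. by have /andP[/(le_trans (ltW a0))] := hab v. Qed.
Let bh : bm h.
Proof. by split => //; exists b => v; rewrite ger0_norm//; have /andP[] := hab v. Qed.

Let Hp := primv mu h.

(* The truncation keeps the averages in [[a, b]] near the endpoint [0] too. *)
Definition steklov (m : nat) (u : R) : R := clip a b (m.+1%:R * (Hp u - Hp (u - m.+1%:R^-1))).

Lemma steklov_range m u : a <= steklov m u <= b. Proof. exact: clip_range. Qed.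

Lemma measurable_clip : measurable_fun setT (clip a b).
Proof. by apply: measurable_maxr => //; exact: measurable_minr. Qed.

Lemma measurable_steklov m : measurable_fun setT (steklov m).
Proof.
apply: (measurableT_comp measurable_clip); apply: measurable_funM => //.
have mp : measurable_fun setT Hp := measurable_primv mu bh.
apply: measurable_funB => //; apply: (measurableT_comp mp).
exact: measurable_funB.
Qed.

Let primv_lip x y : `|Hp x - Hp y| <= b * `|x - y|.
Proof.
wlog xy : x y / y <= x.
  move=> wl; have [yx|/ltW yx] := leP y x; first exact: wl.
  by rewrite distrC [in leRHS]distrC; exact: wl.
rewrite (ger0_norm (x := x - y)) ?subr_ge0//.
have hm : Hp y <= Hp x := primv_homo mu bh h0 xy.
rewrite ger0_norm ?subr_ge0// /Hp primvB//.
have b1 := bm_oc y x.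
apply: (@le_trans _ _ (Ex mu (fun v => b * (y < v <= x)%R%:R))).
  apply: le_Ex; [exact: bmM|exact: bmZ|move=> v].
  by apply: ler_wpM2r => //; have /andP[] := hab v.
rewrite ExZ//; apply: ler_wpM2l; first exact: ltW.
have mi : measurable (`]y, x] : set R) by exact: measurable_itv.
rewrite (@eq_Ex _ _ _ mu _ (fun r => \1_(`]y, x]%classic) r)); last first.
  move=> r; rewrite indicE; congr (_%:R); congr nat_of_bool.
  by apply/idP/idP; rewrite inE/= in_itv.
rewrite -lee_fin -ExE; last first.
  by split; [exact: measurable_indic|exists 1 => v; rewrite indicE; case: (_ \in _); rewrite ?normr1 ?normr0].
rewrite muE//; last by apply/measurable_EFinP; exact: measurable_indic.
rewrite integral_indic//.
apply: (@le_trans _ _ (leb `]y, x]%classic)).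
  apply: le_measure; rewrite ?inE//.
  by apply: measurableI => //; exact: measurable_itv.
rewrite lebesgue_measure_itv/= lte_fin; case: ifPn => // _.
by rewrite lee_fin subr_ge0.
Qed.

Lemma steklov_lip m v u : `|steklov m v - steklov m u| <= m.+1%:R * (2 * b) * `|v - u|.
Proof.
apply: (le_trans (clip_lip _ _ _ _)); rewrite -mulrBr normrM ger0_norm// -mulrA ler_wpM2l//.
set p := Hp v; set q := Hp u; set p' := Hp _; set q' := Hp _.
have -> : p - p' - (q - q') = (p - q) - (p' - q') by ring.
apply: (le_trans (ler_normB _ _)).
have -> : 2 * b * `|v - u| = b * `|v - u| + b * `|v - u| by ring.
apply: lerD; first exact: primv_lip.
apply: (le_trans (primv_lip _ _)); rewrite le_eqVlt; apply/orP; left; apply/eqP.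
by congr (_ * `|_|); ring.
Qed.

(** Before truncation the average is a left difference quotient of [Hp] with step [1 / (m + 1)], so
    this is Lebesgue's differentiation theorem; [clip] is continuous and fixes [h x]. *)
Lemma steklov_cvg : {ae leb, forall x : R, 0 < x < 1 -> steklov m x @[m --> \oo] --> h x}.
Proof.
pose h1 v : R := h v * (0 <= v <= 1)%R%:R.
have mh1 : measurable_fun setT h1.
  apply: measurable_funM => //; apply: measurable_bool.
  by apply: measurable_and; apply: measurable_fun_ler.
have ih1 : leb.-integrable setT (EFin \o h1).
  apply/integrableP; split; first exact/measurable_EFinP.
  have -> : (\int[leb]_x `|(EFin \o h1) x| = \int[mu]_v (h v)%:E)%E.
    rewrite muE//; last exact/measurable_EFinP.
    rewrite [RHS]integral_mkcond; apply: eq_integral => v _.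
    rewrite patchE /h1 /=; case: ifPn; rewrite ?inE/= ?notin_setE/= in_itv/=.
      by move=> ->; rewrite mulr1 ger0_norm.
    by move=> /negP/negbTE->; rewrite mulr0 normr0.
  by rewrite ExE// ltry.
have FE : (fun x => \int[leb]_(t in `]-oo, x]) h1 t) = Hp.
  apply/funext => x; rewrite /Hp /primv /Ex /Rintegral; congr fine.
  rewrite muE; last 2 first.
  - by apply/measurable_EFinP; case: (bmM bh (bm_le x)).
  - by move=> v; rewrite lee_fin mulr_ge0.
  rewrite integral_mkcond [RHS]integral_mkcond; apply: eq_integral => v _.
  rewrite !patchE /h1; case: ifPn; case: ifPn; rewrite ?inE ?notin_setE/= !in_itv/=.
  - by move=> -> ->; rewrite !mulr1.
  - by move=> /negP/negbTE-> _; rewrite mulr0.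
  - by move=> _ /negP/negbTE->; rewrite mulr0.
  - by [].
have := @FTC1Ny R h1; rewrite FE => /(_ _ _) [].
- by move=> y; apply: integrableS ih1.
- by apply: open_integrable_locally => //; exact: openT.
move=> N [mN N0 hN]; exists N; split => // x /= nx; apply: hN => -[dH eH]; apply: nx => /andP[x0 x1].
have h1x : h1 x = h x by rewrite /h1 !ltW// mulr1.
rewrite -(clip_id (hab x)).
have cc : {for h x, continuous (clip a b)}.
  apply/cvgrPdist_le => e e0; near=> y.
  by apply: (le_trans (clip_lip _ _ _ _)); near: y; exact: cvgr_dist_le.
suff hs : m.+1%:R * (Hp x - Hp (x - m.+1%:R^-1)) @[m --> \oo] --> h x by exact: (cvg_comp _ _ hs cc).
move: dH => /cvg_ex[l hl].
have ll : l = h x.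
  rewrite -h1x -eH derive1E; apply/esym; exact: cvg_lim.
rewrite ll in hl.
have /cvg_dnbhs_at_left/cvg_at_leftP/(_ (fun m => - m.+1%:R^-1)) := hl.
have hm : (forall n : nat, - (n.+1%:R : R)^-1 < 0) /\ - (n.+1%:R : R)^-1 @[n --> \oo] --> (0 : R).
  split; first by move=> n; rewrite oppr_lt0 invr_gt0.
  by rewrite -[X in _ --> X]oppr0; apply: cvgN; exact: cvg_harmonic.
move=> /(_ hm); apply: cvg_trans; apply: near_eq_cvg; near=> m.
by rewrite /= /GRing.scale /= mulr1 invrN invrK (addrC _ x) mulNr -mulrN opprB.
Unshelve. all: by end_near. Qed.

(** The bound [2 * b ^+ 2 + 2 * b] covers the three cases needed: [x], [x ^ 2] and [(y - x) ^ 2]. *)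
Lemma steklov_Ex (G : R -> R -> R) : (forall m, bm (fun v => G (steklov m v) (h v))) ->
  (forall y, continuous (G ^~ y)) -> (forall x y, a <= x <= b -> a <= y <= b -> `|G x y| <= 2 * b ^+ 2 + 2 * b) ->
  bm (fun v => G (h v) (h v)) ->
  Ex mu (fun v => G (steklov m v) (h v)) @[m --> \oo] --> Ex mu (fun v => G (h v) (h v)).
Proof.
move=> bG cG GC bGh; apply: (@Ex_cvg _ _ (2 * b ^+ 2 + 2 * b)).
- by move=> m; have [] := bG m.
- by case: bGh.
- by move=> m x; apply: GC; rewrite ?steklov_range.
- by move=> x; apply: GC.
have [N [mN N0 hN]] := steklov_cvg; exists N; split => // x nx; apply: hN => hx; apply: nx => x01.
exact: (cvg_comp _ _ (hx x01) (cG (h x) (h x))).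
Qed.

End steklov.

(** * Central limit theorem for gap sums *)

Section heat_lipschitz.
Context {R : realType}.
Implicit Types x y s t : R.

Lemma gbound_ge0 : 0 <= gbound :> R.
Proof. by rewrite /gbound mulr_ge0// normal_peak_ge0. Qed.

Lemma Phi_lip y z : `|Phi z - Phi y| <= gbound * `|z - y| :> R.
Proof.
apply: (@MVT_bound _ (fun=> True) Phi stdnormal y z gbound) => //; first by move=> c _; exact: is_derive_Phi.
move=> c _ _; rewrite ger0_norm ?stdnormal_ge0//.
by have := stdnormal_bound c (isT : (0 <= 4)%N); rewrite expr0 mul1r.
Qed.

Lemma heat0 x s y : 0 < s -> heat x s 0 y = Phi ((x - y) / s).
Proof. by move=> s0; rewrite /heat addr0 sqrtr_sqr ger0_norm// ltW. Qed.

Lemma heat0_lip x s y z : 0 < s -> `|heat x s 0 z - heat x s 0 y| <= gbound / s * `|z - y|.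
Proof.
move=> s0; rewrite !heat0//; apply: (le_trans (Phi_lip _ _)).
rewrite -mulrA ler_wpM2l ?gbound_ge0//.
have -> : (x - z) / s - (x - y) / s = (y - z) / s by ring.
by rewrite normrM normfV (gtr0_norm s0) distrC mulrC.
Qed.

Lemma heat0_range x s y : 0 <= heat x s 0 y <= 1.
Proof. by rewrite /heat Phi_ge0 Phi_le1. Qed.

Lemma measurable_heat0 x s : 0 < s -> measurable_fun setT (heat x s 0).
Proof.
move=> s0; apply: continuous_measurable_fun => y; apply/cvgrPdist_le => e e0.
have g1 : 0 < gbound / s + 1 by rewrite ltr_wpDl// divr_ge0 ?gbound_ge0// ltW.
near=> z; apply: (le_trans (heat0_lip _ _ _ s0)).
apply: (@le_trans _ _ ((gbound / s + 1) * `|y - z|)); first by rewrite ler_wpM2r// lerDl.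
rewrite mulrC -ler_pdivlMr//; near: z.
have e1 : 0 < e / (gbound / s + 1) by rewrite divr_gt0.
by apply/nbhs_ballP; exists (e / (gbound / s + 1)) => //= z; rewrite /ball/= => /ltW.
Unshelve. all: by end_near. Qed.

Lemma heat_t_lip x s t t' y : 0 < s -> 0 <= t -> 0 <= t' ->
  `|heat x s t' y - heat x s t y| <= Kheat s * (`|t' - t| + `|t' - t| ^+ 2).
Proof.
move=> s0 t0 t'0; have TF := test_fun_heat x s0.
have h1 := tf_taylor TF y y t0 t'0; have h2 := tf_yy TF y t0.
move: h1; rewrite subrr normr0 !expr0n /= !mulr0 subr0 !addr0 !add0r => h1.
have -> : `|t' - t| ^+ 2 = (t' - t) ^+ 2 by rewrite real_normK// num_real.
rewrite mulrDr; set d := heat x s t' y - _ in h1 *; set k := heat_yy x s t y / 2 * (t' - t) in h1.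
have hk : `|k| <= Kheat s * `|t' - t|.
  rewrite /k normrM ler_wpM2r// normrM (ger0_norm (x := 2^-1)) ?invr_ge0//.
  have := normr_ge0 (heat_yy x s t y); move: h2.
  by move: (`|heat_yy x s t y|) (Kheat s) => u v; lra.
have -> : d = k + (d - k) by ring.
exact: (le_trans (ler_normD _ _) (lerD hk h1)).
Qed.

End heat_lipschitz.

(** * A form of the central limit theorem stable under perturbation *)

Section clt_convergence.
Context d (T : measurableType d) (R : realType) (P : probability T R).
Implicit Types (Y Z : nat -> T -> R) (q : R).

(** Convergence in law is tested on smoothed indicators only. These are Lipschitz, hence insensitive
    to perturbations small in variance, and [heat x s q 0] is the smoothed distribution function of
    the Gaussian law of variance [q]. *)
Definition clt_conv Y q := [/\ forall n, bm (Y n),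
  Vr P (Y n) @[n --> \oo] --> q &
  forall x s : R, 0 < s ->
    Ex P (fun w => heat x s 0 (Y n w - Ex P (Y n))) @[n --> \oo] --> heat x s q 0].

Lemma bm_heat0 (x s c : R) (f : T -> R) : 0 < s -> bm f -> bm (fun w => heat x s 0 (f w - c)).
Proof.
move=> s0 [mf _]; split.
  by apply: (measurableT_comp (measurable_heat0 x s0)); exact: measurable_funB.
by exists 1 => w; rewrite ger0_norm; have /andP[] := heat0_range x s (f w - c).
Qed.

Let bcst (c : R) : bm (fun _ : T => c). Proof. exact: bm_cst. Qed.

(** After centring, [(p + r) ^ 2 - p ^ 2 = 2 p r + r ^ 2] with
    [2 |p r| <= eta p ^ 2 + r ^ 2 / eta]. *)
Lemma Vr_near f g eta : 0 < eta -> bm f -> bm g ->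
  `|Vr P f - Vr P g| <= eta * Vr P g + (1 + eta^-1) * Vr P (fun w => f w - g w).
Proof.
move=> e0 bf bg; have bd := bmB bf bg.
pose g' w := g w - Ex P g; pose k w := (f w - g w) - Ex P (fun w => f w - g w).
have bg' : bm g' := bmB bg (bcst _).
have bk : bm k := bmB bd (bcst _).
have bg2 := bm_sqr bg'; have bk2 := bm_sqr bk.
have Eg : Vr P g = Ex P (fun w => g' w ^+ 2) by rewrite VrE.
have Ek : Vr P (fun w => f w - g w) = Ex P (fun w => k w ^+ 2) by rewrite VrE.
have Ef : Vr P f = Ex P (fun w => (g' w + k w) ^+ 2).
  rewrite VrE//; apply: eq_Ex => w; congr (_ ^+ 2).
  by rewrite /g' /k (ExB P bf bg); ring.
have bs := bm_sqr (bmD bg' bk).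
rewrite Ef Ek Eg -(ExB P bs bg2).
rewrite -(ExZ P eta bg2) -(ExZ P _ bk2) -(ExD P (bmZ _ bg2) (bmZ _ bk2)).
apply: (le_trans (norm_Ex P (bmB bs bg2))).
apply: le_Ex.
- have [m4 [C hC]] := bmB bs bg2; split; first exact: measurableT_comp.
  by exists C => w; rewrite normr_id.
- exact: (bmD (bmZ _ bg2) (bmZ _ bk2)).
move=> w; move: (g' w) (k w) => p r.
have -> : (p + r) ^+ 2 - p ^+ 2 = 2 * p * r + r ^+ 2 by ring.
have h : eta * p ^+ 2 + eta^-1 * r ^+ 2 - 2 * p * r = eta * (p - r / eta) ^+ 2 /\
         eta * p ^+ 2 + eta^-1 * r ^+ 2 + 2 * p * r = eta * (p + r / eta) ^+ 2.
  by split; field; rewrite gt_eqF.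
have h1 : 0 <= eta * (p - r / eta) ^+ 2 by rewrite mulr_ge0 ?sqr_ge0// ltW.
have h2 : 0 <= eta * (p + r / eta) ^+ 2 by rewrite mulr_ge0 ?sqr_ge0// ltW.
rewrite -h.1 in h1; rewrite -h.2 in h2; have r2 := sqr_ge0 r.
have -> : eta * p ^+ 2 + (1 + eta^-1) * r ^+ 2 = eta * p ^+ 2 + (r ^+ 2 + eta^-1 * r ^+ 2) by ring.
rewrite ler_norml; move: h1 h2 r2.
move: (eta * p ^+ 2) (eta^-1 * r ^+ 2) (2 * p * r) (r ^+ 2) => A B C D h1 h2 h3.
by apply/andP; split; lra.
Qed.

Lemma heat_near (x s : R) f g : 0 < s -> bm f -> bm g ->
  `|Ex P (fun w => heat x s 0 (f w - Ex P f)) - Ex P (fun w => heat x s 0 (g w - Ex P g))|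
  <= gbound / s * Num.sqrt (Vr P (fun w => f w - g w)).
Proof.
move=> s0 bf bg; have bd := bmB bf bg.
pose k w := (f w - g w) - Ex P (fun w => f w - g w).
have bk : bm k := bmB bd (bcst _).
have bnk : bm (fun w => `|k w|).
  have [mk [C hC]] := bk; split; first exact: measurableT_comp.
  by exists C => w; rewrite normr_id.
have g0 : 0 <= gbound / s by rewrite divr_ge0 ?gbound_ge0// ltW.
have b1 := bm_heat0 x (Ex P f) s0 bf; have b2 := bm_heat0 x (Ex P g) s0 bg.
rewrite -(ExB P b1 b2); apply: (le_trans (norm_Ex P (bmB b1 b2))).
apply: (@le_trans _ _ (Ex P (fun w => gbound / s * `|k w|))).
  apply: le_Ex; last move=> w.
  - have [m4 [C hC]] := bmB b1 b2; split; first exact: measurableT_comp.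
    by exists C => w; rewrite normr_id.
  - exact: bmZ.
  - apply: (le_trans (heat0_lip _ _ _ s0)); apply: ler_wpM2l => //.
    by rewrite /k (ExB P bf bg) le_eqVlt; apply/orP; left; apply/eqP; congr `|_|; ring.
rewrite ExZ// ler_wpM2l//.
rewrite -[leLHS]ger0_norm ?Ex_ge0// -sqrtr_sqr ler_wsqrtr// (VrE P bd).
exact: Ex_norm_sqr.
Qed.

(** Serves twice: to pass from Lipschitz approximations to a general [h], and to drop the two
    extreme gaps. The tolerance is taken as [eta ^ 2] because [heat_near] loses a square root. *)
Lemma clt_perturb Y q : 0 <= q -> (forall n, bm (Y n)) ->
  (forall e : R, 0 < e -> exists Z q', [/\ clt_conv Z q', 0 <= q', `|q' - q| <= e &
     \forall n \near \oo, Vr P (fun w => Y n w - Z n w) <= e]) -> clt_conv Y q.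
Proof.
move=> q0 bY app; split => //.
  apply/cvgrPdist_le => e e0.
  (* [q + 6] is the total of the coefficients of [eta] in the final estimate. *)
  pose eta : R := Num.min 1 (e / (q + 6)).
  have q6 : 0 < q + 6 by rewrite ltr_wpDl.
  have t0 : 0 < eta by rewrite /eta lt_min ltr01 divr_gt0.
  have t1 : eta <= 1 by rewrite /eta ge_min lexx.
  have te : eta * (q + 6) <= e by rewrite -ler_pdivlMr// /eta ge_min lexx orbT.
  have [Z [q' [[bZ VZ _] q'0 qq nD]]] := app (eta ^+ 2) (exprn_gt0 2 t0).
  have nZ : \forall n \near \oo, `|q' - Vr P (Z n)| <= eta by apply: cvgr_dist_le.
  near=> n.
  have hD : Vr P (fun w => Y n w - Z n w) <= eta ^+ 2 by near: n.
  have hZ : `|q' - Vr P (Z n)| <= eta by near: n.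
  have hV := Vr_near t0 (bY n) (bZ n).
  have h3 : (1 + eta^-1) * Vr P (fun w => Y n w - Z n w) <= 2 * eta.
    apply: (@le_trans _ _ ((1 + eta^-1) * eta ^+ 2)).
      by apply: ler_wpM2l => //; rewrite addr_ge0// invr_ge0 ltW.
    have -> : (1 + eta^-1) * eta ^+ 2 = eta + eta ^+ 2 by field; rewrite gt_eqF.
    by have : eta ^+ 2 <= eta; [rewrite expr2 ger_pMr|lra].
  have q2 : eta ^+ 2 <= eta by rewrite expr2 ger_pMr.
  have v2 : Vr P (Z n) <= q + 2.
    move: hZ qq; rewrite !ler_norml => /andP[z1 z2] /andP[z3 z4]; lra.
  have h4 : eta * Vr P (Z n) <= eta * (q + 2) by rewrite ler_pM2l.
  apply: (le_trans _ te).
  have -> : q - Vr P (Y n) = - (q' - q) + (q' - Vr P (Z n)) - (Vr P (Y n) - Vr P (Z n)) by ring.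
  apply: (le_trans (ler_normB _ _)).
  apply: (@le_trans _ _ (`|q' - q| + `|q' - Vr P (Z n)| + `|Vr P (Y n) - Vr P (Z n)|)).
    by rewrite lerD2r (le_trans (ler_normD _ _))// normrN.
  have -> : eta * (q + 6) = eta * (q + 2) + 2 * eta + eta + eta by ring.
  move: (`|Vr P (Y n) - _|) (`|q' - q|) (`|q' - _|) hV qq hZ h3 h4 q2 => A B C.
  move: (eta * Vr P (Z n)) (eta * (q + 2)) ((1 + eta^-1) * _) (eta ^+ 2) => D E F G.
  by lra.
move=> x s s0; apply/cvgrPdist_le => e e0.
have g0 : 0 <= gbound / s by rewrite divr_ge0 ?gbound_ge0// ltW.
have K0 : 0 <= Kheat s := tf_K0 (test_fun_heat x s0).
pose c := gbound / s + 2 * Kheat s + 1.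
have c0 : 0 < c by rewrite ltr_wpDl// addr_ge0// mulr_ge0.
pose eta : R := Num.min 1 (e / c).
have t0 : 0 < eta by rewrite /eta lt_min ltr01 divr_gt0.
have t1 : eta <= 1 by rewrite /eta ge_min lexx.
have te : c * eta <= e by rewrite mulrC -ler_pdivlMr// /eta ge_min lexx orbT.
have q2 : eta ^+ 2 <= eta by rewrite expr2 ger_pMr.
have [Z [q' [[bZ _ CZ] q'0 qq nD]]] := app (eta ^+ 2) (exprn_gt0 2 t0).
have nZ : \forall n \near \oo, `|heat x s q' 0 - Ex P (fun w => heat x s 0 (Z n w - Ex P (Z n)))| <= eta.
  by apply: cvgr_dist_le => //; exact: CZ.
near=> n.
have hD : Vr P (fun w => Y n w - Z n w) <= eta ^+ 2 by near: n.
have hZ : `|heat x s q' 0 - Ex P (fun w => heat x s 0 (Z n w - Ex P (Z n)))| <= eta by near: n.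
have hY := heat_near x s0 (bY n) (bZ n).
have hs : gbound / s * Num.sqrt (Vr P (fun w => Y n w - Z n w)) <= gbound / s * eta.
  rewrite ler_wpM2l// -[leRHS](ger0_norm (ltW t0)) -sqrtr_sqr.
  exact: ler_wsqrtr.
have ht := heat_t_lip x 0 s0 q0 q'0.
have ht2 : Kheat s * (`|q' - q| + `|q' - q| ^+ 2) <= 2 * Kheat s * eta.
  have q1 : `|q' - q| <= eta := le_trans qq q2.
  have q3 : `|q' - q| ^+ 2 <= `|q' - q| by rewrite expr2 ler_piMr// (le_trans q1).
  have -> : 2 * Kheat s * eta = Kheat s * (2 * eta) by ring.
  by rewrite ler_wpM2l//; move: (`|q' - q|) (`|q' - q| ^+ 2) q1 q3 => A B h1 h2; lra.
apply: (le_trans _ te); rewrite /c.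
set A := Ex P _ in hY *; set B := Ex P _ in hY hZ.
set h1 := heat x s q' 0 in hZ ht; set h0 := heat x s q 0 in ht *.
have -> : h0 - A = - (h1 - h0) + (h1 - B) - (A - B) by ring.
apply: (le_trans (ler_normB _ _)); apply: (le_trans (lerD (ler_normD _ _) (lexx _))); rewrite normrN.
have -> : (gbound / s + 2 * Kheat s + 1) * eta = 2 * Kheat s * eta + eta + gbound / s * eta by ring.
by apply: lerD; [apply: lerD => //; exact: (le_trans ht ht2)|exact: (le_trans hY hs)].
Unshelve. all: by end_near. Qed.

End clt_convergence.

Section gap_clt.
Context {R : realType} d (T : measurableType d) (P : probability T R) (mu : probability R R).
Local Notation leb := (@lebesgue_measure R).
Local Notation v := (pi ^+ 2 / 3 - 2 : R).
Variables (U : nat -> T -> R).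
Hypothesis HU : iid P mu U.
Hypothesis muE : forall phi : R -> \bar R, measurable_fun setT phi -> (forall x, 0 <= phi x)%E ->
  (\int[mu]_x phi x = \int[leb]_(x in `[0%R, 1%R]) phi x)%E.
Hypothesis U01 : forall i w, 0 <= U i w <= 1.

Lemma bm_gapsum (H : R -> R) (b : R) n : measurable_fun setT H -> (forall x, 0 <= H x <= b) ->
  bm (fun w => gapsum (gapx H) 1 (sample U (iota 0 n) w)).
Proof.
move=> mH Hb; have bF := bseq_gapsum (size (iota 0 n)) mH Hb.
by have [] := Ex_sample HU (iota_uniq 0 n) bF.
Qed.

(** The heat flow of a square adds [t], and its expansion has no remainder. *)
Lemma test_fun_sqr (c : R) : test_fun (fun t y => (y + c) ^+ 2 + t) (fun _ y => 2 * (y + c))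
  (fun _ _ => 2) (2 * (1 + `|c|)).
Proof.
have c0 : 0 <= 2 * (1 + `|c|) by rewrite mulr_ge0// addr_ge0.
split => //.
- apply: measurable_funD => //; apply: measurable_funX; exact: measurable_funD.
- move=> t y t' y' _ _.
  rewrite (_ : (y' + c) ^+ 2 + t' - _ - _ - _ = 0); last by field.
  rewrite normr0; apply: mulr_ge0 => //.
  by apply: addr_ge0; [apply: addr_ge0; [exact: exprn_ge0|exact: sqr_ge0]|exact: mulr_ge0].
- move=> t y _; rewrite normrM (ger0_norm (x := 2))// -mulrA ler_wpM2l//.
  apply: (le_trans (ler_normD _ _)); rewrite mulrDr mulr1 mulrDl mul1r.
  have := mulr_ge0 (normr_ge0 c) (normr_ge0 y); lra.
- by move=> t y _; rewrite ger0_norm// ler_peMr// lerDl.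
Qed.

Section lipschitz.
Variables (h H A B : R -> R) (a b K : R).
Hypothesis LD : lip_density h H A B a b K.
Hypothesis Hb : forall x, 0 <= H x <= b.
Hypothesis Hh : {homo H : x y / x <= y}.

Lemma lip_clt_conv :
  clt_conv P (fun n w => Num.sqrt n%:R * gapsum (gapx H) 1 (sample U (iota 0 n) w)) (rest_var H A 1).
Proof.
have U1 i w : U i w <= 1 by have /andP[] := U01 i w.
have bL n := bm_gapsum n (ld_mH LD) Hb.
pose L n w := gapsum (gapx H) 1 (sample U (iota 0 n) w).
pose V n w := Num.sqrt n%:R * (L n w - centering H B n 1).
have bY n : bm (fun w => Num.sqrt n%:R * L n w) := bmZ _ (bL n).
have VE n w : V n w = Num.sqrt n%:R * L n w - Num.sqrt n%:R * centering H B n 1 by rewrite /V mulrBr.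
have bcst (c : R) : bm (fun _ : T => c) by exact: bm_cst.
have bV n : bm (V n).
  have := bmB (bY n) (bcst (Num.sqrt n%:R * centering H B n 1)).
  by congr bm; apply/funext => w; rewrite VE.
have EV n : Ex P (V n) = Ex P (fun w => Num.sqrt n%:R * L n w) - Num.sqrt n%:R * centering H B n 1.
  by rewrite (eq_Ex P (VE n)) (ExB P (bY n) (bcst _)) Ex_cst.
have cen n w : Num.sqrt n%:R * L n w - Ex P (fun w => Num.sqrt n%:R * L n w) = V n w - Ex P (V n).
  by rewrite EV VE; ring.
have VrV n : Vr P (fun w => Num.sqrt n%:R * L n w) = Vr P (V n).
  by rewrite (VrE P (bY n)) (VrE P (bV n)); apply: eq_Ex => w; congr (_ ^+ 2); exact: cen.
have q0 c : Ex P (fun w => (V n w + c) ^+ 2 + 0) @[n --> \oo] --> (0 + c) ^+ 2 + rest_var H A 1.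
  apply: (lip_clt HU muE U1 LD Hb Hh (test_fun_sqr c)).
  by move=> y; rewrite addr0 sqr_ge0.
have e2 : Ex P (fun w => V n w ^+ 2) @[n --> \oo] --> rest_var H A 1.
  have := q0 0; rewrite addr0 expr0n/= add0r.
  apply: cvg_trans; apply: near_eq_cvg; near=> n.
  by apply: eq_Ex => w; rewrite !addr0.
(* [lip_clt] asks for [psi 0] to be nonnegative, which excludes the identity; the mean is recovered
   from the difference of the squares with shifts 1 and 0. *)
have e1 : Ex P (V n) @[n --> \oo] --> (0 : R).
  have h1 := cvgB (q0 1) e2.
  have h2 : (2^-1) * (Ex P (fun w => (V n w + 1) ^+ 2 + 0) - Ex P (fun w => V n w ^+ 2) - 1) @[n --> \oo]
     --> 2^-1 * ((0 + 1) ^+ 2 + rest_var H A 1 - rest_var H A 1 - 1).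
    by apply: cvgM; [exact: cvg_cst|apply: cvgB; [exact: h1|exact: cvg_cst]].
  rewrite (_ : 2^-1 * _ = 0) in h2; last by field.
  apply: cvg_trans h2; apply: near_eq_cvg; near=> n.
  have bV2 := bm_sqr (bV n); have b3 := bmZ 2 (bV n).
  rewrite (@eq_Ex _ _ _ P (fun w => (V n w + 1) ^+ 2 + 0) (fun w => V n w ^+ 2 + (2 * V n w + 1))); last by move=> w; ring.
  by rewrite (ExD P bV2 (bmD b3 (bcst _))) (ExD P b3 (bcst _)) (ExZ P _ (bV n)) Ex_cst; field.
split => //.
  have -> : (fun n => Vr P (fun w => Num.sqrt n%:R * L n w)) = (fun n => Ex P (fun w => V n w ^+ 2) - Ex P (V n) ^+ 2).
    by apply/funext => n; rewrite VrV.
  have -> : rest_var H A 1 = rest_var H A 1 - 0 ^+ 2 by rewrite expr0n/= subr0.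
  apply: cvgB; first exact: e2.
  exact: (cvg_comp _ _ e1 (@exprn_continuous _ 2 0)).
move=> x s s0.
have hh : Ex P (fun w => heat x s 0 (V n w)) @[n --> \oo] --> heat x s (rest_var H A 1) 0.
  apply: (lip_clt HU muE U1 LD Hb Hh (test_fun_heat x s0)).
  by move=> y; have /andP[] := heat0_range x s y.
have hb n c : bm (fun w => heat x s 0 (V n w - c)) by exact: bm_heat0.
have -> : heat x s (rest_var H A 1) 0 = heat x s (rest_var H A 1) 0 + 0 by rewrite addr0.
(* Replacing [centering] by the true mean costs at most a Lipschitz constant times [|Ex P (V n)|],
   which tends to 0. *)
have -> : (fun n => Ex P (fun w => heat x s 0 (Num.sqrt n%:R * L n w - Ex P (fun w => Num.sqrt n%:R * L n w)))) =
  fun n => Ex P (fun w => heat x s 0 (V n w)) +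
   (Ex P (fun w => heat x s 0 (V n w - Ex P (V n))) - Ex P (fun w => heat x s 0 (V n w))).
  by apply/funext => n; rewrite (eq_Ex P (fun w => congr1 (heat x s 0) (cen n w))) [RHS]addrC subrK.
apply: cvgD; first exact: hh.
apply/norm_cvg0P.
apply: (@squeeze_cvgr _ _ _ _ (fun=> 0) (fun n => gbound / s * `|Ex P (V n)|)).
- near=> n; rewrite normr_ge0/=.
  have b0 : bm (fun w => heat x s 0 (V n w)).
    by have := hb n 0; congr bm; apply/funext => w; rewrite subr0.
  rewrite -(ExB P (hb n _) b0) (le_trans (norm_Ex P (bmB (hb n _) b0)))//.
  rewrite -[leRHS](Ex_cst P); apply: le_Ex => //.
    have [m4 [C hC]] := bmB (hb n (Ex P (V n))) b0; split; first exact: measurableT_comp.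
    by exists C => w; rewrite normr_id.
  move=> w; apply: (le_trans (heat0_lip _ _ _ s0)).
  by rewrite (_ : V n w - _ - V n w = - Ex P (V n)) ?normrN//; ring.
- exact: cvg_cst.
- rewrite -[X in _ --> X](mulr0 (gbound / s)); apply: cvgM; first exact: cvg_cst.
  by rewrite -(@normr0 _ R); apply: (cvg_norm e1).
Unshelve. all: by end_near. Qed.

End lipschitz.

Section general.
Variables (h : R -> R) (a b : R).
Hypothesis a0 : 0 < a.
Hypothesis mh : measurable_fun setT h.
Hypothesis hab : forall x, a <= h x <= b.

Let ab : a <= b. Proof. by have /andP[] := hab 0; exact: le_trans. Qed.
Let b0 : 0 < b. Proof. exact: lt_le_trans ab. Qed.
Let h0 x : 0 <= h x <= b.
Proof. by have /andP[/(le_trans (ltW a0)) -> ->] := hab x. Qed.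
Let bh : bm h.
Proof. by split => //; exists b => x; rewrite ger0_norm//; have /andP[] := h0 x. Qed.

Lemma gap_clt_conv :
  clt_conv P (fun n w => Num.sqrt n%:R * gapsum (gapx (primv mu h)) 1 (sample U (iota 0 n) w))
    (v * Ex mu (fun x => h x ^+ 2) - Ex mu h ^+ 2).
Proof.
have v1 : 1 <= v by have := @pi2_gt9 R; lra.
have Hb := fun x => primv_range mu x bh h0.
have mH := measurable_primv mu bh.
have bh2 := bm_sqr bh.
pose hs m := steklov mu h a b m.
have hsab m x : a <= hs m x <= b by exact: steklov_range.
have hs0 m x : 0 <= hs m x <= b by have /andP[/(le_trans (ltW a0)) -> ->] := hsab m x.
have bhs m : bm (hs m).
  split; first exact: (measurable_steklov mu a0 mh hab).
  by exists b => x; rewrite ger0_norm//; have /andP[] := hs0 m x.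
have bound x y : a <= x <= b -> a <= y <= b -> [/\ `|x| <= 2 * b ^+ 2 + 2 * b, `|x ^+ 2| <= 2 * b ^+ 2 + 2 * b
    & `|(y - x) ^+ 2| <= 2 * b ^+ 2 + 2 * b].
  move=> /andP[ax xb] /andP[ay yb].
  have x0 : 0 <= x by rewrite (le_trans (ltW a0)).
  have y0 : 0 <= y by rewrite (le_trans (ltW a0)).
  rewrite (ger0_norm x0) !ger0_norm ?sqr_ge0//.
  have x2 : x ^+ 2 <= b ^+ 2 by rewrite lerXn2r ?nnegrE// ltW.
  have d2 : (y - x) ^+ 2 <= b ^+ 2.
    by rewrite -[leLHS]real_normK ?num_real// lerXn2r ?nnegrE// ?(ltW b0)// ler_norml; apply/andP; split; lra.
  by have b20 := sqr_ge0 b; split; move: (b ^+ 2) x2 d2 b20 => B ? ? ?; lra.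
have c1 : Ex mu (hs m) @[m --> \oo] --> Ex mu h.
  apply: (@steklov_Ex _ _ muE h a b a0 mh hab (fun x _ => x)) => //.
    by move=> y x; exact: cvg_id.
  by move=> x y hx hy; have [] := bound x y hx hy.
have c2 : Ex mu (fun x => hs m x ^+ 2) @[m --> \oo] --> Ex mu (fun x => h x ^+ 2).
  apply: (@steklov_Ex _ _ muE h a b a0 mh hab (fun x _ => x ^+ 2)) => //.
  - by move=> m; exact: bm_sqr.
  - by move=> y x; exact: exprn_continuous.
  by move=> x y hx hy; have [] := bound x y hx hy.
have c3 : Ex mu (fun x => (h x - hs m x) ^+ 2) @[m --> \oo] --> (0 : R).
  have -> : (0 : R) = Ex mu (fun x => (h x - h x) ^+ 2).
    by rewrite -[LHS](Ex_cst mu); apply: eq_Ex => x; rewrite subrr expr0n.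
  apply: (@steklov_Ex _ _ muE h a b a0 mh hab (fun x y => (y - x) ^+ 2)) => //.
  - by move=> m; apply: bm_sqr; exact: bmB.
  - move=> y x; apply: (@continuous_comp _ _ _ (fun x => y - x) (fun z => z ^+ 2)); last exact: exprn_continuous.
    by apply: cvgB; [exact: cvg_cst|exact: cvg_id].
  - by move=> x y hx hy; have [] := bound x y hx hy.
  by apply: bm_sqr; exact: bmB.
have cq : v * Ex mu (fun x => hs m x ^+ 2) - Ex mu (hs m) ^+ 2 @[m --> \oo] -->
    v * Ex mu (fun x => h x ^+ 2) - Ex mu h ^+ 2.
  apply: cvgB; first by apply: cvgM; [exact: cvg_cst|exact: c2].
  exact: (cvg_comp _ _ c1 (@exprn_continuous _ 2 _)).
have q_ge0 g : bm g -> 0 <= v * Ex mu (fun x => g x ^+ 2) - Ex mu g ^+ 2.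
  move=> bg; have h1 := Ex_sqr_le mu bg.
  have h2 : 0 <= Ex mu (fun x => g x ^+ 2) by apply: Ex_ge0; [exact: bm_sqr|move=> x; exact: sqr_ge0].
  by rewrite subr_ge0 (le_trans h1)// ler_peMl.
apply: clt_perturb; first exact: q_ge0.
  by move=> n; apply: bmZ; exact: bm_gapsum Hb.
move=> e e0.
(* The factor [16 * (b / a)] is the constant of [efron_stein], so that this tolerance on the mean
   square of [h - hs m] gives a variance of at most [e]. *)
have e1 : 0 < e / (16 * (b / a)) by rewrite divr_gt0// mulr_gt0// divr_gt0.
have n1 : \forall m \near \oo, `|v * Ex mu (fun x => h x ^+ 2) - Ex mu h ^+ 2 -
    (v * Ex mu (fun x => hs m x ^+ 2) - Ex mu (hs m) ^+ 2)| <= e by exact: cvgr_dist_le.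
have n2 : \forall m \near \oo, `|0 - Ex mu (fun x => (h x - hs m x) ^+ 2)| <= e / (16 * (b / a)).
  by apply: cvgr_dist_le.
have [m [m1 m2]] : exists m, `|v * Ex mu (fun x => h x ^+ 2) - Ex mu h ^+ 2 -
    (v * Ex mu (fun x => hs m x ^+ 2) - Ex mu (hs m) ^+ 2)| <= e /\
    `|0 - Ex mu (fun x => (h x - hs m x) ^+ 2)| <= e / (16 * (b / a)).
  near \oo => m; exists m; split; near: m.
    exact: n1.
  exact: n2.
pose H' := primv mu (hs m).
have Hb' := fun x => primv_range mu x (bhs m) (hs0 m).
have mH' := measurable_primv mu (bhs m).
pose K : R := m.+1%:R * (2 * b).
have K0 : 0 <= K by rewrite mulr_ge0// mulr_ge0// ltW.
have LD := lipschitz_density muE a0 K0 (bhs m).1 (hsab m)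
  (fun x y _ _ => steklov_lip muE a0 mh hab m x y).
exists (fun n w => Num.sqrt n%:R * gapsum (gapx H') 1 (sample U (iota 0 n) w)).
exists (v * Ex mu (fun x => hs m x ^+ 2) - Ex mu (hs m) ^+ 2); split.
- have := lip_clt_conv LD Hb' (primv_homo mu (bhs m) (fun x => (andP (hs0 m x)).1)).
  by rewrite /rest_var mul1r !(primv1 muE)//; exact: bm_sqr.
- exact: q_ge0.
- by rewrite distrC.
exists 1%N => // n /= n0.
pose D w := gapdiff (primv mu h) H' (sample U (iota 0 n) w).
have bD : bm D by apply: bmB; [exact: bm_gapsum Hb|exact: bm_gapsum Hb'].
have -> : Vr P (fun w => Num.sqrt n%:R * gapsum (gapx (primv mu h)) 1 (sample U (iota 0 n) w) -
    Num.sqrt n%:R * gapsum (gapx H') 1 (sample U (iota 0 n) w)) = n%:R * Vr P D.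
  rewrite (_ : (fun w => _ - _) = fun w => Num.sqrt n%:R * D w); last by apply/funext => w; rewrite -mulrBr.
  rewrite /Vr (ExZ P _ bD) exprMn sqr_sqrtr// mulrBr; congr (_ - _).
  rewrite -(ExZ P _ (bm_sqr bD)); apply: eq_Ex => w.
  by rewrite exprMn sqr_sqrtr.
have mdl := (bm_sqr (bmB bh (bhs m))).1.
have := @efron_stein _ _ _ P mu muE U HU U01 a b (primv mu h) H' (fun x => (h x - hs m x) ^+ 2)
  (2 * b ^+ 2 + 2 * b) a0 ab (fun x u => primv_bounds muE bh hab)
  (fun x u => primv_bounds muE (bhs m) (hsab m)) Hb Hb' mH mH' mdl (fun x => sqr_ge0 _) _
  (fun p x => primv_diff_sqr muE bh (bhs m)) n n0.
have dC x : (h x - hs m x) ^+ 2 <= 2 * b ^+ 2 + 2 * b.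
  by have [_ _] := bound _ _ (hsab m x) (hab x); rewrite ger0_norm// sqr_ge0.
move=> /(_ dC) hE.
have n0' : (0 : R) < n%:R by rewrite ltr0n.
rewrite ler_pdivlMr// in hE; rewrite mulrC (le_trans hE)//.
move: m2; rewrite sub0r normrN => /(le_trans (ler_norm _)).
rewrite ler_pdivlMr; last by rewrite mulr_gt0// divr_gt0.
by rewrite mulrC.
Unshelve. all: by end_near. Qed.

End general.
End gap_clt.

(** * The two extreme gaps *)

Section reflection.
Context {R : realType}.
Local Notation leb := (@lebesgue_measure R).

Lemma lebesgue_reflect (phi : R -> \bar R) : measurable_fun setT phi -> (forall x, 0 <= phi x)%E ->
  (\int[leb]_(x in `[0%R, 1%R]) phi (1 - x)%R = \int[leb]_(x in `[0%R, 1%R]) phi x)%E.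
Proof.
move=> mphi phi0.
have mr : measurable_fun setT (fun x : measurableTypeR R => (1 - x)%R : measurableTypeR R).
  exact: measurable_funB.
pose S : {mfun measurableTypeR R >-> measurableTypeR R} :=
  HB.pack (fun x : measurableTypeR R => (1 - x)%R : measurableTypeR R)
    (isMeasurableFun.Build _ _ _ _ _ mr).
pose m0 : {measure set (measurableTypeR R) -> \bar R} := pushforward leb S.
pose m : {measure set (measurableTypeR R) -> \bar R} := m0 mr.
have mE A : measurable A -> leb A = m A.
  apply: lebesgue_measure_unique => _ [[x y] _ <-] /=.
  rewrite /m /m0 /pushforward /=.
  have -> : (fun z : R => (1 - z)%R) @^-1` `]x, y] = `[(1 - y)%R, (1 - x)%R[%classic.
    apply/seteqP; split => z /=; rewrite !in_itv /= => /andP[h1 h2]; apply/andP; split; lra.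
  rewrite !lebesgue_measure_itv /= !lte_fin ltrD2l ltrN2.
  by case: ifPn => _ //; rewrite -!EFinB; congr EFin; ring.
rewrite integral_mkcond [RHS]integral_mkcond.
transitivity (\int[m]_x (phi \_ `[0%R, 1%R]) x)%E.
  rewrite /m (ge0_integral_pushforward mr leb measurableT _ (fun x _ => _))//.
  - apply: eq_integral => x _; rewrite /= !patchE.
    suff -> : ((1 - x)%R \in (`[0%R, 1%R]%classic : set R)) = (x \in (`[0%R, 1%R]%classic : set R)) by [].
    apply/idP/idP; rewrite !inE/= !in_itv/= => /andP[h1 h2]; apply/andP; split; lra.
  - by apply/(measurable_restrictT _ _).1 => //; exact: measurable_funTS.
  - by move=> x _; rewrite patchE; case: ifP.
by apply: eq_measure_integral => A mA _; exact: esym (mE A mA).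
Qed.

End reflection.

Section extreme_gaps.
Context {R : realType} d (T : measurableType d) (P : probability T R) (mu : probability R R).
Local Notation leb := (@lebesgue_measure R).
Local Notation c9 := (2 * 27%:R ^+ 9 : R).
Hypothesis muE : forall phi : R -> \bar R, measurable_fun setT phi -> (forall x, 0 <= phi x)%E ->
  (\int[mu]_x phi x = \int[leb]_(x in `[0%R, 1%R]) phi x)%E.

Lemma iid_reflect (U : nat -> T -> R) : iid P mu U -> iid P mu (fun i w => 1 - U i w).
Proof.
move=> HU; split; first by move=> i; apply: measurable_funB => //; exact: HU.1.
move=> s B us mB; pose B' i := (fun x : R => 1 - x) @^-1` (B i).
have mr : measurable_fun setT (fun x : R => 1 - x) by exact: measurable_funB.
have mB' i : measurable (B' i) by rewrite -[X in measurable X]setTI; exact: mr.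
rewrite (_ : \bigcap_(i in _) _ = \bigcap_(i in [set` s]) (U i @^-1` B' i))//.
rewrite HU.2//; apply: eq_bigr => i _.
have e A : measurable A -> mu A = (\int[mu]_x (\1_A x)%:E)%E by move=> mA; rewrite integral_indic// setIT.
have mi A : measurable A -> measurable_fun setT (fun x : R => (\1_A x : R)%:E).
  by move=> mA; apply/measurable_EFinP; exact: measurable_indic.
rewrite !e//; rewrite !muE; [|exact: mi|by []|exact: mi|by []].
by rewrite -(lebesgue_reflect (mi _ (mB i))).
Qed.

(** By [tpow_max] the maximum has the law of [powE n.+1], and [1 - w <= log_weight n.+1 w / n.+1].
    The fourth power is needed because the square of [xlogx] is bounded through [norm_xlogx_sqr]. *)
Lemma max_moment (U : nat -> T -> R) n : (0 < n)%N -> iid P mu U ->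
  (\int[P]_w ((1 - last 0 (sort <=%R (sample U (iota 0 n.+1) w))) ^+ 4)%:E <= (c9 / n.+1%:R ^+ 4)%:E)%E.
Proof.
move=> n1 HU; pose F s : \bar R := ((1 - last 0 (sort <=%R s)) ^+ 4)%:E.
have e4 (x : R) : 0 <= x ^+ 4 by rewrite (_ : x ^+ 4 = (x ^+ 2) ^+ 2) ?sqr_ge0//; ring.
have mF : mseq n.+1 F.
  apply/measurable_EFinP; apply: measurable_funX; apply: measurable_funB => //.
  have := @measurable_nth_sort R n.+1 n; congr (measurable_fun _ _); apply/funext => t.
  have st : size (sort <=%R t) = n.+1 by rewrite size_sort size_tuple.
  by rewrite -nth_last st.
have F0 s : (0 <= F s)%E by rewrite lee_fin.
have Fs s s' : perm_eq s s' -> F s = F s'.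
  by move=> ss; rewrite /F; have /perm_sortP -> := ss; [|exact: le_total|exact: le_trans|exact: le_anti].
have mF' : mseq (size (iota 0 n.+1)) F by rewrite size_iota.
apply: (@le_trans _ _ (\int[P]_w F (sample U (iota 0 n.+1) w))%E); first exact: lexx.
rewrite (iid_int HU (iota_uniq 0 n.+1) mF' F0) size_iota.
rewrite (tpow_max HU (uniform_atomless muE) mF F0 Fs).
pose F1 s : \bar R := ((1 - head 0 s) ^+ 4 * (all (<= head 0 s) s)%:R)%:E.
have mF1 : mseq n.+1 F1.
  apply/measurable_EFinP; apply: measurable_funM; last exact: measurable_all_head.
  apply: measurable_funX; apply: measurable_funB => //.
  rewrite (_ : (fun _ => _) = (fun t : n.+1.-tuple R => tnth t ord0)); first exact: measurable_tnth.
  by apply/funext => t; rewrite (tnth_nth 0) nth0.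
have F10 s : (0 <= F1 s)%E by rewrite lee_fin mulr_ge0.
have -> : (\int[mu]_x \int[tpow mu n]_t (F (x :: t) * ((all (<= x) t)%:R)%:E) =
    \int[mu]_x \int[tpow mu n]_t F1 (x :: t))%E.
  apply: eq_integral => x _; apply: eq_integral => t _; rewrite /F /F1 /= lexx -EFinM.
  case: (boolP (all (<= x) t)) => [tx|_]; last by rewrite !mulr0.
  by rewrite sort_cons_max// last_rcons.
rewrite muE; [|exact: measurable_tpow_cons|by move=> x; exact: integral_ge0].
rewrite integral_itv_bndoo; last by apply: measurable_funTS; exact: measurable_tpow_cons.
have -> : (\int[leb]_(x in `]0%R, 1%R[) \int[tpow mu n]_t F1 (x :: t) =
    \int[leb]_(x in `]0%R, 1%R[) (x ^+ n * (1 - x) ^+ 4)%:E)%E.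
  apply: eq_integral => x; rewrite inE/= in_itv/= => /andP[x0 x1].
  have x01 : 0 < x <= 1 by rewrite x0 ltW.
  rewrite mulrC EFinM -(tpow_mass muE n x01) -ge0_integralZl//.
  - by apply: eq_integral => t _; rewrite /F1 /= lexx EFinM.
  - by apply/measurable_EFinP; exact: measurable_all.
  - by rewrite lee_fin.
have mg : measurable_fun setT (fun x : R => (1 - x) ^+ 4).
  by apply: measurable_funX; exact: measurable_funB.
have n0 : (0 : R) < n.+1%:R by rewrite ltr0n.
have hf (w : R) : 0 < w < 1 -> `|(1 - w) ^+ 4| <= (n.+1%:R ^+ 4)^-1 * log_weight n.+1 w ^+ 4.
  move=> /andP[w0 w1]; rewrite ger0_norm// mulrC -exprVn -exprMn.
  apply: lerXn2r; rewrite ?nnegrE.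
  - by rewrite subr_ge0 ltW.
  - rewrite mulr_ge0 ?invr_ge0//; have w01 : 0 < w < 1 by rewrite w0.
    exact: (le_trans ler01 (Yk_ge1 n.+1 w01)).
  rewrite ler_pdivlMr// /log_weight.
  have h : ln w <= w - 1.
    by have := @le_ln1Dx R (w - 1); rewrite addrCA subrr addr0; apply; lra.
  have : n.+1%:R * ln w <= n.+1%:R * (w - 1) by rewrite ler_pM2l.
  by move: (n.+1%:R : R) (ln w) => N l; lra.
have i4 : 0 <= (n.+1%:R ^+ 4 : R)^-1 by rewrite invr_ge0.
have hP := norm_powE_Y (n1 : (1 < n.+1)%N) (isT : (4 <= 9)%N) i4 mg hf.
have ag : admissible n.+1 (fun x : R => (1 - x) ^+ 4).
  split => //; exists ((n.+1%:R ^+ 4)^-1) => w w01; apply: (le_trans (hf w w01)).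
  by rewrite ler_wpM2l// le_Yk.
have ig := powE_integrable (n1 : (1 < n.+1)%N) ag.
rewrite -ge0_integralZl//; last 2 first.
- by apply: measurable_funTS; apply/measurable_EFinP; apply: measurable_funM => //; exact: measurable_funX.
- by move=> x; rewrite /= in_itv/= => /andP[x0 _]; rewrite lee_fin mulr_ge0// exprn_ge0// ltW.
have -> : (\int[leb]_(x in `]0%R, 1%R[) (n.+1%:R%:E * (x ^+ n * (1 - x) ^+ 4)%:E) =
    (powE n.+1 (fun x : R => (1 - x) ^+ 4))%:E)%E.
  rewrite /powE /Rintegral fineK//; last exact: integrable_fin_num.
  by apply: eq_integral => w _; rewrite /= -EFinM mulrA.
by rewrite lee_fin mulrC (le_trans (ler_norm _)).
Qed.

Lemma sort_reflect (s : seq R) : sort <=%R [seq 1 - x | x <- s] = rev [seq 1 - x | x <- sort <=%R s].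
Proof.
apply: (@sorted_eq _ <=%R).
- exact: le_trans.
- exact: le_anti.
- exact/sort_sorted/le_total.
- rewrite rev_sorted sorted_map.
  have : sorted <=%R (sort <=%R s) by exact/sort_sorted/le_total.
  by apply: sub_sorted => x y xy /=; rewrite lerD2l lerN2.
- rewrite perm_sort perm_sym perm_rev; apply: perm_map; rewrite perm_sort.
  exact: perm_refl.
Qed.

Lemma min_moment (U : nat -> T -> R) n : (0 < n)%N -> iid P mu U ->
  (\int[P]_w ((head 0 (sort <=%R (sample U (iota 0 n.+1) w))) ^+ 4)%:E <= (c9 / n.+1%:R ^+ 4)%:E)%E.
Proof.
move=> n1 HU; apply: (le_trans _ (max_moment n1 (iid_reflect HU))).
rewrite le_eqVlt; apply/orP; left; apply/eqP; apply: eq_integral => w _; congr (_ ^+ 4)%:E.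
have -> : sample (fun i w => 1 - U i w) (iota 0 n.+1) w = [seq 1 - x | x <- sample U (iota 0 n.+1) w].
  by rewrite /sample -map_comp.
rewrite sort_reflect.
have : size (sort <=%R (sample U (iota 0 n.+1) w)) = n.+1 by rewrite size_sort size_map size_iota.
case: (sort _ _) => //= x s _.
by rewrite rev_cons last_rcons subKr.
Qed.

End extreme_gaps.

(** * From the gap sum to the spacing statistic *)

Section inner_gaps.
Context {R : realType}.
Implicit Types (f : R -> R -> R) (s : seq R).

Lemma gsum_inner f a x s u : gsum f a (x :: s) u =
  f a x + \sum_(1 <= i < (size s).+1) f (nth 0 (x :: s) i.-1) (nth 0 (x :: s) i) + f (last x s) u.
Proof.
elim: s a x => [|y s IH] a x /=; first by rewrite big_geq// addr0.
rewrite big_ltn// big_add1 /= -!addrA; congr (_ + _).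
have := IH x y; rewrite /= => ->; rewrite -!addrA; congr (_ + _); congr (_ + _).
by rewrite !big_nat; apply: eq_bigr => -[|i].
Qed.

(** [xlogx (N r) = N xlogx r + N (ln N) r], and the lengths [r] telescope. *)
Lemma gsum_mulN (H : R -> R) (N a u : R) s : 0 < N -> {homo H : x y / x <= y} ->
  path <=%R a (rcons s u) ->
  gsum (fun x y => xlogx (N * (H y - H x))) a s u =
  N * gsum (gapx H) a s u + N * ln N * (H u - H a).
Proof.
move=> N0 Hh; have key x y : x <= y -> xlogx (N * (H y - H x)) = N * gapx H x y + N * ln N * (H y - H x).
  move=> xy; have := Hh _ _ xy; rewrite -subr_ge0 /gapx; move: (H y - H x) => r.
  rewrite le_eqVlt => /predU1P[<-|r0]; first by rewrite !mulr0 xlogx_le0// mulr0 addr0.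
  by rewrite /xlogx lnM ?posrE//; ring.
elim: s a => [|x s IH] a /=; first by rewrite andbT; exact: key.
by move=> /andP[ax xs]; rewrite key// IH//; ring.
Qed.

End inner_gaps.

Section spacing_clt.
Context {R : realType} d (T : measurableType d) (P : probability T R) (mu : probability R R).
Local Notation leb := (@lebesgue_measure R).
Local Notation v := (pi ^+ 2 / 3 - 2 : R).
Local Notation c9 := (2 * 27%:R ^+ 9 : R).
Variables (U : nat -> T -> R).
Hypothesis HU : iid P mu U.
Hypothesis muE : forall phi : R -> \bar R, measurable_fun setT phi -> (forall x, 0 <= phi x)%E ->
  (\int[mu]_x phi x = \int[leb]_(x in `[0%R, 1%R]) phi x)%E.
Hypothesis U01 : forall i w, 0 <= U i w <= 1.
Variables (h : R -> R) (a b : R).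
Hypothesis a0 : 0 < a.
Hypothesis mh : measurable_fun setT h.
Hypothesis hab : forall x, a <= h x <= b.
Local Notation H := (primv mu h).

Let ab : a <= b. Proof. by have /andP[] := hab 0; exact: le_trans. Qed.
Let b0 : 0 < b. Proof. exact: lt_le_trans ab. Qed.
Let h0 x : 0 <= h x <= b.
Proof. by have /andP[/(le_trans (ltW a0)) -> ->] := hab x. Qed.
Let bh : bm h.
Proof. by split => //; exists b => x; rewrite ger0_norm//; have /andP[] := h0 x. Qed.
Let Hh : {homo H : x y / x <= y}.
Proof. by apply: primv_homo => // x; have /andP[] := h0 x. Qed.
Let Hb x : 0 <= H x <= b. Proof. exact: primv_range. Qed.
Let mH : measurable_fun setT H. Proof. exact: measurable_primv. Qed.

Let srt n w := sort <=%R (sample U (iota 0 n) w).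

Definition inner_sum n w : R :=
  \sum_(1 <= i < n) xlogx (n%:R * (H (nth 0 (srt n w) i) - H (nth 0 (srt n w) i.-1))).

Definition edge n w : R :=
  xlogx (n%:R * H (head 0 (srt n w))) + xlogx (n%:R * (H 1 - H (last 0 (srt n w)))).

Let size_srt n w : size (srt n w) = n.
Proof. by rewrite size_sort size_map size_iota. Qed.

Let srt01 n w : all (fun x => 0 <= x <= 1) (srt n w).
Proof. by apply/allP => x; rewrite mem_sort => /mapP[i _ ->]. Qed.

(** The middle term is deterministic and disappears on centring, so only [edge] has to be
    controlled. *)
Lemma inner_sumE n w : (0 < n)%N -> inner_sum n w =
  n%:R * gapsum (gapx H) 1 (sample U (iota 0 n) w) + n%:R * ln n%:R * H 1 - edge n w.
Proof.
move=> n0; have N0 : (0 : R) < n%:R by rewrite ltr0n.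
have ps : path <=%R 0 (rcons (srt n w) 1).
  have ss : sorted <=%R (srt n w) by exact/sort_sorted/le_total.
  rewrite rcons_path; apply/andP; split.
    rewrite path_sortedE; last exact: le_trans.
    by rewrite ss andbT; apply: sub_all (srt01 n w) => x /andP[].
  have := srt01 n w; case: (srt n w) => [_|x s sx] /=; first by rewrite ler01.
  by have := allP sx _ (mem_last x s) => /andP[].
have := gsum_mulN N0 Hh ps.
rewrite (primv0 muE bh) subr0 /gapsum -/(srt n w) => <-; rewrite /inner_sum /edge.
have := size_srt n w; case: (srt n w) => [|x s] /=; first by move=> n0'; move: n0; rewrite -n0'.
move=> sn; rewrite [X in _ = X - _](gsum_inner _ 0 x s 1) -sn (primv0 muE bh) subr0.
by rewrite [xlogx _ + \sum_(_ <= _ < _) _]addrC -[_ + _ + xlogx _]addrA addrK.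
Qed.

Let bm_seq (F : seq R -> R) n : bseq n F -> bm (fun w => F (sample U (iota 0 n) w)).
Proof.
move=> bF; have bF' : bseq (size (iota 0 n)) F by rewrite size_iota.
by have [] := Ex_sample HU (iota_uniq 0 n) bF'.
Qed.

Let h_e4 (x : R) : 0 <= x ^+ 4.
Proof. by rewrite (_ : x ^+ 4 = (x ^+ 2) ^+ 2) ?sqr_ge0//; ring. Qed.

Let ends01 n w : (0 < n)%N -> 0 <= head 0 (srt n w) <= 1 /\ 0 <= last 0 (srt n w) <= 1.
Proof.
have := srt01 n w; have := size_srt n w; case: (srt n w) => [<-//|x s _ sx _] /=; split.
  by have /andP[] := sx.
by have := allP sx _ (mem_last x s).
Qed.

Lemma bm_edge n : (0 < n)%N -> bm (edge n).
Proof.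
move=> n0.
have bb (K : R -> R) : measurable_fun setT K -> (forall x, 0 <= K x <= b) ->
    forall k, bseq n (fun s => xlogx (n%:R * K (nth 0 (sort <=%R s) k))).
  move=> mK Kb k; split.
    apply: (measurableT_comp measurable_xlogx); apply: measurable_funM => //.
    by apply: (measurableT_comp mK); exact: measurable_nth_sort.
  exists (2 + (n%:R * b) ^+ 2) => t; apply: (le_trans (norm_xlogx_sqr _)); rewrite lerD2l.
  have /andP[k0 kb] := Kb (nth 0 (sort <=%R t) k).
  by rewrite lerXn2r ?nnegrE ?mulr_ge0 ?(ltW b0)// ler_wpM2l.
(* The minimum with 1 changes nothing on the sample, but keeps the function within [[0, b]] at every
   real. *)
have mK : measurable_fun setT (fun x : R => H 1 - H (Order.min 1 x)).
  apply: measurable_funB => //; apply: (measurableT_comp mH); exact: measurable_minr.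
have Kb x : 0 <= H 1 - H (Order.min 1 x) <= b.
  have m1 : Order.min 1 x <= 1 by rewrite ge_min lexx.
  have := Hh m1; have /andP[_ h1] := Hb 1; have /andP[h2 _] := Hb (Order.min 1 x).
  by move: (H 1) (H (Order.min 1 x)) h1 h2 => p q ? ? ?; apply/andP; split; lra.
have := bmD (bm_seq (bb _ mH Hb 0)) (bm_seq (bb _ mK Kb n.-1)); congr bm; apply/funext => w.
rewrite /edge -/(srt n w) nth0; congr (_ + xlogx (_ * (_ - H _))).
have [_ /andP[_ l1]] := ends01 w n0.
by have -> : nth 0 (srt n w) n.-1 = last 0 (srt n w); [rewrite -nth_last size_srt|exact: min_r].
Qed.

Definition edge_cst : R := 32 + 8 * b ^+ 4 * c9.

(** [n] times an extreme gap has a fourth moment bounded in [n]; after division by [sqrt n] the edge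
    terms are therefore negligible in mean square. *)
Lemma edge_bound n : (1 < n)%N -> Ex P (fun w => edge n w ^+ 2) <= edge_cst.
Proof.
case: n => // n n1; set N := n.+1; have N0 : (0 < N)%N by [].
have NR : (0 : R) < N%:R by rewrite ltr0n.
have sq (x y : R) : 0 <= x -> x <= b * y -> xlogx (N%:R * x) ^+ 2 <= 8 + 2 * (N%:R ^+ 4 * b ^+ 4 * y ^+ 4).
  move=> x0 xy; have y0 : 0 <= y by rewrite -(pmulr_rge0 _ b0) (le_trans x0).
  have hx := norm_xlogx_sqr (N%:R * x).
  have h1 : xlogx (N%:R * x) ^+ 2 <= (2 + (N%:R * x) ^+ 2) ^+ 2.
    by rewrite -[leLHS]real_normK ?num_real// lerXn2r ?nnegrE// addr_ge0// sqr_ge0.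
  apply: (le_trans h1).
  have h2 : (N%:R * x) ^+ 4 <= N%:R ^+ 4 * b ^+ 4 * y ^+ 4.
    by rewrite -!exprMn lerXn2r ?nnegrE ?mulr_ge0 ?(ltW NR) ?(ltW b0)// -mulrA ler_wpM2l// ltW.
  have -> : (2 + (N%:R * x) ^+ 2) ^+ 2 = 8 + 2 * (N%:R * x) ^+ 4 - (2 - (N%:R * x) ^+ 2) ^+ 2 by ring.
  have := sqr_ge0 (2 - (N%:R * x) ^+ 2); move: h2.
  by move: ((N%:R * x) ^+ 4) ((2 - (N%:R * x) ^+ 2) ^+ 2) (N%:R ^+ 4 * b ^+ 4 * y ^+ 4) => ? ? ? ? ?; lra.
pose c : R := 4 * (N%:R ^+ 4 * b ^+ 4).
have c0 : 0 <= c by rewrite mulr_ge0// mulr_ge0.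
pose F1 s : R := head 0 (sort <=%R s) ^+ 4.
pose F2 s : R := (1 - last 0 (sort <=%R s)) ^+ 4.
pose sm w := sample U (iota 0 N) w.
have pw w : edge N w ^+ 2 <= 32 + c * (F1 (sm w) + F2 (sm w)).
  have [/andP[u0 u1] /andP[l0 l1]] := ends01 w N0.
  rewrite /edge /F1 /F2 /sm -/(srt N w); move: (head 0 (srt N w)) (last 0 (srt N w)) u0 u1 l0 l1 => u l u0 u1 l0 l1.
  have q1 : 0 <= H u <= b * u.
    have /andP[-> _] /= := Hb u.
    by have /andP[_] := primv_bounds muE bh hab (lexx 0) u0 u1; rewrite (primv0 muE bh) !subr0.
  have q2 : 0 <= H 1 - H l <= b * (1 - l).
    have /andP[q3 ->] := primv_bounds muE bh hab l0 l1 (lexx 1); rewrite andbT (le_trans _ q3)//.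
    by rewrite mulr_ge0 ?(ltW a0)// subr_ge0.
  have /andP[q3 q4] := q1; have /andP[q5 q6] := q2.
  have s1 := sq _ _ q3 q4; have s2 := sq _ _ q5 q6; rewrite /c.
  move: (xlogx _) (xlogx _) s1 s2 => p q.
  move: (u ^+ 4) ((1 - l) ^+ 4) (N%:R ^+ 4 * b ^+ 4) => A B D s1 s2.
  have := sqr_ge0 (p - q); have -> : (p - q) ^+ 2 = 2 * p ^+ 2 + 2 * q ^+ 2 - (q + p) ^+ 2 by ring.
  have -> : 32 + 4 * D * (A + B) = 2 * (8 + 2 * (D * A)) + 2 * (8 + 2 * (D * B)) by ring.
  move: ((q + p) ^+ 2) (p ^+ 2) (q ^+ 2) (8 + 2 * (D * A)) (8 + 2 * (D * B)) s1 s2 => ? ? ? ? ? ? ? ?; lra.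
have msort k : measurable_fun setT (fun w => nth 0 (srt N w) k).
  apply/measurable_EFinP; apply: (measurable_sample HU (F := fun s => (nth 0 (sort <=%R s) k)%:E)).
  by apply/measurable_EFinP; exact: measurable_nth_sort.
have bm1 (f : T -> R) : measurable_fun setT f -> (forall w, 0 <= f w <= 1) -> bm (fun w => f w ^+ 4).
  move=> mf f01; split; first exact: measurable_funX.
  by exists 1 => w; have /andP[? ?] := f01 w; rewrite ger0_norm// exprn_ile1.
have b1 : bm (fun w => F1 (sm w)).
  apply: bm1; last by move=> w; have [] := ends01 w N0.
  by have := msort 0%N; congr measurable_fun; apply/funext => w; rewrite nth0.
have b2 : bm (fun w => F2 (sm w)).
  apply: (bm1 (fun w => 1 - last 0 (srt N w))).
    apply: measurable_funB => //.
    by have := msort n; congr measurable_fun; apply/funext => w; rewrite -nth_last size_srt.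
  by move=> w; have [_ /andP[? ?]] := ends01 w N0; apply/andP; split; lra.
have m1 := min_moment muE n1 HU; have m2 := max_moment muE n1 HU.
have e1 := ExE P b1; have e2 := ExE P b2; rewrite /F1 /F2 /sm in e1 e2.
rewrite e1 lee_fin in m1; rewrite e2 lee_fin in m2.
have b3 := bmZ c (bmD b1 b2); have b4 : bm (fun _ : T => 32 : R) by exact: bm_cst.
have hE := @le_Ex _ _ _ P _ _ (bm_sqr (bm_edge N0)) (bmD b4 b3) pw.
apply: (le_trans hE).
rewrite (ExD P b4 b3) Ex_cst (ExZ P _ (bmD b1 b2)) (ExD P b1 b2) /edge_cst lerD2l.
apply: (le_trans (ler_wpM2l c0 (lerD m1 m2))); rewrite /c -/N.
have n4 : (N%:R : R) ^+ 4 != 0 by rewrite expf_neq0// gt_eqF.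
rewrite le_eqVlt; apply/orP; left; apply/eqP.
by move: (N%:R ^+ 4 : R) n4 (b ^+ 4) (27%:R ^+ 9 : R) => x x0 y z; field.
Qed.

Lemma spacing_clt_conv :
  clt_conv P (fun n w => (Num.sqrt n%:R)^-1 * inner_sum n w)
    (v * Ex mu (fun x => h x ^+ 2) - Ex mu h ^+ 2).
Proof.
have GC := gap_clt_conv HU muE U01 a0 mh hab.
have bG n : bm (fun w => Num.sqrt n%:R * gapsum (gapx H) 1 (sample U (iota 0 n) w)).
  by have [bG _ _] := GC.
have rE n : (0 < n)%N -> exists c : R, forall w, (Num.sqrt n%:R)^-1 * inner_sum n w =
    Num.sqrt n%:R * gapsum (gapx H) 1 (sample U (iota 0 n) w) + (c - (Num.sqrt n%:R)^-1 * edge n w).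
  move=> n0; exists ((Num.sqrt n%:R)^-1 * (n%:R * ln n%:R * H 1)) => w.
  have r0 : Num.sqrt (n%:R : R) != 0 by rewrite gt_eqF// sqrtr_gt0 ltr0n.
  rewrite inner_sumE// -{2}(sqr_sqrtr (ler0n R n)).
  by move: (Num.sqrt n%:R) r0 (gapsum _ _ _) (edge n w) => r r0 g e; field.
have bcst (c : R) : bm (fun _ : T => c) by exact: bm_cst.
have bY n : bm (fun w => (Num.sqrt n%:R)^-1 * inner_sum n w).
  case: n => [|n].
    have := bcst 0; congr bm; apply/funext => w.
    by rewrite /inner_sum big_geq// mulr0.
  have [c cE] := rE n.+1 isT.
  have := bmD (bG n.+1) (bmB (bcst c) (bmZ (Num.sqrt n.+1%:R)^-1 (bm_edge (isT : (0 < n.+1)%N)))).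
  by congr bm; apply/funext => w; rewrite cE.
have q0 : 0 <= v * Ex mu (fun x => h x ^+ 2) - Ex mu h ^+ 2.
  have v1 : 1 <= v by have := @pi2_gt9 R; lra.
  have h1 := Ex_sqr_le mu bh.
  have h2 : 0 <= Ex mu (fun x => h x ^+ 2) by apply: Ex_ge0; [exact: bm_sqr|move=> x; exact: sqr_ge0].
  by rewrite subr_ge0 (le_trans h1)// ler_peMl.
apply: clt_perturb => // e e0; exists (fun n w => Num.sqrt n%:R * gapsum (gapx H) 1 (sample U (iota 0 n) w)).
exists (v * Ex mu (fun x => h x ^+ 2) - Ex mu h ^+ 2); split => //.
  by rewrite subrr normr0 ltW.
have C0 : 0 <= edge_cst by rewrite /edge_cst addr_ge0// mulr_ge0// mulr_ge0.
near=> n.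
have n1 : (1 < n)%N by near: n; exists 2%N.
have n0 : (0 < n)%N := ltnW n1.
have n0' : (0 : R) < n%:R by rewrite ltr0n.
have [c cE] := rE n n0.
have be := bm_edge n0.
have -> : (fun w => (Num.sqrt n%:R)^-1 * inner_sum n w - Num.sqrt n%:R * gapsum (gapx H) 1 (sample U (iota 0 n) w))
    = fun w => c - (Num.sqrt n%:R)^-1 * edge n w.
  by apply/funext => w; rewrite cE addrAC subrr add0r.
have bd := bmB (bcst c) (bmZ (Num.sqrt n%:R)^-1 be).
apply: (le_trans (Vr_le _ c bd)).
rewrite (@eq_Ex _ _ _ P _ (fun w => n%:R^-1 * edge n w ^+ 2)); last first.
  by move=> w; rewrite addrAC subrr add0r sqrrN exprMn exprVn sqr_sqrtr.
rewrite (ExZ P _ (bm_sqr be)) mulrC ler_pdivrMr//.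
apply: (le_trans (edge_bound n1)); rewrite mulrC -ler_pdivrMr//.
by near: n; exact: nbhs_infty_ger.
Unshelve. all: by end_near. Qed.

End spacing_clt.

(** * From smoothed indicators to distribution functions *)

Section clt_cdf.
Context d (T : measurableType d) (R : realType) (P : probability T R).

Lemma Phi_continuous : continuous (@Phi R).
Proof.
by move=> z; apply: differentiable_continuous; apply/derivable1_diffP; have [] := is_derive_Phi z.
Qed.

(** The shift is [m + 1] times the smoothing width: beyond it the smoothed indicator differs from
    the true one by a Gaussian tail at [m + 1], and both tend to 0. *)
Let delta (m : nat) : R := m.+1%:R^-1.
Let width (m : nat) : R := m.+1%:R^-1 ^+ 2.

Let delta0 m : 0 < delta m. Proof. by rewrite invr_gt0. Qed.
Let width0 m : 0 < width m. Proof. by rewrite exprn_gt0// invr_gt0. Qed.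
Let delta_width m : delta m / width m = m.+1%:R.
Proof. by rewrite /delta /width expr2 invfM invrK mulrA mulVf ?mul1r// pnatr_eq0. Qed.

Let cvg_shift (q x e : R) : 0 < q -> heat (x + e * delta m) (width m) q 0 @[m --> \oo] --> Phi (x / Num.sqrt q).
Proof.
move=> q0; rewrite /heat.
have d0 : delta m @[m --> \oo] --> (0 : R) by exact: cvg_harmonic.
have w0 : width m ^+ 2 + q @[m --> \oo] --> ((0 ^+ 2) ^+ 2 + q : R).
  apply: cvgD; last exact: cvg_cst.
  have h1 := cvg_comp _ _ d0 (@exprn_continuous R 2 0).
  exact: (cvg_comp _ _ h1 (@exprn_continuous R 2 _)).
have hin : (x + e * delta m - 0) / Num.sqrt (width m ^+ 2 + q) @[m --> \oo] --> x / Num.sqrt q.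
  have -> : x / Num.sqrt q = (x + e * 0 - 0) / Num.sqrt ((0 ^+ 2) ^+ 2 + q).
    by rewrite mulr0 addr0 subr0 !expr0n /= add0r.
  apply: cvgM.
    apply: cvgB; last exact: cvg_cst.
    by apply: cvgD; [exact: cvg_cst|apply: cvgM; [exact: cvg_cst|exact: d0]].
  apply: cvgV; first by rewrite !expr0n /= add0r gt_eqF// sqrtr_gt0.
  exact: (cvg_comp _ _ w0 (@sqrt_continuous R _)).
exact: (cvg_comp _ _ hin (@Phi_continuous _)).
Qed.

Let indicator_le (x y : R) m :
  heat (x - delta m) (width m) 0 y - Phi (- m.+1%:R) <= (y <= x)%R%:R <=
  heat (x + delta m) (width m) 0 y + (1 - Phi m.+1%:R).
Proof.
have s0 := width0 m; have d0 := delta0 m.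
rewrite !heat0//; have [yx|xy] := leP y x.
  rewrite mulr1n; apply/andP; split.
    have := Phi_le1 ((x - delta m - y) / width m); have := @Phi_ge0 R (- m.+1%:R).
    by lra.
  rewrite addrCA lerDl subr_ge0 -delta_width; apply: Phi_homo.
  by rewrite ler_pM2r ?invr_gt0//; lra.
rewrite mulr0n; apply/andP; split.
  rewrite subr_le0 -delta_width -mulNr; apply: Phi_homo.
  by rewrite ler_pM2r ?invr_gt0//; lra.
have := Phi_le1 (m.+1%:R : R); have := Phi_ge0 ((x + delta m - y) / width m).
by lra.
Qed.

Let sandwich (A B C D F G I J e : R) : `|A - B| <= e / 3 -> `|A - C| <= e / 3 -> `|D| <= e / 3 ->
  `|1 - F| <= e / 3 -> `|B - G| <= e / 3 -> `|C - I| <= e / 3 -> J <= G + (1 - F) -> I - D <= J -> `|A - J| <= e.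
Proof.
rewrite !ler_norml => /andP[? ?] /andP[? ?] /andP[? ?] /andP[? ?] /andP[? ?] /andP[? ?] ? ?.
by apply/andP; split; lra.
Qed.

Lemma clt_conv_cdf (Y : nat -> T -> R) (q x : R) : clt_conv P Y q -> 0 < q ->
  P [set w | Y n w - Ex P (Y n) <= x] @[n --> \oo] --> normal_prob (0 : R) (Num.sqrt q) `]-oo, x]%classic.
Proof.
move=> [bY _ CY] q0; rewrite normal_prob_Phi ?sqrtr_gt0//.
pose W n w := Y n w - Ex P (Y n).
have bcst (c : R) : bm (fun _ : T => c) by exact: bm_cst.
have bW n : bm (W n) := bmB (bY n) (bcst _).
have bI n : bm (fun w => (W n w <= x)%R%:R : R).
  split; last by exists 1 => w; case: (W n w <= x); rewrite ?normr1 ?normr0.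
  by apply: measurable_bool; apply: measurable_fun_ler => //; have [] := bW n.
pose p n := Ex P (fun w => (W n w <= x)%R%:R).
have pE n : P [set w | Y n w - Ex P (Y n) <= x] = (p n)%:E.
  rewrite /p -ExE//.
  have mS : measurable [set w | Y n w - Ex P (Y n) <= x].
    rewrite -[X in measurable X]setTI; have [mW _] := bW n.
    rewrite (_ : [set w | _] = W n @^-1` `]-oo, x]%classic); first exact: mW (measurable_itv _).
    by apply/seteqP; split => w /=; rewrite in_itv.
  rewrite -[X in P X]setIT -integral_indic//; apply: eq_integral => w _.
  by rewrite indicE; congr (_%:R%:E); congr nat_of_bool; apply/idP/idP; rewrite inE.
under eq_fun do rewrite pE.
apply: cvg_EFin; first exact: nearW.
apply/cvgrPdist_le => e e0.
have e4 : 0 < e / 3 by rewrite divr_gt0.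
have n1 : \forall m \near \oo, `|Phi (x / Num.sqrt q) - heat (x + 1 * delta m) (width m) q 0| <= e / 3.
  by apply: cvgr_dist_le => //; exact: cvg_shift.
have n2 : \forall m \near \oo, `|Phi (x / Num.sqrt q) - heat (x + -1 * delta m) (width m) q 0| <= e / 3.
  by apply: cvgr_dist_le => //; exact: cvg_shift.
have n3 : \forall m \near \oo, `|0 - Phi (- m%:R : R)| <= e / 3 by apply: cvgr_dist_le => //; exact: Phi_tail.
have n4 : \forall m \near \oo, `|1 - Phi (m%:R : R)| <= e / 3 by apply: cvgr_dist_le => //; exact: Phi_cotail.
(* The smoothing level is fixed before [n] tends to infinity. *)
have [m [m1 m2 m3 m4]] : exists m, [/\ `|Phi (x / Num.sqrt q) - heat (x + 1 * delta m) (width m) q 0| <= e / 3,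
    `|Phi (x / Num.sqrt q) - heat (x + -1 * delta m) (width m) q 0| <= e / 3,
    `|0 - Phi (- m.+1%:R : R)| <= e / 3 & `|1 - Phi (m.+1%:R : R)| <= e / 3].
  have [N1 _ h1] := n1; have [N2 _ h2] := n2; have [N3 _ h3] := n3; have [N4 _ h4] := n4.
  exists (N1 + N2 + N3 + N4)%N; split.
  - by apply: h1 => /=; rewrite -!addnA leq_addr.
  - by apply: h2 => /=; rewrite -addnA (addnC N1) -addnA leq_addr.
  - by apply: h3 => /=; apply: leqW; rewrite -addnA (addnC (N1 + N2)%N) -addnA leq_addr.
  - by apply: h4 => /=; apply: leqW; exact: leq_addl.
have up := CY (x + 1 * delta m) _ (width0 m); have lo := CY (x + -1 * delta m) _ (width0 m).
have n5 : \forall n \near \oo, `|heat (x + 1 * delta m) (width m) q 0 -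
    Ex P (fun w => heat (x + 1 * delta m) (width m) 0 (W n w))| <= e / 3 by apply: cvgr_dist_le.
have n6 : \forall n \near \oo, `|heat (x + -1 * delta m) (width m) q 0 -
    Ex P (fun w => heat (x + -1 * delta m) (width m) 0 (W n w))| <= e / 3 by apply: cvgr_dist_le.
have [N5 _ k5] := n5; have [N6 _ k6] := n6; exists (N5 + N6)%N => // n /= nN.
have h5 := k5 n (leq_trans (leq_addr N6 N5) nN); have h6 := k6 n (leq_trans (leq_addl N5 N6) nN).
have bH z : bm (fun w => heat z (width m) 0 (W n w)) := bm_heat0 z _ (width0 m) (bY n).
have u1 : p n <= Ex P (fun w => heat (x + 1 * delta m) (width m) 0 (W n w)) + (1 - Phi m.+1%:R).
  rewrite -[X in _ <= _ + X](Ex_cst P) -(ExD P (bH _) (bcst _)).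
  apply: le_Ex => //; first exact: (bmD (bH _) (bcst _)).
  by move=> w; have /andP[_] := indicator_le x (W n w) m; rewrite mul1r.
have l1 : Ex P (fun w => heat (x + -1 * delta m) (width m) 0 (W n w)) - Phi (- m.+1%:R) <= p n.
  rewrite -[X in _ - X <= _](Ex_cst P) -(ExB P (bH _) (bcst _)).
  apply: le_Ex => //; first exact: (bmB (bH _) (bcst _)).
  by move=> w; have /andP[+ _] := indicator_le x (W n w) m; rewrite mulN1r.
by rewrite sub0r normrN in m3; exact: (sandwich m1 m2 m3 m4 h5 h6 u1 l1).
Qed.

End clt_cdf.

(** * Reduction to the uniform law *)

Section density_cdf.
Context {R : realType}.
Local Notation leb := (@lebesgue_measure R).
Variables (c1 c2 : R) (f : R -> R).
Hypothesis hf : is_density_on c1 c2 f.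
Local Notation F := (density_cdf f).

Lemma dens_measurable : measurable_fun setT f. Proof. by case: hf => -[]. Qed.
Lemma dens_ge0 x : 0 <= f x. Proof. by case: hf => -[]. Qed.
Lemma dens_out x : x \notin `[c1, c2] -> f x = 0. Proof. by case: hf => _ h _ _; exact: h. Qed.

Let mfE D : measurable_fun D (fun x => (f x)%:E).
Proof. by apply: measurable_funTS; apply/measurable_EFinP; exact: dens_measurable. Qed.

Lemma dens_integrable : leb.-integrable setT (EFin \o f).
Proof.
apply/integrableP; split; first exact: mfE.
have -> : (\int[leb]_x `|(EFin \o f) x| = \int[leb]_x (f x)%:E)%E.
  by apply: eq_integral => x _; rewrite /= ger0_norm// dens_ge0.
by case: hf => -[_ _ ->] _ _ _; rewrite ltry.
Qed.

Lemma density_cdfE x : (\int[leb]_(y in `]-oo, x]) (f y)%:E = (F x)%:E)%E.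
Proof.
rewrite /density_cdf /Rintegral fineK//; apply: integrable_fin_num => //.
exact: (integrableS _ _ (subsetT _) dens_integrable).
Qed.

Lemma density_cdfB x y : x <= y -> (\int[leb]_(z in `]x, y]) (f z)%:E = (F y - F x)%:E)%E.
Proof.
move=> xy; have U : `]-oo, y]%classic = `]-oo, x]%classic `|` `]x, y]%classic.
  apply/seteqP; split => z /=; rewrite !in_itv/=.
    by move=> zy; have [zx|xz] := leP z x; [left|right].
  by case=> [zx|/andP[]//]; exact: le_trans xy.
have := density_cdfE y; rewrite U ge0_integral_setU//=.
- by rewrite density_cdfE => h; rewrite EFinB -h [X in _ = (X - _)%E]addeC addeK.
- exact: mfE.
- by move=> z _; rewrite lee_fin dens_ge0.
- apply/disj_set2P/seteqP; split => z //= []; rewrite !in_itv/= => zx /andP[xz _].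
  by move: (lt_le_trans xz zx); rewrite ltxx.
Qed.

Lemma density_cdf_homo : {homo F : x y / x <= y}.
Proof.
move=> x y xy; rewrite -subr_ge0 -lee_fin -density_cdfB//.
by apply: integral_ge0 => z _; rewrite lee_fin dens_ge0.
Qed.

Let M := sval (cid (let: And4 _ _ h _ := hf in h)).
Let fM x : f x <= M. Proof. exact: (svalP (cid (let: And4 _ _ h _ := hf in h))). Qed.
Let M0 : 0 <= M. Proof. exact: le_trans (dens_ge0 0) (fM 0). Qed.

Lemma density_cdf_lip x y : x <= y -> F y - F x <= M * (y - x).
Proof.
move=> xy; rewrite -lee_fin -density_cdfB//.
apply: (@le_trans _ _ (\int[leb]_(z in `]x, y]) (cst M%:E z))%E).
  apply: ge0_le_integral => //.
  - by move=> z _; rewrite lee_fin dens_ge0.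
  - exact: mfE.
  - by move=> z _; rewrite lee_fin.
rewrite integral_cst//= lebesgue_measure_itv/= lte_fin.
case: ifPn => _; first by rewrite -EFinB -EFinM.
by rewrite mule0 lee_fin mulr_ge0// subr_ge0.
Qed.

Lemma density_cdf_incr x y : c1 <= x -> x < y -> y <= c2 -> F x < F y.
Proof.
move=> cx xy yc; case: hf => _ _ _ [m m0 fm].
rewrite -subr_gt0; apply: (@lt_le_trans _ _ (m * (y - x))); first by rewrite mulr_gt0// subr_gt0.
have xy' := ltW xy; rewrite -lee_fin -density_cdfB//.
apply: (@le_trans _ _ (\int[leb]_(z in `]x, y]) (cst m%:E z))%E).
  by rewrite integral_cst//= lebesgue_measure_itv/= lte_fin xy.
apply: ge0_le_integral => //.
- by move=> z _; rewrite lee_fin ltW.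
- exact: mfE.
move=> z; rewrite /= in_itv/= lee_fin => /andP[xz zy]; apply: fm.
by rewrite in_itv/= (le_trans cx (ltW xz)) (le_trans zy).
Qed.

Lemma density_cdf_ge0 x : 0 <= F x.
Proof. by rewrite -lee_fin -density_cdfE; apply: integral_ge0 => z _; rewrite lee_fin dens_ge0. Qed.

Lemma density_cdf1 x : c2 <= x -> F x = 1.
Proof.
move=> cx; apply/EFin_inj; rewrite -density_cdfE; case: (hf) => -[_ _ <-] _ _ _.
rewrite integral_mkcond; apply: eq_integral => y _; rewrite patchE; case: ifPn => //.
rewrite notin_setE/= in_itv/= => /negP; rewrite -ltNge => xy; rewrite dens_out//.
by rewrite in_itv/= negb_and orbC -ltNge (le_lt_trans cx).
Qed.

Lemma density_cdf_le1 x : F x <= 1.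
Proof.
have [xc|/ltW cx] := leP x c2; last by rewrite density_cdf1.
by rewrite -(density_cdf1 (lexx c2)); exact: density_cdf_homo.
Qed.

Lemma density_cdf0 x : x <= c1 -> F x = 0.
Proof.
have F0 y : y < c1 -> F y = 0.
  move=> yc; apply/EFin_inj; rewrite -density_cdfE; apply: integral0_eq => z; rewrite /= in_itv/= => zy.
  by rewrite dens_out// in_itv/= negb_and -ltNge (le_lt_trans zy).
rewrite le_eqVlt => /predU1P[->|]; last exact: F0.
(* At [c1] itself the value is reached from the left by the Lipschitz bound. *)
apply/eqP; rewrite eq_le density_cdf_ge0 andbT.
apply/ler_addgt0Pr => e e0; rewrite add0r.
have M1 : 0 < M + 1 by rewrite ltr_wpDl.
pose y := c1 - e / (M + 1).
have d0 : 0 < e / (M + 1) by rewrite divr_gt0.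
have yc : y < c1 by rewrite /y ltrBlDr ltrDl.
have := density_cdf_lip (ltW yc); rewrite (F0 y yc) subr0 => /le_trans; apply.
rewrite /y opprB addrC subrK mulrCA ler_piMr ?(ltW e0)//.
by rewrite ler_pdivrMr// mul1r lerDl.
Qed.

Lemma density_support : c1 < c2.
Proof.
rewrite ltNge; apply/negP => cc; have := density_cdf1 cc; rewrite density_cdf0//.
by move=> /eqP; rewrite eq_sym oner_eq0.
Qed.

Lemma density_cdf_continuous : continuous F.
Proof.
have lip x y : `|F x - F y| <= M * `|x - y|.
  wlog xy : x y / y <= x.
    move=> wl; have [yx|/ltW yx] := leP y x; first exact: wl.
    by rewrite distrC [in leRHS]distrC; exact: wl.
  rewrite !ger0_norm ?subr_ge0//; last exact: density_cdf_homo.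
  exact: density_cdf_lip.
have M1 : 0 < M + 1 by rewrite ltr_wpDl.
move=> y; apply/cvgrPdist_le => e e0; near=> z.
apply: (le_trans (lip _ _)); apply: (@le_trans _ _ ((M + 1) * `|y - z|)); first by rewrite ler_wpM2r// lerDl.
rewrite mulrC -ler_pdivlMr//; near: z.
by apply/nbhs_ballP; exists (e / (M + 1)); [rewrite /= divr_gt0|move=> z; rewrite /ball/= => /ltW].
Unshelve. all: by end_near. Qed.

Lemma measurable_density_cdf : measurable_fun setT F.
Proof. by apply: continuous_measurable_fun; exact: density_cdf_continuous. Qed.

(** Truncating [u] makes the equation solvable for every real, so the quantile is defined and
    monotone on the whole line. *)
Definition quantile (u : R) : R := xget c1 [set x | c1 <= x <= c2 /\ F x = clip 0 1 u].

Lemma quantileP u : c1 <= quantile u <= c2 /\ F (quantile u) = clip 0 1 u.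
Proof.
rewrite /quantile; case: xgetP => [x _ //|no]; exfalso.
have /andP[u0 u1] := clip_range u (@ler01 R).
have cc := ltW density_support.
have cont : {within `[c1, c2], continuous F}.
  by apply: continuous_subspaceT; exact: density_cdf_continuous.
have [] := IVT (v := clip 0 1 u) cc cont.
  by rewrite (density_cdf0 (lexx _)) (density_cdf1 (lexx _)) min_l// max_r// u0.
by move=> x; rewrite in_itv/= => xc xu; exact: (no x).
Qed.

Lemma density_cdf_inj x y : c1 <= x <= c2 -> c1 <= y <= c2 -> F x = F y -> x = y.
Proof.
move=> /andP[x1 x2] /andP[y1 y2] e; case: (ltgtP x y) => // xy.
  by have := density_cdf_incr x1 xy y2; rewrite e ltxx.
by have := density_cdf_incr y1 xy x2; rewrite e ltxx.
Qed.

Lemma quantile_cdf x : c1 <= x <= c2 -> quantile (F x) = x.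
Proof.
move=> xc; have [qc qF] := quantileP (F x); apply: density_cdf_inj => //.
by rewrite qF clip_id// density_cdf_ge0 density_cdf_le1.
Qed.

Lemma quantile_homo : {homo quantile : u v / u <= v}.
Proof.
move=> u v uv; rewrite leNgt; apply/negP => qq.
have [/andP[u1 u2] uF] := quantileP u; have [/andP[v1 v2] vF] := quantileP v.
have := density_cdf_incr v1 qq u2; rewrite uF vF ltNge => /negP; apply.
by rewrite /clip ge_max !le_max lexx/= le_min !ge_min lexx uv/= !orbT.
Qed.

Lemma measurable_quantile : measurable_fun setT quantile.
Proof. by apply: nondecreasing_measurable => //; exact: quantile_homo. Qed.

(** At [u = 1] the equivalence fails for [x > c2]. *)
Lemma density_cdf_le x u : 0 <= u < 1 -> (F x <= u) = (x <= quantile u).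
Proof.
move=> /andP[u0 u1]; have [/andP[q1 q2] qF] := quantileP u.
rewrite clip_id ?u0 ?ltW// in qF.
apply/idP/idP => [|xq]; last by rewrite -qF; exact: density_cdf_homo.
apply: contraLR; rewrite -!ltNge => qx.
have qc : quantile u < c2.
  by rewrite lt_neqAle q2 andbT; apply: contraTneq u1 => e; rewrite -qF e density_cdf1// ltxx.
rewrite -qF; have [xc|cx] := leP x c2; first exact: density_cdf_incr.
by rewrite (density_cdf1 (ltW cx)) qF.
Qed.

End density_cdf.

Section rays.
Context {R : realType}.
Local Notation leb := (@lebesgue_measure R).

Lemma probability_rays (m1 m2 : probability R R) :
  (forall x, m1 `]-oo, x]%classic = m2 `]-oo, x]%classic) -> forall A, measurable A -> m1 A = m2 A.
Proof.
move=> m12 A mA.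
have mi (x y : R) : measurable (`]x, y]%classic : set R) by exact: measurable_itv.
have mr (x : R) : measurable (`]-oo, x]%classic : set R) by exact: measurable_itv.
apply: (@measure_unique _ R R (@measurable _ (ocitv_type R))
  (fun n => `](- n%:R), n%:R]%classic)) => //.
- by move=> B C mB mC; exact: measurableI.
- by move=> i; exact: is_ocitv.
- by rewrite bigcup_itvT.
- move=> _ [[x y] _ <-] /=.
  have [xy|yx] := ltP x y; last by rewrite set_itv_ge ?measure0// bnd_simp -leNgt.
  have e : `]x, y]%classic = `]-oo, y]%classic `\` `]-oo, x]%classic :> set R.
    apply/seteqP; split => z /=; rewrite !in_itv/=.
      by move=> /andP[xz zy]; split => //; apply/negP; rewrite -ltNge.
    by move=> [zy /negP]; rewrite -ltNge zy andbT.
  have s : `]-oo, x]%classic `<=` `]-oo, y]%classic by move=> z /=; rewrite !in_itv/= => /le_trans; apply; exact: ltW.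
  have fm (m : probability R R) B : measurable B -> (m B < +oo)%E.
    by move=> mB; exact: (le_lt_trans (probability_le1 m mB) (ltry 1)).
  rewrite e (measureD (mr y) (mr x) (fm m1 _ (mr y))) (measureD (mr y) (mr x) (fm m2 _ (mr y))).
  rewrite (_ : `]-oo, y]%classic `&` _ = `]-oo, x]%classic); last exact: setIidr.
  exact: (congr2 (fun p q => p - q)%E (m12 y) (m12 x)).
- by move=> k; exact: (le_lt_trans (probability_le1 m1 (mi _ _)) (ltry 1)).
Qed.

(** Change of variables through the Radon-Nikodym derivative, which agrees with [f] almost
    everywhere because both have the same integrals over measurable sets. *)
Lemma integral_density (nu : probability (measurableTypeR R) R) (f : R -> R) :
  leb.-integrable setT (EFin \o f) ->
  (forall B : set R, measurable B -> nu B = (\int[leb]_(x in B) (f x)%:E)%E) ->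
  forall phi : R -> \bar R, measurable_fun setT phi -> (forall x, 0 <= phi x)%E ->
  (\int[nu]_x phi x = \int[leb]_x (phi x * (f x)%:E))%E.
Proof.
move=> fi nuE phi mphi phi0.
have mf : measurable_fun setT (EFin \o f) := measurable_int leb fi.
have dom : nu `<< leb.
  apply/null_content_dominatesP => A mA A0; rewrite nuE//.
  by apply: null_set_integral => //; exact: measurable_funTS.
rewrite -(Radon_Nikodym_SigmaFinite.change_of_variables dom)//.
have iF := Radon_Nikodym_SigmaFinite.f_integrable dom.
have mF := measurable_int leb iF.
apply: ae_eq_integral => //; try exact: emeasurable_funM.
apply: ae_eqe_mul2l; apply: integral_ae_eq => // E _ mE.
by rewrite -(Radon_Nikodym_SigmaFinite.f_integral dom mE); exact: nuE.
Qed.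

Let mid : measurable_fun setT (fun x : measurableTypeR R => x : R).
Proof. exact: measurable_id. Qed.
Let idR : {mfun measurableTypeR R >-> R} := HB.pack (fun x : measurableTypeR R => x : R)
  (isMeasurableFun.Build _ _ _ _ _ mid).

(* [uniform_prob] lives on [measurableTypeR R], which is not the canonical
   measurable structure of [R]. *)
Definition unif01 : probability R R := distribution (uniform_prob (@ltr01 R)) idR.

Lemma uniform_integral (phi : R -> \bar R) : measurable_fun setT phi -> (forall x, 0 <= phi x)%E ->
  (\int[unif01]_x phi x = \int[leb]_(x in `[0%R, 1%R]) phi x)%E.
Proof.
move=> mphi phi0; rewrite /unif01 ge0_integral_distribution//.
by rewrite integral_uniform// subr0 invr1 mul1e.
Qed.

Let mid' : measurable_fun setT (fun x : R => x : measurableTypeR R).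
Proof. exact: measurable_id. Qed.
Let idR' : {mfun R >-> measurableTypeR R} := HB.pack (fun x : R => x : measurableTypeR R)
  (isMeasurableFun.Build _ _ _ _ _ mid').

(** The previous lemma for the canonical measurable structure of [R], transported along the
    identity. *)
Lemma integral_density' (nu : probability R R) (f : R -> R) :
  leb.-integrable setT (EFin \o f) ->
  (forall B : set R, measurable B -> nu B = (\int[leb]_(x in B) (f x)%:E)%E) ->
  forall phi : R -> \bar R, measurable_fun setT phi -> (forall x, 0 <= phi x)%E ->
  (\int[nu]_x phi x = \int[leb]_x (phi x * (f x)%:E))%E.
Proof.
move=> fi nuE phi mphi phi0.
rewrite -(@integral_density (distribution nu idR') f fi nuE phi mphi phi0).
by rewrite ge0_integral_distribution.
Qed.

End rays.

Section uniform_transform.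
Context {R : realType} d (T : measurableType d) (P : probability T R).
Local Notation leb := (@lebesgue_measure R).
Variables (c1 c2 : R) (f g : R -> R).
Hypothesis hf : is_density_on c1 c2 f.
Hypothesis hg : is_density_on c1 c2 g.
Variable X : nat -> {RV P >-> R}.
Hypothesis Xindep : mutually_independent X.
Hypothesis Xdens : forall i, has_density (X i) f.
Local Notation F := (density_cdf f).
Local Notation mu := (@unif01 R).

Lemma uniform_prob_ray (u : R) : mu `]-oo, u]%classic = (clip 0 1 u)%:E.
Proof.
have mr : measurable (`]-oo, u]%classic : set R) by exact: measurable_itv.
transitivity (\int[mu]_x (\1_(`]-oo, u]%classic) x)%:E)%E; first by rewrite integral_indic// setIT.
rewrite uniform_integral//; last by apply/measurable_EFinP; exact: measurable_indic.
rewrite integral_indic// /clip.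
have [u0|u0] := ltP u 0.
  rewrite (_ : _ `&` _ = set0); last first.
    apply/seteqP; split => z //=; rewrite !in_itv/= => -[zu /andP[z0 _]].
    by have := le_lt_trans zu u0; rewrite ltNge z0.
  by rewrite measure0 min_r ?max_l// ltW// (lt_trans u0).
rewrite (_ : _ `&` _ = [set` `[0, Order.min 1 u]]); last first.
  apply/seteqP; split => z /=; rewrite !in_itv/= le_min; first by move=> [-> /andP[-> ->]].
  by move=> /andP[-> /andP[-> ->]].
have := @lebesgue_measure_itv R `[0, Order.min 1 u]; rewrite /= lte_fin => eL; apply: (etrans eL).
rewrite max_r ?le_min ?ler01 ?u0//.
case: ifPn => [_|]; first by rewrite -EFinB subr0.
by rewrite lt_min ltr01/= -leNgt => u0'; rewrite min_r ?(le_trans u0')//; congr EFin; apply/eqP; rewrite eq_le u0.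
Qed.

Let U i w := F (X i w).

Lemma density_cdf_rv_measurable i : measurable_fun setT (U i).
Proof. exact: (measurableT_comp (measurable_density_cdf hf)). Qed.

(** A probability is determined by its values on rays. For [0 <= u < 1], [density_cdf_le] turns the
    event into [X i] being at most a quantile; for other [u] both sides are 0 or 1. *)
Let preimage_law i (B : set R) : measurable B -> P (U i @^-1` B) = mu B.
Proof.
pose Ui : {mfun T >-> R} := HB.pack (fun w : T => U i w)
    (isMeasurableFun.Build _ _ _ _ _ (density_cdf_rv_measurable i)).
apply: (@probability_rays _ (distribution P Ui) mu) => u.
rewrite uniform_prob_ray; change (P (U i @^-1` `]-oo, u]%classic) = (clip 0 1 u)%:E).
have [u0|u0] := ltP u 0.
  rewrite (_ : _ @^-1` _ = set0); last first.
    apply/seteqP; split => w //=; rewrite in_itv/= => /le_lt_trans /(_ u0).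
    by rewrite ltNge (density_cdf_ge0 hf).
  by rewrite measure0 /clip min_r ?max_l// ltW// (lt_trans u0).
have [u1|u1] := ltP u 1.
  have u01 : 0 <= u < 1 by rewrite u0.
  rewrite (_ : _ @^-1` _ = X i @^-1` `]-oo, quantile c1 c2 f u]%classic); last first.
    by apply/seteqP; split => w /=; rewrite !in_itv/= (density_cdf_le hf _ u01).
  have := Xdens i (measurable_itv `]-oo, quantile c1 c2 f u]); rewrite /distribution /pushforward => ->.
  by rewrite (density_cdfE hf) (quantileP hf u).2.
rewrite (_ : _ @^-1` _ = setT); last first.
  apply/seteqP; split => w //= _; rewrite in_itv/= (le_trans _ u1)//.
  exact: (density_cdf_le1 hf).
rewrite probability_setT /clip min_l//; congr EFin.
by rewrite max_r.
Qed.

Lemma uniform_iid : iid P mu U.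
Proof.
split; first exact: density_cdf_rv_measurable.
move=> s B us mB.
have mB' i : measurable (F @^-1` B i).
  by rewrite -[X in measurable X]setTI; exact: (measurable_density_cdf hf).
have := Xindep us mB'; rewrite (_ : \bigcap_(i in _) _ = \bigcap_(i in [set` s]) (U i @^-1` B i))// => ->.
by apply: eq_bigr => i _; exact: preimage_law.
Qed.

(** Both sides are the mean of [psi (F (X 0))]. *)
Lemma uniform_density (psi : R -> \bar R) : measurable_fun setT psi -> (forall x, 0 <= psi x)%E ->
  (\int[mu]_u psi u = \int[leb]_x (psi (F x) * (f x)%:E))%E.
Proof.
move=> mpsi psi0.
pose U0 : {mfun T >-> R} := HB.pack (fun w : T => U 0%N w)
    (isMeasurableFun.Build _ _ _ _ _ (density_cdf_rv_measurable 0)).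
have mF := measurableT_comp mpsi (measurable_density_cdf hf).
have e1 := integral_density' (dens_integrable hf) (Xdens 0%N) mF (fun x => psi0 _).
have e2 := ge0_integral_distribution (X 0%N) mF (fun x => psi0 _).
have e3 := ge0_integral_distribution (P := P) U0 mpsi psi0.
apply: (etrans _ (etrans (esym e2) e1)); apply: (etrans _ e3).
by apply: eq_measure_integral => A mA _; exact: esym (preimage_law 0 mA).
Qed.

End uniform_transform.

Section moments.
Context d (T : measurableType d) (R : realType) (P : probability T R).

Lemma expectation_Ex (f : T -> R) : fine 'E_P[f] = Ex P f.
Proof. by rewrite unlock. Qed.

Lemma variance_Vr (f : T -> R) : bm f -> variance P f = (Vr P f)%:E.
Proof.
move=> bf; rewrite /variance covariance.unlock expectation_Ex unlock (VrE P bf).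
have bg := bmB bf (bm_cst _ (Ex P f)).
by rewrite -ExE//; exact: bm_sqr.
Qed.

Lemma VrZ (c : R) (f : T -> R) : bm f -> Vr P (fun w => c * f w) = c ^+ 2 * Vr P f.
Proof.
move=> bf; rewrite /Vr (ExZ P _ bf) exprMn mulrBr; congr (_ - _).
by rewrite -(ExZ P _ (bm_sqr bf)); apply: eq_Ex => w; rewrite exprMn.
Qed.

End moments.

Section sort_map_homo.
Context {R : realType}.

Lemma sort_map_homo (F : R -> R) s : {homo F : x y / x <= y} ->
  sort <=%R (map F s) = map F (sort <=%R s).
Proof.
move=> hF; apply: (@sorted_eq _ <=%R).
- exact: le_trans.
- exact: le_anti.
- exact/sort_sorted/le_total.
- rewrite sorted_map; have : sorted <=%R (sort <=%R s) by exact/sort_sorted/le_total.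
  by apply: sub_sorted => x y; exact: hF.
- by rewrite perm_sort perm_sym; apply: perm_map; rewrite perm_sort; exact: perm_refl.
Qed.

End sort_map_homo.

(** * The density ratio and the identification of the limit variance *)

Section reduction.
Context {R : realType} d (T : measurableType d) (P : probability T R).
Local Notation leb := (@lebesgue_measure R).
Variables (c1 c2 : R) (f g : R -> R).
Hypothesis hf : is_density_on c1 c2 f.
Hypothesis hg : is_density_on c1 c2 g.
Variable X : nat -> {RV P >-> R}.
Hypothesis Xindep : mutually_independent X.
Hypothesis Xdens : forall i, has_density (X i) f.
Local Notation F := (density_cdf f).
Local Notation mu := (@unif01 R).

Definition quantile_ratio (u : R) : R := g (quantile c1 c2 f u) / f (quantile c1 c2 f u).
Local Notation h := quantile_ratio.

Lemma quantile_ratio_bounds : exists2 a, 0 < a & exists b, forall u, a <= h u <= b.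
Proof.
case: hf => _ _ [Mf fM] [mf mf0 fm]; case: hg => _ _ [Mg gM] [mg mg0 gm].
have qc u : quantile c1 c2 f u \in `[c1, c2] by rewrite in_itv/=; case: (quantileP hf u).
have Mf0 : 0 < Mf := lt_le_trans mf0 (le_trans (fm _ (qc 0)) (fM _)).
have Mg0 : 0 < Mg := lt_le_trans mg0 (le_trans (gm _ (qc 0)) (gM _)).
exists (mg / Mf); first by rewrite divr_gt0.
exists (Mg / mf) => u; have q := qc u; rewrite /h.
have f0 := lt_le_trans mf0 (fm _ q).
apply/andP; split; apply: ler_pM; rewrite ?invr_ge0 ?gm ?gM ?(ltW mg0) ?(ltW Mf0) ?(ltW f0)//.
- by rewrite lef_pV2 ?posrE.
- exact: (le_trans (ltW mg0) (gm _ q)).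
- by rewrite lef_pV2 ?posrE// fm.
Qed.

Lemma measurable_quantile_ratio : measurable_fun setT h.
Proof.
have mq := measurable_quantile hf.
apply: measurable_funM; first exact: (measurableT_comp (dens_measurable hg) mq).
apply: (measurableT_comp measurable_invr).
exact: (measurableT_comp (dens_measurable hf) mq).
Qed.

Lemma quantile_ratio_cdf x : c1 <= x <= c2 -> h (F x) * f x = g x /\ f x != 0.
Proof.
move=> xc; case: hf => _ _ _ [m m0 fm].
have f0 : f x != 0 by rewrite gt_eqF// (lt_le_trans m0)// fm// in_itv.
by rewrite /h (quantile_cdf hf xc) divfK.
Qed.

Lemma density_cdf_primv x : density_cdf g x = primv mu h (F x).
Proof.
have [a a0 [b hab]] := quantile_ratio_bounds.
have h0 u : 0 <= h u by have /andP[/(le_trans (ltW a0))] := hab u.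
have mh := measurable_quantile_ratio.
have mF := measurable_density_cdf hf.
rewrite /density_cdf /primv /Ex /Rintegral; congr fine.
pose psi u : \bar R := (h u * (u <= F x)%R%:R)%:E.
have mpsi : measurable_fun setT psi.
  apply/measurable_EFinP; apply: measurable_funM => //; apply: measurable_bool.
  exact: measurable_fun_ler.
have psi0 u : (0 <= psi u)%E by rewrite lee_fin mulr_ge0.
rewrite (uniform_density hf Xdens mpsi psi0) integral_mkcond.
apply: ae_eq_integral => //.
- apply/(measurable_restrictT _ _).1 => //; apply: measurable_funTS.
  by apply/measurable_EFinP; exact: (dens_measurable hg).
- apply: emeasurable_funM; first exact: (measurableT_comp mpsi mF).
  by apply/measurable_EFinP; exact: (dens_measurable hf).
(* [F y <= F x] is equivalent to [y <= x] on the support, except at [y = c1] when [x < c1]: there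
   both values of [F] vanish. *)
exists [set c1]; split; [exact: measurable_set1|exact: lebesgue_measure_set1|].
move=> y /= ne; apply: contrapT => yc; apply: ne => _.
rewrite patchE /psi; have [yA|yA] := boolP (y \in `[c1, c2]); last first.
  rewrite (dens_out hf yA) mule0; case: ifP => // _.
  by rewrite (dens_out hg yA).
rewrite in_itv/= in yA; have [hg' f0] := quantile_ratio_cdf yA.
have -> : (y \in (`]-oo, x]%classic : set R)) = (F y <= F x).
  apply/idP/idP; rewrite inE/= in_itv/=; first exact: (density_cdf_homo hf).
  apply: contraLR; rewrite -!ltNge => xy.
  have /andP[y1 y2] := yA.
  have [cx|xc] := leP c1 x; first exact: (density_cdf_incr hf cx xy y2).
  rewrite (density_cdf0 hf (ltW xc)) -(density_cdf0 hf (lexx c1)).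
  apply: (density_cdf_incr hf) => //.
  by rewrite lt_neqAle y1 andbT; apply/eqP => e; apply: yc.
by case: (F y <= F x); rewrite ?mulr1 ?mulr0 ?mul0e// -EFinM hg'.
Qed.

(** On the support [h (F x) ^ 2 * f x = g x ^ 2 / f x] and [h (F x) * f x = g x], so both integrals
    are moments of [h] under the uniform law. *)
Lemma sigma2E : sigma2 c1 c2 f g =
  (pi ^+ 2 / 3 - 2) * Ex mu (fun u => h u ^+ 2) - Ex mu h ^+ 2.
Proof.
have [a a0 [b hab]] := quantile_ratio_bounds.
have h0 u : 0 <= h u by have /andP[/(le_trans (ltW a0))] := hab u.
have mh := measurable_quantile_ratio.
have key (k : nat) : Ex mu (fun u => h u ^+ k) =
    \int[leb]_(x in `[c1, c2]) (h (F x) ^+ k * f x).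
  rewrite /Ex /Rintegral; congr fine.
  have mk : measurable_fun setT (fun u => (h u ^+ k)%:E).
    by apply/measurable_EFinP; exact: measurable_funX.
  have k0 u : (0 <= (h u ^+ k)%:E)%E by rewrite lee_fin exprn_ge0.
  rewrite (uniform_density hf Xdens mk k0) [RHS]integral_mkcond.
  apply: eq_integral => y _; rewrite patchE; case: ifPn => //.
  rewrite notin_setE/= => /negP yA.
  by rewrite (dens_out hf yA) mule0.
rewrite /sigma2 (key 2) -[X in _ - X ^+ 2 = _]/(_) (_ : Ex mu h = Ex mu (fun u => h u ^+ 1)); last first.
  by apply: eq_Ex => u; rewrite expr1.
rewrite (key 1); congr (_ * _ - _ ^+ 2); apply: eq_Rintegral => y; rewrite inE/= in_itv/= => yA.
  have [<- f0] := quantile_ratio_cdf yA.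
  by field.
by have [<- f0] := quantile_ratio_cdf yA; rewrite expr1.
Qed.

(** [density_cdf_primv] at [c2], where both distribution functions equal 1. *)
Lemma mean_quantile_ratio : Ex mu h = 1.
Proof.
have [a a0 [b hab]] := quantile_ratio_bounds.
have h0 u : 0 <= h u by have /andP[/(le_trans (ltW a0))] := hab u.
have mh := measurable_quantile_ratio.
have bh : bm h by split => //; exists b => u; rewrite ger0_norm//; have /andP[] := hab u.
have := density_cdf_primv c2; rewrite (density_cdf1 hg (lexx _)) (density_cdf1 hf (lexx _)).
by rewrite (primv1 (@uniform_integral R) bh).
Qed.

Lemma spacing_statE n w : spacing_stat (@xlogx R) g (fun i => X i : T -> R) n w =
  inner_sum mu (fun i w => F (X i w)) h n w.
Proof.
rewrite /spacing_stat /inner_sum /order_stat.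
have -> : sample (fun i w => F (X i w)) (iota 0 n) w = map F [seq X i w | i <- iota 0 n].
  by rewrite /sample -map_comp.
rewrite (sort_map_homo _ (density_cdf_homo hf)).
set s := sort <=%R _; have ss : size s = n by rewrite size_sort size_map size_iota.
rewrite !big_nat; apply: eq_bigr => i /andP[i0 i_n].
rewrite !density_cdf_primv !(nth_map 0) ?ss//.
exact: leq_ltn_trans (leq_pred _) i_n.
Qed.

Lemma spacing_stat_clt : clt_conv P
  (fun n w => (Num.sqrt n%:R)^-1 * spacing_stat (@xlogx R) g (fun i => X i : T -> R) n w)
  (sigma2 c1 c2 f g).
Proof.
have [a a0 [b hab]] := quantile_ratio_bounds.
have := spacing_clt_conv (uniform_iid hf Xindep Xdens) (@uniform_integral R) _ a0
  measurable_quantile_ratio hab.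
rewrite -sigma2E; have -> : (fun n w => (Num.sqrt n%:R)^-1 *
    spacing_stat (@xlogx R) g (fun i => X i : T -> R) n w) =
    fun n w => (Num.sqrt n%:R)^-1 * inner_sum mu (fun i w => F (X i w)) h n w.
  by apply/funext => n; apply/funext => w; rewrite spacing_statE.
apply => i w; by rewrite (density_cdf_ge0 hf) (density_cdf_le1 hf).
Qed.

Lemma sigma2_gt0 : 0 < sigma2 c1 c2 f g.
Proof.
have [a a0 [b hab]] := quantile_ratio_bounds.
have h0 u : 0 <= h u by have /andP[/(le_trans (ltW a0))] := hab u.
have mh := measurable_quantile_ratio.
have bh : bm h by split => //; exists b => u; rewrite ger0_norm//; have /andP[] := hab u.
have := Ex_sqr_le mu bh; rewrite sigma2E mean_quantile_ratio expr1n.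
have := @pi2_gt9 R; set q := Ex mu _ => p9 q1.
have v1 : 1 < pi ^+ 2 / 3 - 2 :> R by lra.
rewrite subr_gt0 (lt_le_trans v1)// ler_peMr//; lra.
Qed.

End reduction.

(* [normal_prob m s] takes the standard deviation [s]. Here [sigma2] is
   positive: it is at least pi^2/3 - 3, by the Cauchy-Schwarz inequality. *)
Theorem corollary3p3 (R : realType) (c1 c2 : R) (f g : R -> R)
    (hf : is_density_on c1 c2 f) (hg : is_density_on c1 c2 g)
    (d : measure_display) (T : measurableType d) (P : probability T R)
    (X : nat -> {RV P >-> R})
    (Xindep : mutually_independent X)
    (Xdens : forall i, has_density (X i) f) :
  let S : nat -> T -> R := spacing_stat (@xlogx R) g (fun i => X i : T -> R) in
  ((n%:R^-1)%:E * variance P (S n))%E @[n --> \oo]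
    --> (sigma2 c1 c2 f g)%:E /\
  cvg_in_distribution P
    (fun n w => (Num.sqrt n%:R)^-1 * (S n w - fine 'E_P[S n]))
    (normal_prob 0 (Num.sqrt (sigma2 c1 c2 f g))).
Proof.
move=> S; have CC := spacing_stat_clt hf hg Xindep Xdens.
have [bY VY _] := CC.
have s2 := sigma2_gt0 hf hg Xdens.
have bS n : bm (S n).
  (* For [n = 0] the statistic is an empty sum, while the factor [sqrt 0] cannot be divided out. *)
  case: n => [|n].
    have := bm_cst T (0 : R); congr bm; apply/funext => w.
    by rewrite /S /spacing_stat big_geq.
  have := bmZ (Num.sqrt n.+1%:R) (bY n.+1); congr bm; apply/funext => w.
  by rewrite mulrA divff ?mul1r// gt_eqF// sqrtr_gt0 ltr0n.
split.
  have -> : (fun n => ((n%:R^-1)%:E * variance P (S n))%E) =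
      fun n => (Vr P (fun w => (Num.sqrt n%:R)^-1 * S n w))%:E.
    apply/funext => n; rewrite (variance_Vr P (bS n)) (VrZ P _ (bS n)) -EFinM.
    by rewrite exprVn sqr_sqrtr.
  by apply: cvg_EFin; [exact: nearW|exact: VY].
have YE n w : (Num.sqrt n%:R)^-1 * (S n w - fine 'E_P[S n]) =
    (Num.sqrt n%:R)^-1 * S n w - Ex P (fun w => (Num.sqrt n%:R)^-1 * S n w).
  by rewrite expectation_Ex (ExZ P _ (bS n)) mulrBr.
split => [n|x _].
  under eq_fun do rewrite YE.
  by apply: measurable_funB => //; have [] := bY n.
have := @clt_conv_cdf _ _ _ P _ _ x CC s2.
by under eq_fun do (under eq_set do rewrite -YE).
Qed.
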